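(* Let $(W,S)$ be a Coxeter system, $\mathfrak o$ a right $W$-set, and $\mathfrak h$ a reflection-balanced reflection-stable Abe realization of $(W,S)$ over $\Bbbk$. There is an equivalence of 2-categories $$\Psi^{\mathrm{alg}}:\ \mathcal A^\oplus(\mathfrak h,M^{\mathfrak o}(W))\ \xrightarrow{\ \sim\ }\ \mathcal A^\oplus(\mathfrak h,W,\mathfrak o)$$ which restricts, for each $\mathcal L\in\mathfrak o$, to an equivalence of monoidal categories $\Psi^{\mathrm{alg}}_{\mathcal L}:\mathcal A^\oplus(\mathfrak h,W_{\mathcal L}^\circ)\to{}_{\mathcal L}\mathcal A_{\mathcal L}^{\oplus,\circ}(\mathfrak h,W,\mathfrak o)$ sending $B_{\underline x}$ to an object isomorphic to $B_{\underline x'}^{\mathcal L}$, where $\underline x'$ is obtained from $\underline x\in\mathrm{Exp}(W_{\mathcal L}^\circ)$ by replacing each element of $S_{\mathcal L}^\circ$ by a reduced expression in $W$.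
   Context: **Coxeter data.** $\ell$ is the length function of $(W,S)$, $m_{s,t}$ the order of $st$, $\mathscr R(W)=\{wsw^{-1}:w\in W,s\in S\}$. $\mathrm{Exp}(W)$ is the set of finite sequences $\underline w=(s_1,\dots,s_k)$ in $S$. For $\mathcal L\in\mathfrak o$ put $\mathcal L\underline w=\mathcal Ls_1\cdots s_k$, ${}_{\mathcal L}W_{\mathcal L'}=\{w\in W:\mathcal Lw=\mathcal L'\}$, $K(\underline w,\mathcal L)=\{i:\mathcal Ls_1\cdots s_i=\mathcal Ls_1\cdots s_{i-1}\}$. Let $b_{\mathcal L}(\underline w)\in W$ be the product, in order, of the $s_i$ with $i\notin K(\underline w,\mathcal L)$; it depends only on $w=s_1\cdots s_k$, write $b_{\mathcal L}(w)$. The nonempty fibres of $b_{\mathcal L}:{}_{\mathcal L}W_{\mathcal L'}\to{}_{\mathcal L}W_{\mathcal L'}$ are the *blocks*; their set is ${}_{\mathcal L}\underline W_{\mathcal L'}$, and $w^\beta\in\beta$ denotes the value of $b_{\mathcal L}$ on the block $\beta$. For $\beta\in{}_{\mathcal L}\underline W_{\mathcal L'}$, $\gamma\in{}_{\mathcal L'}\underline W_{\mathcal L''}$, $\beta\gamma$ is the block $\{xy:x\in\beta,y\in\gamma\}$. $\ell_{\mathcal L}(w)=\#K(\underline w,\mathcal L)$ for $\underline w$ a reduced expression of $w$. $W_{\mathcal L}^\circ=\{w\in{}_{\mathcal L}W_{\mathcal L}:b_{\mathcal L}(w)=e\}$ and $S_{\mathcal L}^\circ=\{w\in W_{\mathcal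 L}^\circ:\ell_{\mathcal L}(w)=1\}$; $(W_{\mathcal L}^\circ,S_{\mathcal L}^\circ)$ is a Coxeter system and $S_{\mathcal L}^\circ\subset\mathscr R(W)$. **Realizations.** $\Bbbk$ is an integral domain. A pre-realization is a free finite-rank $\Bbbk$-module $\mathfrak h$ with $\alpha_s^\vee\in\mathfrak h$, $\alpha_s\in\mathfrak h^*$ ($s\in S$) such that $\langle\alpha_s^\vee,\alpha_s\rangle=2$, $s(v)=v-\langle v,\alpha_s\rangle\alpha_s^\vee$ defines a $W$-action on $\mathfrak h$, and $\alpha_s:\mathfrak h\to\Bbbk$, $\alpha_s^\vee:\mathfrak h^*\to\Bbbk$ are surjective. Put $a_{s,t}=\langle\alpha_s^\vee,\alpha_t\rangle$. In $\mathbb Z[x,y]$ set $[0]_x=[0]_y=0$, $[1]_x=[1]_y=1$, $[2]_x=x$, $[2]_y=y$, $[n+1]_x=[2]_x[n]_y-[n-1]_x$, $[n+1]_y=[2]_y[n]_x-[n-1]_y$; $x(d)=[d+1]_x-[d-1]_x$, $y(d)=[d+1]_y-[d-1]_y$; $[n]_{x(d)},[n]_{y(d)}$ are obtained from $[n]_x,[n]_y$ by substituting $x\mapsto x(d)$, $y\mapsto y(d)$; $\binom nk_{x(d)}=\frac{[n]_{x(d)}\cdots[n-k+1]_{x(d)}}{[1]_{x(d)}\cdots[k]_{x(d)}}$, similarly with $y(d)$. $\mathfrak h$ is *reflection-stable Abe* if for all distinct $s,t\in S$ with $m=m_{s,t}<\infty$, all $v>1$ dividing $m$ and $1\le k\le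 v-1$, $\binom vk_{x(m/v)}$ and $\binom vk_{y(m/v)}$ vanish at $(a_{s,t},a_{t,s})$; *reflection-balanced* if for such $s,t$ and divisors $1\le d<m$ of $m$, $[m/d-1]_{x(d)}=1=[m/d-1]_{y(d)}$ at $(-a_{s,t},-a_{t,s})$. **Bimodules.** $R=\mathrm{Sym}(\mathfrak h^* )$, $\deg\mathfrak h^*=2$. For $r=xsx^{-1}\in\mathscr R(W)$ with $s\in S$, $xs>x$, put $\alpha_r=x\alpha_s$, $\alpha_r^\vee=x\alpha_s^\vee$ (well defined by balancedness); $Q=R[\alpha_r^{-1}:r\in\mathscr R(W)]$; $M(n)^i=M^{n+i}$. ${}_{\mathcal L}\mathcal C_{\mathcal L'}$ has objects $(M,(M_Q^w)_{w\in W},\xi_M)$: $M$ a graded $R$-bimodule, finitely generated as a bimodule and flat as a right $R$-module; $M^w_Q$ graded $(R,Q)$-bimodules with $m\cdot f=w(f)\cdot m$ for $f\in R$, nonzero for only finitely many $w$ and zero unless $w\in{}_{\mathcal L}W_{\mathcal L'}$; $\xi_M:M\otimes_RQ\cong\bigoplus_wM_Q^w$ an isomorphism of graded $(R,Q)$-bimodules. Morphisms are $R$-bimodule maps (of any degree) carrying each $M_Q^w$ into $N_Q^w$. $\otimes_R$, with $(M\otimes_RN)_Q^w=\bigoplus_{xy=w}M_Q^x\otimes_QN_Q^y$, gives ${}_{\mathcal L}\mathcal C_{\mathcal L'}\times{}_{\mathcal L'}\mathcal C_{\mathcal L''}\to{}_{\mathcal L}\mathcal C_{\mathcal L''}$.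 $R_w$ is $R$ with right action $m\cdot f=w(f)m$, localized only at $w$. For $s$ in $S$ or some $S_{\mathcal L}^\circ$, $C_s=R\otimes_{R^s}R(1)$ with $(C_s)_Q^e=(\delta\otimes1-1\otimes s(\delta))Q$, $(C_s)_Q^s=(\delta\otimes1-1\otimes\delta)Q$, where $\delta\in\mathfrak h^*$, $\langle\alpha_s^\vee,\delta\rangle=1$. $B_s^{\mathcal L}=C_s$ if $\mathcal Ls=\mathcal L$, else $R_s$; $B_{\underline w}^{\mathcal L}=B_{s_1}^{\mathcal L}\otimes_R\cdots\otimes_RB_{s_k}^{\mathcal Ls_1\cdots s_{k-1}}$. $\mathcal A^\oplus(\mathfrak h,W,\mathfrak o)$ is the 2-category with object set $\mathfrak o$ and morphism category from $\mathcal L$ to $\mathcal L'$ the full subcategory of ${}_{\mathcal L}\mathcal C_{\mathcal L'}$ of objects isomorphic to finite direct sums of $B_{\underline w}^{\mathcal L}$ with $\mathcal L\underline w=\mathcal L'$; horizontal composition is $\otimes_R$. ${}_{\mathcal L}\mathcal A_{\mathcal L}^{\oplus,\circ}$ is the full subcategory (of the endomorphism category of $\mathcal L$) of sums of $B_{\underline w}^{\mathcal L}$ with $\underline w$ expressing an element of $W_{\mathcal L}^\circ$. $\mathcal A^\oplus(\mathfrak h,W_{\mathcal L}^\circ)$ is the monoidal category obtained by the same construction from $(W_{\mathcal L}^\circ,S_{\mathcal L}^\circ)$, the one-point parameter set, and $\mathfrak h$ with roots and coroots $\alpha_{s'},\alpha_{s'}^\vee$, $s'\in S_{\mathcal L}^\circ$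 (so $B_{s'}=C_{s'}$). **Endoscopic 2-category.** For $\beta\in{}_{\mathcal L}\underline W_{\mathcal L'}$, ${}^\beta(-):\mathcal A^\oplus(\mathfrak h,W_{\mathcal L'}^\circ)\to\mathcal A^\oplus(\mathfrak h,W_{\mathcal L}^\circ)$ is the monoidal equivalence induced by the isomorphism of Coxeter groups $W_{\mathcal L'}^\circ\to W_{\mathcal L}^\circ$, $w\mapsto w^\beta w(w^\beta)^{-1}$ (it sends $C_s$ to $C_{w^\beta s(w^\beta)^{-1}}$, twisting both $R$-actions by $w^\beta$). $\mathcal A^\oplus(\mathfrak h,M^{\mathfrak o}(W))$ has object set $\mathfrak o$; its morphism category from $\mathcal L$ to $\mathcal L'$ is $\bigoplus_{\beta\in{}_{\mathcal L}\underline W_{\mathcal L'}}\mathcal A^\oplus(\mathfrak h,\beta)$ with $\mathcal A^\oplus(\mathfrak h,\beta):=\mathcal A^\oplus(\mathfrak h,W_{\mathcal L}^\circ)$; horizontal composition $\mathcal A^\oplus(\mathfrak h,\beta)\times\mathcal A^\oplus(\mathfrak h,\gamma)\to\mathcal A^\oplus(\mathfrak h,\beta\gamma)$ is $(M,N)\mapsto M\otimes_R{}^\beta N$. *)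

(* Defs.v *)
From HB Require Import structures.
From mathcomp Require Import all_boot all_order all_algebra.
From mathcomp Require Import mpoly boolp.

Set Implicit Arguments.
Unset Strict Implicit.
Unset Printing Implicit Defensive.

Import GRing.Theory.
Local Open Scope quotient_scope.
Local Open Scope ring_scope.

(* 1-cells and 2-cells are composed in diagrammatic order, so that [comp1 f g]
   becomes the tensor product of [f] and [g].  The data are separated from the
   laws; associators and unitors are required to be invertible in the laws. *)
Record bicat_data := BicatData {
  ob : Type;
  c1 : ob -> ob -> Type;
  c2 : forall a b, c1 a b -> c1 a b -> Type;
  id1 : forall a, c1 a a;
  comp1 : forall a b c, c1 a b -> c1 b c -> c1 a c;
  id2 : forall a b (f : c1 a b), c2 f f;
  comp2 : forall a b (f g h : c1 a b), c2 f g -> c2 g h -> c2 f h;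
  hcomp2 : forall a b c (f f' : c1 a b) (g g' : c1 b c),
    c2 f f' -> c2 g g' -> c2 (comp1 f g) (comp1 f' g');
  assoc : forall a b c d (f : c1 a b) (g : c1 b c) (h : c1 c d),
    c2 (comp1 (comp1 f g) h) (comp1 f (comp1 g h));
  lunit : forall a b (f : c1 a b), c2 (comp1 (id1 a) f) f;
  runit : forall a b (f : c1 a b), c2 (comp1 f (id1 b)) f }.

Arguments id1 {_} _.
Arguments id2 {_ _ _} _.

Definition inv2 (D : bicat_data) (a b : ob D) (f g : c1 a b) (x : c2 f g) :=
  exists y : c2 g f, comp2 x y = id2 f /\ comp2 y x = id2 g.

Definition iso1 (D : bicat_data) (a b : ob D) (f g : c1 a b) :=
  exists x : c2 f g, inv2 x.

Record is_bicategory (D : bicat_data) : Prop := IsBicategory {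
  comp2A : forall (a b : ob D) (f g h i : c1 a b)
    (x : c2 f g) (y : c2 g h) (z : c2 h i),
    comp2 (comp2 x y) z = comp2 x (comp2 y z);
  comp21l : forall (a b : ob D) (f g : c1 a b) (x : c2 f g), comp2 (id2 f) x = x;
  comp21r : forall (a b : ob D) (f g : c1 a b) (x : c2 f g), comp2 x (id2 g) = x;
  hcomp2_id : forall (a b c : ob D) (f : c1 a b) (g : c1 b c),
    hcomp2 (id2 f) (id2 g) = id2 (comp1 f g);
  hcomp2_comp : forall (a b c : ob D) (f f' f'' : c1 a b) (g g' g'' : c1 b c)
    (x : c2 f f') (x' : c2 f' f'') (y : c2 g g') (y' : c2 g' g''),
    hcomp2 (comp2 x x') (comp2 y y') = comp2 (hcomp2 x y) (hcomp2 x' y');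
  assoc_nat : forall (a b c d : ob D) (f f' : c1 a b) (g g' : c1 b c)
    (h h' : c1 c d) (x : c2 f f') (y : c2 g g') (z : c2 h h'),
    comp2 (hcomp2 (hcomp2 x y) z) (assoc f' g' h')
    = comp2 (assoc f g h) (hcomp2 x (hcomp2 y z));
  lunit_nat : forall (a b : ob D) (f f' : c1 a b) (x : c2 f f'),
    comp2 (hcomp2 (id2 (id1 a)) x) (lunit f') = comp2 (lunit f) x;
  runit_nat : forall (a b : ob D) (f f' : c1 a b) (x : c2 f f'),
    comp2 (hcomp2 x (id2 (id1 b))) (runit f') = comp2 (runit f) x;
  assoc_inv : forall (a b c d : ob D) (f : c1 a b) (g : c1 b c) (h : c1 c d),
    inv2 (assoc f g h);
  lunit_inv : forall (a b : ob D) (f : c1 a b), inv2 (lunit f);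
  runit_inv : forall (a b : ob D) (f : c1 a b), inv2 (runit f);
  pentagon : forall (a b c d e : ob D)
    (f : c1 a b) (g : c1 b c) (h : c1 c d) (i : c1 d e),
    comp2 (assoc (comp1 f g) h i) (assoc f g (comp1 h i))
    = comp2 (hcomp2 (assoc f g h) (id2 i))
        (comp2 (assoc f (comp1 g h) i) (hcomp2 (id2 f) (assoc g h i)));
  triangle : forall (a b c : ob D) (f : c1 a b) (g : c1 b c),
    hcomp2 (runit f) (id2 g)
    = comp2 (assoc f (id1 b) g) (hcomp2 (id2 f) (lunit g)) }.

Section SubBicategory.
(* The sub-bicategory on the 1-cells satisfying [p1] and the 2-cells satisfying
   [p2].  It is formed from a proof that these are closed under the operations. *)
Variable D : bicat_data.
Variable p1 : forall a b : ob D, c1 a b -> Prop.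
Variable p2 : forall (a b : ob D) (f g : c1 a b), c2 f g -> Prop.

Record sub_closed : Prop := SubClosed {
  cl_id1 : forall a : ob D, p1 (id1 a);
  cl_comp1 : forall (a b c : ob D) (f : c1 a b) (g : c1 b c),
    p1 f -> p1 g -> p1 (comp1 f g);
  cl_id2 : forall (a b : ob D) (f : c1 a b), p1 f -> p2 (id2 f);
  cl_comp2 : forall (a b : ob D) (f g h : c1 a b) (x : c2 f g) (y : c2 g h),
    p1 f -> p1 g -> p1 h -> p2 x -> p2 y -> p2 (comp2 x y);
  cl_hcomp2 : forall (a b c : ob D) (f f' : c1 a b) (g g' : c1 b c)
    (x : c2 f f') (y : c2 g g'),
    p1 f -> p1 f' -> p1 g -> p1 g' -> p2 x -> p2 y -> p2 (hcomp2 x y);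
  cl_assoc : forall (a b c d : ob D) (f : c1 a b) (g : c1 b c) (h : c1 c d),
    p1 f -> p1 g -> p1 h -> p2 (assoc f g h);
  cl_lunit : forall (a b : ob D) (f : c1 a b), p1 f -> p2 (lunit f);
  cl_runit : forall (a b : ob D) (f : c1 a b), p1 f -> p2 (runit f) }.

Hypothesis cl : sub_closed.

Definition sub_bicat : bicat_data :=
  @BicatData (ob D)
    (fun a b => {f : c1 a b | p1 f})
    (fun a b f g => {x : c2 (sval f) (sval g) | p2 x})
    (fun a => exist _ (id1 a) (cl_id1 cl a))
    (fun a b c f g =>
       exist _ (comp1 (sval f) (sval g)) (cl_comp1 cl (svalP f) (svalP g)))
    (fun a b f => exist _ (id2 (sval f)) (cl_id2 cl (svalP f)))
    (fun a b f g h x y => exist _ (comp2 (sval x) (sval y))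
       (cl_comp2 cl (svalP f) (svalP g) (svalP h) (svalP x) (svalP y)))
    (fun a b c f f' g g' x y => exist _ (hcomp2 (sval x) (sval y))
       (cl_hcomp2 cl (svalP f) (svalP f') (svalP g) (svalP g')
          (svalP x) (svalP y)))
    (fun a b c d f g h => exist _ (assoc (sval f) (sval g) (sval h))
       (cl_assoc cl (svalP f) (svalP g) (svalP h)))
    (fun a b f => exist _ (lunit (sval f)) (cl_lunit cl (svalP f)))
    (fun a b f => exist _ (runit (sval f)) (cl_runit cl (svalP f))).

End SubBicategory.

Section Pseudofunctor.
Variables (D E : bicat_data) (f0 : ob D -> ob E).

Record pfun_data := PfunData {
  F1 : forall a b : ob D, c1 a b -> c1 (f0 a) (f0 b);
  F2 : forall (a b : ob D) (f g : c1 a b), c2 f g -> c2 (F1 f) (F1 g);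
  Fc : forall (a b c : ob D) (f : c1 a b) (g : c1 b c),
    c2 (comp1 (F1 f) (F1 g)) (F1 (comp1 f g));
  Fu : forall a : ob D, c2 (id1 (f0 a)) (F1 (id1 a)) }.

Variable F : pfun_data.

Record is_pseudofunctor : Prop := IsPseudofunctor {
  F2_id : forall (a b : ob D) (f : c1 a b), F2 F (id2 f) = id2 (F1 F f);
  F2_comp : forall (a b : ob D) (f g h : c1 a b) (x : c2 f g) (y : c2 g h),
    F2 F (comp2 x y) = comp2 (F2 F x) (F2 F y);
  Fc_nat : forall (a b c : ob D) (f f' : c1 a b) (g g' : c1 b c)
    (x : c2 f f') (y : c2 g g'),
    comp2 (hcomp2 (F2 F x) (F2 F y)) (Fc F f' g')
    = comp2 (Fc F f g) (F2 F (hcomp2 x y));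
  Fc_inv : forall (a b c : ob D) (f : c1 a b) (g : c1 b c), inv2 (Fc F f g);
  Fu_inv : forall a : ob D, inv2 (Fu F a);
  F_assoc : forall (a b c d : ob D) (f : c1 a b) (g : c1 b c) (h : c1 c d),
    comp2 (hcomp2 (Fc F f g) (id2 (F1 F h)))
      (comp2 (Fc F (comp1 f g) h) (F2 F (assoc f g h)))
    = comp2 (assoc (F1 F f) (F1 F g) (F1 F h))
        (comp2 (hcomp2 (id2 (F1 F f)) (Fc F g h)) (Fc F f (comp1 g h)));
  F_lunit : forall (a b : ob D) (f : c1 a b),
    lunit (F1 F f)
    = comp2 (hcomp2 (Fu F a) (id2 (F1 F f)))
        (comp2 (Fc F (id1 a) f) (F2 F (lunit f)));
  F_runit : forall (a b : ob D) (f : c1 a b),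
    runit (F1 F f)
    = comp2 (hcomp2 (id2 (F1 F f)) (Fu F b))
        (comp2 (Fc F f (id1 b)) (F2 F (runit f))) }.

(* The functor between the categories of 1-cells from [a] to [b] has a
   quasi-inverse. *)
Definition local_equivalence (a b : ob D) : Prop :=
  exists (G1 : c1 (f0 a) (f0 b) -> c1 a b)
         (G2 : forall g g' : c1 (f0 a) (f0 b), c2 g g' -> c2 (G1 g) (G1 g')),
  [/\ forall g, G2 _ _ (id2 g) = id2 (G1 g),
      forall g g' g'' (x : c2 g g') (y : c2 g' g''),
        G2 _ _ (comp2 x y) = comp2 (G2 _ _ x) (G2 _ _ y),
      exists eta : forall f : c1 a b, c2 f (G1 (F1 F f)),
        (forall f, inv2 (eta f)) /\
        (forall f f' (x : c2 f f'),
          comp2 x (eta f') = comp2 (eta f) (G2 _ _ (F2 F x)))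
    & exists eps : forall g : c1 (f0 a) (f0 b), c2 (F1 F (G1 g)) g,
        (forall g, inv2 (eps g)) /\
        (forall g g' (y : c2 g g'),
          comp2 (F2 F (G2 _ _ y)) (eps g') = comp2 (eps g) y)].

Definition surjective_up_to_equivalence : Prop :=
  forall b : ob E, exists (a : ob D) (f : c1 (f0 a) b) (g : c1 b (f0 a)),
    iso1 (comp1 f g) (id1 (f0 a)) /\ iso1 (comp1 g f) (id1 b).

Definition is_biequivalence : Prop :=
  [/\ is_pseudofunctor, forall a b, local_equivalence a b
    & surjective_up_to_equivalence].

End Pseudofunctor.

Section Tensor.
Variables (M N : zmodType) (B : Type) (r : M -> B -> M) (l : B -> N -> N).

Definition balanced (G : zmodType) (phi : M -> N -> G) : Prop :=
  [/\ forall m m' n, phi (m + m') n = phi m n + phi m' n,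
      forall m n n', phi m (n + n') = phi m n + phi m n'
    & forall m b n, phi (r m b) n = phi m (l b n)].

Definition fsum (G : zmodType) (phi : M -> N -> G) (s : seq (M * N)) : G :=
  \sum_(x <- s) phi x.1 x.2.

(* A formal sum of pairs stands for the corresponding sum of pure tensors; two
   of them are identified when no balanced biadditive map separates them, which
   by the universal property is equality in the tensor product over [B]. *)
Definition teq (s t : seq (M * N)) : bool :=
  `[< forall (G : zmodType) (phi : M -> N -> G),
        balanced phi -> fsum phi s = fsum phi t >].

Lemma teq_refl : reflexive teq.
Proof. by move=> s; apply/asboolP. Qed.
Lemma teq_sym : ssrbool.symmetric teq.
Proof.
by move=> s t; apply/idP/idP => /asboolP H; apply/asboolP => G phi hb;
  rewrite H.
Qed.
Lemma teq_trans : transitive teq.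
Proof.
by move=> s t u /asboolP H1 /asboolP H2; apply/asboolP => G phi hb;
  rewrite H1 ?H2.
Qed.

Canonical teq_equiv := EquivRel teq teq_refl teq_sym teq_trans.

Definition tens := {eq_quot teq_equiv}.
HB.instance Definition _ := Choice.on tens.
HB.instance Definition _ := EqQuotient.on tens.

Definition tlift (G : zmodType) (phi : M -> N -> G) (t : tens) : G :=
  fsum phi (repr t).

Lemma tlift_pi (G : zmodType) (phi : M -> N -> G) s :
  balanced phi -> tlift phi (\pi_tens s) = fsum phi s.
Proof.
move=> hb; rewrite /tlift.
have /eqmodP/asboolP H : repr (\pi_tens s) = s %[mod tens] by rewrite reprK.
exact: H.
Qed.

Lemma tens_eq (s t : seq (M * N)) :
  (forall (G : zmodType) (phi : M -> N -> G),
     balanced phi -> fsum phi s = fsum phi t) -> \pi_tens s = \pi_tens t.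
Proof. by move=> H; apply/eqmodP/asboolP. Qed.

Definition tadd (a b : tens) : tens := \pi_tens (repr a ++ repr b).
Definition topp (a : tens) : tens := \pi_tens [seq (- x.1, x.2) | x <- repr a].
Definition tzero : tens := \pi_tens [::].

Lemma fsum_cat (G : zmodType) (phi : M -> N -> G) s t :
  fsum phi (s ++ t) = fsum phi s + fsum phi t.
Proof. by rewrite /fsum big_cat. Qed.

Lemma balanced0l (G : zmodType) (phi : M -> N -> G) n :
  balanced phi -> phi 0 n = 0.
Proof.
by case=> H _ _; apply: (addrI (phi 0 n)); rewrite -H addr0 addr0.
Qed.

Lemma balancedNl (G : zmodType) (phi : M -> N -> G) m n :
  balanced phi -> phi (- m) n = - phi m n.
Proof.
move=> hb; apply: (addIr (phi m n)); case: (hb) => H _ _.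
by rewrite -H !addNr balanced0l.
Qed.

Lemma fsum_opp (G : zmodType) (phi : M -> N -> G) s : balanced phi ->
  fsum phi [seq (- x.1, x.2) | x <- s] = - fsum phi s.
Proof.
move=> hb; rewrite /fsum big_map /= -sumrN.
by apply: eq_bigr => x _; rewrite balancedNl.
Qed.

Lemma tlift_repr (G : zmodType) (phi : M -> N -> G) t :
  fsum phi (repr t) = tlift phi t.
Proof. by []. Qed.

Lemma tensP (a b : tens) :
  (forall (G : zmodType) (phi : M -> N -> G),
     balanced phi -> tlift phi a = tlift phi b) -> a = b.
Proof. by move=> H; rewrite -[a]reprK -[b]reprK; apply: tens_eq. Qed.

Lemma tliftD_op (G : zmodType) (phi : M -> N -> G) a b : balanced phi ->
  tlift phi (tadd a b) = tlift phi a + tlift phi b.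
Proof. by move=> hb; rewrite tlift_pi // fsum_cat. Qed.
Lemma tliftN_op (G : zmodType) (phi : M -> N -> G) a : balanced phi ->
  tlift phi (topp a) = - tlift phi a.
Proof. by move=> hb; rewrite tlift_pi // fsum_opp. Qed.
Lemma tlift0_op (G : zmodType) (phi : M -> N -> G) : balanced phi ->
  tlift phi tzero = 0.
Proof. by move=> hb; rewrite tlift_pi // /fsum big_nil. Qed.

Lemma taddA : associative tadd.
Proof. by move=> a b c; apply: tensP => G phi hb; rewrite !tliftD_op // addrA. Qed.
Lemma taddC : commutative tadd.
Proof. by move=> a b; apply: tensP => G phi hb; rewrite !tliftD_op // addrC. Qed.
Lemma tadd0 : left_id tzero tadd.
Proof. by move=> a; apply: tensP => G phi hb; rewrite tliftD_op // tlift0_op // add0r. Qed.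
Lemma taddN : left_inverse tzero topp tadd.
Proof.
move=> a; apply: tensP => G phi hb.
by rewrite tliftD_op // tliftN_op // tlift0_op // addNr.
Qed.

HB.instance Definition _ := GRing.isZmodule.Build tens taddA taddC tadd0 taddN.

Lemma tliftD (G : zmodType) (phi : M -> N -> G) (a b : tens) : balanced phi ->
  tlift phi (a + b) = tlift phi a + tlift phi b.
Proof. exact: tliftD_op. Qed.

Definition tpure (m : M) (n : N) : tens := \pi_tens [:: (m, n)].

Lemma tlift_pure (G : zmodType) (phi : M -> N -> G) m n : balanced phi ->
  tlift phi (tpure m n) = phi m n.
Proof. by move=> hb; rewrite tlift_pi // /fsum big_seq1. Qed.

Lemma tpure_balanced : balanced tpure.
Proof.
split=> [m m' n | m n n' | m b n]; apply: tensP => G phi hb;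
  rewrite ?tliftD // !tlift_pure //; by case: hb.
Qed.

Lemma tens_repr (t : tens) : t = \sum_(x <- repr t) tpure x.1 x.2.
Proof.
apply: tensP => G phi hb; rewrite {1}/tlift /fsum.
elim: (repr t) => [|x s IH]; first by rewrite !big_nil tlift0_op.
by rewrite !big_cons tliftD // tlift_pure // IH.
Qed.

Lemma additive0 (G : zmodType) (f : tens -> G) :
  (forall x y, f (x + y) = f x + f y) -> f 0 = 0.
Proof. by move=> H; apply: (addrI (f 0)); rewrite -H !addr0. Qed.

Lemma tens_ext (G : zmodType) (f g : tens -> G) :
  (forall x y, f (x + y) = f x + f y) -> (forall x y, g (x + y) = g x + g y) ->
  (forall m n, f (tpure m n) = g (tpure m n)) -> f =1 g.
Proof.
move=> fD gD H t; rewrite [t]tens_repr; elim: (repr t) => [|x s IH].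
  by rewrite big_nil !additive0.
by rewrite big_cons fD gD H IH.
Qed.

End Tensor.

Definition tmap (M N M' N' : zmodType) (B B' : Type)
    (r : M -> B -> M) (l : B -> N -> N) (r' : M' -> B' -> M') (l' : B' -> N' -> N')
    (f : M -> M') (g : N -> N') : tens r l -> tens r' l' :=
  tlift (fun m n => tpure r' l' (f m) (g n)).
Arguments tmap {M N M' N' B B'} r l r' l' f g.

Section TensorMap.
Variables (M N M' N' : zmodType) (B : Type).
Variables (r : M -> B -> M) (l : B -> N -> N).
Variables (r' : M' -> B -> M') (l' : B -> N' -> N').
Variables (f : M -> M') (g : N -> N').
Hypothesis fD : forall x y, f (x + y) = f x + f y.
Hypothesis gD : forall x y, g (x + y) = g x + g y.
Hypothesis fr : forall m b, f (r m b) = r' (f m) b.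
Hypothesis gl : forall b n, g (l b n) = l' b (g n).

Lemma tmap_balanced : balanced r l (fun m n => tpure r' l' (f m) (g n)).
Proof.
have [H1 H2 H3] := tpure_balanced r' l'.
by split=> [m m' n|m n n'|m b n]; rewrite ?fD ?gD ?fr ?gl ?H1 ?H2 ?H3.
Qed.

Lemma tmapD x y : tmap r l r' l' f g (x + y)
  = tmap r l r' l' f g x + tmap r l r' l' f g y.
Proof. exact/tliftD/tmap_balanced. Qed.

Lemma tmap_pure m n :
  tmap r l r' l' f g (tpure r l m n) = tpure r' l' (f m) (g n).
Proof. exact/tlift_pure/tmap_balanced. Qed.

End TensorMap.

Section BimodAxioms.
Variables (A C : pzRingType) (M : zmodType) (la : A -> M -> M) (ra : M -> C -> M).
Record bimod_axioms : Prop := BimodAxioms {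
  bml1 : forall m, la 1 m = m;
  bmlM : forall a b m, la (a * b) m = la a (la b m);
  bmlDl : forall a b m, la (a + b) m = la a m + la b m;
  bmlDr : forall a m m', la a (m + m') = la a m + la a m';
  bmr1 : forall m, ra m 1 = m;
  bmrM : forall m a b, ra m (a * b) = ra (ra m a) b;
  bmrDr : forall m a b, ra m (a + b) = ra m a + ra m b;
  bmrDl : forall m m' a, ra (m + m') a = ra m a + ra m' a;
  bmC : forall a m c, ra (la a m) c = la a (ra m c) }.
End BimodAxioms.

Record bimod (A C : pzRingType) := Bimod {
  bcar :> zmodType;
  lact : A -> bcar -> bcar;
  ract : bcar -> C -> bcar;
  bimodP : bimod_axioms lact ract }.
Arguments lact {A C} _ _ _.
Arguments ract {A C} _ _ _.

Section BimodHom.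
Variables (A C : pzRingType).

Record bhom_axioms (M N : bimod A C) (f : M -> N) : Prop := BhomAxioms {
  bhomD : forall x y, f (x + y) = f x + f y;
  bhoml : forall a x, f (lact M a x) = lact N a (f x);
  bhomr : forall x c, f (ract M x c) = ract N (f x) c }.

Record bhom (M N : bimod A C) := Bhom {
  bfun :> M -> N;
  bhomP : bhom_axioms bfun }.

Lemma bid_axioms (M : bimod A C) : bhom_axioms (fun x : M => x).
Proof. by split. Qed.
Definition bid (M : bimod A C) : bhom M M := Bhom (bid_axioms M).

Lemma bcomp_axioms (M N P : bimod A C) (f : bhom M N) (g : bhom N P) :
  bhom_axioms (fun x => g (f x)).
Proof.
by case: f g => [f [f1 f2 f3]] [g [g1 g2 g3]]; split=> * /=;
  rewrite ?(f1, f2, f3) ?(g1, g2, g3).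
Qed.
(* diagrammatic order *)
Definition bcomp (M N P : bimod A C) (f : bhom M N) (g : bhom N P) : bhom M P :=
  Bhom (bcomp_axioms f g).

Lemma lact0 (M : bimod A C) a : lact M a 0 = 0.
Proof. by have [_ _ _ H _ _ _ _ _] := bimodP M; apply: (addrI (lact M a 0)); rewrite -H !addr0. Qed.
Lemma ract0 (M : bimod A C) c : ract M 0 c = 0.
Proof. by have [_ _ _ _ _ _ _ H _] := bimodP M; apply: (addrI (ract M 0 c)); rewrite -H !addr0. Qed.

Lemma bhom0 (M N : bimod A C) (f : bhom M N) : f 0 = 0.
Proof. by apply: (addrI (f 0)); rewrite -(bhomD (bhomP f)) !addr0. Qed.

Lemma bzero_axioms (M N : bimod A C) : bhom_axioms (fun _ : M => 0 : N).
Proof. by split=> * /=; rewrite ?addr0 ?lact0 ?ract0. Qed.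
Definition bzero (M N : bimod A C) : bhom M N := Bhom (bzero_axioms M N).

Lemma bsum_axioms (M N : bimod A C) (J : finType) (f : J -> bhom M N) :
  bhom_axioms (fun x => \sum_j f j x).
Proof.
have HN := bimodP N.
split=> [x y|a x|x c].
- by rewrite -big_split; apply: eq_bigr => j _; rewrite (bhomD (bhomP (f j))).
- rewrite (big_morph _ (bmlDr HN a) (lact0 N a)).
  by apply: eq_bigr => j _; rewrite (bhoml (bhomP (f j))).
- rewrite (big_morph (fun y => ract N y c) (fun y z => bmrDl HN y z c) (ract0 N c)).
  by apply: eq_bigr => j _; rewrite (bhomr (bhomP (f j))).
Qed.
Definition bsum (M N : bimod A C) (J : finType) (f : J -> bhom M N) : bhom M N :=
  Bhom (bsum_axioms f).

End BimodHom.

Section TensorBimod.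
Variables (A B C : pzRingType).

Section Obj.
Variables (M : bimod A B) (N : bimod B C).
Let T := tens (ract M) (lact N).
Definition tb_lact (a : A) : T -> T :=
  tmap (ract M) (lact N) (ract M) (lact N) (lact M a) id.
Definition tb_ract (t : T) (c : C) : T :=
  tmap (ract M) (lact N) (ract M) (lact N) id ((ract N)^~ c) t.

Let HM := bimodP M.
Let HN := bimodP N.

Lemma tb_lact_bal a :
  balanced (ract M) (lact N) (fun m n => tpure (ract M) (lact N) (lact M a m) n).
Proof. by apply: (@tmap_balanced _ _ _ _ _ _ _ _ _ (lact M a) id) => *;
  rewrite ?(bmlDr HM) ?(bmC HM). Qed.
Lemma tb_ract_bal c :
  balanced (ract M) (lact N) (fun m n => tpure (ract M) (lact N) m (ract N n c)).
Proof. by apply: (@tmap_balanced _ _ _ _ _ _ _ _ _ id ((ract N)^~ c)) => *;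
  rewrite ?(bmrDl HN) ?(bmC HN). Qed.

Lemma tb_lactD a x y : tb_lact a (x + y) = tb_lact a x + tb_lact a y.
Proof. exact/tliftD/tb_lact_bal. Qed.
Lemma tb_ractD x y c : tb_ract (x + y) c = tb_ract x c + tb_ract y c.
Proof. exact/tliftD/tb_ract_bal. Qed.
Lemma tb_lactE a m n : tb_lact a (tpure _ _ m n) = tpure _ _ (lact M a m) n.
Proof. exact/tlift_pure/tb_lact_bal. Qed.
Lemma tb_ractE c m n : tb_ract (tpure _ _ m n) c = tpure _ _ m (ract N n c).
Proof. exact/tlift_pure/tb_ract_bal. Qed.

Lemma tb_axioms : bimod_axioms tb_lact tb_ract.
Proof.
have [P1 P2 P3] := tpure_balanced (ract M) (lact N).
have E (f g : T -> T) := @tens_ext _ _ _ (ract M) (lact N) T f g.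
split=> [t|a b t|a b t|a t t'|t|t a b|t a b|t t' a|a t c].
- apply: (E (tb_lact 1) id) => [u v|u v|m n]; [exact: tb_lactD|by []|].
  by rewrite tb_lactE (bml1 HM).
- apply: (E (tb_lact (a * b)) (fun t => tb_lact a (tb_lact b t))) => [u v|u v|m n];
    [exact: tb_lactD|by rewrite !tb_lactD|].
  by rewrite !tb_lactE (bmlM HM).
- apply: (E (tb_lact (a + b)) (fun t => tb_lact a t + tb_lact b t)) => [u v|u v|m n];
    [exact: tb_lactD|by rewrite !tb_lactD [LHS]addrACA|].
  by rewrite !tb_lactE (bmlDl HM) P1.
- exact: tb_lactD.
- apply: (E (tb_ract^~ 1) id) => [u v|u v|m n]; [exact: tb_ractD|by []|].
  by rewrite tb_ractE (bmr1 HN).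
- apply: (E (tb_ract^~ (a * b)) (fun t => tb_ract (tb_ract t a) b)) => [u v|u v|m n];
    [exact: tb_ractD|by rewrite !tb_ractD|].
  by rewrite !tb_ractE (bmrM HN).
- apply: (E (tb_ract^~ (a + b)) (fun t => tb_ract t a + tb_ract t b)) => [u v|u v|m n];
    [exact: tb_ractD|by rewrite !tb_ractD [LHS]addrACA|].
  by rewrite !tb_ractE (bmrDr HN) P2.
- exact: tb_ractD.
- apply: (E (fun t => tb_ract (tb_lact a t) c) (fun t => tb_lact a (tb_ract t c)))
    => [u v|u v|m n].
  + by rewrite tb_lactD tb_ractD.
  + by rewrite tb_ractD tb_lactD.
  + by rewrite tb_lactE !tb_ractE tb_lactE.
Qed.

Definition tbim : bimod A C := Bimod tb_axioms.
Definition tp (m : M) (n : N) : tbim := tpure (ract M) (lact N) m n.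

Lemma tp_balanced : balanced (ract M) (lact N) tp.
Proof. exact: tpure_balanced. Qed.
End Obj.

Lemma tblift_axioms (M : bimod A B) (N : bimod B C) (P : bimod A C)
    (phi : M -> N -> P) (hb : balanced (ract M) (lact N) phi)
    (hl : forall a m n, phi (lact M a m) n = lact P a (phi m n))
    (hr : forall m n c, phi m (ract N n c) = ract P (phi m n) c) :
  bhom_axioms (tlift phi : tbim M N -> P).
Proof.
have HP := bimodP P; have HT := bimodP (tbim M N).
have Dl a (x y : tbim M N) := bmlDr HT a x y.
have Dr c (x y : tbim M N) := bmrDl HT x y c.
have L (x y : tbim M N) : tlift phi (x + y) = tlift phi x + tlift phi y
  by exact: tliftD.
split=> [x y|a x|x c]; first exact: tliftD.
- apply: (@tens_ext _ _ _ _ _ _ (fun x => tlift phi (lact (tbim M N) a x))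
            (fun x => lact P a (tlift phi x))) => [u v|u v|m n].
  + by rewrite Dl L.
  + by rewrite tliftD // (bmlDr HP).
  + by rewrite /= tb_lactE !tlift_pure.
- apply: (@tens_ext _ _ _ _ _ _ (fun x => tlift phi (ract (tbim M N) x c))
            (fun x => ract P (tlift phi x) c)) => [u v|u v|m n].
  + by rewrite Dr L.
  + by rewrite tliftD // (bmrDl HP).
  + by rewrite /= tb_ractE !tlift_pure.
Qed.

Lemma thom_bal (M M' : bimod A B) (N N' : bimod B C) (f : bhom M M')
    (g : bhom N N') :
  balanced (ract M) (lact N) (fun m n => tp (f m) (g n)).
Proof.
case: f g => [f [f1 f2 f3]] [g [g1 g2 g3]].
exact: (@tmap_balanced _ _ _ _ _ _ _ _ _ f g).
Qed.

Definition thom (M M' : bimod A B) (N N' : bimod B C) (f : bhom M M')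
    (g : bhom N N') : bhom (tbim M N) (tbim M' N').
Proof.
refine (Bhom (tblift_axioms (thom_bal f g) _ _)).
- by move=> a m n; rewrite /tp /= tb_lactE (bhoml (bhomP f)).
- by move=> m n c; rewrite /tp /= tb_ractE (bhomr (bhomP g)).
Defined.

End TensorBimod.

Section TensorAssoc.
Variables (A B C D : pzRingType) (M : bimod A B) (N : bimod B C) (P : bimod C D).

Lemma ta_bal2 (p : P) :
  balanced (ract M) (lact N) (fun m n => tp m (tp n p) : tbim M (tbim N P)).
Proof.
have [P1 P2 P3] := tp_balanced M (tbim N P).
have [Q1 Q2 Q3] := tp_balanced N P.
split=> [m m' n|m n n'|m b n]; rewrite ?P1 ?Q1 ?P2 // P3; congr (tp m _).
by rewrite /tp /= tb_lactE.
Qed.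

Definition ta_fun (t : tbim M N) (p : P) : tbim M (tbim N P) :=
  tlift (fun m n => tp m (tp n p) : tbim M (tbim N P)) t.

Lemma ta_pure m n p : ta_fun (tp m n) p = tp m (tp n p).
Proof. exact/tlift_pure/ta_bal2. Qed.
Lemma ta_Dl t t' p : ta_fun (t + t') p = ta_fun t p + ta_fun t' p.
Proof. exact/tliftD/ta_bal2. Qed.

Lemma ta_bal : balanced (ract (tbim M N)) (lact P) ta_fun.
Proof.
have [P1 P2 P3] := tp_balanced M (tbim N P).
have [Q1 Q2 Q3] := tp_balanced N P.
split=> [t t' p|t p p'|t c p]; first exact: ta_Dl.
- apply: (@tens_ext _ _ _ _ _ _ (fun t => ta_fun t (p + p'))
            (fun t => ta_fun t p + ta_fun t p')) => [u v|u v|m n].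
  + exact: ta_Dl.
  + by rewrite [ta_fun (u + v) p]ta_Dl [ta_fun (u + v) p']ta_Dl addrACA.
  + by rewrite -/(tp m n) !ta_pure Q2 P2.
- apply: (@tens_ext _ _ _ _ _ _ (fun t => ta_fun (ract (tbim M N) t c) p)
            (fun t => ta_fun t (lact P c p))) => [u v|u v|m n].
  + by rewrite [ract _ _ _]tb_ractD ta_Dl.
  + exact: ta_Dl.
  + by rewrite [ract _ _ _]tb_ractE -/(tp _ _) -/(tp _ _) !ta_pure Q3.
Qed.

Definition tassoc : bhom (tbim (tbim M N) P) (tbim M (tbim N P)).
Proof.
refine (Bhom (tblift_axioms ta_bal _ _)).
- move=> a t p; apply: (@tens_ext _ _ _ _ _ _
      (fun t => ta_fun (lact (tbim M N) a t) p)
      (fun t => lact (tbim M (tbim N P)) a (ta_fun t p))) => [u v|u v|m n].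
  + by rewrite [lact _ _ _]tb_lactD ta_Dl.
  + by rewrite [ta_fun (u + v) p]ta_Dl [LHS]tb_lactD.
  + by rewrite [lact (tbim M N) _ _]tb_lactE -/(tp _ _) -/(tp _ _) !ta_pure [RHS]tb_lactE.
- move=> t p c; apply: (@tens_ext _ _ _ _ _ _
      (fun t => ta_fun t (ract P p c))
      (fun t => ract (tbim M (tbim N P)) (ta_fun t p) c)) => [u v|u v|m n].
  + exact: ta_Dl.
  + by rewrite [ta_fun (u + v) p]ta_Dl [LHS]tb_ractD.
  + rewrite -/(tp _ _) !ta_pure [RHS]tb_ractE -/(tp _ _).
    by rewrite [ract (tbim N P) _ _]tb_ractE.
Defined.

End TensorAssoc.

Section Coxeter.
Variable W : groupType.
Implicit Types (S : W -> Prop) (u v : seq W) (w x y s t : W).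
Local Open Scope group_scope.

Definition wprod u : W := foldr (fun x y => x * y) 1 u.
Definition in_exp S u : Prop := forall s, s \in u -> S s.
Definition expresses S u w : Prop := in_exp S u /\ wprod u = w.
Definition reduced S u w : Prop :=
  expresses S u w /\ forall v, expresses S v w -> (size u <= size v)%N.
Definition gen S w : Prop := exists u, expresses S u w.
Definition shorter S x y : Prop :=
  exists u v, [/\ reduced S u x, reduced S v y & (size u < size v)%N].

Definition has_order x (m : nat) : Prop :=
  [/\ (0 < m)%N, x ^+ m = 1 & forall j, (0 < j < m)%N -> x ^+ j <> 1].

(* Equality of words in the group generated by [S] subject to (st)^m(s,t) = 1;
   the case s = t, m(s,t) = 1 says that the generators are involutions. *)
Inductive cox_eq S : seq W -> seq W -> Prop :=
| CoxRefl u : cox_eq S u u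
| CoxSym u v : cox_eq S u v -> cox_eq S v u
| CoxTrans u v v' : cox_eq S u v -> cox_eq S v v' -> cox_eq S u v'
| CoxRel u v s t m : S s -> S t -> has_order (s * t) m ->
    cox_eq S (u ++ flatten (nseq m [:: s; t]) ++ v) (u ++ v).

Definition coxeter_system S : Prop :=
  [/\ forall s, S s -> has_order s 2,
      forall w, gen S w
    & forall u, in_exp S u -> wprod u = 1 -> cox_eq S u [::]].

(* [p] is (x, s) with r = x s x^-1 and xs > x, as in the definition of the root
   and coroot of the reflection r *)
Definition refl_pair S (r : W) (p : W * W) : Prop :=
  [/\ gen S p.1, S p.2, r = p.1 * p.2 * p.1^-1 & shorter S p.1 (p.1 * p.2)].

End Coxeter.

Record wset (W : groupType) := Wset {
  wcar :> eqType;
  wact : wcar -> W -> wcar;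
  wact1 : forall L, wact L 1%g = L;
  wactM : forall L x y, wact L (x * y)%g = wact (wact L x) y }.
Arguments wact {W w0} _ _ : rename.

Definition pt_wset (W : groupType) : wset W :=
  @Wset W unit (fun L _ => L) (fun _ => erefl) (fun _ _ _ => erefl).

Section Blocks.
Variables (W : groupType) (S : W -> Prop) (o : wset W).
Implicit Types (L : o) (u v : seq W) (w : W).
Local Open Scope group_scope.

Definition wactw L u : o := foldl wact L u.

(* the indicator sequence of K(u, L) in the positions of u *)
Fixpoint Kmask L u : bitseq :=
  if u is s :: u' then (wact L s == L) :: Kmask (wact L s) u' else [::].

Definition bword L u : W := wprod (mask (map negb (Kmask L u)) u).

(* b_L(w) = v; the element v does not depend on the expression of w *)
Definition bval L w (v : W) : Prop := exists u, expresses S u w /\ bword L u = v.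

Definition Wo L w : Prop := wact L w = L /\ bval L w 1.
Definition So L w : Prop :=
  Wo L w /\ exists u, reduced S u w /\ count id (Kmask L u) = 1%N.

(* A nonempty fibre beta of b_L on {w | L w = L'} is recorded by its value
   w^beta; [block_set] recovers the fibre. *)
Definition is_block_value L L' (v : W) : Prop :=
  exists w, wact L w = L' /\ bval L w v.
Record block L L' := Block {
  bw : W;
  bwP : is_block_value L L' bw }.
Definition block_set L L' (b : block L L') (w : W) : Prop :=
  wact L w = L' /\ bval L w (bw b).

Lemma wprod_cat u v : wprod (u ++ v) = wprod u * wprod v.
Proof. by elim: u => [|s u IH] /=; rewrite ?mul1g // IH mulgA. Qed.

Lemma wact_wprod L u : wact L (wprod u) = wactw L u.
Proof. by elim: u L => [|s u IH] L /=; rewrite ?wact1 // wactM IH. Qed.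

Lemma Kmask_cat L u v : Kmask L (u ++ v) = Kmask L u ++ Kmask (wactw L u) v.
Proof. by elim: u L => [|s u IH] L //=; rewrite IH. Qed.

Lemma size_Kmask L u : size (Kmask L u) = size u.
Proof. by elim: u L => [|s u IH] L //=; rewrite IH. Qed.

Lemma bword_cat L u v : bword L (u ++ v) = bword L u * bword (wactw L u) v.
Proof.
by rewrite /bword Kmask_cat map_cat mask_cat ?wprod_cat // size_map size_Kmask.
Qed.

Lemma bval_mul L L' x y (v w : W) : wact L x = L' -> bval L x v -> bval L' y w ->
  bval L (x * y) (v * w).
Proof.
move=> Lx [u [[uS ux] uv]] [u' [[uS' uy] uw]]; exists (u ++ u'); split.
  split; last by rewrite wprod_cat ux uy.
  by move=> s; rewrite mem_cat => /orP[/uS|/uS'].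
by rewrite bword_cat -wact_wprod ux Lx uv uw.
Qed.

Lemma block_mul_subproof L L' L'' (b : block L L') (c : block L' L'') :
  is_block_value L L'' (bw b * bw c).
Proof.
case: b c => v [x [Lx xv]] [w [y [Ly yw]]] /=.
by exists (x * y); rewrite wactM Lx; split=> //; apply: bval_mul Lx xv yw.
Qed.
Definition block_mul L L' L'' (b : block L L') (c : block L' L'') : block L L'' :=
  Block (block_mul_subproof b c).

Lemma block_one_subproof L : is_block_value L L 1.
Proof. by exists 1; rewrite wact1; split=> //; exists [::]. Qed.
Definition block_one L : block L L := Block (block_one_subproof L).

Lemma bw_in_block L L' (b : block L L') : block_set b (bw b).
Proof.
case: b => v [w [Lw [u [[uS uw] uv]]]]; rewrite /block_set /= -uv.
have E u' L0 : bword L0 (mask (map negb (Kmask L0 u')) u') = bword L0 u' /\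
    wactw L0 (mask (map negb (Kmask L0 u')) u') = wactw L0 u'.
  elim: u' L0 => [|s u' IH] L0 //=; rewrite /bword /=.
  case: eqP => [Ls|/eqP/negbTE Ls] /=; first by rewrite Ls; exact: IH.
  by rewrite Ls /=; case: (IH (wact L0 s)); rewrite /bword => -> ->.
have [E1 E2] := E u L; split; first by rewrite wact_wprod E2 -wact_wprod uw.
exists (mask (map negb (Kmask L u)) u); split; last exact: E1.
by split=> // s /mem_mask /uS.
Qed.

(* [block_mul] is the product of blocks as sets. *)
Lemma block_setM (Sinv : forall s, S s -> s * s = 1) L L' L''
    (b : block L L') (c : block L' L'') w :
  block_set (block_mul b c) w <->
  exists x y, [/\ block_set b x, block_set c y & w = x * y].
Proof.
split=> [[Lw Hw]|[x [y [[Lx Hx] [Ly Hy] ->]]]]; last first.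
  by split; [rewrite wactM Lx | apply: bval_mul Lx Hx Hy].
have [Lc [u [[uS uc] cu]]] := bw_in_block c.
have invol (s : W) : s * s = 1 -> s = s^-1.
  by move=> H; apply: (@mulgI _ s); rewrite mulgV.
have revP (u0 : seq W) : in_exp S u0 -> in_exp S (rev u0) /\ wprod (rev u0) = (wprod u0)^-1.
  elim: u0 => [|s u0 IH] sS; first by rewrite /= invg1.
  have [|H1 H2] := IH; first by move=> t tu; apply: sS; rewrite inE tu orbT.
  split; first by move=> t; rewrite mem_rev => /sS.
  rewrite rev_cons -cats1 wprod_cat H2 /= mulg1 invgM.
  by congr (_ * _); apply/invol/Sinv/sS; rewrite inE eqxx.
have brev (u0 : seq W) L0 : in_exp S u0 ->
    bword (wactw L0 u0) (rev u0) = (bword L0 u0)^-1.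
  elim: u0 L0 => [|s u0 IH] L0 sS; first by rewrite /bword /= invg1.
  have sS0 : in_exp S u0 by move=> t tu; apply: sS; rewrite inE tu orbT.
  have ss : s * s = 1 by apply/Sinv/sS; rewrite inE eqxx.
  have Lrev : wactw (wactw (wact L0 s) u0) (rev u0) = wact L0 s.
    by rewrite -!wact_wprod (revP _ sS0).2 -wactM mulgV wact1.
  rewrite rev_cons -cats1 bword_cat /= IH // Lrev.
  rewrite /bword /= -wactM ss wact1 [L0 == _]eq_sym.
  case: eqP => /= _; rewrite ?mulg1 // invgM; congr (_ * _); exact: invol.
have Lci : wact L'' (bw c)^-1 = L'.
  have := congr1 (fun L0 => wact L0 (bw c)^-1) Lc.
  by rewrite -wactM mulgV wact1 => <-.
exists (w * (bw c)^-1), (bw c); split; [|exact: bw_in_block|by rewrite mulgVK].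
split; first by rewrite wactM Lw.
have [rS rP] := revP _ uS.
have Hr : bval L'' (bw c)^-1 (bw c)^-1.
  exists (rev u); split; first by split=> //; rewrite rP uc.
  have := brev u L' uS; rewrite -wact_wprod uc cu => <-; congr (bword _ _).
  by rewrite Lc.
have := bval_mul Lw Hw Hr; rewrite /= mulgK; exact.
Qed.

End Blocks.

Section TwoColored.
Variable A : comPzRingType.

Fixpoint qnum (n : nat) (x y : A) : A :=
  match n with
  | 0 => 0
  | n'.+1 => if n' is n''.+1 then x * qnum n' y x - qnum n'' x y else 1
  end.

(* x(d); y(d) is [xd d y x] *)
Definition xd (d : nat) (x y : A) : A := qnum d.+1 x y - qnum d.-1 x y.

End TwoColored.

Definition Zxy := {mpoly int[2]}.
Definition zx : Zxy := 'X_ord0.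
Definition zy : Zxy := 'X_ord_max.

(* the value of a polynomial in Z[x,y] at (a, b) *)
Definition zeval (k : idomainType) (a b : k) (p : Zxy) : k :=
  mmap intr (fun i : 'I_2 => if i == ord0 then a else b) p.

(* The binomial (v choose j)_x is the polynomial quotient p; those with index y
   are obtained by exchanging x and y. *)
Definition is_qbinom (x y : Zxy) (v j : nat) (p : Zxy) : Prop :=
  p * (\prod_(i < j) qnum i.+1 x y) = \prod_(i < j) qnum (v - i) x y.

Section Realizations.
Variables (W : groupType) (k : idomainType) (n : nat).

Definition pairing (v : 'cV[k]_n) (a : 'rV[k]_n) : k := (a *m v) ord0 ord0.

Record rep := Rep {
  rho :> W -> 'M[k]_n;
  rho1 : rho 1%g = 1%:M;
  rhoM : forall x y, rho (x * y)%g = rho x *m rho y }.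

(* h = k^n (columns), its dual is the space of rows *)
Record prerealization (S : W -> Prop) := Prerealization {
  hrep :> rep;
  alpha : W -> 'rV[k]_n;
  alphav : W -> 'cV[k]_n;
  alpha_pair : forall s, S s -> pairing (alphav s) (alpha s) = 2%:R;
  alpha_refl : forall s v, S s ->
    hrep s *m v = v - pairing v (alpha s) *: alphav s;
  alpha_surj : forall s c, S s -> exists v, pairing v (alpha s) = c;
  alphav_surj : forall s c, S s -> exists a, pairing (alphav s) a = c }.

Variables (S : W -> Prop) (h : prerealization S).

Definition cartan (s t : W) : k := pairing (alphav h s) (alpha h t).

Definition reflection_stable_abe : Prop :=
  forall s t m, S s -> S t -> s <> t -> has_order (s * t)%g m ->
  forall v j, (1 < v)%N -> (v %| m)%N -> (1 <= j <= v.-1)%N ->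
  let d := (m %/ v)%N in let X := xd d zx zy in let Y := xd d zy zx in
  (exists p, is_qbinom X Y v j p /\ zeval (cartan s t) (cartan t s) p = 0) /\
  (exists p, is_qbinom Y X v j p /\ zeval (cartan s t) (cartan t s) p = 0).

Definition reflection_balanced : Prop :=
  forall s t m, S s -> S t -> s <> t -> has_order (s * t)%g m ->
  forall d, (1 <= d < m)%N -> (d %| m)%N ->
  let X := xd d zx zy in let Y := xd d zy zx in
  zeval (- cartan s t) (- cartan t s) (qnum (m %/ d).-1 X Y) = 1 /\
  zeval (- cartan s t) (- cartan t s) (qnum (m %/ d).-1 Y X) = 1.

End Realizations.
Arguments rep : clear implicits.
Arguments prerealization {W} k n S.

Section LocRing.
Variables (A : idomainType) (den : A -> Prop).
Local Notation F := {fraction A}.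

(* A[d^-1 : d in den] inside the fraction field of A *)
Definition in_locring : {pred F} := fun q =>
  `[< forall P : F -> Prop,
        P 1 -> (forall x y, P x -> P y -> P (x - y)) ->
        (forall x y, P x -> P y -> P (x * y)) ->
        (forall a, P (tofrac a)) -> (forall d, den d -> P (tofrac d)^-1) -> P q >].

Lemma in_locring_subring : subring_closed in_locring.
Proof.
split=> [|x y /asboolP Hx /asboolP Hy|x y /asboolP Hx /asboolP Hy].
- by apply/asboolP.
- by apply/asboolP => P P1 PB PM PF Pd; apply: (PB); [apply: Hx | apply: Hy].
- by apply/asboolP => P P1 PB PM PF Pd; apply: (PM); [apply: Hx | apply: Hy].
Qed.

Lemma in_locringF a : tofrac a \in in_locring.
Proof. by apply/asboolP. Qed.

Record locring := Locring { lval : F; lvalP : lval \in in_locring }.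
HB.instance Definition _ := [isSub for lval].
HB.instance Definition _ := [Choice of locring by <:].
HB.instance Definition _ :=
  GRing.SubChoice_isSubComNzRing.Build F in_locring locring in_locring_subring.

Definition loc_of (a : A) : locring := Locring (in_locringF a).

Lemma lvalE : lval = val. Proof. by []. Qed.
Lemma loc_ofD a b : loc_of (a + b) = loc_of a + loc_of b.
Proof. by apply: val_inj; rewrite [RHS]rmorphD /= tofracD. Qed.
Lemma loc_ofM a b : loc_of (a * b) = loc_of a * loc_of b.
Proof. by apply: val_inj; rewrite [RHS]rmorphM /= tofracM. Qed.
Lemma loc_of1 : loc_of 1 = 1.
Proof. by apply: val_inj; rewrite [RHS]rmorph1 /= tofrac1. Qed.

Lemma locbim_axioms :
  @bimod_axioms A locring locring (fun a q => loc_of a * q) (fun q c => q * c).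
Proof.
by split=> *; rewrite ?(loc_of1, loc_ofM, loc_ofD) ?mul1r ?mulr1
  ?mulrA ?mulrDl ?mulrDr.
Qed.
Definition locbim : bimod A locring := Bimod locbim_axioms.

End LocRing.

Section Sym.
Variables (W : groupType) (k : idomainType) (n : nat) (rho : rep W k n).

(* Sym(h^* ) is the polynomial ring in the coordinates of h = k^n, and [symv] is the
   embedding of h^*. *)
Definition Rh : idomainType := {mpoly k[n]}.

Definition symv (a : 'rV[k]_n) : {mpoly k[n]} := \sum_(i < n) a ord0 i *: 'X_i.

(* the action of W on h^* is (w a)(v) = a(w^-1 v) *)
Definition actV (w : W) (a : 'rV[k]_n) : 'rV[k]_n := a *m rho w^-1%g.
Definition actR (w : W) (f : Rh) : Rh :=
  (f : {mpoly k[n]}) \mPo [tuple symv (actV w (delta_mx ord0 i)) | i < n].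

Lemma actR_is_zmod w : zmod_morphism (actR w).
Proof. exact: rmorphB. Qed.
Lemma actR_is_monoid w : monoid_morphism (actR w).
Proof. by split; [exact: rmorph1 | exact: rmorphM]. Qed.
HB.instance Definition _ w :=
  GRing.isZmodMorphism.Build Rh Rh (actR w) (actR_is_zmod w).
HB.instance Definition _ w :=
  GRing.isMonoidMorphism.Build Rh Rh (actR w) (actR_is_monoid w).

Lemma symvD a b : symv (a + b) = symv a + symv b.
Proof.
by rewrite /symv -big_split; apply: eq_bigr => i _; rewrite mxE scalerDl.
Qed.
Lemma symvZ c a : symv (c *: a) = c *: symv a.
Proof.
by rewrite /symv scaler_sumr; apply: eq_bigr => i _; rewrite mxE scalerA.
Qed.
Lemma symv_sum (J : finType) (F : J -> 'rV[k]_n) :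
  symv (\sum_j F j) = \sum_j symv (F j).
Proof.
apply: (big_morph symv symvD).
by rewrite /symv big1 // => i _; rewrite mxE scale0r.
Qed.

Lemma symv_delta i : symv (delta_mx ord0 i) = 'X_i.
Proof.
rewrite /symv (bigD1 i) //= big1 ?addr0 => [|j ji].
  by rewrite mxE !eqxx scale1r.
by rewrite mxE eqxx /= (negbTE ji) scale0r.
Qed.

Lemma actR_X w i : actR w 'X_i = symv (actV w (delta_mx ord0 i)).
Proof. by rewrite /actR comp_mpolyXU -tnth_nth tnth_mktuple. Qed.

Lemma actR_symv w a : actR w (symv a) = symv (actV w a).
Proof.
rewrite {1}/symv /actR raddf_sum /= [in RHS](row_sum_delta a).
rewrite /actV mulmx_suml symv_sum; apply: eq_bigr => i _.
by rewrite comp_mpolyZ -[_ \mPo _]/(actR w 'X_i) actR_X -scalemxAl symvZ.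
Qed.

Lemma actR_ext (f g : {rmorphism Rh -> Rh}) :
  (forall c, f (c%:MP : {mpoly k[n]}) = g (c%:MP : {mpoly k[n]})) ->
  (forall i, f ('X_i : {mpoly k[n]}) = g ('X_i : {mpoly k[n]})) -> f =1 g.
Proof.
move=> fC fX p; rewrite (mpolyE (p : {mpoly k[n]})) !rmorph_sum.
apply: eq_bigr => m _; rewrite -mul_mpolyC !rmorphM fC; congr (_ * _).
rewrite (mpolyXE_id k m) !rmorph_prod; apply: eq_bigr => i _.
by rewrite !rmorphXn fX.
Qed.

Lemma actR1 f : actR 1%g f = f.
Proof.
have := @actR_ext (actR 1%g) idfun; apply => [c|i] /=; first exact: comp_mpolyC.
by rewrite actR_X /actV invg1 rho1 mulmx1 symv_delta.
Qed.

Lemma actRM x y f : actR (x * y)%g f = actR x (actR y f).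
Proof.
have := @actR_ext (actR (x * y)%g) (actR x \o actR y); apply => [c|i] /=.
  by rewrite /actR !comp_mpolyC.
by rewrite !actR_X actR_symv /actV invgM rhoM mulmxA.
Qed.

Lemma actRK w f : actR w^-1%g (actR w f) = f.
Proof. by rewrite -actRM mulVg actR1. Qed.
Lemma actRVK w f : actR w (actR w^-1%g f) = f.
Proof. by rewrite -actRM mulgV actR1. Qed.

End Sym.

(* V is the internal direct sum of the subgroups P j. *)
Definition direct_sum_of (V : zmodType) (J : eqType) (P : J -> V -> Prop) : Prop :=
  [/\ forall j, P j 0 /\ (forall x y, P j x -> P j y -> P j (x - y)),
      forall v, exists (s : seq J) (c : J -> V),
        (forall j, j \in s -> P j (c j)) /\ v = \sum_(j <- s) c j
    & forall (s : seq J) (c : J -> V), uniq s ->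
        (forall j, j \in s -> P j (c j)) -> \sum_(j <- s) c j = 0 ->
        forall j, j \in s -> c j = 0].

Definition add_span (V : zmodType) (P : V -> Prop) (v : V) : Prop :=
  exists s : seq V, (forall x, x \in s -> P x) /\ v = \sum_(x <- s) x.

Section Category.
Variables (W : groupType) (k : idomainType) (n : nat) (rho : rep W k n).
Local Notation R := (Rh k n).
Local Notation act := (actR rho).

(* A Coxeter subsystem of W: [gens] is a set of reflections, generating the subgroup
   [gen (gens D)], and [root], [coroot] matter only on it.  It is used for (W, S)
   and for the endoscopic groups; bimodules for D have summands indexed by all of W
   that vanish outside [gen (gens D)]. *)
Record rdatum := Rdatum {
  gens : W -> Prop;
  root : W -> 'rV[k]_n;
  coroot : W -> 'cV[k]_n }.

Definition rdeg (i : int) (f : R) : Prop :=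
  f = 0 \/ exists2 j : nat, i = (2 * j)%N%:Z & (f : {mpoly k[n]}) \is j.-homog.

Variable D : rdatum.

Definition is_root (d : R) : Prop :=
  exists r p, refl_pair (gens D) r p /\ d = symv (actV rho p.1 (root D p.2)).

Definition Q : comNzRingType := locring is_root.
Definition Qbim : bimod R Q := locbim is_root.

Definition qdeg (i : int) (q : Q) : Prop :=
  exists f d a b, [/\ rdeg a f, rdeg b d, d != 0, i = a - b
                    & lval q = tofrac f / tofrac d].

(* M_Q = M (x)_R Q *)
Definition MQ (M : bimod R R) : bimod R Q := tbim M Qbim.
Definition mq (M : bimod R R) (m : M) (q : Q) : MQ M := @tp R R Q M Qbim m q.
Definition fQ (M N : bimod R R) (f : bhom M N) : bhom (MQ M) (MQ N) :=
  thom f (bid Qbim).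

(* The summands M_Q^w of M_Q are given as the subsets [lcomp M w] of M (x)_R Q
   that xi_M identifies with them.  The axioms are in [in_C] below. *)
Record lbim := Lbim {
  lbmod :> bimod R R;
  ldeg : int -> lbmod -> Prop;
  lcomp : W -> MQ lbmod -> Prop }.

Definition mqdeg (M : lbim) (i : int) : MQ M -> Prop :=
  add_span (fun x => exists (m : M) (q : Q) (a b : int),
    [/\ ldeg a m, qdeg b q, i = a + b & x = mq m q]).

(* the intersection of M with M_Q^w; it spans M_Q^w over Q *)
Definition lat (M : lbim) (w : W) (m : M) : Prop := lcomp w (mq m 1).

Definition fin_gen_bimod (M : bimod R R) : Prop :=
  exists g : seq M, forall m : M,
    add_span (fun x => exists (a b : R) (y : M),
      y \in g /\ x = ract M (lact M a y) b) m.

Definition right_flat (M : bimod R R) : Prop :=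
  forall (X Y : lmodType R) (f : {linear X -> Y}), injective f ->
    injective (tmap (ract M) (fun (a : R) (x : X) => a *: x)
                    (ract M) (fun (a : R) (y : Y) => a *: y) id f).

Record in_C (o : wset W) (L L' : o) (M : lbim) : Prop := InC {
  inC_graded : direct_sum_of (@ldeg M);
  inC_degl : forall i j f (m : M), rdeg i f -> ldeg j m -> ldeg (i + j) (lact M f m);
  inC_degr : forall i j f (m : M), rdeg i f -> ldeg j m -> ldeg (i + j) (ract M m f);
  inC_fg : fin_gen_bimod M;
  inC_flat : right_flat M;
  inC_sum : direct_sum_of (@lcomp M);
  inC_lact : forall w f (x : MQ M), lcomp w x -> lcomp w (lact (MQ M) f x);
  inC_ract : forall w q (x : MQ M), lcomp w x -> lcomp w (ract (MQ M) x q);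
  inC_twist : forall w f (x : MQ M), lcomp w x ->
    ract (MQ M) x (loc_of is_root f) = lact (MQ M) (act w f) x;
  inC_compdeg : forall w (x : MQ M), lcomp w x ->
    add_span (fun y => lcomp w y /\ exists i, mqdeg i y) x;
  inC_finite : exists s : seq W, forall w (x : MQ M), lcomp w x -> x <> 0 -> w \in s;
  inC_supp : forall w (x : MQ M), lcomp w x -> x <> 0 ->
    gen (gens D) w /\ wact L w = L' }.

Definition is_mor (M N : lbim) (f : bhom M N) : Prop :=
  forall w x, lcomp w x -> lcomp w (fQ f x).

(* (M (x) N)_Q^w is the Q-span of the tensors of elements of M_Q^x and N_Q^y with
   xy = w, which may be taken in M and N. *)
Definition ltens (M N : lbim) : lbim :=
  @Lbim (tbim M N)
    (fun i => add_span (fun t => exists (m : M) (p : N) (a b : int),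
       [/\ ldeg a m, ldeg b p, i = a + b & t = tp m p]))
    (fun w => add_span (fun t => exists (m : M) (p : N) (q : Q) (x y : W),
       [/\ lat x m, lat y p, (x * y)%g = w & t = mq (tp m p : tbim M N) q])).

Lemma Rw_axioms (w : W) :
  @bimod_axioms R R R (fun f m => f * m) (fun m f => act w f * m).
Proof.
split=> *; rewrite ?rmorph1 ?rmorphM ?rmorphD ?mul1r ?mulrDl ?mulrDr //.
- by rewrite mulrA.
- by rewrite mulrCA mulrA.
- by rewrite mulrCA.
Qed.
Definition Rw (w : W) : lbim :=
  @Lbim (Bimod (Rw_axioms w)) rdeg (fun x p => x = w \/ p = 0).

Section Cs.
Variable s : W.
Definition Rs := {f : R | act s f = f}.
Let rs (g : R) (f : Rs) : R := g * sval f.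
Let ls (f : Rs) (g : R) : R := sval f * g.
Let T := tens rs ls.
Let cl (a : R) : T -> T := tmap rs ls rs ls (fun g => a * g) id.
Let cr (t : T) (a : R) : T := tmap rs ls rs ls id (fun g => g * a) t.

Let clD a x y : cl a (x + y) = cl a x + cl a y.
Proof. by apply: tmapD => *; rewrite /rs /ls ?mulrDr ?mulrA. Qed.
Let crD a x y : cr (x + y) a = cr x a + cr y a.
Proof. by apply: tmapD => *; rewrite /rs /ls ?mulrDl ?mulrA. Qed.
Let clE a g g' : cl a (tpure rs ls g g') = tpure rs ls (a * g) g'.
Proof. by apply: tmap_pure => *; rewrite /rs /ls ?mulrDr ?mulrA. Qed.
Let crE a g g' : cr (tpure rs ls g g') a = tpure rs ls g (g' * a).
Proof. by apply: tmap_pure => *; rewrite /rs /ls ?mulrDl ?mulrA. Qed.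

Lemma Cs_axioms : bimod_axioms cl cr.
Proof.
have [P1 P2 P3] := tpure_balanced rs ls.
have E (f g : T -> T) := @tens_ext _ _ _ rs ls T f g.
split=> [t|a b t|a b t|a t t'|t|t a b|t a b|t t' a|a t c].
- by apply: (E (cl 1) id) => [u v|u v|m p]; rewrite ?clD ?clE ?mul1r.
- by apply: (E (cl (a * b)) (fun t => cl a (cl b t))) => [u v|u v|m p];
    rewrite ?clD ?clE ?mulrA.
- apply: (E (cl (a + b)) (fun t => cl a t + cl b t)) => [u v|u v|m p];
    [exact: clD|by rewrite !clD [LHS]addrACA|].
  by rewrite !clE mulrDl P1.
- exact: clD.
- by apply: (E (cr^~ 1) id) => [u v|u v|m p]; rewrite ?crD ?crE ?mulr1.
- by apply: (E (cr^~ (a * b)) (fun t => cr (cr t a) b)) => [u v|u v|m p];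
    rewrite ?crD ?crE ?mulrA.
- apply: (E (cr^~ (a + b)) (fun t => cr t a + cr t b)) => [u v|u v|m p];
    [exact: crD|by rewrite !crD [LHS]addrACA|].
  by rewrite !crE mulrDr P2.
- exact: crD.
- apply: (E (fun t => cr (cl a t) c) (fun t => cl a (cr t c))) => [u v|u v|m p].
  + by rewrite clD crD.
  + by rewrite crD clD.
  + by rewrite clE !crE clE.
Qed.

Definition Cs_bim : bimod R R := Bimod Cs_axioms.
Definition cs_tp (f g : R) : Cs_bim := tpure rs ls f g.

(* R (x)_{R^s} R (1).  The generators of the two components do not depend on the
   choice of [a] = delta. *)
Definition Cs : lbim :=
  @Lbim Cs_bim
    (fun i => add_span (fun t => exists (f g : R) (a b : int),
       [/\ rdeg a f, rdeg b g, i + 1 = a + b & t = cs_tp f g]))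
    (fun w x => [\/ x = 0,
       w = 1%g /\ exists (a : 'rV[k]_n) (q : Q), pairing (coroot D s) a = 1 /\
         x = mq (cs_tp (symv a) 1 - cs_tp 1 (symv (actV rho s a))) q
     | w = s /\ exists (a : 'rV[k]_n) (q : Q), pairing (coroot D s) a = 1 /\
         x = mq (cs_tp (symv a) 1 - cs_tp 1 (symv a)) q]).
End Cs.

Section BottSamelson.
Variable o : wset W.

Definition Bs (L : o) (s : W) : lbim := if wact L s == L then Cs s else Rw s.
Fixpoint Bw (L : o) (u : seq W) : lbim :=
  match u with
  | [::] => Rw 1%g
  | [:: s] => Bs L s
  | s :: u' => ltens (Bs L s) (Bw (wact L s) u')
  end.
End BottSamelson.

(* finite direct sums in the additive category C are biproducts *)
Definition is_direct_sum (M : lbim) (d : nat) (X : 'I_d -> lbim) : Prop :=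
  exists (inc : forall i, bhom (X i) M) (pro : forall i, bhom M (X i)),
  [/\ forall i, is_mor (inc i) /\ is_mor (pro i),
      forall i x, pro i (inc i x) = x,
      forall i j x, i <> j -> pro j (inc i x) = 0
    & forall m, m = \sum_i inc i (pro i m)].

Definition iso_C (M N : lbim) : Prop :=
  exists (f : bhom M N) (g : bhom N M),
    [/\ is_mor f, is_mor g, cancel f g & cancel g f].

Definition in_A (o : wset W) (L L' : o) (M : lbim) : Prop :=
  in_C L L' M /\
  exists (d : nat) (us : 'I_d -> seq W),
    (forall i, in_exp (gens D) (us i) /\ wactw L (us i) = L') /\
    is_direct_sum M (fun i => Bw L (us i)).

(* sums of B_u with u expressing an element of the subgroup Wo L *)
Definition in_Ao (o : wset W) (L : o) (M : lbim) : Prop :=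
  in_C L L M /\
  exists (d : nat) (us : 'I_d -> seq W),
    (forall i, in_exp (gens D) (us i) /\ Wo (gens D) L (wprod (us i))) /\
    is_direct_sum M (fun i => Bw L (us i)).

Lemma lun_bal (M : bimod R R) :
  balanced (ract (Rw 1%g)) (lact M) (fun (f : R) m => lact M f m).
Proof.
have H := bimodP M; split=> [f f' m|f m m'|f b m].
- exact: (bmlDl H).
- exact: (bmlDr H).
- by rewrite /= actR1 mulrC (bmlM H).
Qed.
Definition lun (M : bimod R R) : bhom (tbim (Rw 1%g) M) M.
Proof.
refine (Bhom (tblift_axioms (lun_bal M) _ _)) => [a f m|f m c].
- exact: (bmlM (bimodP M)).
- by rewrite (bmC (bimodP M)).
Defined.

Lemma run_bal (M : bimod R R) :
  balanced (ract M) (lact (Rw 1%g)) (fun m (f : R) => ract M m f).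
Proof.
have H := bimodP M; split=> [m m' f|m f f'|m b f].
- exact: (bmrDl H).
- exact: (bmrDr H).
- by rewrite /= (bmrM H).
Qed.
Definition run (M : bimod R R) : bhom (tbim M (Rw 1%g)) M.
Proof.
refine (Bhom (tblift_axioms (run_bal M) _ _)) => [a m f|m f c].
- by rewrite (bmC (bimodP M)).
- by rewrite /= actR1 mulrC (bmrM (bimodP M)).
Defined.

(* All (decorated) bimodules and all bimodule maps, with any set of objects; the
   2-categories below are cut out of it by [in_A] and [is_mor]. *)
Definition bim_bicat (X : Type) : bicat_data :=
  @BicatData X (fun _ _ => lbim) (fun _ _ M N => bhom M N)
    (fun _ => Rw 1%g) (fun _ _ _ M N => ltens M N)
    (fun _ _ M => bid M) (fun _ _ M N P f g => bcomp f g)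
    (fun _ _ _ M M' N N' f g => thom f g)
    (fun _ _ _ _ M N P => tassoc M N P)
    (fun _ _ M => lun M) (fun _ _ M => run M).

End Category.

Section AlgebraicTwoCategory.
Variables (W : groupType) (k : idomainType) (n : nat) (rho : rep W k n).
Variables (D : rdatum W k n) (o : wset W).

Definition A_closed : Prop :=
  @sub_closed (bim_bicat rho D o)
    (fun L L' M => in_A L L' M) (fun _ _ M N f => is_mor f).

Definition A_bicat (cl : A_closed) : bicat_data := sub_bicat cl.

(* the monoidal category of endomorphisms of L that are sums of B_u with u
   expressing an element of Wo L, as a bicategory with one object *)
Definition Ao_closed (L : o) : Prop :=
  @sub_closed (bim_bicat rho D unit)
    (fun _ _ M => in_Ao L M) (fun _ _ M N f => is_mor f).

Definition Ao_bicat (L : o) (cl : Ao_closed L) : bicat_data := sub_bicat cl.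

End AlgebraicTwoCategory.

Section Twist.
Variables (W : groupType) (k : idomainType) (n : nat) (rho : rep W k n).
Local Notation R := (Rh k n).
Local Notation act := (actR rho).

Lemma twist_axioms (v : W) (M : bimod R R) :
  @bimod_axioms R R M (fun f m => lact M (act v^-1%g f) m)
    (fun m f => ract M m (act v^-1%g f)).
Proof.
have H := bimodP M; split=> *; rewrite ?rmorph1 ?rmorphM ?rmorphD.
- exact: (bml1 H).
- exact: (bmlM H).
- exact: (bmlDl H).
- exact: (bmlDr H).
- exact: (bmr1 H).
- exact: (bmrM H).
- exact: (bmrDr H).
- exact: (bmrDl H).
- exact: (bmC H).
Qed.
Definition twist (v : W) (M : bimod R R) : bimod R R := Bimod (twist_axioms v M).

(* [M] is localized with respect to D', [ltwist v M] with respect to D, where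
   conjugation by v is an isomorphism from the group of D' to that of D.  Again
   M_Q^w is spanned by its intersection with M. *)
Definition ltwist (D' D : rdatum W k n) (v : W) (M : lbim rho D') : lbim rho D :=
  @Lbim W k n rho D (twist v M) (@ldeg _ _ _ _ _ M)
    (fun w => add_span (fun x => exists (m : M) (q : Q rho D),
       lat (v^-1 * w * v)%g m /\ x = @mq W k n rho D (twist v M) m q)).

Lemma tw_hom_axioms (v v' : W) (M N : bimod R R) (f : bhom M N) :
  @bhom_axioms R R (twist v M) (twist v' N) (fun m => if v == v' then f m else 0).
Proof.
have [f1 f2 f3] := bhomP f; split=> [x y|a x|x c].
- by case: eqP; rewrite ?addr0.
- by rewrite /=; case: eqP => [->|_]; [exact: f2 | rewrite lact0].
- by rewrite /=; case: eqP => [->|_]; [exact: f3 | rewrite ract0].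
Qed.
Definition tw_hom (v v' : W) (M N : bimod R R) (f : bhom M N) :
  bhom (twist v M) (twist v' N) := Bhom (tw_hom_axioms v v' f).

Lemma tw_one_axioms (M : bimod R R) :
  @bhom_axioms R R (twist 1%g M) M (fun m => m).
Proof.
split=> [x y|a x|x c] //.
- by rewrite [LHS]/= invg1 actR1.
- by rewrite [LHS]/= invg1 actR1.
Qed.
Definition tw_one (M : bimod R R) : bhom (twist 1%g M) M :=
  Bhom (tw_one_axioms M).

Lemma tw_mul_axioms (v v' : W) (M : bimod R R) :
  @bhom_axioms R R (twist (v * v')%g M) (twist v (twist v' M)) (fun m => m).
Proof.
split=> [x y|a x|x c] //.
- by rewrite [LHS]/= invgM actRM.
- by rewrite [LHS]/= invgM actRM.
Qed.
Definition tw_mul (v v' : W) (M : bimod R R) :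
  bhom (twist (v * v')%g M) (twist v (twist v' M)) := Bhom (tw_mul_axioms v v' M).

Lemma tw_tens_bal (v : W) (M N : bimod R R) :
  balanced (ract (twist v M)) (lact (twist v N))
    (fun (m : M) (p : N) => tp m p).
Proof.
have [H1 H2 H3] := tp_balanced M N.
by split=> [m m' p|m p p'|m f p] /=; rewrite ?H1 ?H2 ?H3.
Qed.
Definition tw_tens (v : W) (M N : bimod R R) :
  bhom (tbim (twist v M) (twist v N)) (twist v (tbim M N)).
Proof.
refine (Bhom (@tblift_axioms R R R (twist v M) (twist v N) (twist v (tbim M N))
  _ (tw_tens_bal v M N) _ _)) => [f m p|m p f] /=.
- by rewrite [RHS]tb_lactE.
- by rewrite [RHS]tb_ractE.
Defined.

Lemma tw_R_axioms (D : rdatum W k n) (v : W) :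
  @bhom_axioms R R (twist v (Rw rho D 1%g)) (Rw rho D 1%g) (fun f => act v f).
Proof.
have M (f g : R) : act v (f * g) = act v f * act v g by exact: rmorphM.
split=> [x y|a x|x c]; first exact: rmorphD.
- by rewrite [LHS]M actRVK.
- by rewrite [LHS]M /= !actR1 actRVK.
Qed.
Definition tw_R (D : rdatum W k n) (v : W) :
  bhom (twist v (Rw rho D 1%g)) (Rw rho D 1%g) := Bhom (tw_R_axioms D v).

End Twist.

Section Endoscopic.
Variables (W : groupType) (S : W -> Prop) (k : idomainType) (n : nat).
Variables (h : prerealization k n S) (o : wset W).
Local Notation R := (Rh k n).

Definition full_datum : rdatum W k n := Rdatum S (alpha h) (alphav h).

Definition chosen_pair (r : W) : W * W :=
  if pselect (exists p, refl_pair S r p) is left e then sval (cid e)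
  else (1%g, 1%g).
(* alpha_r and its coroot for a reflection r; balancedness makes them independent
   of the choice of (x, s). *)
Definition refl_root (r : W) : 'rV[k]_n :=
  actV h (chosen_pair r).1 (alpha h (chosen_pair r).2).
Definition refl_coroot (r : W) : 'cV[k]_n :=
  hrep h (chosen_pair r).1 *m alphav h (chosen_pair r).2.

Definition endo_datum (L : o) : rdatum W k n :=
  Rdatum (So S L) refl_root refl_coroot.

Local Notation lbo L := (lbim h (endo_datum L)).

(* The direct sum of the categories A(h, beta): finite formal sums of objects of
   the summands, with matrices of morphisms, vanishing between different
   blocks. *)
Record ecell (L L' : o) := Ecell {
  eix : finType;
  etag : eix -> block S L L';
  eobj : eix -> lbo L }.
Arguments etag {L L'} _ _.
Arguments eobj {L L'} _ _.

Record ehom (L L' : o) (X Y : ecell L L') := Ehom {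
  emx : forall (i : eix X) (j : eix Y), bhom (eobj X i) (eobj Y j);
  emx0 : forall i j, bw (etag X i) <> bw (etag Y j) -> forall x, emx i j x = 0 }.

Section Delta.
Variables (L L' : o) (X Y : ecell L L') (g : eix X -> eix Y).
Hypothesis gtag : forall i, bw (etag X i) = bw (etag Y (g i)).
Variable phi : forall i, bhom (eobj X i) (eobj Y (g i)).

Definition edelta_mx (i : eix X) (j : eix Y) : bhom (eobj X i) (eobj Y j) :=
  match g i =P j with
  | ReflectT e =>
      match e in _ = j' return bhom (eobj X i) (eobj Y j') with
      | erefl => phi i
      end
  | ReflectF _ => bzero (eobj X i) (eobj Y j)
  end.

Lemma edelta0 i j : bw (etag X i) <> bw (etag Y j) ->
  forall x, edelta_mx i j x = 0.
Proof.
by move=> H x; rewrite /edelta_mx; case: eqP => // e; case: H; rewrite -e.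
Qed.
Definition edelta : ehom X Y := Ehom edelta0.
End Delta.

Definition eid (L L' : o) (X : ecell L L') : ehom X X :=
  @edelta L L' X X id (fun _ => erefl) (fun i => bid (eobj X i)).

Lemma ecomp0 (L L' : o) (X Y Z : ecell L L') (f : ehom X Y) (g : ehom Y Z) i j :
  bw (etag X i) <> bw (etag Z j) ->
  forall x, bsum (fun m => bcomp (emx f i m) (emx g m j)) x = 0.
Proof.
move=> H x; rewrite /= big1 // => m _.
case: (pselect (bw (etag X i) = bw (etag Y m))) => [e|ne].
  by rewrite (emx0 g) // -e.
by rewrite (emx0 f) // bhom0.
Qed.
Definition ecomp2 (L L' : o) (X Y Z : ecell L L') (f : ehom X Y) (g : ehom Y Z) :
  ehom X Z := Ehom (ecomp0 f g).

Definition ecell1 (L : o) : ecell L L :=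
  @Ecell L L unit (fun _ => block_one S L) (fun _ => Rw h (endo_datum L) 1%g).

Definition btwist (L L' : o) (b : block S L L') (N : lbo L') : lbo L :=
  ltwist (endo_datum L) (bw b) N.

Definition ecomp1 (L L' L'' : o) (X : ecell L L') (Y : ecell L' L'') :
  ecell L L'' :=
  @Ecell L L'' (eix X * eix Y)%type
    (fun ij => block_mul (etag X ij.1) (etag Y ij.2))
    (fun ij => ltens (eobj X ij.1) (btwist (etag X ij.1) (eobj Y ij.2))).

Section Horizontal.
Variables (L L' L'' : o) (X X' : ecell L L') (Y Y' : ecell L' L'').
Variables (f : ehom X X') (g : ehom Y Y').

Definition ehcomp_mx (i : eix (ecomp1 X Y)) (j : eix (ecomp1 X' Y')) :
    bhom (eobj (ecomp1 X Y) i) (eobj (ecomp1 X' Y') j) :=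
  thom (emx f i.1 j.1)
    (tw_hom h (bw (etag X i.1)) (bw (etag X' j.1)) (emx g i.2 j.2)).

Lemma ehcomp0 i j :
  bw (etag (ecomp1 X Y) i) <> bw (etag (ecomp1 X' Y') j) ->
  forall x, ehcomp_mx i j x = 0.
Proof.
case: i j => [i1 i2] [j1 j2] /= H.
have T0 (M N M' N' : bimod R R) (u : bhom M M') (w : bhom N N') :
    (forall m, u m = 0) \/ (forall p, w p = 0) -> forall x, thom u w x = 0.
  move=> H0 x; have hD := bhomD (bhomP (thom u w)).
  apply: (@tens_ext _ _ _ _ _ _ (thom u w) (fun _ => 0)) => // [a b|m p].
    by rewrite addr0.
  rewrite [LHS]tlift_pure; last exact: thom_bal.
  have [P1 P2 P3] := tp_balanced M' N'.
  case: H0 => ->; first exact/balanced0l/tp_balanced.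
  by apply: (addrI (tp (u m) 0)); rewrite -P2 !addr0.
move=> x; refine (T0 _ _ _ _ (emx f i1 j1) (tw_hom h _ _ (emx g i2 j2)) _ x).
case: (pselect (bw (etag X i1) = bw (etag X' j1))) => e; last first.
  by left=> m; apply: emx0.
right=> p; rewrite /= e eqxx; apply: emx0 => e'.
by apply: H; rewrite e e'.
Qed.
Definition ehcomp : ehom (ecomp1 X Y) (ecomp1 X' Y') := Ehom ehcomp0.
End Horizontal.

Definition eassoc (L1 L2 L3 L4 : o) (X : ecell L1 L2) (Y : ecell L2 L3)
    (Z : ecell L3 L4) :
  ehom (ecomp1 (ecomp1 X Y) Z) (ecomp1 X (ecomp1 Y Z)).
Proof.
refine (@edelta L1 L4 (ecomp1 (ecomp1 X Y) Z) (ecomp1 X (ecomp1 Y Z))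
  (fun i => (i.1.1, (i.1.2, i.2))) _
  (fun i => bcomp
     (tassoc (eobj X i.1.1) (twist h (bw (etag X i.1.1)) (eobj Y i.1.2))
        (twist h (bw (etag X i.1.1) * bw (etag Y i.1.2))%g (eobj Z i.2)))
     (thom (bid (eobj X i.1.1))
        (bcomp
           (thom (bid (twist h (bw (etag X i.1.1)) (eobj Y i.1.2)))
              (tw_mul h (bw (etag X i.1.1)) (bw (etag Y i.1.2)) (eobj Z i.2)))
           (tw_tens h (bw (etag X i.1.1)) (eobj Y i.1.2)
              (twist h (bw (etag Y i.1.2)) (eobj Z i.2))))))).
by move=> i /=; rewrite mulgA.
Defined.

Definition elunit (L L' : o) (X : ecell L L') : ehom (ecomp1 (ecell1 L) X) X.
Proof.
refine (@edelta L L' (ecomp1 (ecell1 L) X) X (fun i => i.2) _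
  (fun i => bcomp (thom (bid (Rw h (endo_datum L) 1%g)) (tw_one h (eobj X i.2)))
              (lun h (endo_datum L) (eobj X i.2)))).
by move=> i /=; rewrite mul1g.
Defined.

Definition erunit (L L' : o) (X : ecell L L') : ehom (ecomp1 X (ecell1 L')) X.
Proof.
refine (@edelta L L' (ecomp1 X (ecell1 L')) X (fun i => i.1) _
  (fun i => bcomp
     (thom (bid (eobj X i.1)) (tw_R h (endo_datum L') (bw (etag X i.1))))
     (run h (endo_datum L') (eobj X i.1)))).
by move=> i /=; rewrite mulg1.
Defined.

Definition endo_bim_bicat : bicat_data :=
  @BicatData o ecell ehom ecell1 ecomp1 eid ecomp2 ehcomp eassoc elunit erunit.

Definition in_Aendo (L : o) (M : lbo L) : Prop :=
  @in_A W k n h (endo_datum L) (pt_wset W) tt tt M.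

Definition in_endo (L L' : o) (X : ecell L L') : Prop :=
  forall i, in_Aendo (eobj X i).
Definition is_emor (L L' : o) (X Y : ecell L L') (f : ehom X Y) : Prop :=
  forall i j, is_mor (emx f i j).

Definition endo_closed : Prop := @sub_closed endo_bim_bicat in_endo is_emor.

(* A(h, M^o(W)) *)
Definition endo_bicat (cl : endo_closed) : bicat_data := sub_bicat cl.

(* the monoidal category A(h, Wo L), with one object *)
Definition Aendo_closed (L : o) : Prop := A_closed h (endo_datum L) (pt_wset W).
Definition Aendo_bicat (L : o) (cl : Aendo_closed L) : bicat_data :=
  A_bicat cl.

(* The functor from A(h, Wo L) to the endomorphisms of L in A(h, M^o(W)), onto
   the summand of the neutral block. *)
Section Inclusion.
Variable L : o.

Definition single (M : lbo L) : ecell L L :=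
  @Ecell L L unit (fun _ => block_one S L) (fun _ => M).

Lemma single_hom0 (M N : lbo L) (f : bhom M N) (i : eix (single M))
    (j : eix (single N)) :
  bw (etag (single M) i) <> bw (etag (single N) j) -> forall x, f x = 0.
Proof. by move=> /= H; case: H. Qed.
Definition single_hom (M N : lbo L) (f : bhom M N) : ehom (single M) (single N) :=
  Ehom (single_hom0 f).

Definition single_comp (M N : lbo L) :
  ehom (ecomp1 (single M) (single N)) (single (ltens M N)).
Proof.
refine (@edelta L L (ecomp1 (single M) (single N)) (single (ltens M N))
  (fun _ => tt) _ (fun i => thom (bid M) (tw_one h N))).
by move=> i /=; rewrite mulg1.
Defined.

End Inclusion.

End Endoscopic.

Section Restriction.
Variables (W : groupType) (S : W -> Prop) (k : idomainType) (n : nat).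
Variables (h : prerealization k n S) (o : wset W).
Variables (clM : endo_closed h o) (clA : A_closed h (full_datum h) o).
Variable Psi : @pfun_data (endo_bicat clM) (A_bicat clA) (fun L : o => L).
Variables (L : o) (cl : Aendo_closed h L) (clo : Ao_closed h (full_datum h) L).

Lemma inc1P (a b : unit) (M : @c1 (Aendo_bicat cl) a b) : in_endo (single (sval M)).
Proof. by case: a b M => [] [] M i; exact: (svalP M). Qed.

Definition inc1 (a b : unit) (M : @c1 (Aendo_bicat cl) a b) :
    @c1 (endo_bicat clM) L L :=
  exist _ (single (sval M)) (@inc1P a b M).

Definition inc2 (a b : unit) (M N : @c1 (Aendo_bicat cl) a b) (f : c2 M N) :
    c2 (inc1 M) (inc1 N) :=
  exist (@is_emor _ _ _ _ h o L L (single (sval M)) (single (sval N)))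
    (single_hom (sval f)) (fun _ _ => svalP f).

Definition single_comp_mor : Prop :=
  forall (a b c : unit) (M : @c1 (Aendo_bicat cl) a b)
    (N : @c1 (Aendo_bicat cl) b c),
  is_emor (single_comp (sval M) (sval N)).

Definition restricts_to_Ao : Prop :=
  forall (a b : unit) (M : @c1 (Aendo_bicat cl) a b),
    in_Ao L (sval (F1 Psi (inc1 M))).

Hypothesis (pc : single_comp_mor) (pr : restricts_to_Ao).

Definition incc (a b c : unit) (M : @c1 (Aendo_bicat cl) a b)
    (N : @c1 (Aendo_bicat cl) b c) :
    c2 (comp1 (inc1 M) (inc1 N)) (inc1 (comp1 M N)) :=
  exist _ (single_comp (sval M) (sval N)) (@pc a b c M N).

Definition incu (a : unit) : c2 (@id1 (endo_bicat clM) L) (inc1 (@id1 (Aendo_bicat cl) a)) :=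
  id2 (@id1 (endo_bicat clM) L).

Definition restriction :
    @pfun_data (Aendo_bicat cl) (Ao_bicat clo) (fun a : unit => a) :=
  @PfunData (Aendo_bicat cl) (Ao_bicat clo) (fun a : unit => a)
    (fun a b M => exist _ (sval (F1 Psi (inc1 M))) (pr M))
    (fun a b M N f => F2 Psi (inc2 f))
    (fun a b c M N => comp2 (Fc Psi (inc1 M) (inc1 N)) (F2 Psi (incc M N)))
    (fun a => comp2 (Fu Psi L) (F2 Psi (incu a))).

End Restriction.

Definition expands (W : groupType) (S : W -> Prop) (x x' : seq W) : Prop :=
  exists us : seq (seq W), [/\ size us = size x,
    forall i, (i < size x)%N -> reduced S (nth [::] us i) (nth 1%g x i)
  & x' = flatten us].

(* Main.v *)
From HB Require Import structures.
From mathcomp Require Import all_boot all_order all_algebra.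
From mathcomp Require Import ring mpoly boolp.
Require Import Defs.

(* The 2-functor is the identity on bimodules up to a twist: a family (M_beta) is sent to the
   direct sum of the M_beta, the right action on M_beta being twisted by w^beta, and the
   composition constraint sends (x_i) (x) (y_j) to (x_i (x) y_j).  It is fully faithful because
   the sets Wo w^beta supporting the summands of different blocks are disjoint.

   For a word u, let v_i be the product of the letters before s_i outside K(u, L).  Moving the
   factors R_s of B_u to the right identifies B_u with the tensor product of the C_t,
   t = v_i s_i v_i^-1 with i in K(u, L), twisted on the right by b_L(u).  Each such t belongs to
   So L, which gives essential surjectivity.  Conversely, a word in So L and a block beta come
   in this way from the reduced expressions of the letters, followed by an expression of w^beta
   on which K is empty; hence the 2-functor takes values in the right category.

   Compatibility with the components M_Q^w is checked on the lattices M cap M_Q^w after clearing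
   denominators.  The roots attached to one reflection by different choices of (x, s) differ by a
   unit, since a reflection determines the product of its coroot and its root and both are
   primitive.  The bicategory laws on the endoscopic side follow from those for bimodules, as
   the 2-functor is locally fully faithful. *)

Set Implicit Arguments.
Unset Strict Implicit.
Unset Printing Implicit Defensive.

Import GRing.Theory.
Local Open Scope ring_scope.

(** * Bimodules and tensor products *)

(** The ring Q depends on the reflection datum: over an endoscopic datum only the roots of its own
    reflections are inverted, over the full datum those of all reflections. A component M_Q^w thus
    cannot be carried from one datum to the other, while its trace [lat w] on M can, and the trace
    spans the component. Inside one datum denominators are cleared with products of roots and units,
    the predicate [den]; across two data with any nonzero polynomial, since M_Q is torsion free and
    the direct sum of its components ([good_lat_div]). Tensors of lattice elements fill the lattice
    of a tensor product only up to denominators, and a denominator on the right of M has to cross N,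
    which twists it. Hence [den] is made stable under the group, and directness of the sum of
    components is propagated through tensor products by explicit maps ([nice]). Isomorphisms between
    bimodules over different data are semilinear, with one twist on the left and another on the
    right ([siso]). They compose and tensor, so comparisons are assembled from those of R_w and
    C_s. *)

Section BimodFacts.
Variables A B C : pzRingType.

Lemma bhom_ext (M N : bimod A C) (f g : bhom M N) : f =1 g -> f = g.
Proof.
case: f g => [f hf] [g hg] /= /funext fg; subst g.
by congr Bhom; exact: Prop_irrelevance.
Qed.

Lemma bcompE (M N P : bimod A C) (f : bhom M N) (g : bhom N P) x :
  bcomp f g x = g (f x).
Proof. by []. Qed.

Lemma bsumE (M N : bimod A C) (J : finType) (f : J -> bhom M N) x :
  bsum f x = \sum_j f j x.
Proof. by []. Qed.

Lemma bhom_sum (M N : bimod A C) (f : bhom M N) (I : Type) (r : seq I)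
    (P : pred I) (F : I -> M) :
  f (\sum_(i <- r | P i) F i) = \sum_(i <- r | P i) f (F i).
Proof. by apply: big_morph => [x y|]; [exact: bhomD (bhomP f) x y | exact: bhom0]. Qed.

Lemma bhomN (M N : bimod A C) (f : bhom M N) x : f (- x) = - f x.
Proof.
by apply: (addrI (f x)); rewrite -(bhomD (bhomP f)) !subrr bhom0.
Qed.

Lemma bhomB (M N : bimod A C) (f : bhom M N) x y : f (x - y) = f x - f y.
Proof. by rewrite (bhomD (bhomP f)) bhomN. Qed.

Lemma lactD (M : bimod A C) a (x y : M) : lact M a (x + y) = lact M a x + lact M a y.
Proof. exact: (bmlDr (bimodP M)). Qed.
Lemma ractD (M : bimod A C) (x y : M) c : ract M (x + y) c = ract M x c + ract M y c.
Proof. exact: (bmrDl (bimodP M)). Qed.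
Lemma lactM (M : bimod A C) a b (x : M) : lact M (a * b) x = lact M a (lact M b x).
Proof. exact: (bmlM (bimodP M)). Qed.
Lemma ractM (M : bimod A C) (x : M) a b : ract M x (a * b) = ract M (ract M x a) b.
Proof. exact: (bmrM (bimodP M)). Qed.
Lemma lact1 (M : bimod A C) (x : M) : lact M 1 x = x.
Proof. exact: (bml1 (bimodP M)). Qed.
Lemma ract1 (M : bimod A C) (x : M) : ract M x 1 = x.
Proof. exact: (bmr1 (bimodP M)). Qed.
Lemma lact_Dl (M : bimod A C) a b (x : M) : lact M (a + b) x = lact M a x + lact M b x.
Proof. exact: (bmlDl (bimodP M)). Qed.
Lemma ract_Dr (M : bimod A C) (x : M) a b : ract M x (a + b) = ract M x a + ract M x b.
Proof. exact: (bmrDr (bimodP M)). Qed.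
Lemma lractC (M : bimod A C) a (m : M) c : ract M (lact M a m) c = lact M a (ract M m c).
Proof. exact: (bmC (bimodP M)). Qed.

Lemma lact_sum (M : bimod A C) a (I : Type) (r : seq I) (P : pred I) (F : I -> M) :
  lact M a (\sum_(i <- r | P i) F i) = \sum_(i <- r | P i) lact M a (F i).
Proof. by apply: big_morph => [x y|]; [exact: lactD | exact: lact0]. Qed.
Lemma ract_sum (M : bimod A C) c (I : Type) (r : seq I) (P : pred I) (F : I -> M) :
  ract M (\sum_(i <- r | P i) F i) c = \sum_(i <- r | P i) ract M (F i) c.
Proof.
by apply: (big_morph (fun x => ract M x c)) => [x y|]; [exact: ractD | exact: ract0].
Qed.

Lemma lactN (M : bimod A C) a (x : M) : lact M a (- x) = - lact M a x.
Proof. by apply: (addrI (lact M a x)); rewrite -lactD !subrr lact0. Qed.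
Lemma ractN (M : bimod A C) (x : M) c : ract M (- x) c = - ract M x c.
Proof. by apply: (addrI (ract M x c)); rewrite -ractD !subrr ract0. Qed.
Lemma ract_Nr (M : bimod A C) (x : M) c : ract M x (- c) = - ract M x c.
Proof.
apply: (addrI (ract M x c)); rewrite -ract_Dr !subrr.
by apply: (addrI (ract M x 0)); rewrite -ract_Dr !addr0.
Qed.
Lemma lact_0l (M : bimod A C) (x : M) : lact M 0 x = 0.
Proof. by apply: (addrI (lact M 0 x)); rewrite -lact_Dl !addr0. Qed.
Lemma ract_0r (M : bimod A C) (x : M) : ract M x 0 = 0.
Proof. by apply: (addrI (ract M x 0)); rewrite -ract_Dr !addr0. Qed.

Section Tp.
Variables (M : bimod A B) (N : bimod B C).

Lemma tpDl (m m' : M) (p : N) : tp (m + m') p = tp m p + tp m' p.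
Proof. by case: (tp_balanced M N). Qed.
Lemma tpDr (m : M) (p p' : N) : tp m (p + p') = tp m p + tp m p'.
Proof. by case: (tp_balanced M N). Qed.
Lemma tp_mid (m : M) b (p : N) : tp (ract M m b) p = tp m (lact N b p).
Proof. by case: (tp_balanced M N). Qed.
Lemma tp0l (p : N) : tp (0 : M) p = 0.
Proof. by apply: (addrI (tp 0 p)); rewrite -tpDl !addr0. Qed.
Lemma tp0r (m : M) : tp m (0 : N) = 0.
Proof. by apply: (addrI (tp m 0)); rewrite -tpDr !addr0. Qed.
Lemma tpNl (m : M) (p : N) : tp (- m) p = - tp m p.
Proof. by apply: (addrI (tp m p)); rewrite -tpDl !subrr tp0l. Qed.
Lemma tpNr (m : M) (p : N) : tp m (- p) = - tp m p.
Proof. by apply: (addrI (tp m p)); rewrite -tpDr !subrr tp0r. Qed.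
Lemma tp_suml (I : Type) (r : seq I) (P : pred I) (F : I -> M) (p : N) :
  tp (\sum_(i <- r | P i) F i) p = \sum_(i <- r | P i) tp (F i) p.
Proof.
by apply: (big_morph (fun x => tp x p)) => [x y|]; [exact: tpDl | exact: tp0l].
Qed.
Lemma tp_sumr (I : Type) (r : seq I) (P : pred I) (m : M) (F : I -> N) :
  tp m (\sum_(i <- r | P i) F i) = \sum_(i <- r | P i) tp m (F i).
Proof.
by apply: (big_morph (fun x => tp m x)) => [x y|]; [exact: tpDr | exact: tp0r].
Qed.
Lemma lact_tp a (m : M) (p : N) : lact (tbim M N) a (tp m p) = tp (lact M a m) p.
Proof. exact: tb_lactE. Qed.
Lemma ract_tp (m : M) (p : N) c : ract (tbim M N) (tp m p) c = tp m (ract N p c).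
Proof. exact: tb_ractE. Qed.

Lemma tb_ind (P : tbim M N -> Prop) :
  P 0 -> (forall x y, P x -> P y -> P (x + y)) -> (forall m p, P (tp m p)) ->
  forall t, P t.
Proof.
move=> P0 PD Pp t; rewrite [t]tens_repr; elim: (repr t) => [|x s IH].
  by rewrite big_nil.
by rewrite big_cons; apply: PD => //; exact: Pp.
Qed.

Lemma tb_hom_ext (P : bimod A C) (f g : bhom (tbim M N) P) :
  (forall m p, f (tp m p) = g (tp m p)) -> f = g.
Proof.
move=> fg; apply: bhom_ext; apply: tb_ind => [|x y fx fy|//].
  by rewrite !bhom0.
by rewrite (bhomD (bhomP f)) (bhomD (bhomP g)) fx fy.
Qed.

Lemma thomE (M' : bimod A B) (N' : bimod B C) (f : bhom M M') (g : bhom N N') m p :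
  thom f g (tp m p) = tp (f m) (g p).
Proof. exact/tlift_pure/thom_bal. Qed.

End Tp.

Lemma thom_id (M : bimod A B) (N : bimod B C) : thom (bid M) (bid N) = bid (tbim M N).
Proof. by apply: tb_hom_ext => m p; rewrite thomE. Qed.

Lemma thom_comp (M M' M'' : bimod A B) (N N' N'' : bimod B C) (f : bhom M M')
    (f' : bhom M' M'') (g : bhom N N') (g' : bhom N' N'') :
  thom (bcomp f f') (bcomp g g') = bcomp (thom f g) (thom f' g').
Proof. by apply: tb_hom_ext => m p; rewrite bcompE !thomE. Qed.

End BimodFacts.

Section AssocFacts.
Variables (A B C D : pzRingType).

Lemma tb_hom_ext3 (M : bimod A B) (N : bimod B C) (P : bimod C D) (T : bimod A D)
    (f g : bhom (tbim (tbim M N) P) T) :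
  (forall m p q, f (tp (tp m p) q) = g (tp (tp m p) q)) -> f = g.
Proof.
move=> fg; apply: tb_hom_ext => t q; elim/tb_ind: t => [|x y fx fy|//].
  by rewrite tp0l !bhom0.
by rewrite tpDl (bhomD (bhomP f)) (bhomD (bhomP g)) fx fy.
Qed.

Lemma tb_hom_ext3r (M : bimod A B) (N : bimod B C) (P : bimod C D) (T : bimod A D)
    (f g : bhom (tbim M (tbim N P)) T) :
  (forall m p q, f (tp m (tp p q)) = g (tp m (tp p q))) -> f = g.
Proof.
move=> fg; apply: tb_hom_ext => m t; elim/tb_ind: t => [|x y fx fy|//].
  by rewrite tp0r !bhom0.
by rewrite tpDr (bhomD (bhomP f)) (bhomD (bhomP g)) fx fy.
Qed.

Variables (M : bimod A B) (N : bimod B C) (P : bimod C D).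

Lemma tassocE m p q : tassoc M N P (tp (tp m p) q) = tp m (tp p q).
Proof.
rewrite [LHS]tlift_pure; first exact: ta_pure.
exact: ta_bal.
Qed.

Definition tassoc'_fun (m : M) (t : tbim N P) : tbim (tbim M N) P :=
  tlift (fun p q => tp (tp m p) q : tbim (tbim M N) P) t.

Lemma tassoc'_bal2 m :
  balanced (ract N) (lact P) (fun p q => tp (tp m p) q : tbim (tbim M N) P).
Proof.
split=> [p p' q|p q q'|p c q]; first by rewrite tpDr tpDl.
  by rewrite tpDr.
by rewrite -ract_tp tp_mid.
Qed.

Lemma tassoc'_pure m p q : tassoc'_fun m (tp p q) = tp (tp m p) q.
Proof. exact/tlift_pure/tassoc'_bal2. Qed.
Lemma tassoc'_Dr m t t' : tassoc'_fun m (t + t') = tassoc'_fun m t + tassoc'_fun m t'.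
Proof. exact/tliftD/tassoc'_bal2. Qed.
Lemma tassoc'_0r m : tassoc'_fun m 0 = 0.
Proof. by apply: (addrI (tassoc'_fun m 0)); rewrite -tassoc'_Dr !addr0. Qed.

Lemma tassoc'_bal : balanced (ract M) (lact (tbim N P)) tassoc'_fun.
Proof.
split=> [m m' t|m t t'|m b t]; last 2 first.
- exact: tassoc'_Dr.
- elim/tb_ind: t => [|x y IHx IHy|p q]; first by rewrite lact0 !tassoc'_0r.
    by rewrite lactD !tassoc'_Dr IHx IHy.
  by rewrite lact_tp !tassoc'_pure tp_mid.
elim/tb_ind: t => [|x y IHx IHy|p q]; first by rewrite !tassoc'_0r addr0.
  by rewrite !tassoc'_Dr IHx IHy addrACA.
by rewrite !tassoc'_pure !tpDl.
Qed.

Definition tassoc' : bhom (tbim M (tbim N P)) (tbim (tbim M N) P).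
Proof.
refine (Bhom (tblift_axioms tassoc'_bal _ _)).
- move=> a m t; elim/tb_ind: t => [|x y IHx IHy|p q].
  + by rewrite !tassoc'_0r lact0.
  + by rewrite !tassoc'_Dr IHx IHy lactD.
  + by rewrite !tassoc'_pure !lact_tp.
- move=> m t c; elim/tb_ind: t => [|x y IHx IHy|p q].
  + by rewrite ract0 !tassoc'_0r ract0.
  + by rewrite ractD !tassoc'_Dr IHx IHy ractD.
  + by rewrite ract_tp !tassoc'_pure ract_tp.
Defined.

Lemma tassoc'E m p q : tassoc' (tp m (tp p q)) = tp (tp m p) q.
Proof.
rewrite [LHS]tlift_pure; first exact: tassoc'_pure.
exact: tassoc'_bal.
Qed.

Lemma tassocK : bcomp (tassoc M N P) tassoc' = bid _.
Proof. by apply: tb_hom_ext3 => m p q; rewrite bcompE tassocE tassoc'E. Qed.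
Lemma tassoc'K : bcomp tassoc' (tassoc M N P) = bid _.
Proof. by apply: tb_hom_ext3r => m p q; rewrite bcompE tassoc'E tassocE. Qed.

End AssocFacts.

(** * Bicategories *)

Lemma sval_inj_prop (T : Type) (P : T -> Prop) (x y : {z : T | P z}) :
  sval x = sval y -> x = y.
Proof.
case: x y => [x hx] [y hy] /= xy; subst y.
by rewrite (Prop_irrelevance hx hy).
Qed.

Section SubBicategoryLaws.
Variables (D : bicat_data) (p1 : forall a b : ob D, c1 a b -> Prop).
Variable p2 : forall (a b : ob D) (f g : c1 a b), c2 f g -> Prop.
Arguments p2 {a b f g} _.
Hypothesis cl : sub_closed (@p1) (@p2).

(** An inverse in the ambient bicategory need not satisfy [p2], so it is required together with its
    membership in the sub-bicategory. *)
Definition inv2_in (a b : ob D) (f g : c1 a b) (x : c2 f g) :=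
  exists y : c2 g f, [/\ p2 y, comp2 x y = id2 f & comp2 y x = id2 g].

Lemma sub_inv2 (a b : ob D) (f g : {f : c1 a b | p1 f})
    (x : {x : c2 (sval f) (sval g) | p2 x}) :
  inv2_in (sval x) -> @inv2 (sub_bicat cl) a b f g x.
Proof.
by case=> y [py xy yx]; exists (exist _ y py); split; apply: sval_inj_prop.
Qed.

Lemma sub_bicategory :
  is_bicategory D ->
  (forall (a b c d : ob D) (f : c1 a b) (g : c1 b c) (h : c1 c d),
     p1 f -> p1 g -> p1 h -> inv2_in (assoc f g h)) ->
  (forall (a b : ob D) (f : c1 a b), p1 f -> inv2_in (lunit f)) ->
  (forall (a b : ob D) (f : c1 a b), p1 f -> inv2_in (runit f)) ->
  is_bicategory (sub_bicat cl).
Proof.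
move=> HD iA iL iR; split.
- by move=> *; apply: sval_inj_prop; exact: (comp2A HD).
- by move=> *; apply: sval_inj_prop; exact: (comp21l HD).
- by move=> *; apply: sval_inj_prop; exact: (comp21r HD).
- by move=> *; apply: sval_inj_prop; exact: (hcomp2_id HD).
- by move=> *; apply: sval_inj_prop; exact: (hcomp2_comp HD).
- by move=> *; apply: sval_inj_prop; exact: (assoc_nat HD).
- by move=> *; apply: sval_inj_prop; exact: (lunit_nat HD).
- by move=> *; apply: sval_inj_prop; exact: (runit_nat HD).
- move=> a b c d [f pf] [g pg] [h ph].
  exact/(@sub_inv2 a d (exist _ _ _) (exist _ _ _) (exist _ _ _))/iA.
- move=> a b [f pf].
  exact/(@sub_inv2 a b (exist _ _ _) (exist _ _ _) (exist _ _ _))/iL.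
- move=> a b [f pf].
  exact/(@sub_inv2 a b (exist _ _ _) (exist _ _ _) (exist _ _ _))/iR.
- by move=> *; apply: sval_inj_prop; exact: (pentagon HD).
- by move=> *; apply: sval_inj_prop; exact: (triangle HD).
Qed.

End SubBicategoryLaws.

Section Cancel.
Variables (E : bicat_data) (HE : is_bicategory E) (a b : ob E).

Lemma inv2_epi (f g h : c1 a b) (x : c2 f g) (y z : c2 g h) :
  inv2 x -> comp2 x y = comp2 x z -> y = z.
Proof.
case=> x' [_ x'x] e; have := congr1 (comp2 x') e.
by rewrite -!(comp2A HE) x'x !(comp21l HE).
Qed.

Lemma inv2_comp (f g h : c1 a b) (x : c2 f g) (y : c2 g h) :
  inv2 x -> inv2 y -> inv2 (comp2 x y).
Proof.
case=> x' [xx x'x] [y' [yy y'y]]; exists (comp2 y' x'); split.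
  by rewrite (comp2A HE) -(comp2A HE y) yy (comp21l HE) xx.
by rewrite (comp2A HE) -(comp2A HE x') x'x (comp21l HE) y'y.
Qed.

Lemma inv2_id (f : c1 a b) : inv2 (id2 f).
Proof. by exists (id2 f); rewrite !(comp21l HE). Qed.

End Cancel.

Lemma inv2_hcomp (E : bicat_data) (HE : is_bicategory E) (a b c : ob E)
    (f f' : c1 a b) (g g' : c1 b c) (x : c2 f f') (y : c2 g g') :
  inv2 x -> inv2 y -> inv2 (hcomp2 x y).
Proof.
case=> x' [xx x'x] [y' [yy y'y]]; exists (hcomp2 x' y').
by rewrite -!(hcomp2_comp HE) xx x'x yy y'y !(hcomp2_id HE).
Qed.

(* The laws of a bicategory can be tested after a locally fully faithful
   pseudofunctor. *)
Section Pullback.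
Variables (D E : bicat_data) (f0 : ob D -> ob E) (F : pfun_data f0).
Hypotheses (HE : is_bicategory E) (HF : is_pseudofunctor F).
Hypothesis F2inj : forall (a b : ob D) (f g : c1 a b) (x y : c2 f g),
  F2 F x = F2 F y -> x = y.
Hypothesis F2surj : forall (a b : ob D) (f g : c1 a b) (y : c2 (F1 F f) (F1 F g)),
  exists x : c2 f g, F2 F x = y.

Let cA := comp2A HE.
Let c1l := comp21l HE.
Let c1r := comp21r HE.
Let hcc := hcomp2_comp HE.
Let Fcc := F2_comp HF.

Lemma F2_inv2 (a b : ob D) (f g : c1 a b) (x : c2 f g) :
  inv2 (F2 F x) -> inv2 x.
Proof.
case=> y' [xy yx]; have [y yE] := F2surj y'; subst y'; exists y.
by split; apply: F2inj; rewrite Fcc (F2_id HF).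
Qed.

(** Serves for the structural 2-cells: the coherence laws of F exhibit F2 of each of them as the
    last factor of an invertible composite. *)
Lemma inv2_rcancel (a b : ob E) (f g h : c1 a b) (x : c2 f g) (y : c2 g h) :
  inv2 x -> inv2 (comp2 x y) -> inv2 y.
Proof.
case=> x' [xx x'x] [z [xyz zxy]]; exists (comp2 z x); split.
  apply: (inv2_epi HE (x := x)); first by exists x'.
  by rewrite -!cA xyz c1l c1r.
by rewrite cA zxy.
Qed.

Lemma pull_hcomp2_id (a b c : ob D) (f : c1 a b) (g : c1 b c) :
  hcomp2 (id2 f) (id2 g) = id2 (comp1 f g).
Proof.
apply: F2inj; apply: (inv2_epi HE (Fc_inv HF f g)).
by rewrite -(Fc_nat HF) !(F2_id HF) (hcomp2_id HE) c1l c1r.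
Qed.

Lemma pull_hcomp2_comp (a b c : ob D) (f f' f'' : c1 a b) (g g' g'' : c1 b c)
    (x : c2 f f') (x' : c2 f' f'') (y : c2 g g') (y' : c2 g' g'') :
  hcomp2 (comp2 x x') (comp2 y y') = comp2 (hcomp2 x y) (hcomp2 x' y').
Proof.
apply: F2inj; apply: (inv2_epi HE (Fc_inv HF f g)).
by rewrite Fcc -(Fc_nat HF) !Fcc hcc cA (Fc_nat HF) -cA (Fc_nat HF) cA.
Qed.

Lemma Fc_natl (a b c : ob D) (f f' : c1 a b) (h : c1 b c) (x : c2 f f') :
  comp2 (hcomp2 (F2 F x) (id2 (F1 F h))) (Fc F f' h)
  = comp2 (Fc F f h) (F2 F (hcomp2 x (id2 h))).
Proof. by rewrite -(F2_id HF) (Fc_nat HF). Qed.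
Lemma Fc_natr (a b c : ob D) (f : c1 a b) (h h' : c1 b c) (x : c2 h h') :
  comp2 (hcomp2 (id2 (F1 F f)) (F2 F x)) (Fc F f h')
  = comp2 (Fc F f h) (F2 F (hcomp2 (id2 f) x)).
Proof. by rewrite -(F2_id HF) (Fc_nat HF). Qed.

(** Both sides are compared after precomposition with invertible constraints, which turn F2 of the
    associator into the associator of E by [F_assoc]; naturality in E concludes. The remaining laws
    follow the same pattern. *)
Lemma pull_assoc_nat (a b c d : ob D) (f f' : c1 a b) (g g' : c1 b c)
    (h h' : c1 c d) (x : c2 f f') (y : c2 g g') (z : c2 h h') :
  comp2 (hcomp2 (hcomp2 x y) z) (assoc f' g' h')
  = comp2 (assoc f g h) (hcomp2 x (hcomp2 y z)).
Proof.
apply: F2inj.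
have I1 := inv2_hcomp HE (Fc_inv HF f g) (inv2_id HE (F1 F h)).
have I2 := Fc_inv HF (comp1 f g) h.
apply: (inv2_epi HE I2); apply: (inv2_epi HE I1).
transitivity (comp2 (hcomp2 (hcomp2 (F2 F x) (F2 F y)) (F2 F z))
  (comp2 (hcomp2 (Fc F f' g') (id2 (F1 F h')))
    (comp2 (Fc F (comp1 f' g') h') (F2 F (assoc f' g' h'))))).
  rewrite Fcc -(cA (Fc _ _ _)) -(Fc_nat HF) !cA -(cA (hcomp2 (Fc F f g) _)).
  by rewrite -hcc c1l -(Fc_nat HF) -!cA -hcc c1r.
rewrite (F_assoc HF) -(cA _ (assoc _ _ _)) (assoc_nat HE).
rewrite cA -(cA _ (hcomp2 (id2 _) (Fc _ _ _))) -hcc c1r (Fc_nat HF).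
rewrite -{1}(c1l (F2 F x)) hcc cA (Fc_nat HF) -!cA.
by rewrite Fcc -[RHS]cA; congr comp2; rewrite !cA (F_assoc HF).
Qed.

Lemma pull_lunit_nat (a b : ob D) (f f' : c1 a b) (x : c2 f f') :
  comp2 (hcomp2 (id2 (id1 a)) x) (lunit f') = comp2 (lunit f) x.
Proof.
apply: F2inj; rewrite !Fcc.
have I1 := inv2_hcomp HE (Fu_inv HF a) (inv2_id HE (F1 F f)).
apply: (inv2_epi HE (Fc_inv HF (id1 a) f)); apply: (inv2_epi HE I1).
rewrite -[in RHS](cA (Fc _ _ _)) -[RHS]cA -(F_lunit HF).
rewrite -(cA (Fc _ _ _)) -Fc_natr cA -cA -hcc c1l c1r.
by rewrite -{1}(c1l (Fu F a)) -{1}(c1r (F2 F x)) hcc cA -(F_lunit HF) (lunit_nat HE).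
Qed.

Lemma pull_runit_nat (a b : ob D) (f f' : c1 a b) (x : c2 f f') :
  comp2 (hcomp2 x (id2 (id1 b))) (runit f') = comp2 (runit f) x.
Proof.
apply: F2inj; rewrite !Fcc.
have I1 := inv2_hcomp HE (inv2_id HE (F1 F f)) (Fu_inv HF b).
apply: (inv2_epi HE (Fc_inv HF f (id1 b))); apply: (inv2_epi HE I1).
rewrite -[in RHS](cA (Fc _ _ _)) -[RHS]cA -(F_runit HF).
rewrite -(cA (Fc _ _ _)) -Fc_natl cA -cA -hcc c1l c1r.
by rewrite -{1}(c1l (Fu F b)) -{1}(c1r (F2 F x)) hcc cA -(F_runit HF) (runit_nat HE).
Qed.

Lemma pull_assoc_inv (a b c d : ob D) (f : c1 a b) (g : c1 b c) (h : c1 c d) :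
  inv2 (assoc f g h).
Proof.
apply: F2_inv2.
have I1 := inv2_hcomp HE (Fc_inv HF f g) (inv2_id HE (F1 F h)).
apply: (inv2_rcancel (inv2_comp HE I1 (Fc_inv HF (comp1 f g) h))).
rewrite cA (F_assoc HF); apply: (inv2_comp HE (assoc_inv HE _ _ _)).
exact: (inv2_comp HE (inv2_hcomp HE (inv2_id HE _) (Fc_inv HF _ _)) (Fc_inv HF _ _)).
Qed.

Lemma pull_lunit_inv (a b : ob D) (f : c1 a b) : inv2 (lunit f).
Proof.
apply: F2_inv2.
have I1 := inv2_hcomp HE (Fu_inv HF a) (inv2_id HE (F1 F f)).
apply: (inv2_rcancel (inv2_comp HE I1 (Fc_inv HF (id1 a) f))).
by rewrite cA -(F_lunit HF); exact: lunit_inv.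
Qed.

Lemma pull_runit_inv (a b : ob D) (f : c1 a b) : inv2 (runit f).
Proof.
apply: F2_inv2.
have I1 := inv2_hcomp HE (inv2_id HE (F1 F f)) (Fu_inv HF b).
apply: (inv2_rcancel (inv2_comp HE I1 (Fc_inv HF f (id1 b)))).
by rewrite cA -(F_runit HF); exact: runit_inv.
Qed.

Lemma pull_triangle (a b c : ob D) (f : c1 a b) (g : c1 b c) :
  hcomp2 (runit f) (id2 g) = comp2 (assoc f (id1 b) g) (hcomp2 (id2 f) (lunit g)).
Proof.
apply: F2inj; rewrite Fcc.
have I0 := inv2_hcomp HE (inv2_hcomp HE (inv2_id HE (F1 F f)) (Fu_inv HF b))
  (inv2_id HE (F1 F g)).
have I1 := inv2_hcomp HE (Fc_inv HF f (id1 b)) (inv2_id HE (F1 F g)).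
apply: (inv2_epi HE (Fc_inv HF (comp1 f (id1 b)) g)).
apply: (inv2_epi HE I1); apply: (inv2_epi HE I0).
rewrite -Fc_natl -(cA _ _ (Fc F f g)) -(cA _ _ (Fc F f g)) -!hcc !c1l.
rewrite -(F_runit HF) -(cA (Fc F _ g)) -[in RHS](cA (hcomp2 (Fc F f _) _)).
rewrite (F_assoc HF) !cA -Fc_natr -(cA _ (assoc _ _ _)) (assoc_nat HE) !cA.
rewrite (triangle HE) cA; congr comp2.
by rewrite -!cA -!hcc !c1l (F_lunit HF) -!cA.
Qed.

Lemma pull_pentagon (a b c d e : ob D)
    (f : c1 a b) (g : c1 b c) (h : c1 c d) (i : c1 d e) :
  comp2 (assoc (comp1 f g) h i) (assoc f g (comp1 h i))
  = comp2 (hcomp2 (assoc f g h) (id2 i))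
      (comp2 (assoc f (comp1 g h) i) (hcomp2 (id2 f) (assoc g h i))).
Proof.
apply: F2inj; rewrite !Fcc.
set Ff := F1 F f; set Fg := F1 F g; set Fh := F1 F h; set Fi := F1 F i.
have I0 := inv2_hcomp HE (inv2_hcomp HE (Fc_inv HF f g) (inv2_id HE Fh))
  (inv2_id HE Fi).
have I1 := inv2_hcomp HE (Fc_inv HF (comp1 f g) h) (inv2_id HE Fi).
apply: (inv2_epi HE (Fc_inv HF (comp1 (comp1 f g) h) i)).
apply: (inv2_epi HE I1); apply: (inv2_epi HE I0).
(* The constraints that assemble F f (F g (F h F i)) into F (f (g (h i))). Each side becomes one
   side of the pentagon of E followed by this tail. *)
pose last := comp2 (hcomp2 (id2 Ff) (hcomp2 (id2 Fg) (Fc F h i)))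
  (comp2 (hcomp2 (id2 Ff) (Fc F g (comp1 h i))) (Fc F f (comp1 g (comp1 h i)))).
transitivity (comp2 (comp2 (assoc (comp1 Ff Fg) Fh Fi) (assoc Ff Fg (comp1 Fh Fi))) last).
  rewrite -(cA (Fc F _ i)) -[in LHS](cA (hcomp2 (Fc F _ h) _)) (F_assoc HF).
  rewrite !cA -[in LHS](cA (hcomp2 (hcomp2 _ _) _)) (assoc_nat HE) !cA.
  congr comp2; rewrite (hcomp2_id HE) -(cA (hcomp2 (Fc F f g) _)) -hcc c1l c1r.
  rewrite -{1}(c1r (Fc F h i)) -{1}(c1l (Fc F f g)) hcc cA (F_assoc HF) /last.
  by rewrite -(hcomp2_id HE) -(cA _ (assoc _ _ _)) (assoc_nat HE) !cA.
rewrite (pentagon HE) /last.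
rewrite -(cA (Fc F _ i)) -Fc_natl !cA.
rewrite -(cA (hcomp2 (Fc F _ h) _)) -(cA (hcomp2 (hcomp2 _ _) _)) -!hcc !c1l (F_assoc HF).
have hw x y z (p : c2 x y) (q : c2 y z) :
    hcomp2 (comp2 p q) (id2 Fi) = comp2 (hcomp2 p (id2 Fi)) (hcomp2 q (id2 Fi)).
  by rewrite -hcc c1l.
rewrite !hw !cA; congr comp2.
rewrite -(cA (Fc F _ i)) -(cA (hcomp2 (Fc F f _) _)) (F_assoc HF).
rewrite cA -(cA _ (assoc _ _ _)) (assoc_nat HE) !cA; congr comp2.
rewrite -Fc_natr -!cA -!hcc !c1l; congr (comp2 (hcomp2 _ _) _).
by rewrite !cA (F_assoc HF).
Qed.

Lemma pullback_bicategory : is_bicategory D.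
Proof.
split.
- by move=> *; apply: F2inj; rewrite !Fcc cA.
- by move=> *; apply: F2inj; rewrite !Fcc (F2_id HF) c1l.
- by move=> *; apply: F2inj; rewrite !Fcc (F2_id HF) c1r.
- exact: pull_hcomp2_id.
- exact: pull_hcomp2_comp.
- exact: pull_assoc_nat.
- exact: pull_lunit_nat.
- exact: pull_runit_nat.
- exact: pull_assoc_inv.
- exact: pull_lunit_inv.
- exact: pull_runit_inv.
- exact: pull_pentagon.
- exact: pull_triangle.
Qed.

End Pullback.

(** * Equivalences between categories of 1-cells *)

Section LocalEquivalence.
Variables (D E : bicat_data) (f0 : ob D -> ob E) (F : pfun_data f0).
Variables (a b : ob D).

(** A quasi-inverse is chosen from essential surjectivity. On 2-cells it conjugates by the chosen
    isomorphisms [eps] and lifts the result through F2; uniqueness of lifts makes it functorial and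
    [eps] natural. *)
Lemma local_equivalence_ff :
  is_bicategory E ->
  (forall f : c1 a b, F2 F (id2 f) = id2 (F1 F f)) ->
  (forall (f g h : c1 a b) (x : c2 f g) (y : c2 g h),
     F2 F (comp2 x y) = comp2 (F2 F x) (F2 F y)) ->
  (forall (f g : c1 a b) (x y : c2 f g), F2 F x = F2 F y -> x = y) ->
  (forall (f g : c1 a b) (y : c2 (F1 F f) (F1 F g)), exists x : c2 f g, F2 F x = y) ->
  (forall g : c1 (f0 a) (f0 b), exists f : c1 a b, iso1 (F1 F f) g) ->
  local_equivalence F a b.
Proof.
move=> HE Fid Fcomp Finj Fsurj Fess.
have cA := comp2A HE; have c1l := comp21l HE; have c1r := comp21r HE.
pose G1 g := sval (cid (Fess g)).
pose eps g : c2 (F1 F (G1 g)) g := sval (cid (svalP (cid (Fess g)))).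
have epsI g : inv2 (eps g) := svalP (cid (svalP (cid (Fess g)))).
pose eps' g : c2 g (F1 F (G1 g)) := sval (cid (epsI g)).
have eK g : comp2 (eps g) (eps' g) = id2 _ := (svalP (cid (epsI g))).1.
have e'K g : comp2 (eps' g) (eps g) = id2 _ := (svalP (cid (epsI g))).2.
pose un (f f' : c1 a b) (y : c2 (F1 F f) (F1 F f')) := sval (cid (Fsurj _ _ y)).
have unK (f f' : c1 a b) (y : c2 (F1 F f) (F1 F f')) : F2 F (un f f' y) = y
  by exact: svalP (cid (Fsurj _ _ y)).
exists G1, (fun g g' y => un _ _ (comp2 (eps g) (comp2 y (eps' g')))); split.
- by move=> g; apply: Finj; rewrite unK c1l eK Fid.
- move=> g g' g'' x y; apply: Finj; rewrite Fcomp !unK !cA.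
  by rewrite -(cA _ _ _ _ _ _ (eps' g')) e'K c1l.
- exists (fun f => un _ _ (eps' (F1 F f))); split=> [f|f f' x].
    exists (un _ _ (eps (F1 F f))).
    by split; apply: Finj; rewrite Fcomp !unK Fid ?eK ?e'K.
  apply: Finj; rewrite !Fcomp !unK -(cA _ _ _ _ _ _ (eps' _)) e'K c1l.
  by [].
exists eps; split=> // g g' y; rewrite unK !cA e'K c1r.
by [].
Qed.

End LocalEquivalence.

(** * Direct sums and localization *)

Section AddSpan.
Variable V : zmodType.
Implicit Types (P Q K : V -> Prop).

Lemma add_span0 P : add_span P 0.
Proof. by exists [::]; rewrite big_nil. Qed.

Lemma add_spanD P x y : add_span P x -> add_span P y -> add_span P (x + y).
Proof.
case=> s [sP ->] [t [tP ->]]; exists (s ++ t); rewrite big_cat; split=> // z.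
by rewrite mem_cat => /orP[/sP|/tP].
Qed.

Lemma add_span_gen P x : P x -> add_span P x.
Proof.
by move=> Px; exists [:: x]; rewrite big_seq1; split=> // y; rewrite inE => /eqP->.
Qed.

Lemma add_span_ind P K x :
  K 0 -> (forall x y, K x -> K y -> K (x + y)) -> (forall x, P x -> K x) ->
  add_span P x -> K x.
Proof.
move=> K0 KD PK [s [sP ->]]; elim: s sP => [|y s IH] sP; first by rewrite big_nil.
rewrite big_cons; apply: KD; first by apply/PK/sP; rewrite inE eqxx.
by apply: IH => z zs; apply: sP; rewrite inE zs orbT.
Qed.

(** [add_span] takes sums only, so closure under opposites must come from the generators. *)
Lemma add_spanN P x : (forall y, P y -> P (- y)) -> add_span P x -> add_span P (- x).
Proof.
move=> PN; apply: (add_span_ind (K := fun x => add_span P (- x))).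
- by rewrite oppr0; exact: add_span0.
- by move=> y z Hy Hz; rewrite opprD; exact: add_spanD.
- by move=> y /PN/add_span_gen.
Qed.

Lemma add_spanB P x y : (forall y, P y -> P (- y)) ->
  add_span P x -> add_span P y -> add_span P (x - y).
Proof. by move=> PN Hx Hy; apply: add_spanD => //; exact: add_spanN. Qed.

Lemma add_span_sum P (I : Type) (r : seq I) (p : pred I) (F : I -> V) :
  (forall i, p i -> add_span P (F i)) -> add_span P (\sum_(i <- r | p i) F i).
Proof.
move=> H; elim/big_ind: _ => [|x y|i /H//]; [exact: add_span0|exact: add_spanD].
Qed.

End AddSpan.

Lemma add_span_map (V V' : zmodType) (P : V -> Prop) (Q : V' -> Prop) (f : V -> V') x :
  f 0 = 0 -> (forall x y, f (x + y) = f x + f y) ->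
  (forall x, P x -> add_span Q (f x)) -> add_span P x -> add_span Q (f x).
Proof.
move=> f0 fD PQ; apply: (add_span_ind (K := fun x => add_span Q (f x))) => //.
- by rewrite f0; exact: add_span0.
- by move=> y z Hy Hz; rewrite fD; exact: add_spanD.
Qed.

Section DirectSum.
Variables (V : zmodType) (J : eqType) (P : J -> V -> Prop).
Hypothesis Psub : forall j, P j 0 /\ (forall x y, P j x -> P j y -> P j (x - y)).

Lemma dsP0 j : P j 0. Proof. by case: (Psub j). Qed.
Lemma dsPB j x y : P j x -> P j y -> P j (x - y).
Proof. by case: (Psub j) => _ H; exact: H. Qed.
Lemma dsPN j x : P j x -> P j (- x).
Proof. by move=> Px; rewrite -sub0r; apply: dsPB => //; exact: dsP0. Qed.
Lemma dsPD j x y : P j x -> P j y -> P j (x + y).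
Proof. by move=> Px Py; rewrite -[y]opprK; apply/dsPB/dsPN. Qed.
Lemma dsP_sum j (I : Type) (r : seq I) (p : pred I) (F : I -> V) :
  (forall i, p i -> P j (F i)) -> P j (\sum_(i <- r | p i) F i).
Proof.
by move=> H; elim/big_ind: _ => [|x y|i /H//]; [exact: dsP0|exact: dsPD].
Qed.

(** The decomposition is a function on all of J with finite support rather than a list of indices,
    so that decompositions can be added and compared pointwise. *)
Definition ds_rep (v : V) (a : J -> V) : Prop :=
  (forall j, P j (a j)) /\
  exists s : seq J, [/\ uniq s, forall j, j \notin s -> a j = 0
                      & v = \sum_(j <- s) a j].

Lemma sum_uniq_support (s t : seq J) (a : J -> V) : uniq s -> uniq t ->
  {subset s <= t} -> (forall j, j \notin s -> a j = 0) ->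
  \sum_(j <- t) a j = \sum_(j <- s) a j.
Proof.
move=> us ut st a0; rewrite (bigID (mem s)) /= [X in _ + X]big1 ?addr0; last first.
  by move=> j /a0.
rewrite -big_filter; apply/perm_big/uniq_perm => //; first exact: filter_uniq.
by move=> j; rewrite mem_filter /=; case js: (j \in s) => //=; rewrite st.
Qed.

Lemma ds_repD v w a b : ds_rep v a -> ds_rep w b -> ds_rep (v + w) (fun j => a j + b j).
Proof.
case=> [aP [s [us sa ->]]] [bP [t [ut tb ->]]]; split=> [j|]; first exact: dsPD.
exists (undup (s ++ t)); split=> [|j|]; first exact: undup_uniq.
  by rewrite mem_undup mem_cat negb_or => /andP[/sa-> /tb->]; rewrite addr0.
have sub u : {subset u <= s ++ t} -> {subset u <= undup (s ++ t)}.
  by move=> H j /H; rewrite mem_undup.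
rewrite big_split /=; congr (_ + _); apply/esym/sum_uniq_support => //;
  rewrite ?undup_uniq //; by apply: sub => j; rewrite mem_cat => ->; rewrite ?orbT.
Qed.

Lemma ds_repN v a : ds_rep v a -> ds_rep (- v) (fun j => - a j).
Proof.
case=> [aP [s [us sa ->]]]; split=> [j|]; first exact: dsPN.
by exists s; split=> // [j /sa->|]; rewrite ?oppr0 // sumrN.
Qed.

Lemma ds_rep1 j x : P j x -> ds_rep x (fun i => if i == j then x else 0).
Proof.
move=> Px; split=> [i|]; first by case: eqP => [->|_] //; exact: dsP0.
exists [:: j]; split=> // [i|]; first by rewrite inE => /negbTE->.
by rewrite big_seq1 eqxx.
Qed.

Lemma ds_rep0 : ds_rep 0 (fun=> 0).
Proof. by split=> [j|]; [exact: dsP0 | exists [::]; rewrite big_nil]. Qed.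

Lemma ds_rep_span v : add_span (fun x => exists j, P j x) v -> exists a, ds_rep v a.
Proof.
apply: (add_span_ind (K := fun v => exists a, ds_rep v a)).
- by exists (fun=> 0); exact: ds_rep0.
- by move=> x y [a Ha] [b Hb]; exists (fun j => a j + b j); exact: ds_repD.
- by move=> x [j Px]; eexists; exact: ds_rep1 Px.
Qed.

(* The functions [p j] separate the summands; they need not be projections. *)
Lemma direct_sum_of_sep (V' : zmodType) (p : J -> V -> V') :
  (forall j x y, p j (x + y) = p j x + p j y) ->
  (forall j x, P j x -> p j x = 0 -> x = 0) ->
  (forall i j x, P i x -> i <> j -> p j x = 0) ->
  (forall v, add_span (fun x => exists j, P j x) v) ->
  direct_sum_of P.
Proof.
move=> pD pi pk ex; split=> // [v|s c us cP c0 j js].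
  have [a [aP [s [_ _ ->]]]] := ds_rep_span (ex v).
  by exists s, a.
apply: (pi j); first exact: cP.
have p0 i : p i 0 = 0 by apply: (addrI (p i 0)); rewrite -pD !addr0.
have := congr1 (p j) c0; rewrite (big_morph (p j) (pD j) (p0 j)) p0 => <-.
rewrite (bigD1_seq j) //= big_seq_cond big1 ?addr0 // => i /andP[iS /eqP ij].
exact: pk (cP i iS) ij.
Qed.

End DirectSum.

Section DirectSumProjections.
Variables (V : zmodType) (J : eqType) (P : J -> V -> Prop).
Hypothesis Pds : direct_sum_of P.

Lemma ds_sub j : P j 0 /\ (forall x y, P j x -> P j y -> P j (x - y)).
Proof. by case: Pds. Qed.

Local Notation ds_rep := (ds_rep P).

Lemma ds_rep_ex v : exists a, ds_rep v a.
Proof.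
apply: (ds_rep_span ds_sub); case: Pds => _ /(_ v)[s [c [cP ->]]] _.
rewrite big_seq_cond; apply: add_span_sum => j /andP[js _].
by apply: add_span_gen; exists j; exact: cP.
Qed.

Lemma ds_rep_uniq v a b : ds_rep v a -> ds_rep v b -> a =1 b.
Proof.
move=> Ha Hb j; apply/eqP; rewrite -subr_eq0; apply/eqP.
have [cP [s [us s0 sv]]] := ds_repD ds_sub Ha (ds_repN ds_sub Hb).
case: (boolP (j \in s)) => [js|/s0//]; case: Pds => _ _ ind.
by apply: (ind s (fun j => a j - b j)) => //; rewrite -sv subrr.
Qed.

Definition dsproj (j : J) (v : V) : V := sval (cid (ds_rep_ex v)) j.

Lemma dsproj_rep v : ds_rep v (dsproj^~ v).
Proof. exact: svalP (cid (ds_rep_ex v)). Qed.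

Lemma dsproj_in j v : P j (dsproj j v).
Proof. by case: (dsproj_rep v). Qed.

Lemma dsprojD j v w : dsproj j (v + w) = dsproj j v + dsproj j w.
Proof.
exact: (ds_rep_uniq (dsproj_rep (v + w)) (ds_repD ds_sub (dsproj_rep v) (dsproj_rep w)) j).
Qed.

Lemma dsprojE j v : P j v -> forall i, dsproj i v = if i == j then v else 0.
Proof. by move=> Pv i; exact: (ds_rep_uniq (dsproj_rep v) (ds_rep1 ds_sub Pv)). Qed.

Lemma dsproj_sum v : exists s : seq J,
  [/\ uniq s, forall j, j \notin s -> dsproj j v = 0 & v = \sum_(j <- s) dsproj j v].
Proof. by case: (dsproj_rep v). Qed.

Lemma ds_span v : add_span (fun x => exists j, P j x) v.
Proof.
have [s [_ _ ->]] := dsproj_sum v; apply: add_span_sum => j _.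
by apply: add_span_gen; exists j; exact: dsproj_in.
Qed.

End DirectSumProjections.

(** * Localization at a set of denominators *)

Section Localization.
Variables (A : idomainType) (den : A -> Prop).

Lemma tofrac_inj : injective (@tofrac A).
Proof. by move=> a b /eqP; rewrite tofrac_eq => /eqP. Qed.

Lemma loc_of_inj : injective (@loc_of A den).
Proof. by move=> a b /(congr1 (@lval A den)) /=; exact: tofrac_inj. Qed.

Lemma loc_of0 : @loc_of A den 0 = 0.
Proof. by apply: val_inj; rewrite /= tofrac0. Qed.

Lemma loc_of_inv d : d != 0 -> den d -> exists q : locring den, loc_of den d * q = 1.
Proof.
move=> d0 dd.
have H : (tofrac d)^-1 \in in_locring den by apply/asboolP => P _ _ _ _; exact.
exists (Locring H); apply: val_inj => /=.
by rewrite mulfV // -tofrac0 tofrac_eq.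
Qed.

(** The fractions with a product of elements of [den] below form a subring of the fraction field
    containing A and those inverses, and [in_locring] is the intersection of all such subrings. *)
Lemma locring_frac (q : locring den) :
  exists (rs : seq A) (a : A), (forall r, r \in rs -> den r) /\
    loc_of den (\prod_(r <- rs) r) * q = loc_of den a.
Proof.
case: q => q hq.
pose P (x : {fraction A}) := exists (rs : seq A) (a : A),
  (forall r, r \in rs -> den r) /\ tofrac (\prod_(r <- rs) r) * x = tofrac a.
suff [rs [a [rsP e]]] : P q by exists rs, a; split=> //; exact: val_inj.
have memcat rs ss : (forall r, r \in rs -> den r) -> (forall r, r \in ss -> den r) ->
    forall r : A, r \in rs ++ ss -> den r.
  by move=> H1 H2 r; rewrite mem_cat => /orP[/H1|/H2].
apply: (asboolP _ hq) => [|x y [rs [a [H e]]] [ss [b [H' e']]]|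
    x y [rs [a [H e]]] [ss [b [H' e']]]|a|d dd].
- by exists [::], 1; split=> //; rewrite big_nil mulr1.
- exists (rs ++ ss), ((\prod_(r <- ss) r) * a - (\prod_(r <- rs) r) * b).
  split; first exact: memcat.
  rewrite big_cat tofracB !tofracM -e -e' mulrBr /=.
  by rewrite -!mulrA; congr (_ - _); rewrite mulrCA.
- exists (rs ++ ss), (a * b); split; first exact: memcat.
  by rewrite big_cat /= !tofracM -e -e' mulrACA.
- by exists [::], a; split=> //; rewrite big_nil mul1r.
(* [den] may contain 0, whose inverse in the field is 0; the empty denominator serves then. *)
- case: (eqVneq d 0) => [->|d0].
    by exists [::], 0; split=> //; rewrite !tofrac0 invr0 mulr0.
  exists [:: d], 1; split; first by move=> r; rewrite inE => /eqP->.
  by rewrite big_seq1 mulfV // -tofrac0 tofrac_eq.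
Qed.

(** A copy of the localization that carries its A-module structure, because flatness is quantified
    over left modules; [loc_lin] is the injection to which it is applied. *)
Definition locmod := locring den.
HB.instance Definition _ := GRing.Zmodule.copy locmod (locring den).
Definition locmod_scale (a : A) (q : locmod) : locmod := loc_of den a * (q : locring den).
Lemma locmod_scaleA a b q : locmod_scale a (locmod_scale b q) = locmod_scale (a * b) q.
Proof. by rewrite /locmod_scale loc_ofM mulrA. Qed.
Lemma locmod_scale1 : left_id 1 locmod_scale.
Proof. by move=> q; rewrite /locmod_scale loc_of1 mul1r. Qed.
Lemma locmod_scaleDr : right_distributive locmod_scale +%R.
Proof. by move=> a p q; rewrite /locmod_scale mulrDr. Qed.
Lemma locmod_scaleDl q : {morph locmod_scale^~ q : a b / a + b}.
Proof. by move=> a b; rewrite /locmod_scale loc_ofD mulrDl. Qed.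
HB.instance Definition _ := GRing.Zmodule_isLmodule.Build A locmod
  locmod_scaleA locmod_scale1 locmod_scaleDr locmod_scaleDl.

Definition loc_lin (a : A^o) : locmod := loc_of den a.
Lemma loc_lin_linear : linear loc_lin.
Proof. by move=> a x y; rewrite /loc_lin loc_ofD loc_ofM. Qed.
HB.instance Definition _ := GRing.isLinear.Build A A^o locmod _ loc_lin loc_lin_linear.

End Localization.

(** * The grading of the polynomial ring *)

Section Homogeneous.
Variables (W : groupType) (k : idomainType) (n : nat) (rho : rep W k n).
Local Notation R := (Rh k n).
Local Notation act := (actR rho).

Lemma actR_M w f g : act w (f * g) = act w f * act w g. Proof. exact: rmorphM. Qed.
Lemma actR_D w f g : act w (f + g) = act w f + act w g. Proof. exact: rmorphD. Qed.
Lemma actR_B w f g : act w (f - g) = act w f - act w g. Proof. exact: rmorphB. Qed.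
Lemma actR_0 w : act w 0 = 0. Proof. exact: rmorph0. Qed.
Lemma actR_1 w : act w 1 = 1. Proof. exact: rmorph1. Qed.

Definition homogR (f : R) : Prop := exists j : nat, (f : {mpoly k[n]}) \is j.-homog.

Lemma homogRM f g : homogR f -> homogR g -> homogR (f * g).
Proof. by case=> i hf [j hg]; exists (i + j)%N; exact: dhomogM. Qed.
Lemma homogR_rdeg f : homogR f -> exists i, rdeg i f.
Proof. by case=> j hf; exists (2 * j)%N%:Z; right; exists j. Qed.

Lemma symv_homog (a : 'rV[k]_n) : symv a \is 1.-homog.
Proof.
rewrite /symv; apply: rpred_sum => i _; apply: rpredZ.
by rewrite dhomogX /= mdeg1.
Qed.

Lemma actR_const w (c : k) : act w (c%:MP : {mpoly k[n]}) = c%:MP.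
Proof. exact: comp_mpolyC. Qed.

Lemma actR_homog w (f : R) j : (f : {mpoly k[n]}) \is j.-homog ->
  (act w f : {mpoly k[n]}) \is j.-homog.
Proof.
move=> /dhomogP hf.
rewrite [f](mpolyE (f : {mpoly k[n]})) rmorph_sum big_seq.
apply: rpred_sum => m /hf mj.
rewrite -mul_mpolyC rmorphM [X in X * _]actR_const mul_mpolyC; apply: rpredZ.
rewrite (mpolyXE_id k m) rmorph_prod.
have -> : j = (\sum_(i < n) m i)%N by rewrite -mj; exact: mdegE.
elim/big_ind2: _ => [|x i y l hx hy|i _]; first exact: dhomog1.
  exact: dhomogM.
have := dhomogMn (m i) (symv_homog (actV rho w (delta_mx ord0 i))).
by rewrite mul1n rmorphXn -actR_X.
Qed.

Lemma actR_rdeg w i (f : R) : rdeg i f -> rdeg i (act w f).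
Proof.
case=> [->|[j -> hf]]; first by left; rewrite rmorph0.
by right; exists j => //; exact: actR_homog.
Qed.

Lemma rdegM i j (f g : R) : rdeg i f -> rdeg j g -> rdeg (i + j) (f * g).
Proof.
case=> [->|[a -> hf]]; first by left; rewrite mul0r.
case=> [->|[b -> hg]]; first by left; rewrite mulr0.
by right; exists (a + b)%N; [rewrite mulnDr PoszD | exact: dhomogM].
Qed.

Lemma rdegB i (f g : R) : rdeg i f -> rdeg i g -> rdeg i (f - g).
Proof.
case=> [->|[a -> hf]].
  rewrite sub0r => -[->|[b -> hg]]; first by left; rewrite oppr0.
  by right; exists b => //; rewrite dhomogN.
case=> [->|[b ab hg]]; first by rewrite subr0; right; exists a.
right; exists a => //; have ba : b = a.
  by case: ab => /eqP; rewrite eqn_pmul2l // => /eqP ->.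
by apply: rpredB => //; rewrite -ba.
Qed.

Definition rcomp (i : int) (f : R) : R :=
  if i is Posz m then if odd m then 0 else pihomog mdeg m./2 f else 0.

Lemma rdeg_direct : direct_sum_of (@rdeg k n).
Proof.
have sub j : rdeg j (0 : R) /\ (forall x y : R, rdeg j x -> rdeg j y -> rdeg j (x - y)).
  by split; [left | exact: rdegB].
apply: (@direct_sum_of_sep _ _ _ sub _ rcomp).
- by move=> [m|m] x y /=; rewrite ?addr0 //; case: odd; rewrite ?addr0 ?pihomogD.
- move=> i x [->//|[j -> hx]]; rewrite /= oddM /= mul2n doubleK.
  by rewrite pihomog_dE.
- move=> i j x [->|[a -> hx]] ij.
    by case: j ij => // m _ /=; rewrite pihomog0 if_same.
  case: j ij => // m ij /=; case: ifP => // /negbT/even_halfK e.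
  by apply: (pihomog_ne0 _ hx); apply/eqP => ae; apply: ij; rewrite ae mul2n e.
- move=> f; rewrite [f](pihomog_partitionE (leqnn (mmeasure mdeg f))).
  apply: add_span_sum => i _; apply: add_span_gen; exists (2 * i)%N%:Z; right.
  by exists i => //; exact: pihomogP.
Qed.

Lemma rdeg_span (f : R) : add_span (fun g => exists i, rdeg i g) f.
Proof. exact: (ds_span rdeg_direct). Qed.

End Homogeneous.

(** * Reflection data and lattices *)

Section Gen.
Variables (W : groupType) (S : W -> Prop).
Local Open Scope group_scope.

Lemma gen1 : gen S 1. Proof. by exists [::]. Qed.
Lemma gen_in s : S s -> gen S s.
Proof.
by move=> Ss; exists [:: s]; split; [move=> t; rewrite inE => /eqP-> | rewrite /= mulg1].
Qed.
Lemma in_exp_cat (u v : seq W) : in_exp S (u ++ v) <-> in_exp S u /\ in_exp S v.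
Proof.
split=> [H|[Hu Hv] s]; first by split=> s ss; apply: H; rewrite mem_cat ss ?orbT.
by rewrite mem_cat => /orP[/Hu|/Hv].
Qed.
Lemma genM x y : gen S x -> gen S y -> gen S (x * y).
Proof.
case=> u [uS <-] [v [vS <-]]; exists (u ++ v).
by split; [exact/in_exp_cat | rewrite wprod_cat].
Qed.
Hypothesis Sinv : forall s, S s -> s * s = 1.
Lemma invol_inv s : S s -> s^-1 = s.
Proof. by move=> /Sinv ss; apply: (@mulgI _ s); rewrite mulgV ss. Qed.
Lemma wprod_rev u : in_exp S u -> wprod (rev u) = (wprod u)^-1.
Proof.
elim: u => [|s u IH] uS; first by rewrite invg1.
rewrite rev_cons -cats1 wprod_cat IH => [|t tu]; last by apply: uS; rewrite inE tu orbT.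
by rewrite /= mulg1 invgM (@invol_inv s) //; apply: uS; rewrite inE eqxx.
Qed.
Lemma in_exp_rev u : in_exp S u -> in_exp S (rev u).
Proof. by move=> uS s; rewrite mem_rev => /uS. Qed.
Lemma genV x : gen S x -> gen S x^-1.
Proof.
case=> u [uS <-]; exists (rev u); split; first exact: in_exp_rev.
exact: wprod_rev.
Qed.
End Gen.

Section Datum.
Variables (W : groupType) (k : idomainType) (n : nat) (rho : rep W k n).
Local Notation R := (Rh k n).
Local Notation act := (actR rho).
Implicit Types (D : rdatum W k n).

Definition dinv D (d : R) : Prop := exists q : Q rho D, loc_of (is_root rho D) d * q = 1.

(** The roots appear here for every w of the group, without the length condition of [is_root], which
    makes the class stable under the group; the units absorb the ambiguity of the root of a
    reflection. *)
Inductive den D : R -> Prop :=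
| den_const c of c \is a GRing.unit : den D (c%:MP : {mpoly k[n]})
| den_root w g of gen (gens D) w & gens D g : den D (symv (actV rho w (root D g)))
| den_mul a b of den D a & den D b : den D (a * b).

(** What the theory of bimodules has to know of a datum; it holds for the full system and for each
    endoscopic group. Field [gd_den] covers the roots that [is_root] leaves out. *)
Record gdatum D : Prop := Gdatum {
  gd_ord : forall g, gens D g -> (g * g = 1)%g /\ g <> 1%g;
  gd_rho : forall g, gens D g -> rho g = 1%:M - coroot D g *m root D g;
  gd_rootP : forall g, gens D g -> exists v, pairing v (root D g) = 1;
  gd_corootP : forall g, gens D g -> exists a, pairing (coroot D g) a = 1;
  gd_pair : forall g, gens D g -> pairing (coroot D g) (root D g) = 2%:R;
  gd_den : forall w g, gen (gens D) w -> gens D g ->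
    dinv D (symv (actV rho w (root D g))) }.

Lemma den1 D : den D 1.
Proof. by have := @den_const D 1 (unitr1 _); rewrite mpolyC1. Qed.

Lemma den_prod D (I : Type) (r : seq I) (p : pred I) (F : I -> R) :
  (forall i, p i -> den D (F i)) -> den D (\prod_(i <- r | p i) F i).
Proof. by move=> H; elim/big_ind: _ => [|x y|i /H//]; [exact: den1 | exact: den_mul]. Qed.

Lemma den_homogR D d : den D d -> homogR d.
Proof.
elim=> [c _|w g _ _|a b _ Ha _ Hb]; last exact: homogRM.
- exists 0%N; rewrite -[c%:MP]mulr1 mul_mpolyC; by apply: dhomogZ; exact: dhomog1.
- by exists 1%N; exact: symv_homog.
Qed.

Lemma actVM x y (a : 'rV[k]_n) : actV rho (x * y)%g a = actV rho x (actV rho y a).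
Proof. by rewrite /actV invgM rhoM mulmxA. Qed.
Lemma actV1 (a : 'rV[k]_n) : actV rho 1%g a = a.
Proof. by rewrite /actV invg1 rho1 mulmx1. Qed.

(** The condition under which a twist by v turns denominators over D' into denominators over D. *)
Definition rebases v D' D := forall w g, gen (gens D') w -> gens D' g ->
  den D (symv (actV rho (v * w)%g (root D' g))).

Lemma den_rebase v D' D d : rebases v D' D -> den D' d -> den D (act v d).
Proof.
move=> H; elim=> [c cu|w g gw gg|a b _ Ha _ Hb].
- by rewrite actR_const; exact: den_const.
- by rewrite actR_symv -actVM; exact: H.
- by rewrite rmorphM; exact: den_mul.
Qed.

Lemma rebases_gen D v : gen (gens D) v -> rebases v D D.
Proof. by move=> gv w g gw gg; apply: den_root => //; exact: genM. Qed.

Lemma den_act D v d : gen (gens D) v -> den D d -> den D (act v d).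
Proof. by move=> /rebases_gen; exact: den_rebase. Qed.

Lemma dinvM D a b : dinv D a -> dinv D b -> dinv D (a * b).
Proof.
case=> p ap [q bq]; exists (p * q).
by rewrite loc_ofM mulrACA ap bq mulr1.
Qed.

Section Good.
Variables (D : rdatum W k n) (HD : gdatum D).
Local Notation loc := (loc_of (is_root rho D)).
Local Notation Q := (Q rho D).

Lemma gd_inv g : gens D g -> (g * g = 1)%g. Proof. by move/(gd_ord HD) => -[]. Qed.

Lemma den_dinv d : den D d -> dinv D d.
Proof.
elim=> [c cu|w g gw gg|a b _ Ha _ Hb]; last exact: dinvM.
- exists (loc (c^-1)%:MP); rewrite -loc_ofM -mpolyCM divrr // mpolyC1.
  exact: loc_of1.
- exact: gd_den.
Qed.

Lemma den_neq0 d : den D d -> d != 0.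
Proof.
case/den_dinv => q dq; apply/eqP => d0; move: dq.
by rewrite d0 loc_of0 mul0r => /esym/eqP; rewrite oner_eq0.
Qed.

Lemma Q_frac (q : Q) : exists d a, den D d /\ loc d * q = loc a.
Proof.
have [rs [a [rsP e]]] := locring_frac q.
exists (\prod_(r <- rs) r), a; split=> //; rewrite big_seq; apply: den_prod => r /rsP.
by case=> r0 [p [[gp Dp _ _] ->]]; exact: den_root.
Qed.

Section MQFacts.
Variable M : bimod R R.
Implicit Types (m : M) (q : Q) (x : MQ rho D M).

Lemma mqDl m m' q : @mq _ _ _ rho D M (m + m') q = mq m q + mq m' q.
Proof. exact: tpDl. Qed.
Lemma mqDr m q q' : @mq _ _ _ rho D M m (q + q') = mq m q + mq m q'.
Proof. exact: tpDr. Qed.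
Lemma mq0l q : @mq _ _ _ rho D M 0 q = 0. Proof. exact: tp0l. Qed.
Lemma mq0r m : @mq _ _ _ rho D M m 0 = 0. Proof. exact: tp0r. Qed.
Lemma mqNr m q : @mq _ _ _ rho D M m (- q) = - mq m q. Proof. exact: tpNr. Qed.
Lemma mqNl m q : @mq _ _ _ rho D M (- m) q = - mq m q. Proof. exact: tpNl. Qed.
Lemma mq_suml (I : Type) (r : seq I) (p : pred I) (F : I -> M) q :
  @mq _ _ _ rho D M (\sum_(i <- r | p i) F i) q = \sum_(i <- r | p i) mq (F i) q.
Proof. exact: tp_suml. Qed.
Lemma mq_ractl m f q : @mq _ _ _ rho D M (ract M m f) q = mq m (loc f * q).
Proof. exact: tp_mid. Qed.
Lemma ract_mq m q q' : ract (MQ rho D M) (mq m q) q' = mq m (q * q').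
Proof. exact: ract_tp. Qed.
Lemma lact_mq f m q : lact (MQ rho D M) f (mq m q) = mq (lact M f m) q.
Proof. exact: lact_tp. Qed.

Lemma MQ_ind (P : MQ rho D M -> Prop) :
  P 0 -> (forall x y, P x -> P y -> P (x + y)) -> (forall m q, P (mq m q)) ->
  forall x, P x.
Proof. exact: tb_ind. Qed.

Lemma MQ_frac x : exists d m, den D d /\ ract (MQ rho D M) x (loc d) = mq m 1.
Proof.
elim/MQ_ind: x => [|x y [d [m [dd xm]]] [e [p [de yp]]]|m q].
- by exists 1, 0; split; [exact: den1 | rewrite ract0 mq0l].
- exists (d * e), (ract M m e + ract M p d); split; first exact: den_mul.
  rewrite ractD {2}[d * e]mulrC !loc_ofM !ractM xm yp !ract_mq !mul1r.
  by rewrite mqDl !mq_ractl !mulr1.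
- have [d [a [dd e]]] := Q_frac q; exists d, (ract M m a); split=> //.
  by rewrite ract_mq mq_ractl mulr1 mulrC e.
Qed.

Lemma MQ_ractI d x : den D d -> ract (MQ rho D M) x (loc d) = 0 -> x = 0.
Proof.
case/den_dinv => q dq x0; rewrite -[x]ract1 -dq ractM x0; exact: ract0.
Qed.

Hypothesis flatM : right_flat M.

(** Flatness is applied to the inclusion of R in its localization: m (x) 1 already vanishes in M (x)
    R, which the right action maps back to M. *)
Lemma mq_inj m : @mq _ _ _ rho D M m 1 = 0 -> m = 0.
Proof.
move=> m0.
pose X : lmodType R := R^o; pose Y : lmodType R := locmod (is_root rho D).
pose f : {linear X -> Y} := loc_lin (is_root rho D).
have fI : injective f by move=> a b; exact: loc_of_inj.
pose tX (p : M) (a : X) := tpure (ract M) (fun (a : R) (x : X) => a *: x) p a.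
have fD (x y : X) : f (x + y) = f x + f y by exact: linearD.
have fl b (x : X) : f (b *: x) = b *: f x by exact: linearZ.
have E p a : tmap (ract M) (fun (a : R) (x : X) => a *: x)
    (ract M) (fun (a : R) (y : Y) => a *: y) id f (tX p a) = tpure _ _ p (f a).
  by rewrite tmap_pure.
have mX0 : tX m 1 = tX 0 1.
  apply: (flatM fI); rewrite !E /=.
  have -> : f 1 = loc 1 by []. rewrite loc_of1.
  by transitivity (@mq _ _ _ rho D M m 1); [by [] | rewrite m0; symmetry; exact: mq0l].
have bal : balanced (ract M) (fun (a : R) (x : X) => a *: x) (fun p (a : X) => ract M p (a : R)).
  split=> [p p' a|p a a'|p b a]; [exact: ractD|exact: ract_Dr|by rewrite -ractM].
have := congr1 (tlift (fun p (a : X) => ract M p (a : R))) mX0.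
by rewrite !tlift_pure // ract1 ract0.
Qed.

Lemma mq_inj2 m m' : @mq _ _ _ rho D M m 1 = mq m' 1 -> m = m'.
Proof.
move=> e; apply/eqP; rewrite -subr_eq0; apply/eqP/mq_inj.
by rewrite mqDl mqNl e subrr.
Qed.

End MQFacts.

Lemma fQ_mq (M N : bimod R R) (f : bhom M N) m q :
  fQ rho D f (mq m q) = mq (f m) q.
Proof. exact: thomE. Qed.

Lemma fQ_id (M : bimod R R) x : fQ rho D (bid M) x = x.
Proof. by rewrite /fQ thom_id. Qed.

Lemma fQ_comp (M N P : bimod R R) (f : bhom M N) (g : bhom N P) x :
  fQ rho D (bcomp f g) x = fQ rho D g (fQ rho D f x).
Proof.
rewrite -[RHS]bcompE -thom_comp; congr (bfun (thom _ _) x).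
by apply: bhom_ext.
Qed.

Lemma fQ_ext (M N : bimod R R) (f g : bhom M N) x : f =1 g -> fQ rho D f x = fQ rho D g x.
Proof. by move=> /bhom_ext ->. Qed.

Lemma fQ_zero (M N : bimod R R) (f : bhom M N) x : (forall m, f m = 0) -> fQ rho D f x = 0.
Proof.
move=> f0; elim/MQ_ind: x => [|x y fx fy|m q].
- exact: bhom0.
- by rewrite (bhomD (bhomP (fQ rho D f))) fx fy addr0.
- by rewrite fQ_mq f0; exact: mq0l.
Qed.

Lemma fQ_sum (M N : bimod R R) (J : finType) (f : J -> bhom M N) x :
  fQ rho D (bsum f) x = \sum_j fQ rho D (f j) x.
Proof.
elim/MQ_ind: x => [|x y fx fy|m q].
- by rewrite bhom0 big1 // => j _; rewrite bhom0.
- rewrite (bhomD (bhomP (fQ rho D _))) fx fy -big_split.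
  by apply: eq_bigr => j _; rewrite (bhomD (bhomP (fQ rho D _))).
- by rewrite fQ_mq mq_suml; apply: eq_bigr => j _; rewrite fQ_mq.
Qed.

(** The stability of components that calculations with lattices require. Directness of their sum is
    kept apart, since this much passes to tensor products and twists at once. *)
Record lclosed (M : lbim rho D) : Prop := Lclosed {
  lcl_sub : forall w, lcomp w (0 : MQ rho D M) /\
    (forall x y : MQ rho D M, lcomp w x -> lcomp w y -> lcomp w (x - y));
  lcl_l : forall w f (x : MQ rho D M), lcomp w x -> lcomp w (lact (MQ rho D M) f x);
  lcl_r : forall w q (x : MQ rho D M), lcomp w x -> lcomp w (ract (MQ rho D M) x q) }.

Section Lclosed.
Variables (M : lbim rho D) (cM : lclosed M).
Implicit Types (m : M) (x y : MQ rho D M).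

Lemma lcl0 w : lcomp w (0 : MQ rho D M). Proof. by case: (lcl_sub cM w). Qed.
Lemma lclB w x y : lcomp w x -> lcomp w y -> lcomp w (x - y).
Proof. exact: (lcl_sub cM w).2. Qed.
Lemma lclD w x y : lcomp w x -> lcomp w y -> lcomp w (x + y).
Proof. exact: (dsPD (P := @lcomp _ _ _ _ _ M) (lcl_sub cM)). Qed.
Lemma lcl_sum w (I : Type) (r : seq I) (p : pred I) (F : I -> MQ rho D M) :
  (forall i, p i -> lcomp w (F i)) -> lcomp w (\sum_(i <- r | p i) F i).
Proof. exact: (dsP_sum (P := @lcomp _ _ _ _ _ M) (lcl_sub cM)). Qed.

Lemma lcl_mq w m q : lat w m -> lcomp w (mq m q).
Proof. by move=> lm; have := lcl_r cM q lm; rewrite ract_mq mul1r. Qed.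

Lemma lat0 w : lat w (0 : M). Proof. by rewrite /lat mq0l; exact: lcl0. Qed.
Lemma latD w m m' : lat w m -> lat w m' -> lat w (m + m').
Proof. by rewrite /lat mqDl; exact: lclD. Qed.
Lemma latB w m m' : lat w m -> lat w m' -> lat w (m - m').
Proof. by rewrite /lat mqDl mqNl; exact: lclB. Qed.
Lemma lat_sum w (I : Type) (r : seq I) (p : pred I) (F : I -> M) :
  (forall i, p i -> lat w (F i)) -> lat w (\sum_(i <- r | p i) F i).
Proof. by move=> H; rewrite /lat mq_suml; exact: lcl_sum. Qed.
Lemma lat_l w f m : lat w m -> lat w (lact M f m).
Proof. by rewrite /lat -lact_mq; exact: lcl_l. Qed.
Lemma lat_r w f m : lat w m -> lat w (ract M m f).
Proof. by rewrite /lat mq_ractl mulr1; exact: lcl_mq. Qed.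
Lemma lat_div w d m : den D d -> lat w (ract M m d) -> lat w m.
Proof.
case/den_dinv => q dq; rewrite /lat mq_ractl mulr1 => /(lcl_r cM q).
by rewrite ract_mq dq.
Qed.

Lemma lcomp_frac w x : lcomp w x -> exists d m,
  [/\ den D d, lat w m & ract (MQ rho D M) x (loc d) = mq m 1].
Proof.
move=> lx; have [d [m [dd xm]]] := MQ_frac x; exists d, m; split=> //.
by rewrite /lat -xm; exact: lcl_r.
Qed.

Lemma lcomp_lat w x : lcomp w x -> exists m q, lat w m /\ x = mq m q.
Proof.
case/lcomp_frac => d [m [dd lm xm]]; have [q dq] := den_dinv dd.
by exists m, q; split=> //; rewrite -[x]ract1 -dq ractM xm ract_mq mul1r.
Qed.
End Lclosed.

Lemma lclosed_span (M : lbim rho D) (P : W -> M -> Prop) :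
  (forall w x, lcomp w x <-> add_span (fun y => exists m q, P w m /\ y = mq m q) x) ->
  (forall w f m, P w m -> P w (lact M f m)) -> lclosed M.
Proof.
move=> H Pl; split=> [w|w f x|w q x]; rewrite ?H.
- split=> [|x y]; first exact: add_span0.
  rewrite !H; apply: add_spanB => z [m [q [Pm ->]]].
  by exists m, (- q); rewrite mqNr.
- apply: add_span_map => [|y z|y [m [q [Pm ->]]]].
  + exact: lact0.
  + exact: lactD.
  + by apply: add_span_gen; exists (lact M f m), q; rewrite lact_mq; split=> //; exact: Pl.
- apply: (add_span_map (f := fun x => ract (MQ rho D M) x q)) => [|y z|y [m [p [Pm ->]]]].
  + exact: ract0.
  + exact: ractD.
  + by apply: add_span_gen; exists m, (p * q); rewrite ract_mq.
Qed.

(** Each element of a component is a lattice element times a scalar of Q, so morphisms can be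
    recognised on lattices. *)
Lemma is_mor_lat (M N : lbim rho D) (f : bhom M N) : lclosed M -> lclosed N ->
  (forall w m, lat w m -> lat w (f m)) -> is_mor f.
Proof.
move=> cM cN H w x /(lcomp_lat cM)[m [q [lm ->]]].
by rewrite fQ_mq; apply: lcl_mq => //; exact: H.
Qed.

Lemma mor_lat (M N : lbim rho D) (f : bhom M N) w m : is_mor f -> lat w m -> lat w (f m).
Proof. by move=> fm /fm; rewrite fQ_mq. Qed.

Lemma is_mor_id (M : lbim rho D) : is_mor (bid M).
Proof. by move=> w x; rewrite fQ_id. Qed.
Lemma is_mor_comp (M N P : lbim rho D) (f : bhom M N) (g : bhom N P) :
  is_mor f -> is_mor g -> is_mor (bcomp f g).
Proof. by move=> hf hg w x /hf/hg; rewrite fQ_comp. Qed.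
Lemma is_mor_zero (M N : lbim rho D) (f : bhom M N) : lclosed N ->
  (forall m, f m = 0) -> is_mor f.
Proof. by move=> cN f0 w x _; rewrite fQ_zero //; exact: lcl0. Qed.
Lemma is_mor_sum (M N : lbim rho D) (J : finType) (f : J -> bhom M N) : lclosed N ->
  (forall j, is_mor (f j)) -> is_mor (bsum f).
Proof.
move=> cN H w x lx; rewrite fQ_sum; apply: lcl_sum => // j _; exact: H.
Qed.

End Good.
End Datum.

(** * Flatness of tensor products *)

Section FlatTensor.
Variables (k : idomainType) (n : nat).
Local Notation R := (Rh k n).

Section LmodBim.
Variable X : lmodType R.
(** A left R-module is viewed as an (R, Z)-bimodule; tensoring with it then falls under [tbim], and
    associativity is available. *)
Lemma lmod_bim_axioms : @bimod_axioms R int X (fun a x => a *: x) (fun x z => x *~ z).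
Proof.
split=> [x|a b x|a b x|a x y|x|x a b|x a b|x y a|a x c].
- exact: scale1r.
- by rewrite scalerA.
- exact: scalerDl.
- exact: scalerDr.
- exact: mulr1z.
- exact: mulrzA.
- exact: mulrzDr.
- exact: mulrzDl.
- by rewrite scalerMzr.
Qed.
Definition lmod_bim : bimod R int := Bimod lmod_bim_axioms.
End LmodBim.

Lemma lmod_hom_axioms (X Y : lmodType R) (f : {linear X -> Y}) :
  @bhom_axioms R int (lmod_bim X) (lmod_bim Y) f.
Proof. by split=> [x y|a x|x c]; [exact: linearD|exact: linearZ|exact: raddfMz]. Qed.
Definition lmod_hom (X Y : lmodType R) (f : {linear X -> Y}) :
  bhom (lmod_bim X) (lmod_bim Y) := Bhom (lmod_hom_axioms f).

Section TensorLmod.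
Variables (N : bimod R R) (X : lmodType R).
(** N (x) X keeps a left R-module structure, which makes it a test module for the flatness of M. *)
Definition tens_lmod : Type := bcar (tbim N (lmod_bim X)).
HB.instance Definition _ := GRing.Zmodule.copy tens_lmod (bcar (tbim N (lmod_bim X))).
Definition tl_scale (a : R) (t : tens_lmod) : tens_lmod :=
  lact (tbim N (lmod_bim X)) a t.
Lemma tl_scaleA a b t : tl_scale a (tl_scale b t) = tl_scale (a * b) t.
Proof. by rewrite /tl_scale lactM. Qed.
Lemma tl_scale1 : left_id 1 tl_scale. Proof. by move=> t; exact: lact1. Qed.
Lemma tl_scaleDr : right_distributive tl_scale +%R.
Proof. by move=> a x y; exact: lactD. Qed.
Lemma tl_scaleDl t : {morph tl_scale^~ t : a b / a + b}.
Proof. by move=> a b; exact: lact_Dl. Qed.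
HB.instance Definition _ := GRing.Zmodule_isLmodule.Build R tens_lmod
  tl_scaleA tl_scale1 tl_scaleDr tl_scaleDl.
End TensorLmod.

Definition tl_map (N : bimod R R) (X Y : lmodType R) (f : {linear X -> Y})
  (t : tens_lmod N X) : tens_lmod N Y := thom (bid N) (lmod_hom f) t.
Lemma tl_map_linear N X Y f : linear (@tl_map N X Y f).
Proof.
move=> a x y; rewrite /tl_map (bhomD (bhomP (thom _ _))); congr (_ + _).
exact: (bhoml (bhomP (thom _ _))).
Qed.
HB.instance Definition _ N X Y f := GRing.isLinear.Build R (tens_lmod N X)
  (tens_lmod N Y) _ (@tl_map N X Y f) (@tl_map_linear N X Y f).

Lemma right_flatP (M : bimod R R) :
  right_flat M <-> forall (X Y : lmodType R) (f : {linear X -> Y}), injective f ->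
    forall t, thom (bid M) (lmod_hom f) t = 0 -> t = 0.
Proof.
split=> H X Y f fI.
  by move=> t t0; apply: (H X Y f fI); rewrite [RHS](bhom0 (thom (bid M) (lmod_hom f))).
move=> t t' e; apply/eqP; rewrite -subr_eq0; apply/eqP; apply: (H X Y f fI).
by rewrite bhomB; apply/eqP; rewrite subr_eq0; apply/eqP.
Qed.

(** By associativity (M (x) N) (x) f becomes M (x) (N (x) f); flatness of N makes the inner map
    injective, and flatness of M the outer one. *)
Lemma right_flat_tens (M N : bimod R R) : right_flat M -> right_flat N ->
  right_flat (tbim M N).
Proof.
move=> fM fN; apply/right_flatP => X Y f fI t t0.
pose g : {linear tens_lmod N X -> tens_lmod N Y} := tl_map f.
have gI : injective g by exact: (fN X Y f fI).
have E : bcomp (tassoc M N (lmod_bim X)) (thom (bid M) (thom (bid N) (lmod_hom f)))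
    = bcomp (thom (bid (tbim M N)) (lmod_hom f)) (tassoc M N (lmod_bim Y)).
  by apply: tb_hom_ext3 => m p x; rewrite !bcompE tassocE !thomE tassocE.
have := congr1 (fun h => bfun h t) E; rewrite !bcompE t0 bhom0 => at0.
have {at0} at0 : tassoc M N (lmod_bim X) t = 0.
  apply: (fM (tens_lmod N X) (tens_lmod N Y) g gI).
  transitivity (0 : tbim M (tbim N (lmod_bim Y))); first exact: at0.
  by symmetry; exact: (bhom0 (thom (bid M) (thom (bid N) (lmod_hom f)))).
by rewrite -[t]/(bid _ t) -tassocK bcompE at0 bhom0.
Qed.

Lemma right_flat_retract (M : bimod R R) (J : finType) (X : J -> bimod R R)
    (inc : forall j, bhom (X j) M) (pro : forall j, bhom M (X j)) :
  (forall m, m = \sum_j inc j (pro j m)) -> (forall j, right_flat (X j)) ->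
  right_flat M.
Proof.
move=> H fX; apply/right_flatP => Y Z f fI t t0.
pose P j := thom (pro j) (bid (lmod_bim Y)); pose I j := thom (inc j) (bid (lmod_bim Y)).
have -> : t = bsum (fun j => bcomp (P j) (I j)) t.
  rewrite -[t in LHS]/(bid _ t); congr (bfun _ t).
  apply: tb_hom_ext => m y; transitivity (\sum_j tp (inc j (pro j m)) y : tbim M (lmod_bim Y)).
    by rewrite -tp_suml -H.
  by rewrite bsumE; apply: eq_bigr => j _; rewrite bcompE /P /I !thomE.
rewrite bsumE big1 // => j _.
rewrite bcompE; suff -> : P j t = 0 by rewrite bhom0.
apply: (right_flatP (X j)).1 (fX j) _ _ _ fI _ _.
rewrite -bcompE; have -> : bcomp (P j) (thom (bid (X j)) (lmod_hom f))
    = bcomp (thom (bid M) (lmod_hom f)) (thom (pro j) (bid (lmod_bim Z))).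
  by apply: tb_hom_ext => m y; rewrite !bcompE /P !thomE.
by rewrite bcompE t0 bhom0.
Qed.

End FlatTensor.

(** * Bimodules that are direct sums of components after localization *)

Section Good.
Variables (W : groupType) (k : idomainType) (n : nat) (rho : rep W k n).
Local Notation R := (Rh k n).
Local Notation act := (actR rho).
Variables (D : rdatum W k n) (HD : gdatum rho D) (o : wset W).
Local Notation loc := (loc_of (is_root rho D)).
Local Notation lbim := (lbim rho D).
Implicit Types (L : o) (M N : lbim).

Definition left_fg (M : bimod R R) : Prop :=
  exists g : seq M, forall m : M,
    add_span (fun x => exists a y, y \in g /\ x = lact M a y) m.

(* [in_C] without the grading; the bimodules of interest are finitely generated even
   as left modules. *)
Record good L L' M : Prop := Good {
  g_fg : left_fg M;
  g_flat : right_flat M;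
  g_sum : direct_sum_of (@lcomp _ _ _ _ _ M);
  g_l : forall w f (x : MQ rho D M), lcomp w x -> lcomp w (lact (MQ rho D M) f x);
  g_r : forall w q (x : MQ rho D M), lcomp w x -> lcomp w (ract (MQ rho D M) x q);
  g_tw : forall w f (x : MQ rho D M), lcomp w x ->
    ract (MQ rho D M) x (loc f) = lact (MQ rho D M) (act w f) x;
  g_fin : exists s : seq W, forall w (x : MQ rho D M), lcomp w x -> x <> 0 -> w \in s;
  g_supp : forall w (x : MQ rho D M), lcomp w x -> x <> 0 ->
    gen (gens D) w /\ wact L w = L' }.

(* The maps [E w] are multiples of the projections onto the summands that are
   already defined on [M]; they survive tensor products. *)
Record nice L L' M : Prop := Nice {
  n_fg : left_fg M;
  n_flat : right_flat M;
  n_cl : lclosed M;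
  n_tw : forall w f (x : MQ rho D M), lcomp w x ->
    ract (MQ rho D M) x (loc f) = lact (MQ rho D M) (act w f) x;
  n_fin : exists s : seq W, forall w (x : MQ rho D M), lcomp w x -> x <> 0 -> w \in s;
  n_supp : forall w (x : MQ rho D M), lcomp w x -> x <> 0 ->
    gen (gens D) w /\ wact L w = L';
  n_span : forall m : M, add_span (fun x => exists w, lcomp w x) (mq m 1 : MQ rho D M);
  n_sep : forall w, exists (E : bhom M M) (d : R), [/\ den rho D d,
    forall x : MQ rho D M, lcomp w x -> fQ rho D E x = ract (MQ rho D M) x (loc d)
    & forall w' (x : MQ rho D M), w' <> w -> lcomp w' x -> fQ rho D E x = 0] }.

(** The map [E w], extended to M_Q, acts on the component at w by an invertible scalar and kills the
    others, so these maps separate the components. *)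
Lemma nice_good L L' M : nice L L' M -> good L L' M.
Proof.
case=> fg fl cl tw fin supp sp sep; split=> //; [|exact: lcl_l cl|exact: lcl_r cl].
pose E w := sval (cid (sep w)).
have EP w : exists d : R, [/\ den rho D d,
    forall x : MQ rho D M, lcomp w x -> fQ rho D (E w) x = ract (MQ rho D M) x (loc d)
    & forall w' (x : MQ rho D M), w' <> w -> lcomp w' x -> fQ rho D (E w) x = 0].
  exact: svalP (cid (sep w)).
apply: (@direct_sum_of_sep _ _ _ (lcl_sub cl) _ (fun w => fQ rho D (E w))).
- by move=> w; exact: bhomD (bhomP (fQ rho D (E w))).
- move=> w x lx x0; have [d [dd Ed _]] := EP w.
  by apply: (MQ_ractI HD dd); rewrite -Ed.
- by move=> w w' x lx ww'; have [d [_ _ E0]] := EP w'; exact: (E0 w).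
- elim/MQ_ind => [|x y|m q]; [exact: add_span0|exact: add_spanD|].
  rewrite -[q]mul1r -ract_mq.
  apply: (add_span_map (f := fun x => ract (MQ rho D M) x q) _ _ _ (sp m)).
  + exact: ract0.
  + by move=> x y; exact: ractD.
  + by move=> x [w lx]; apply: add_span_gen; exists w; exact: lcl_r.
Qed.

Section GoodFacts.
Variables (L L' : o) (M : lbim) (gM : good L L' M).

Lemma good_cl : lclosed M.
Proof. by split; [case: (g_sum gM) | exact: g_l gM | exact: g_r gM]. Qed.

Lemma lat_tw w f (m : M) : lat w m -> ract M m f = lact M (act w f) m.
Proof.
move=> lm; apply: (mq_inj2 (rho := rho) (D := D) (g_flat gM)).
by rewrite -lact_mq -(g_tw gM) // ract_mq mq_ractl mulr1 mul1r.
Qed.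

Lemma lat_twl w f (m : M) : lat w m -> lact M f m = ract M m (act w^-1%g f).
Proof. by move=> lm; rewrite (lat_tw _ lm) actRVK. Qed.

Lemma lat_supp w (m : M) : lat w m -> m <> 0 -> gen (gens D) w /\ wact L w = L'.
Proof.
move=> lm m0; apply: (g_supp gM lm) => e; exact/m0/(mq_inj (rho := rho) (D := D) (g_flat gM)).
Qed.

Lemma lat_fin : exists s : seq W, forall w (m : M), lat w m -> m <> 0 -> w \in s.
Proof.
have [s Hs] := g_fin gM; exists s => w m lm m0.
by apply: (Hs w _ lm) => e; exact/m0/(mq_inj (rho := rho) (D := D) (g_flat gM)).
Qed.

(** Obtained from the decomposition of m (x) 1 in M_Q by a common denominator; flatness brings the
    resulting identity back to M. *)
Lemma lat_dec (m : M) : exists d, den rho D d /\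
  add_span (fun y => exists w, lat w y) (ract M m d).
Proof.
suff [d [m' [dd sm e]]] : exists d (m' : M), [/\ den rho D d,
    add_span (fun y => exists w, lat w y) m' & ract (MQ rho D M) (mq m 1) (loc d) = mq m' 1].
  exists d; split=> //.
  suff <- : m' = ract M m d by [].
  by apply: (mq_inj2 (rho := rho) (D := D) (g_flat gM)); rewrite -e ract_mq mq_ractl mul1r mulr1.
have cM := good_cl.
apply: (add_span_ind (K := fun x => exists d (m' : M), [/\ den rho D d,
    add_span (fun y => exists w, lat w y) m' & ract (MQ rho D M) x (loc d) = mq m' 1])
  _ _ _ (ds_span (g_sum gM) (mq m 1))).
- by exists 1, 0; split; [exact: den1 | exact: add_span0 | rewrite ract0 mq0l].
- move=> x y [d [a [dd sa xa]]] [e [b [de sb yb]]].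
  have ract_span c z : add_span (fun y : M => exists w, lat w y) z ->
      add_span (fun y : M => exists w, lat w y) (ract M z c).
    apply: (add_span_map (f := fun z => ract M z c)) => [|u v|u [w lu]].
    + exact: ract0.
    + exact: ractD.
    + by apply: add_span_gen; exists w; exact: lat_r.
  exists (d * e), (ract M a e + ract M b d); split; first exact: den_mul.
    by apply: add_spanD; exact: ract_span.
  rewrite ractD {2}[d * e]mulrC !loc_ofM !ractM xa yb !ract_mq !mul1r.
  by rewrite mqDl !mq_ractl !mulr1.
- move=> x [w /(lcomp_frac cM)[d [m' [dd lm e]]]]; exists d, m'; split=> //.
  by apply: add_span_gen; exists w.
Qed.

End GoodFacts.

Section DirectSumGood.
Variables (L L' : o) (M : lbim) (J : finType) (X : J -> lbim).
Variables (inc : forall j, bhom (X j) M) (pro : forall j, bhom M (X j)).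
Hypothesis incM : forall j, is_mor (inc j).
Hypothesis proM : forall j, is_mor (pro j).
Hypothesis incpro : forall m, m = \sum_j inc j (pro j m).
Hypothesis gX : forall j, good L L' (X j).
Hypothesis cM : lclosed M.

Lemma fQ_incpro (x : MQ rho D M) : x = \sum_j fQ rho D (inc j) (fQ rho D (pro j) x).
Proof.
rewrite -[x in LHS]fQ_id.
rewrite (@fQ_ext _ _ _ _ _ _ _ (bid M) (bsum (fun j => bcomp (pro j) (inc j)))).
  by rewrite fQ_sum; apply: eq_bigr => j _; rewrite fQ_comp.
by move=> m; rewrite bsumE; exact: incpro.
Qed.

(** The maps [pro j] are morphisms and jointly detect the elements of M_Q, so directness, twist,
    finiteness and support are inherited from the summands. *)
Lemma good_dsum : good L L' M.
Proof.
have iD j (x y : MQ rho D (X j)) := bhomD (bhomP (fQ rho D (inc j))) x y.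
split; [| | |exact: lcl_l cM|exact: lcl_r cM| | |].
- pose G j := sval (cid (g_fg (gX j))).
  have GP j m : add_span (fun x => exists a y, y \in G j /\ x = lact (X j) a y) m.
    exact: svalP (cid (g_fg (gX j))) m.
  exists (flatten [seq [seq inc j y | y <- G j] | j <- enum J]) => m.
  rewrite [m]incpro; apply: add_span_sum => j _.
  apply: (add_span_map (f := inc j) _ _ _ (GP j (pro j m))) => [|x y|x [a [y [yG ->]]]].
  + exact: bhom0.
  + exact: bhomD (bhomP (inc j)) _ _.
  apply: add_span_gen; exists a, (inc j y); split; last exact: bhoml (bhomP (inc j)) _ _.
  apply/flattenP; exists [seq inc j y | y <- G j]; last exact: map_f.
  by apply: (map_f (fun j => [seq inc j y | y <- G j])); rewrite mem_enum.
- exact: (right_flat_retract incpro (fun j => g_flat (gX j))).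
- split=> [|x|s c us cP c0 w ws]; first exact: lcl_sub cM.
    have : add_span (fun x => exists w, lcomp w x) x.
      rewrite [x]fQ_incpro; apply: add_span_sum => j _.
      apply: (add_span_map _ _ _ (ds_span (g_sum (gX j)) (fQ rho D (pro j) x))).
      + exact: bhom0.
      + exact: iD.
      + by move=> y [w ly]; apply: add_span_gen; exists w; exact: incM.
    case/(ds_rep_span (lcl_sub cM)) => a [aP [s [_ _ ->]]].
    by exists s, a.
  rewrite [c w]fQ_incpro big1 // => j _.
  suff -> : fQ rho D (pro j) (c w) = 0 by exact: bhom0.
  have [_ _ ind] := g_sum (gX j).
  apply: (ind s (fun w => fQ rho D (pro j) (c w)) us) => //.
    by move=> v vs; apply/proM/cP.
  by rewrite -bhom_sum c0 bhom0.
- move=> w f x lx; rewrite [x]fQ_incpro ract_sum lact_sum; apply: eq_bigr => j _.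
  rewrite -(bhomr (bhomP (fQ rho D (inc j)))) -(bhoml (bhomP (fQ rho D (inc j)))).
  by rewrite (g_tw (gX j) f (@proM j w x lx)).
- pose F j := sval (cid (g_fin (gX j))).
  have FP j w x : lcomp w x -> x <> 0 -> w \in F j := svalP (cid (g_fin (gX j))) w x.
  exists (flatten [seq F j | j <- enum J]) => w x lx x0.
  have [j xj] : exists j, fQ rho D (pro j) x <> 0.
    apply: contrapT => H; apply: x0; rewrite [x]fQ_incpro big1 // => j _.
    have [->|xj] := pselect (fQ rho D (pro j) x = 0); first exact: bhom0.
    by case: H; exists j.
  apply/flattenP; exists (F j); first by apply: map_f; rewrite mem_enum.
  exact: (FP j w _ (@proM j w x lx)).
- move=> w x lx x0.
  have [j xj] : exists j, fQ rho D (pro j) x <> 0.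
    apply: contrapT => H; apply: x0; rewrite [x]fQ_incpro big1 // => j _.
    have [->|xj] := pselect (fQ rho D (pro j) x = 0); first exact: bhom0.
    by case: H; exists j.
  exact: (g_supp (gX j) (@proM j w x lx) xj).
Qed.

End DirectSumGood.

Lemma in_C_good L L' M : left_fg M -> in_C L L' M -> good L L' M.
Proof. by move=> fg; case=> *; split. Qed.

End Good.

(** * Components of tensor products *)

Section TensorNice.
Variables (W : groupType) (k : idomainType) (n : nat) (rho : rep W k n).
Local Notation R := (Rh k n).
Local Notation act := (actR rho).
Variables (D : rdatum W k n) (HD : gdatum rho D) (o : wset W).
Local Notation loc := (loc_of (is_root rho D)).
Local Notation Q := (Q rho D).
Local Notation lbim := (lbim rho D).
Implicit Types (L : o) (M N : lbim).

Definition tens_lat (M N : lbim) (w : W) (t : tbim M N) : Prop :=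
  exists (m : M) (p : N) (x y : W), [/\ lat x m, lat y p, (x * y)%g = w & t = tp m p].

Lemma ltens_lcompE M N w (x : MQ rho D (ltens M N)) :
  lcomp w x <-> add_span (fun y => exists t q, tens_lat w t /\ y = mq t q) x.
Proof.
split; apply: add_span_map => // y.
  case=> m [p [q [a [b [la lb e ->]]]]]; apply: add_span_gen.
  by exists (tp m p), q; split=> //; exists m, p, a, b.
case=> t [q [[m [p [a [b [la lb e ->]]]]] ->]]; apply: add_span_gen.
by exists m, p, q, a, b.
Qed.

Lemma ltens_lclosed M N : lclosed M -> lclosed (ltens M N).
Proof.
move=> cM; apply: (@lclosed_span _ _ _ _ _ (ltens M N) (@tens_lat M N)); first exact: ltens_lcompE.
move=> w f t [m [p [x [y [lx ly e ->]]]]]; exists (lact M f m), p, x, y.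
by rewrite lact_tp; split=> //; exact: lat_l.
Qed.

Lemma ltens_lat M N w x y (m : M) (p : N) : lat x m -> lat y p -> (x * y)%g = w ->
  @lat _ _ _ _ _ (ltens M N) w (tp m p).
Proof. by move=> lx ly e; apply: add_span_gen; exists m, p, 1, x, y. Qed.

Lemma left_fg_tens (M N : bimod R R) : left_fg M -> left_fg N -> left_fg (tbim M N).
Proof.
case=> g gP [h hP]; exists [seq tp m p | m <- g, p <- h] => t.
elim/tb_ind: t => [|x y|m p]; [exact: add_span0|exact: add_spanD|].
apply: (add_span_map (f := tp m) _ _ _ (hP p)); first exact: tp0r.
  by move=> x y; exact: tpDr.
move=> _ [a [y [yh ->]]]; rewrite -tp_mid.
apply: (add_span_map (f := fun z => tp z y) _ _ _ (gP (ract M m a))); first exact: tp0l.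
  by move=> x z; exact: tpDl.
move=> _ [b [z [zg ->]]]; rewrite -lact_tp; apply: add_span_gen.
by exists b, (tp z y); split=> //; apply: allpairs_f.
Qed.

(** The work lies in spanning, where denominators of m have to cross p, and in separation, where the
    maps of M and N at all factorizations of w are combined into a single one. *)
Lemma nice_ltens L L' L'' M N : nice L L' M -> nice L' L'' N -> nice L L'' (ltens M N).
Proof.
move=> nM nN; have gM := nice_good HD nM; have gN := nice_good HD nN.
have cT : lclosed (ltens M N) by exact: ltens_lclosed (n_cl nM).
have gen0 w (x : MQ rho D (ltens M N)) (P : Prop) : lcomp w x -> x <> 0 ->
    (forall (m : M) (p : N) a b, (a * b)%g = w -> lat a m -> lat b p -> m <> 0 -> p <> 0 -> P) -> P.
  move=> lx x0 H; apply: contrapT => nP; apply: x0.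
  apply: (add_span_ind (K := fun x => x = 0) _ _ _ lx) => // [u v -> ->|_ [m [p [q [a [b [la lb e ->]]]]]]].
    by rewrite addr0.
  have [->|m0] := pselect (m = 0); first by rewrite tp0l; exact: mq0l.
  have [->|p0] := pselect (p = 0); first by rewrite tp0r; exact: mq0l.
  by case: nP; exact: (H m p a b).
split=> //.
- exact: left_fg_tens (n_fg nM) (n_fg nN).
- exact: right_flat_tens (n_flat nM) (n_flat nN).
- move=> w f x; apply: (add_span_ind (K := fun x => ract (MQ rho D (tbim M N)) x (loc f) =
      lact (MQ rho D (tbim M N)) (act w f) x)) => [|u v Hu Hv|].
  + by rewrite ract0 lact0.
  + by rewrite ractD lactD Hu Hv.
  + move=> _ [m [p [q [a [b [la lb e ->]]]]]].
    rewrite ract_mq lact_mq mulrC -mq_ractl ract_tp lact_tp.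
    by rewrite (lat_tw gN _ lb) -tp_mid (lat_tw gM _ la) -e actRM.
- have [s Hs] := lat_fin gM; have [t Ht] := lat_fin gN.
  exists [seq (a * b)%g | a <- s, b <- t] => w x lx x0.
  apply: (gen0 w x _ lx x0) => m p a b <- la lb m0 p0.
  by apply: allpairs_f; [exact: (Hs a m) | exact: (Ht b p)].
- move=> w x lx x0; apply: (gen0 w x _ lx x0) => m p a b <- la lb m0 p0.
  have [ga La] := lat_supp gM la m0; have [gb Lb] := lat_supp gN lb p0.
  by split; [exact: genM | rewrite wactM La Lb].
- have span_r q (x : MQ rho D (tbim M N)) :
      add_span (fun x => exists w, @lcomp _ _ _ _ _ (ltens M N) w x) x ->
      add_span (fun x => exists w, @lcomp _ _ _ _ _ (ltens M N) w x)
        (ract (MQ rho D (tbim M N)) x q).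
    apply: (add_span_map (f := fun x => ract (MQ rho D (tbim M N)) x q)) => [|u v|u [w lu]].
    + exact: ract0.
    + exact: ractD.
    + by apply: add_span_gen; exists w; exact: (lcl_r cT).
  have span_den d (t : tbim M N) : den rho D d ->
      add_span (fun x => exists w, @lcomp _ _ _ _ _ (ltens M N) w x)
        (mq (ract (tbim M N) t d) 1 : MQ rho D (tbim M N)) ->
      add_span (fun x => exists w, @lcomp _ _ _ _ _ (ltens M N) w x)
        (mq t 1 : MQ rho D (tbim M N)).
    case/(den_dinv HD) => q dq /(span_r q).
    by rewrite ract_mq mul1r mq_ractl dq.
  elim/tb_ind => [|x y Hx Hy|m p]; first by rewrite mq0l; exact: add_span0.
    by rewrite mqDl; exact: add_spanD.
  have [e [de sp]] := lat_dec gN p.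
  apply: (span_den _ _ de); rewrite ract_tp.
  apply: (add_span_map (f := fun p => mq (tp m p : tbim M N) 1) _ _ _ sp).
  + by rewrite tp0r mq0l.
  + by move=> x y; rewrite tpDr mqDl.
  move=> y [b lb]; have [d [dd sm]] := lat_dec gM m.
  have [->|y0] := pselect (y = 0); first by rewrite tp0r mq0l; exact: add_span0.
  have [gb _] := lat_supp gN lb y0.
  have gi g : gens D g -> (g * g = 1)%g by exact: (gd_inv HD).
  (* Since y lies at b, (m d) (x) y = (m (x) y) (b^-1 d): the denominator of m is still a
     denominator after crossing y. *)
  apply: (span_den (act b^-1%g d)); first by apply: den_act => //; exact: (genV gi).
  rewrite ract_tp -(lat_twl gN _ lb) -tp_mid.
  apply: (add_span_map (f := fun z => mq (tp z y : tbim M N) 1) _ _ _ sm).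
  + by rewrite tp0l mq0l.
  + by move=> u v; rewrite tpDl mqDl.
  move=> z [a la]; apply: add_span_gen; exists (a * b)%g.
  exact: ltens_lat la lb erefl.
- move=> w; have [t Ht] := lat_fin gN.
  pose EM a := sval (cid (n_sep nM a)).
  pose dM a := sval (cid (svalP (cid (n_sep nM a)))).
  have HM a : _ := svalP (cid (svalP (cid (n_sep nM a)))).
  pose EN b := sval (cid (n_sep nN b)).
  pose dN b := sval (cid (svalP (cid (n_sep nN b)))).
  have HN b : _ := svalP (cid (svalP (cid (n_sep nN b)))).
  have EMl a (m : M) : lat a m -> EM a m = ract M m (dM a).
    have [_ H _] := HM a; move=> /H; rewrite fQ_mq ract_mq mul1r => e.
    by apply: (mq_inj2 (rho := rho) (D := D) (g_flat gM)); rewrite e mq_ractl mulr1.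
  have EM0 a a' (m : M) : a' <> a -> lat a' m -> EM a m = 0.
    have [_ _ H] := HM a; move=> /H{}H /H; rewrite fQ_mq.
    exact: (mq_inj (rho := rho) (D := D) (g_flat gM)).
  have ENl a (m : N) : lat a m -> EN a m = ract N m (dN a).
    have [_ H _] := HN a; move=> /H; rewrite fQ_mq ract_mq mul1r => e.
    by apply: (mq_inj2 (rho := rho) (D := D) (g_flat gN)); rewrite e mq_ractl mulr1.
  have EN0 a a' (m : N) : a' <> a -> lat a' m -> EN a m = 0.
    have [_ _ H] := HN a; move=> /H{}H /H; rewrite fQ_mq.
    exact: (mq_inj (rho := rho) (D := D) (g_flat gN)).
  have ddM a : den rho D (dM a) by case: (HM a).
  have ddN a : den rho D (dN a) by case: (HN a).
  have gi g : gens D g -> (g * g = 1)%g by exact: (gd_inv HD).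
  (* The finitely many b that can carry a nonzero lattice element of N; they belong to the group, so
     a twist by b^-1 preserves [den]. *)
  pose I := [seq b <- undup t | `[< gen (gens D) b >]].
  (* The scalar by which EM (w b^-1) (x) EN b multiplies a tensor at (w b^-1, b), the factor from M
     having crossed p. *)
  pose c b := act b^-1%g (dM (w * b^-1)%g) * dN b.
  have cd b : b \in I -> den rho D (c b).
    rewrite mem_filter => /andP[/asboolP gb _]; apply: den_mul => //.
    by apply: den_act => //; exact: (genV gi).
  (* The factors of the other indices: with them every summand of E multiplies by the same product,
     and E is one scalar on the whole component at w. *)
  pose cc b := \prod_(b' <- rem b I) c b'.
  have rmul (f : R) : @bhom_axioms R R (tbim M N) (tbim M N) (fun t => ract (tbim M N) t f).
    split=> [x y|a x|x a]; first exact: ractD.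
      exact: lractC.
    by rewrite -!ractM mulrC.
  pose Eb (b : seq_sub I) := bcomp (thom (EM (w * (ssval b)^-1)%g) (EN (ssval b)))
    (Bhom (rmul (cc (ssval b)))).
  have EbE b m p : Eb b (tp m p) = ract (tbim M N)
      (tp (EM (w * (ssval b)^-1)%g m) (EN (ssval b) p)) (cc (ssval b)).
    by rewrite /Eb bcompE thomE.
  pose E := bsum Eb.
  exists E, (\prod_(b <- I) c b); split.
  + by rewrite big_seq; apply: den_prod => b; exact: cd.
  + move=> x; apply: (add_span_ind (K := fun x => fQ rho D E x =
      ract (MQ rho D (tbim M N)) x (loc (\prod_(b <- I) c b)))) => [|u v Hu Hv|].
    * by rewrite bhom0 ract0.
    * by rewrite (bhomD (bhomP (fQ rho D E))) ractD Hu Hv.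
    move=> _ [m [p [q [a [b [la lb e ->]]]]]].
    have [->|p0] := pselect (p = 0); first by rewrite tp0r mq0l bhom0 ract0.
    rewrite fQ_mq ract_mq mulrC -mq_ractl; congr (mq _ q).
    have [gb _] := lat_supp gN lb p0.
    have bI : b \in I.
      by rewrite mem_filter mem_undup (Ht b p) // andbT; apply/asboolP.
    rewrite bsumE (bigD1 (SeqSub bI)) // big1 => [|b' bb'].
      rewrite [LHS]addr0 EbE -[ssval _]/b.
      have -> : (w * b^-1)%g = a by rewrite -e mulgK.
      rewrite EMl // ENl // tp_mid (lat_twl gN _ (lat_r _ _ lb)) //; last exact: n_cl nN.
      rewrite -!ract_tp -!ractM; congr (ract _ _ _).
      have -> : \prod_(b0 <- I) c b0 = c b * cc b by exact: big_rem.
      by rewrite /c -e mulgK -mulrA mulrCA mulrA.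
    have ne : b <> ssval b' by move=> be; case/eqP: bb'; apply: val_inj.
    by rewrite EbE (EN0 _ _ _ ne lb) tp0r ract0.
  + move=> w' x ww'; apply: (add_span_ind (K := fun x => fQ rho D E x = 0)) => [|u v Hu Hv|].
    * by rewrite bhom0.
    * by rewrite (bhomD (bhomP (fQ rho D E))) Hu Hv addr0.
    move=> _ [m [p [q [a [b [la lb e ->]]]]]].
    rewrite fQ_mq bsumE big1; first exact: mq0l.
    move=> b' _; rewrite EbE.
    have [bb'|bb'] := pselect (b = ssval b'); last first.
      by rewrite (EN0 _ _ _ bb' lb) tp0r ract0.
    rewrite (EM0 _ a) //; first by rewrite tp0l ract0.
    by move=> ae; apply: ww'; rewrite -e ae -bb' mulgVK.
Qed.

End TensorNice.

(** * The bimodules R_w and C_s *)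

Section Rh.
Variables (k : idomainType) (n : nat).
Local Notation R := (Rh k n).

Lemma Rh_ind (P : R -> Prop) :
  (forall c : k, P (c%:MP : {mpoly k[n]})) -> (forall i, P ('X_i : {mpoly k[n]})) ->
  (forall f g, P f -> P g -> P (f + g)) -> (forall f g, P f -> P g -> P (f * g)) ->
  forall f, P f.
Proof.
move=> PC PX PD PM f; rewrite [f](mpolyE (f : {mpoly k[n]})).
have P1 : P 1 by have := PC 1; rewrite mpolyC1.
apply: (big_ind P) => [||m _]; [by have := PC 0; rewrite mpolyC0|exact: PD|].
rewrite -mul_mpolyC; apply: (PM) => //; rewrite (mpolyXE_id k m).
apply: (big_ind P) => [||i _]; [exact: P1|exact: PM|].
by elim: (m i) => [|j IH]; [rewrite expr0 | rewrite exprS; apply: (PM)].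
Qed.

Lemma symv_inj : injective (@symv k n).
Proof.
move=> a b ab; apply/rowP => i.
have E (c : 'rV[k]_n) : c ord0 i = (symv c)@_U_(i)%MM.
  rewrite /symv raddf_sum (bigD1 i) //= big1 ?addr0 => [|j ji].
    by rewrite mcoeffZ mcoeffXU eqxx mulr1.
  by rewrite mcoeffZ mcoeffXU (negbTE ji) mulr0.
by rewrite !E ab.
Qed.

End Rh.

Section Rw.
Variables (W : groupType) (k : idomainType) (n : nat) (rho : rep W k n).
Local Notation R := (Rh k n).
Local Notation act := (actR rho).
Variables (D : rdatum W k n) (HD : gdatum rho D) (o : wset W) (L L' : o).
Variable w : W.
Local Notation loc := (loc_of (is_root rho D)).
Local Notation Rw := (Rw rho D w).

(** R_w (x) Z is identified with Z by m (x) z |-> w^-1(m) z, naturally in Z; the twist appears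
    because the right action goes through w. *)
Lemma Rw_flat : right_flat Rw.
Proof.
apply/right_flatP => X Y f fI t t0.
pose phi (Z : lmodType R) (g : Rw) (z : lmod_bim Z) : Z := act w^-1%g (g : R) *: (z : Z).
have bal (Z : lmodType R) : balanced (ract Rw) (lact (lmod_bim Z)) (@phi Z).
  split=> [m m' z|m z z'|m b z].
  - by rewrite /phi rmorphD scalerDl.
  - exact: scalerDr.
  - transitivity ((act w^-1%g (m : R) * b) *: (z : Z)); last by rewrite -scalerA.
    congr (_ *: _); rewrite -[ract Rw m b]/(act w b * (m : R)) [LHS]rmorphM mulrC.
    by congr (_ * _); exact: actRK.
have tE (Z : lmodType R) (u : tbim Rw (lmod_bim Z)) :
    u = tp (1 : Rw) (tlift (@phi Z) u : lmod_bim Z).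
  elim/tb_ind: u => [|x y Hx Hy|m z].
  - by rewrite (additive0 (f := tlift (@phi Z))) ?tp0r // => x y; exact: tliftD.
  - by rewrite tliftD // tpDr -Hx -Hy.
  - rewrite tlift_pure // /phi -[_ *: z]/(lact (lmod_bim Z) _ z) -tp_mid; congr (tp _ z).
    by rewrite /= actRVK mulr1.
have E (u : tbim Rw (lmod_bim X)) : tlift (@phi Y) (thom (bid Rw) (lmod_hom f) u)
    = f (tlift (@phi X) u).
  elim/tb_ind: u => [|x y Hx Hy|m z].
  - rewrite bhom0 !(additive0 (f := tlift _)) ?linear0 // => x y; exact: tliftD.
  - by rewrite (bhomD (bhomP (thom _ _))) !tliftD // linearD Hx Hy.
  - by rewrite thomE !tlift_pure // /phi linearZ.
rewrite [t]tE; suff -> : tlift (@phi X) t = 0 by rewrite tp0r.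
apply: fI; rewrite -E t0 linear0; apply: additive0 => x y; exact: tliftD.
Qed.

Hypotheses (gw : gen (gens D) w) (Lw : wact L w = L').

Lemma Rw_lat x (f : Rw) : lat x f -> x = w \/ f = 0.
Proof. by case=> [->|/(mq_inj Rw_flat)]; [left | right]. Qed.

Lemma Rw_nice : nice L L' Rw.
Proof.
have tw f (x : MQ rho D Rw) : ract (MQ rho D Rw) x (loc f) = lact (MQ rho D Rw) (act w f) x.
  elim/MQ_ind: x => [|x y Hx Hy|m q]; first by rewrite ract0 lact0.
    by rewrite ractD lactD Hx Hy.
  by rewrite ract_mq lact_mq mulrC -mq_ractl.
split.
- exists [:: 1 : Rw] => m; apply: add_span_gen; exists m, 1.
  by rewrite inE eqxx /= mulr1.
- exact: Rw_flat.
- split=> [x|x f p|x q p].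
  + split=> [|p q]; first by right.
    by case=> [->|->]; [left | case=> [->|->]; [left | right; rewrite subr0]].
  + by case=> [->|->]; [left | right; rewrite lact0].
  + by case=> [->|->]; [left | right; rewrite ract0].
- by move=> x f p [->|->]; [exact: tw | rewrite ract0 lact0].
- by exists [:: w] => x p [->|//]; rewrite inE eqxx.
- by move=> x p [->|//].
- by move=> m; apply: add_span_gen; exists w; left.
- move=> x; have [->|xw] := pselect (x = w).
    exists (bid Rw), 1; split; first exact: den1.
      by move=> p _; rewrite fQ_id loc_of1 ract1.
    by move=> w' p w'w [//|->]; rewrite bhom0.
  exists (bzero Rw Rw), 1; split; first exact: den1.
    by move=> p [//|->]; rewrite bhom0 ract0.
  by move=> w' p _ _; apply: fQ_zero.
Qed.

End Rw.

Section Cs.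
Variables (W : groupType) (k : idomainType) (n : nat) (rho : rep W k n).
Local Notation R := (Rh k n).
Local Notation act := (actR rho).
Variables (s : W).
Local Notation C := (Cs_bim rho s).
Local Notation cst := (@cs_tp W k n rho s).

Let rs (g : R) (f : Rs rho s) : R := g * sval f.
Let ls (f : Rs rho s) (g : R) : R := sval f * g.
Lemma cstDl f f' g : cst (f + f') g = cst f g + cst f' g.
Proof. by have [H _ _] := tpure_balanced rs ls; exact: H. Qed.
Lemma cstDr f g g' : cst f (g + g') = cst f g + cst f g'.
Proof. by have [_ H _] := tpure_balanced rs ls; exact: H. Qed.
Lemma cst_mid f c g : act s c = c -> cst (f * c) g = cst f (c * g).
Proof.
by move=> sc; have [_ _ H] := tpure_balanced rs ls; exact: (H f (exist _ c sc) g).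
Qed.
Lemma cst0l g : cst 0 g = 0. Proof. by apply: (addrI (cst 0 g)); rewrite -cstDl !addr0. Qed.
Lemma cst0r f : cst f 0 = 0. Proof. by apply: (addrI (cst f 0)); rewrite -cstDr !addr0. Qed.
Lemma cstNr f g : cst f (- g) = - cst f g.
Proof. by apply: (addrI (cst f g)); rewrite -cstDr !subrr cst0r. Qed.
Lemma cstNl f g : cst (- f) g = - cst f g.
Proof. by apply: (addrI (cst f g)); rewrite -cstDl !subrr cst0l. Qed.
Lemma lact_cst a f g : lact C a (cst f g) = cst (a * f) g.
Proof. by apply: tmap_pure => *; rewrite ?mulrDr ?mulrA. Qed.
Lemma ract_cst a f g : ract C (cst f g) a = cst f (g * a).
Proof. by apply: tmap_pure => *; rewrite ?mulrDl ?mulrA. Qed.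

Lemma cs_ind (P : C -> Prop) :
  P 0 -> (forall x y, P x -> P y -> P (x + y)) -> (forall f g, P (cst f g)) ->
  forall t, P t.
Proof.
move=> P0 PD Pp t; rewrite [t]tens_repr; elim: (repr t) => [|x r IH].
  by rewrite big_nil.
by rewrite big_cons; apply: PD => //; exact: Pp.
Qed.

Definition cs_bal (G : zmodType) (phi : R -> R -> G) : Prop :=
  [/\ forall f f' g, phi (f + f') g = phi f g + phi f' g,
      forall f g g', phi f (g + g') = phi f g + phi f g'
    & forall f c g, act s c = c -> phi (f * c) g = phi f (c * g)].

Lemma cs_lift (G : zmodType) (phi : R -> R -> G) : cs_bal phi ->
  exists F : C -> G, (forall x y, F (x + y) = F x + F y) /\
    (forall f g, F (cst f g) = phi f g).
Proof.
case=> p1 p2 p3.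
have hb : balanced (fun (g : R) (f : Rs rho s) => g * sval f) (fun f g => sval f * g) phi.
  by split=> // f [c cs] g /=; exact: p3.
exists (tlift phi); split=> [x y|f g]; [exact: tliftD | exact: tlift_pure].
Qed.

(** The image of 1 (x) 1 is y: the only relation on that generator is commutation with the
    s-invariants. *)
Lemma cs_hom (M : bimod R R) (y : M) :
  (forall c, act s c = c -> lact M c y = ract M y c) ->
  exists E : bhom C M, forall f g, E (cst f g) = lact M f (ract M y g).
Proof.
move=> yc.
have bal : cs_bal (fun f g => lact M f (ract M y g)).
  split=> [f f' g|f g g'|f c g cc]; first exact: lact_Dl.
    by rewrite ract_Dr lactD.
  by rewrite lactM -lractC yc // -ractM.
have [F [FD FE]] := cs_lift bal.
have F0 : F 0 = 0 by exact: additive0.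
suff A : @bhom_axioms R R C M F by exists (Bhom A).
split=> // [a|] t.
- elim/cs_ind: t => [|x z Hx Hz|f g]; first by rewrite lact0 F0 lact0.
    by rewrite lactD !FD Hx Hz lactD.
  by rewrite lact_cst !FE lactM.
- move=> c; elim/cs_ind: t => [|x z Hx Hz|f g]; first by rewrite ract0 F0 ract0.
    by rewrite ractD !FD Hx Hz ractD.
  by rewrite ract_cst !FE ractM lractC.
Qed.

Variables (D : rdatum W k n) (HD : gdatum rho D) (Ds : gens D s).
Local Notation al := (symv (root D s) : R).

Lemma rhoV_s : rho s^-1%g = rho s.
Proof. by rewrite (invol_inv (gd_inv HD)). Qed.

Lemma act_s_symv a : act s (symv a) = symv a - (pairing (coroot D s) a) *: symv (root D s).
Proof.
rewrite actR_symv /actV rhoV_s (gd_rho HD Ds) mulmxBr mulmx1 mulmxA.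
rewrite (mx11_scalar (a *m coroot D s)) mul_scalar_mx symvD -scaleN1r.
by rewrite !symvZ scaleN1r.
Qed.

Lemma act_s_s f : act s (act s f) = f.
Proof. by rewrite -actRM (gd_inv HD Ds) actR1. Qed.

Lemma al_neq0 : al != 0.
Proof.
have [v va] := gd_rootP HD Ds; apply/eqP => a0.
have r0 : root D s = 0.
  by apply: symv_inj; rewrite a0 /symv big1 // => i _; rewrite mxE scale0r.
by move: va; rewrite /pairing r0 mul0mx mxE => /esym/eqP; rewrite oner_eq0.
Qed.

Lemma act_s_al : act s al = - al.
Proof.
rewrite act_s_symv (gd_pair HD Ds) scaler_nat mulr2n opprD addrA subrr.
by rewrite sub0r.
Qed.

Lemma den_al : den rho D al.
Proof.
by have := den_root rho (gen1 (gens D)) Ds; rewrite actV1.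
Qed.

(** Divisibility holds for linear forms by the reflection formula and extends by the twisted Leibniz
    rule; the quotient is the Demazure operator. *)
Lemma dem_ex f : exists g, f - act s f = al * g.
Proof.
elim/Rh_ind: f => [c|i|f g [u fu] [v gv]|f g [u fu] [v gv]].
- by exists 0; rewrite actR_const subrr mulr0.
- exists ((pairing (coroot D s) (delta_mx ord0 i))%:MP : {mpoly k[n]}).
  have -> : ('X_i : {mpoly k[n]}) = symv (delta_mx ord0 i) by rewrite symv_delta.
  by rewrite act_s_symv opprB addrC subrK mulrC -mul_mpolyC.
- by exists (u + v); rewrite actR_D mulrDr -fu -gv opprD addrACA.
- exists (u * g + act s f * v); rewrite actR_M.
  transitivity ((f - act s f) * g + act s f * (g - act s g)); first by ring.
  by rewrite fu gv; ring.
Qed.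

Definition dem (f : R) : R := sval (cid (dem_ex f)).
Lemma demE f : al * dem f = f - act s f.
Proof. by rewrite (svalP (cid (dem_ex f))). Qed.
Lemma act_sE f : act s f = f - al * dem f.
Proof. by rewrite demE opprB addrC subrK. Qed.
Lemma dem_uniq f g : f - act s f = al * g -> dem f = g.
Proof. by move=> H; apply: (mulfI al_neq0); rewrite demE. Qed.
Lemma demD f g : dem (f + g) = dem f + dem g.
Proof. by apply: dem_uniq; rewrite mulrDr !demE actR_D opprD addrACA. Qed.
Lemma demM f g : dem (f * g) = dem f * g + act s f * dem g.
Proof.
apply: dem_uniq; rewrite actR_M.
transitivity ((f - act s f) * g + act s f * (g - act s g)); first by ring.
by rewrite -!demE; ring.
Qed.
Lemma dem_inv c : act s c = c -> dem c = 0.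
Proof. by move=> sc; apply: dem_uniq; rewrite sc subrr mulr0. Qed.
Lemma demMl c g : act s c = c -> dem (c * g) = c * dem g.
Proof. by move=> sc; rewrite demM dem_inv // mul0r add0r sc. Qed.
Lemma act_dem f : act s (dem f) = dem f.
Proof.
apply: (mulfI al_neq0); rewrite demE -[al]opprK -act_s_al mulNr -actR_M demE.
by rewrite actR_B act_s_s opprB.
Qed.

Variable a : 'rV[k]_n.
Hypothesis ca : pairing (coroot D s) a = 1.
Local Notation de := (symv a : R).

Lemma act_s_de : act s de = de - al.
Proof. by rewrite act_s_symv ca scale1r. Qed.
Lemma dem_de : dem de = 1.
Proof. by apply: dem_uniq; rewrite act_s_de mulr1 opprB addrC subrK. Qed.

(** R is free over the s-invariants on 1 and delta, and the coordinates of f are [und f] and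
    [dem f]. *)
Definition und (f : R) : R := f - de * dem f.
Lemma act_und f : act s (und f) = und f.
Proof.
rewrite /und actR_B actR_M act_dem act_s_de mulrBl demE act_sE demE.
ring.
Qed.
Lemma undE f : f = und f + de * dem f. Proof. by rewrite /und subrK. Qed.
Lemma undD f g : und (f + g) = und f + und g.
Proof. by rewrite /und demD mulrDr opprD addrACA. Qed.
Lemma undMl c g : act s c = c -> und (c * g) = c * und g.
Proof. by move=> sc; rewrite /und demMl // mulrCA -mulrBr. Qed.

Lemma cst_splitl f g : cst f g = cst (f * und g) 1 + cst (f * dem g) de.
Proof.
rewrite {1}[g]undE cstDr -{1}[und g]mulr1 -cst_mid ?act_und //.
by rewrite [de * _]mulrC -cst_mid ?act_dem.
Qed.
Lemma cst_splitr f g : cst f g = cst 1 (und f * g) + cst de (dem f * g).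
Proof.
rewrite {1}[f]undE cstDl -{1}[und f]mul1r cst_mid ?act_und //.
by rewrite cst_mid ?act_dem.
Qed.

(** C_s is free as a left module on 1 (x) 1 and 1 (x) delta; [cs_coordr] concerns the right basis 1
    (x) 1, delta (x) 1. The former serves to test equalities and to bound generators, the latter to
    prove flatness and spanning. *)
Lemma cs_coordl : exists cA cB : C -> R,
  [/\ forall x y, cA (x + y) = cA x + cA y, forall x y, cB (x + y) = cB x + cB y,
      forall f g, cA (cst f g) = f * und g, forall f g, cB (cst f g) = f * dem g
    & forall t, t = cst (cA t) 1 + cst (cB t) de].
Proof.
have [cA [AD AE]] : exists cA : C -> R, (forall x y, cA (x + y) = cA x + cA y) /\
    (forall f g, cA (cst f g) = f * und g).
  apply: cs_lift; split=> [f f' g|f g g'|f c g cc]; first by rewrite mulrDl.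
    by rewrite undD mulrDr.
  by rewrite undMl // mulrA.
have [cB [BD BE]] : exists cB : C -> R, (forall x y, cB (x + y) = cB x + cB y) /\
    (forall f g, cB (cst f g) = f * dem g).
  apply: cs_lift; split=> [f f' g|f g g'|f c g cc]; first by rewrite mulrDl.
    by rewrite demD mulrDr.
  by rewrite demMl // mulrA.
exists cA, cB; split=> // t; elim/cs_ind: t => [|x y Hx Hy|f g].
- by rewrite (additive0 AD) (additive0 BD) !cst0l addr0.
- by rewrite AD BD !cstDl addrACA -Hx -Hy.
- by rewrite AE BE; exact: cst_splitl.
Qed.

Lemma cs_coordr : exists cA cB : C -> R,
  [/\ forall x y, cA (x + y) = cA x + cA y, forall x y, cB (x + y) = cB x + cB y,
      forall f g, cA (cst f g) = und f * g, forall f g, cB (cst f g) = dem f * g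
    & forall t, t = cst 1 (cA t) + cst de (cB t)].
Proof.
have [cA [AD AE]] : exists cA : C -> R, (forall x y, cA (x + y) = cA x + cA y) /\
    (forall f g, cA (cst f g) = und f * g).
  apply: cs_lift; split=> [f f' g|f g g'|f c g cc]; first by rewrite undD mulrDl.
    by rewrite mulrDr.
  by rewrite (mulrC f c) undMl // -mulrA mulrCA.
have [cB [BD BE]] : exists cB : C -> R, (forall x y, cB (x + y) = cB x + cB y) /\
    (forall f g, cB (cst f g) = dem f * g).
  apply: cs_lift; split=> [f f' g|f g g'|f c g cc]; first by rewrite demD mulrDl.
    by rewrite mulrDr.
  by rewrite (mulrC f c) demMl // -mulrA mulrCA.
exists cA, cB; split=> // t; elim/cs_ind: t => [|x y Hx Hy|f g].
- by rewrite (additive0 AD) (additive0 BD) !cst0r addr0.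
- by rewrite AD BD !cstDr addrACA -Hx -Hy.
- by rewrite AE BE; exact: cst_splitr.
Qed.

Definition cs1 : C := cst de 1 - cst 1 (act s de).
Definition css : C := cst de 1 - cst 1 de.

Lemma lact_cs1 f : lact C f cs1 = cst (f * de) 1 - cst f (act s de).
Proof. by rewrite /cs1 lactD lactN !lact_cst mulr1. Qed.
Lemma lact_css f : lact C f css = cst (f * de) 1 - cst f de.
Proof. by rewrite /css lactD lactN !lact_cst mulr1. Qed.

Lemma cs_eq (t u : C) : (forall cA cB : C -> R,
   (forall x y, cA (x + y) = cA x + cA y) -> (forall x y, cB (x + y) = cB x + cB y) ->
   (forall f g, cA (cst f g) = f * und g) -> (forall f g, cB (cst f g) = f * dem g) ->
   cA t = cA u /\ cB t = cB u) -> t = u.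
Proof.
move=> H; have [cA [cB [AD BD AE BE tE]]] := cs_coordl.
by have [eA eB] := H cA cB AD BD AE BE; rewrite [t]tE [u]tE eA eB.
Qed.

Lemma additiveB (G G' : zmodType) (F : G -> G') (FD : forall x y, F (x + y) = F x + F y)
  x y : F (x - y) = F x - F y.
Proof.
have F0 : F 0 = 0 by apply: (addrI (F 0)); rewrite -FD !addr0.
have FN z : F (- z) = - F z by apply: (addrI (F z)); rewrite -FD !subrr.
by rewrite FD FN.
Qed.

(** Compared in the left basis, where the Leibniz rule reduces the claim to a polynomial
    identity. *)
Lemma cs1_comm f : lact C f cs1 = ract C cs1 f.
Proof.
rewrite /cs1 lactD lactN ractD ractN !lact_cst !ract_cst !mulr1 !mul1r.
apply: cs_eq => cA cB AD BD AE BE; rewrite !(additiveB AD) !(additiveB BD) !AE !BE.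
have d1 : dem 1 = 0 by apply: dem_inv; rewrite actR_1.
have ds : dem (act s de) = -1.
  apply: dem_uniq; rewrite act_s_s mulrN1 act_s_de; ring.
rewrite /und !demM act_s_s d1 ds; split; ring.
Qed.

Lemma css_comm f : lact C (act s f) css = ract C css f.
Proof.
rewrite /css lactD lactN ractD ractN !lact_cst !ract_cst !mulr1 !mul1r.
apply: cs_eq => cA cB AD BD AE BE; rewrite !(additiveB AD) !(additiveB BD) !AE !BE.
have d1 : dem 1 = 0 by apply: dem_inv; rewrite actR_1.
rewrite /und !demM dem_de d1 act_s_de act_sE; split; ring.
Qed.

(** By the right basis, C_s (x) Z is naturally the sum of two copies of Z. *)
Lemma cs_flat : right_flat C.
Proof.
have [cA [cB [AD BD AE BE tE]]] := cs_coordr.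
have cr (F : C -> R) (h : R -> R) : (forall x y, F (x + y) = F x + F y) ->
    (forall f g, F (cst f g) = h f * g) -> forall t c, F (ract C t c) = F t * c.
  move=> FD FE t c; have F0 := additive0 FD.
  elim/cs_ind: t => [|x y Hx Hy|f g]; first by rewrite ract0 F0 mul0r.
    by rewrite ractD !FD Hx Hy mulrDl.
  by rewrite ract_cst !FE mulrA.
apply/right_flatP => X Y f fI t t0.
pose phi (F : C -> R) (Z : lmodType R) (g : C) (z : lmod_bim Z) : Z := F g *: (z : Z).
have bal (F : C -> R) (Z : lmodType R) : (forall x y, F (x + y) = F x + F y) ->
    (forall t c, F (ract C t c) = F t * c) ->
    balanced (ract C) (lact (lmod_bim Z)) (@phi F Z).
  move=> FD Fr; split=> [m m' z|m z z'|m b z].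
  - by rewrite /phi FD scalerDl.
  - exact: scalerDr.
  - by rewrite /phi Fr -scalerA.
have balA Z := bal cA Z AD (cr cA und AD AE).
have balB Z := bal cB Z BD (cr cB dem BD BE).
have uE (u : tbim C (lmod_bim X)) : u = tp (cst 1 1) (tlift (@phi cA X) u : lmod_bim X)
    + tp (cst de 1) (tlift (@phi cB X) u : lmod_bim X).
  elim/tb_ind: u => [|x y Hx Hy|m z].
  - rewrite !(additive0 (f := tlift _)) ?tp0r ?addr0 // => x y; exact: tliftD.
  - by rewrite !tliftD // !tpDr [RHS]addrACA -Hx -Hy.
  - rewrite !tlift_pure // /phi {1}[m]tE tpDl.
    by congr (_ + _); rewrite -[_ *: z]/(lact (lmod_bim X) _ z) -tp_mid ract_cst mul1r.
have fE (F : C -> R) (balF : forall Z, balanced (ract C) (lact (lmod_bim Z)) (@phi F Z))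
    (u : tbim C (lmod_bim X)) :
    tlift (@phi F Y) (thom (bid C) (lmod_hom f) u) = f (tlift (@phi F X) u).
  elim/tb_ind: u => [|x y Hx Hy|m z].
  - rewrite bhom0 !(additive0 (f := tlift _)) ?linear0 // => x y; exact: tliftD.
  - by rewrite (bhomD (bhomP (thom _ _))) !tliftD // linearD Hx Hy.
  - by rewrite thomE !tlift_pure // /phi linearZ.
have z (F : C -> R) (balF : forall Z, balanced (ract C) (lact (lmod_bim Z)) (@phi F Z)) :
    tlift (@phi F X) t = 0.
  apply: fI; rewrite -fE // t0 linear0; apply: additive0 => x y; exact: tliftD.
by rewrite [t]uE !z // !tp0r addr0.
Qed.

End Cs.

Section CsNice.
Variables (W : groupType) (k : idomainType) (n : nat) (rho : rep W k n).
Local Notation R := (Rh k n).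
Local Notation act := (actR rho).
Variables (D : rdatum W k n) (HD : gdatum rho D) (o : wset W).
Variables (s : W) (Ds : gens D s) (L : o) (Ls : wact L s = L).
Local Notation loc := (loc_of (is_root rho D)).
Local Notation C := (Cs rho D s).
Local Notation cst := (@cs_tp W k n rho s).
Variable a : 'rV[k]_n.
Hypothesis ca : pairing (coroot D s) a = 1.
Local Notation de := (symv a : R).
Local Notation al := (symv (root D s) : R).
Local Notation cs1a := (cs1 rho s a).
Local Notation cssa := (css rho s a).

(** Two choices of delta differ by an s-invariant linear form, which passes through the tensor and
    cancels. *)
Lemma cs_indep (b : 'rV[k]_n) : pairing (coroot D s) b = 1 ->
  cs1 rho s b = cs1a /\ css rho s b = cssa.
Proof.
move=> cb; pose la := symv (b - a) : R.
have bE : symv b = la + de :> R by rewrite /la -symvD subrK.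
have sla : act s la = la.
  have p0 : pairing (coroot D s) (b - a) = pairing (coroot D s) b - pairing (coroot D s) a.
    by rewrite /pairing mulmxBl !mxE.
  by rewrite /la (act_s_symv HD Ds) p0 cb ca subrr scale0r subr0.
have E : cst la 1 = cst 1 la by rewrite -{1}[la]mul1r cst_mid // mulr1.
rewrite /cs1 /css bE actR_D sla !cstDl !cstDr E !opprD.
by split; rewrite addrACA subrr add0r.
Qed.

Lemma cs_lcompE w (x : MQ rho D C) :
  lcomp w x <-> [\/ x = 0, w = 1%g /\ exists q, x = mq cs1a q
                | w = s /\ exists q, x = mq cssa q].
Proof.
split=> [[->|[-> [b [q [cb ->]]]]|[-> [b [q [cb ->]]]]]|[->|[-> [q ->]]|[-> [q ->]]]].
- by constructor 1.
- constructor 2; split=> //; exists q; rewrite -actR_symv.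
  by have [<- _] := cs_indep cb.
- constructor 3; split=> //; exists q.
  by have [_ <-] := cs_indep cb.
- by constructor 1.
- by constructor 2; split=> //; exists a, q; split=> //; rewrite -actR_symv.
- by constructor 3; split=> //; exists a, q.
Qed.

Let s1 : s <> 1%g. Proof. by have [] := gd_ord HD Ds. Qed.

Lemma cs_lcomp1 (x : MQ rho D C) : lcomp 1%g x <-> exists q, x = mq cs1a q.
Proof.
rewrite cs_lcompE; split=> [[->|[_ //]|[/esym//]]|[q ->]].
  by exists 0; rewrite mq0r.
by constructor 2; split=> //; exists q.
Qed.
Lemma cs_lcomps (x : MQ rho D C) : lcomp s x <-> exists q, x = mq cssa q.
Proof.
rewrite cs_lcompE; split=> [[->|[/s1//]|[_ //]]|[q ->]].
  by exists 0; rewrite mq0r.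
by constructor 3; split=> //; exists q.
Qed.
Lemma cs_lcomp0 w (x : MQ rho D C) : w <> 1%g -> w <> s -> lcomp w x -> x = 0.
Proof. by move=> w1 ws /cs_lcompE[//|[/w1//]|[/ws//]]. Qed.

Lemma cs_lclosed : lclosed C.
Proof.
have K w : (w = 1%g \/ w = s) \/ w <> 1%g /\ w <> s.
  have [->|w1] := pselect (w = 1%g); first by left; left.
  by have [->|ws] := pselect (w = s); [left; right | right].
split=> [w|w f x|w q x]; case: (K w) => [[->|->]|[w1 ws]]; rewrite ?cs_lcomp1 ?cs_lcomps.
- split; first by exists 0; rewrite mq0r.
  move=> x y; rewrite !cs_lcomp1 => -[p ->] [q ->].
  by exists (p - q); rewrite mqDr mqNr.
- split; first by exists 0; rewrite mq0r.
  move=> x y; rewrite !cs_lcomps => -[p ->] [q ->].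
  by exists (p - q); rewrite mqDr mqNr.
- split; first by constructor 1.
  by move=> x y /(cs_lcomp0 w1 ws)-> /(cs_lcomp0 w1 ws)->; rewrite subr0; constructor 1.
- case=> q ->; exists (loc f * q); rewrite lact_mq (cs1_comm HD Ds ca).
  exact: mq_ractl.
- case=> q ->; exists (loc (act s f) * q); rewrite lact_mq.
  by rewrite -{1}[f](act_s_s HD Ds) (css_comm HD Ds ca) mq_ractl.
- by move=> /(cs_lcomp0 w1 ws)->; rewrite lact0; constructor 1.
- by case=> p ->; exists (p * q); rewrite ract_mq.
- by case=> p ->; exists (p * q); rewrite ract_mq.
- by move=> /(cs_lcomp0 w1 ws)->; rewrite ract0; constructor 1.
Qed.

(** Once alpha is inverted, 1 (x) 1 is a combination of the generators of the two components, whence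
    these span. *)
Lemma cs_alE : ract C (cst 1 1) al = cs1a - cssa.
Proof.
rewrite [LHS]ract_cst mul1r /cs1 /css opprB addrC addrA subrK.
by rewrite (act_s_de HD Ds ca) cstDr cstNr opprD opprK addrA subrr add0r.
Qed.

Lemma cs_nice : nice L L C.
Proof.
have cC := cs_lclosed; have [dual daul] := (den_al rho Ds, den_al rho Ds).
split=> //.
- exists [:: cst 1 1; cst 1 de] => m.
  have [cA [cB [_ _ _ _ tE]]] := cs_coordl HD Ds ca; rewrite [m]tE.
  apply: add_spanD; apply: add_span_gen.
    exists (cA m), (cst 1 1); rewrite inE eqxx; split=> //.
    by rewrite [RHS]lact_cst mulr1.
  exists (cB m), (cst 1 de); rewrite !inE eqxx orbT; split=> //.
  by rewrite [RHS]lact_cst mulr1.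
- exact: (cs_flat HD Ds ca).
- move=> w f x /cs_lcompE[->|[-> [q ->]]|[-> [q ->]]].
  + by rewrite ract0 lact0.
  + by rewrite ract_mq lact_mq actR1 (cs1_comm HD Ds ca) mq_ractl mulrC.
  + by rewrite ract_mq lact_mq (css_comm HD Ds ca) mq_ractl mulrC.
- exists [:: 1%g; s] => w x /cs_lcompE[//|[-> _]|[-> _]] _; rewrite !inE eqxx ?orbT //.
- move=> w x /cs_lcompE[//|[-> _]|[-> _]] _.
    by split; [exact: gen1 | rewrite wact1].
  by split; [exact: gen_in |].
- move=> m; pose P (x : MQ rho D C) := add_span (fun x => exists w, lcomp w x) x.
  have Pr x q : P x -> P (ract (MQ rho D C) x q).
    apply: (add_span_map (f := fun x => ract (MQ rho D C) x q)) => [|u v|u [w lu]].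
    + exact: ract0.
    + exact: ractD.
    + by apply: add_span_gen; exists w; exact: (lcl_r cC).
  have P1 : P (mq cs1a 1) by apply: add_span_gen; exists 1%g; apply/cs_lcomp1; exists 1.
  have Ps : P (mq cssa 1) by apply: add_span_gen; exists s; apply/cs_lcomps; exists 1.
  have P11 : P (mq (cst 1 1 : C) 1).
    have [q aq] := den_dinv HD dual; have -> : mq (cst 1 1 : C) 1 =
        ract (MQ rho D C) (mq cs1a 1) q + ract (MQ rho D C) (mq cssa 1) (- q).
      rewrite !ract_mq !mul1r mqNr -mqNl -mqDl -cs_alE mq_ractl aq.
      by [].
    by apply: add_spanD; exact: Pr.
  have Pd : P (mq (cst de 1 : C) 1).
    have -> : cst de 1 = cs1a + ract C (cst 1 1) (act s de).
      by rewrite /cs1 [ract _ _ _]ract_cst mul1r subrK.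
    rewrite mqDl mq_ractl mulr1; apply: add_spanD => //.
    by rewrite -[loc _]mul1r -ract_mq; exact: Pr.
  have [cA [cB [_ _ _ _ tE]]] := cs_coordr HD Ds ca; rewrite [m]tE.
  have E f g : cst f g = ract C (cst f 1) g by rewrite [RHS]ract_cst mul1r.
  rewrite [cst 1 _]E [cst de _]E mqDl !mq_ractl !mulr1; apply: add_spanD.
    by rewrite -[loc _]mul1r -ract_mq; exact: Pr.
  by rewrite -[loc _]mul1r -ract_mq; exact: Pr.
(* Sending 1 (x) 1 to the generator at e gives a map that is alpha on the component at e and zero on
   the one at s; with the generator at s the roles are exchanged and the scalar is -alpha. *)
- have [E1 E1E] := cs_hom (fun c (_ : act s c = c) => cs1_comm HD Ds ca c).
  have ssc c : act s c = c -> lact C c cssa = ract C cssa c.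
    by move=> sc; rewrite -{1}sc; exact: (css_comm HD Ds ca).
  have [Es EsE] := cs_hom ssc.
  have E11 : E1 cs1a = ract C cs1a al.
    rewrite {1}/cs1 bhomB !E1E lact1 ract1 (cs1_comm HD Ds ca) -ract_Nr -ract_Dr.
    by rewrite (act_s_de HD Ds ca) opprB addrC subrK.
  have E1s : E1 cssa = 0.
    by rewrite {1}/css bhomB !E1E lact1 ract1 (cs1_comm HD Ds ca) subrr.
  have deE : lact C de cssa = ract C cssa (act s de).
    by rewrite -(css_comm HD Ds ca) (act_s_s HD Ds).
  have Es1 : Es cs1a = 0.
    by rewrite {1}/cs1 bhomB !EsE lact1 ract1 [X in X - _]deE subrr.
  have Ess : Es cssa = ract C cssa (- al).
    rewrite {1}/css bhomB !EsE lact1 ract1 [X in X - _]deE -ract_Nr -ract_Dr.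
    by rewrite (act_s_de HD Ds ca) addrAC subrr sub0r.
  have dal : den rho D (- al).
    have := den_mul (den_const rho D (c := -1) _) dual.
    by rewrite mpolyCN mpolyC1 mulN1r; apply; rewrite unitrN unitr1.
  move=> w; have [->|w1] := pselect (w = 1%g).
    exists E1, al; split=> //.
      by move=> x /cs_lcomp1[q ->]; rewrite fQ_mq E11 ract_mq mq_ractl mulrC.
    move=> w' x w1 /cs_lcompE[->|[/w1//]|[_ [q ->]]]; first by rewrite bhom0.
    by rewrite fQ_mq E1s; exact: mq0l.
  have [->|ws] := pselect (w = s).
    exists Es, (- al); split=> //.
      by move=> x /cs_lcomps[q ->]; rewrite fQ_mq Ess ract_mq mq_ractl mulrC.
    move=> w' x ws /cs_lcompE[->|[_ [q ->]]|[/ws//]]; first by rewrite bhom0.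
    by rewrite fQ_mq Es1; exact: mq0l.
  exists (bzero C C), 1; split; first exact: den1.
    by move=> x /(cs_lcomp0 w1 ws)->; rewrite bhom0 ract0.
  by move=> w' x _ _; apply: fQ_zero.
Qed.

Lemma cs_lat1 : @lat _ _ _ _ _ C 1%g cs1a.
Proof. by apply/cs_lcomp1; exists 1. Qed.
Lemma cs_lats : @lat _ _ _ _ _ C s cssa.
Proof. by apply/cs_lcomps; exists 1. Qed.

Lemma cs_lat_frac w (m : C) : lat w m -> exists d f, den rho D d /\
  [\/ ract C m d = 0, w = 1%g /\ ract C m d = ract C cs1a f
    | w = s /\ ract C m d = ract C cssa f].
Proof.
have flat := cs_flat HD Ds ca.
move=> /cs_lcompE[/(mq_inj flat)->|[-> [q e]]|[-> [q e]]].
- by exists 1, 0; split; [exact: den1 | constructor 1; exact: ract0].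
- have [d [f [dd df]]] := Q_frac q; exists d, f; split=> //; constructor 2; split=> //.
  apply: (mq_inj2 (rho := rho) (D := D) flat).
  by rewrite mq_ractl mulr1 -[loc d]mul1r -ract_mq e ract_mq mulrC df mq_ractl mulr1.
- have [d [f [dd df]]] := Q_frac q; exists d, f; split=> //; constructor 3; split=> //.
  apply: (mq_inj2 (rho := rho) (D := D) flat).
  by rewrite mq_ractl mulr1 -[loc d]mul1r -ract_mq e ract_mq mulrC df mq_ractl mulr1.
Qed.

End CsNice.

(** * Bott-Samelson bimodules *)

Section BwNice.
Variables (W : groupType) (k : idomainType) (n : nat) (rho : rep W k n).
Variables (D : rdatum W k n) (HD : gdatum rho D) (o : wset W).

Lemma Bs_nice (L : o) s : gens D s -> nice L (wact L s) (Bs rho D L s).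
Proof.
move=> Ds; rewrite /Bs; case: eqP => [e|_]; last by apply: Rw_nice => //; exact: gen_in.
have [a ca] := gd_corootP HD Ds.
by rewrite e; exact: (cs_nice HD Ds e ca).
Qed.

Lemma Bw_nice (L : o) u : in_exp (gens D) u -> nice L (wactw L u) (Bw rho D L u).
Proof.
elim: u L => [|s u IH] L uS /=.
  by apply: Rw_nice; [exact: gen1 | rewrite wact1].
have Ds : gens D s by apply: uS; rewrite inE eqxx.
have uS' : in_exp (gens D) u by move=> t tu; apply: uS; rewrite inE tu orbT.
case: u uS' IH uS => [|t u] uS' IH uS; first exact: Bs_nice.
by apply: (nice_ltens HD (Bs_nice L Ds)); exact: IH.
Qed.

Lemma Bw_good (L : o) u : in_exp (gens D) u -> good L (wactw L u) (Bw rho D L u).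
Proof. by move=> uS; apply: nice_good => //; exact: Bw_nice. Qed.

End BwNice.

(** * Torsion in flat bimodules *)

Section Torsion.
Variables (k : idomainType) (n : nat).
Local Notation R := (Rh k n).

(** Flatness is applied to multiplication by d on R, which is injective as R is a domain. *)
Lemma flat_torsion_free (M : bimod R R) (m : M) (d : R) :
  right_flat M -> d != 0 -> ract M m d = 0 -> m = 0.
Proof.
move=> flatM d0 md.
pose X : lmodType R := R^o.
pose fd (x : X) : X := (d : R) * (x : R).
have fl : linear fd.
  by move=> a x y; rewrite /fd mulrDr -[a *: x]/((a : R) * (x : R)) mulrCA.
pose fL := GRing.isLinear.Build R X X *:%R fd fl.
pose f : {linear X -> X} := HB.pack fd fL.
have fI : injective f by move=> x y; exact: (mulfI d0).
pose tX (p : M) (a : X) := tpure (ract M) (fun (a : R) (x : X) => a *: x) p a.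
have fD (x y : X) : f (x + y) = f x + f y by exact: linearD.
have fZ b (x : X) : f (b *: x) = b *: f x by exact: linearZ.
have E p a : tmap (ract M) (fun (a : R) (x : X) => a *: x)
    (ract M) (fun (a : R) (y : X) => a *: y) id f (tX p a) = tpure _ _ p (f a).
  by rewrite tmap_pure.
have [B1 B2 B3] := tpure_balanced (ract M) (fun (a : R) (x : X) => a *: x).
have mX0 : tX m 1 = tX 0 1.
  apply: (flatM _ _ f fI); rewrite !E.
  have -> : f 1 = d *: (1 : X) by [].
  rewrite -!B3 md; congr (tpure _ _ _ _); symmetry; exact: ract0.
have bal : balanced (ract M) (fun (a : R) (x : X) => a *: x) (fun p (a : X) => ract M p (a : R)).
  split=> [p p' a|p a a'|p b a]; [exact: ractD|exact: ract_Dr|by rewrite -ractM].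
have := congr1 (tlift (fun p (a : X) => ract M p (a : R))) mX0.
by rewrite !tlift_pure // ract1 ract0.
Qed.
End Torsion.

(** * Lattices of tensor products and the structural morphisms *)

Section Lattices.
Variables (W : groupType) (k : idomainType) (n : nat) (rho : rep W k n).
Local Notation R := (Rh k n).
Local Notation act := (actR rho).
Variables (D : rdatum W k n) (HD : gdatum rho D) (o : wset W).
Local Notation loc := (loc_of (is_root rho D)).
Local Notation lbim := (lbim rho D).
Implicit Types (L : o) (M N P : lbim).

Lemma MQ_ractI0 (M : bimod R R) (x : MQ rho D M) d : right_flat M -> d != 0 ->
  ract (MQ rho D M) x (loc d) = 0 -> x = 0.
Proof.
move=> fM d0 xd; have [e [m [de xm]]] := MQ_frac x.
apply: (MQ_ractI HD de); rewrite xm.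
suff -> : m = 0 by exact: mq0l.
apply: (flat_torsion_free fM d0); apply: (mq_inj (rho := rho) (D := D) fM).
rewrite mq_ractl mulr1 -[loc d]mul1r -ract_mq -xm -ractM mulrC ractM xd.
exact: ract0.
Qed.

(** In contrast with [lat_div], d may be a non-unit of Q: every other component of m is annihilated
    by d, and M_Q has no torsion. This removes denominators that come from another datum. *)
Lemma good_lat_div L L' M w (m : M) d : good L L' M -> d != 0 ->
  lat w (ract M m d) -> lat w m.
Proof.
move=> gM d0; rewrite /lat mq_ractl mulr1 -[loc d]mul1r -ract_mq.
move: (mq m 1) => x lx; have S := g_sum gM; have cM := good_cl gM.
have E v : dsproj S v (ract (MQ rho D M) x (loc d)) = ract (MQ rho D M) (dsproj S v x) (loc d).
  apply: (ds_rep_uniq S (dsproj_rep S _) (b := fun v => ract (MQ rho D M) (dsproj S v x) (loc d))).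
  split=> [j|]; first by apply: (lcl_r cM); exact: dsproj_in.
  have [s [us s0 xE]] := dsproj_sum S x; exists s; split=> // [j /s0 e|].
    by rewrite -[LHS]/(ract (MQ rho D M) (dsproj S j x) (loc d)) e ract0.
  by rewrite {1}xE ract_sum.
have z v : v <> w -> dsproj S v x = 0.
  move=> vw; apply: (MQ_ractI0 (g_flat gM) d0); rewrite -E (dsprojE S lx).
  by case: eqP vw.
have [s [us s0 ->]] := dsproj_sum S x.
apply: lcl_sum => // v _; have [->|vw] := pselect (v = w); first exact: dsproj_in.
by rewrite z //; exact: lcl0.
Qed.

(** Tensors of lattice elements span the component only over Q, so a lattice element of the product
    is a sum of such tensors after multiplication by a denominator. *)
Lemma tens_lat_frac M N w (t : tbim M N) : right_flat (tbim M N) -> lclosed N ->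
  @lat _ _ _ _ _ (ltens M N) w t ->
  exists d, den rho D d /\ add_span (@tens_lat _ _ _ _ _ M N w) (ract (tbim M N) t d).
Proof.
move=> fT cN lt.
have sr f (u : tbim M N) : add_span (@tens_lat _ _ _ _ _ M N w) u ->
    add_span (@tens_lat _ _ _ _ _ M N w) (ract (tbim M N) u f).
  apply: (add_span_map (f := fun u => ract (tbim M N) u f)) => [|x y|].
  - exact: ract0.
  - exact: ractD.
  move=> _ [m [p [x [y [lx ly e ->]]]]]; apply: add_span_gen.
  by exists m, (ract N p f), x, y; rewrite ract_tp; split=> //; exact: lat_r.
suff [d [u [dd su e]]] : exists d (u : tbim M N), [/\ den rho D d,
    add_span (@tens_lat _ _ _ _ _ M N w) u
    & ract (MQ rho D (tbim M N)) (mq t 1) (loc d) = mq u 1].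
  exists d; split=> //; suff <- : u = ract (tbim M N) t d by [].
  by apply: (mq_inj2 (rho := rho) (D := D) fT); rewrite -e ract_mq mq_ractl mul1r mulr1.
move/ltens_lcompE: lt; apply: (add_span_ind (K := fun x => exists d (u : tbim M N),
    [/\ den rho D d, add_span (@tens_lat _ _ _ _ _ M N w) u
    & ract (MQ rho D (tbim M N)) x (loc d) = mq u 1])).
- by exists 1, 0; split; [exact: den1 | exact: add_span0 | rewrite ract0 mq0l].
- move=> x y [d [a [dd sa xa]]] [e [b [de sb yb]]].
  exists (d * e), (ract _ a e + ract _ b d); split; first exact: den_mul.
    by apply: add_spanD; exact: sr.
  rewrite ractD {2}[d * e]mulrC !loc_ofM !ractM xa yb !ract_mq !mul1r.
  by rewrite mqDl !mq_ractl !mulr1.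
- move=> _ [u [q [lu ->]]]; have [d [a [dd e]]] := Q_frac q.
  exists d, (ract _ u a); split=> //; first exact/sr/add_span_gen.
  by rewrite ract_mq mq_ractl mulr1 mulrC e.
Qed.

Lemma tens_lat_span M N w (t : tbim M N) : lclosed M ->
  add_span (@tens_lat _ _ _ _ _ M N w) t -> @lat _ _ _ _ _ (ltens M N) w t.
Proof.
move=> cM; have cT := ltens_lclosed N cM.
apply: (add_span_ind (K := fun t => @lat _ _ _ _ _ (ltens M N) w t)).
- exact: lat0.
- by move=> x y; exact: (latD cT).
- by move=> _ [m [p [x [y [lx ly e ->]]]]]; exact: ltens_lat lx ly e.
Qed.

Lemma is_mor_thom M M' N N' (f : bhom M M') (g : bhom N N') :
  is_mor f -> is_mor g -> @is_mor _ _ _ _ _ (ltens M N) (ltens M' N') (thom f g).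
Proof.
move=> hf hg w x; apply: add_span_map => [|u v|]; first exact: bhom0.
  exact: bhomD (bhomP (fQ rho D (thom f g))) u v.
move=> _ [m [p [q [a [b [la lb e ->]]]]]]; rewrite fQ_mq thomE; apply: add_span_gen.
by exists (f m), (g p), q, a, b; split=> //; exact: mor_lat.
Qed.

Section Assoc.
Variables (L1 L2 L3 L4 : o) (M N P : lbim).
Hypotheses (gM : good L1 L2 M) (gN : good L2 L3 N) (gP : good L3 L4 P).
Let cM := good_cl gM.
Let cN := good_cl gN.
Let cP := good_cl gP.
Let fMN := right_flat_tens (g_flat gM) (g_flat gN).
Let fNP := right_flat_tens (g_flat gN) (g_flat gP).
Let gi g : gens D g -> (g * g = 1)%g. Proof. exact: (gd_inv HD). Qed.

(** The denominator that decomposes the factor in M (x) N must cross the element of P and is twisted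
    by b^-1. In [is_mor_assoc'] the factor to decompose stands at the right end, and no twist
    occurs. *)
Lemma is_mor_assoc :
  @is_mor _ _ _ _ _ (ltens (ltens M N) P) (ltens M (ltens N P)) (tassoc M N P).
Proof.
have cS : lclosed (ltens (ltens M N) P) by exact/ltens_lclosed/ltens_lclosed.
have cT : lclosed (ltens M (ltens N P)) by exact: ltens_lclosed.
move=> w x; apply: (add_span_ind (K := fun x => @lcomp _ _ _ _ _ (ltens M (ltens N P)) w
    (fQ rho D (tassoc M N P) x))).
- by rewrite bhom0; exact: lcl0.
- by move=> u v Hu Hv; rewrite (bhomD (bhomP (fQ rho D _))); exact: (lclD cT).
move=> _ [t [p [q [a [b [la lb e ->]]]]]]; rewrite fQ_mq.
have [->|p0] := pselect (p = 0).
  by rewrite tp0r bhom0; rewrite mq0l; exact: lcl0.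
apply: (lcl_mq cT); have [d [dd st]] := tens_lat_frac fMN cN la.
have [gb _] := lat_supp gP lb p0.
apply: (lat_div HD cT (d := act b^-1%g d)); first by apply: den_act => //; exact: genV.
rewrite -(bhomr (bhomP (tassoc M N P))) ract_tp -(lat_twl gP _ lb) -tp_mid.
apply: (add_span_ind (K := fun u => @lat _ _ _ _ _ (ltens M (ltens N P)) w
    (tassoc M N P (tp u p))) _ _ _ st).
- by rewrite tp0l bhom0; exact: (lat0 cT).
- by move=> u v Hu Hv; rewrite tpDl (bhomD (bhomP (tassoc M N P))); exact: (latD cT).
move=> _ [m [r [x1 [x2 [l1 l2 e2 ->]]]]]; rewrite tassocE.
apply: (ltens_lat l1 (ltens_lat l2 lb erefl)).
by rewrite mulgA e2.
Qed.

Lemma is_mor_assoc' :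
  @is_mor _ _ _ _ _ (ltens M (ltens N P)) (ltens (ltens M N) P) (tassoc' M N P).
Proof.
have cS : lclosed (ltens (ltens M N) P) by exact/ltens_lclosed/ltens_lclosed.
move=> w x; apply: (add_span_ind (K := fun x => @lcomp _ _ _ _ _ (ltens (ltens M N) P) w
    (fQ rho D (tassoc' M N P) x))).
- by rewrite bhom0; exact: lcl0.
- by move=> u v Hu Hv; rewrite (bhomD (bhomP (fQ rho D _))); exact: (lclD cS).
move=> _ [m [t [q [a [b [la lb e ->]]]]]]; rewrite fQ_mq.
apply: (lcl_mq cS); have [d [dd st]] := tens_lat_frac fNP cP lb.
apply: (lat_div HD cS dd).
rewrite -(bhomr (bhomP (tassoc' M N P))) ract_tp.
apply: (add_span_ind (K := fun u => @lat _ _ _ _ _ (ltens (ltens M N) P) w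
    (tassoc' M N P (tp m u))) _ _ _ st).
- by rewrite tp0r bhom0; exact: (lat0 cS).
- by move=> u v Hu Hv; rewrite tpDr (bhomD (bhomP (tassoc' M N P))); exact: (latD cS).
move=> _ [r [p [x1 [x2 [l1 l2 e2 ->]]]]]; rewrite tassoc'E.
apply: (ltens_lat (ltens_lat la l1 erefl) l2).
by rewrite -mulgA e2.
Qed.
End Assoc.

Section Units.
Variables (M : lbim) (cM : lclosed M).
Local Notation R1 := (Rw rho D 1%g).

Lemma lunE (f : R1) (m : M) : lun rho D M (tp f m) = lact M f m.
Proof. exact/tlift_pure/lun_bal. Qed.
Lemma runE (f : R1) (m : M) : run rho D M (tp m f) = ract M m f.
Proof. exact/tlift_pure/run_bal. Qed.

Lemma lun'_axioms : @bhom_axioms R R M (tbim R1 M) (fun m => tp (1 : R1) m).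
Proof.
split=> [x y|a x|x c]; first exact: tpDr.
  rewrite lact_tp -tp_mid; congr (tp _ x).
  by rewrite -[ract _ _ _]/(act 1%g a * 1) actR1.
by rewrite ract_tp.
Qed.
Definition lun' : bhom M (tbim R1 M) := Bhom lun'_axioms.

Lemma run'_axioms : @bhom_axioms R R M (tbim M R1) (fun m => tp m (1 : R1)).
Proof.
split=> [x y|a x|x c]; first exact: tpDl.
  by rewrite lact_tp.
rewrite ract_tp tp_mid; congr (tp x _).
by rewrite -[ract _ _ _]/(act 1%g c * 1) actR1.
Qed.
Definition run' : bhom M (tbim M R1) := Bhom run'_axioms.

Lemma lunK : bcomp (lun rho D M) lun' = bid _.
Proof.
apply: tb_hom_ext => f m; rewrite bcompE lunE -[lun' _]/(tp (1 : R1) _) -tp_mid.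
by congr (tp _ m); rewrite -[ract _ _ _]/(act 1%g f * 1) actR1 mulr1.
Qed.
Lemma lun'K : bcomp lun' (lun rho D M) = bid _.
Proof. by apply: bhom_ext => m; rewrite bcompE [lun _ _ _ _]lunE lact1. Qed.
Lemma runK : bcomp (run rho D M) run' = bid _.
Proof.
apply: tb_hom_ext => m f; rewrite bcompE runE -[run' _]/(tp _ (1 : R1)) tp_mid.
by congr (tp m _); rewrite -[lact _ _ _]/((f : R) * 1) mulr1.
Qed.
Lemma run'K : bcomp run' (run rho D M) = bid _.
Proof. by apply: bhom_ext => m; rewrite bcompE [run _ _ _ _]runE ract1. Qed.

Let lat1 : lat 1%g (1 : R1). Proof. by left. Qed.

Lemma is_mor_lun : @is_mor _ _ _ _ _ (ltens R1 M) M (lun rho D M).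
Proof.
move=> w x; apply: (add_span_ind (K := fun x => lcomp w (fQ rho D (lun rho D M) x))).
- by rewrite bhom0; exact: lcl0.
- by move=> u v Hu Hv; rewrite (bhomD (bhomP (fQ rho D _))); exact: (lclD cM).
move=> _ [f [m [q [a [b [la lb e ->]]]]]]; rewrite fQ_mq lunE; apply: (lcl_mq cM).
case: (Rw_lat la) => [a1|->]; last by rewrite lact_0l; exact: lat0.
by rewrite -e a1 mul1g; exact: lat_l.
Qed.
Lemma is_mor_run : @is_mor _ _ _ _ _ (ltens M R1) M (run rho D M).
Proof.
move=> w x; apply: (add_span_ind (K := fun x => lcomp w (fQ rho D (run rho D M) x))).
- by rewrite bhom0; exact: lcl0.
- by move=> u v Hu Hv; rewrite (bhomD (bhomP (fQ rho D _))); exact: (lclD cM).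
move=> _ [m [f [q [a [b [la lb e ->]]]]]]; rewrite fQ_mq runE; apply: (lcl_mq cM).
case: (Rw_lat lb) => [b1|->]; last by rewrite ract_0r; exact: lat0.
by rewrite -e b1 mulg1; exact: lat_r.
Qed.
Lemma is_mor_lun' : @is_mor _ _ _ _ _ M (ltens R1 M) lun'.
Proof.
have cT : lclosed (ltens R1 M).
  exact/ltens_lclosed/(n_cl (@Rw_nice _ _ _ rho D (pt_wset W) tt tt 1%g (gen1 _) erefl)).
apply: is_mor_lat => // w m lm; apply: (ltens_lat lat1 lm); exact: mul1g.
Qed.
Lemma is_mor_run' : @is_mor _ _ _ _ _ M (ltens M R1) run'.
Proof.
have cT : lclosed (ltens M R1) by exact: ltens_lclosed.
apply: is_mor_lat => // w m lm; apply: (ltens_lat lm lat1); exact: mulg1.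
Qed.
End Units.

End Lattices.

(** * Gradings *)

Section Graded.
Variables (W : groupType) (k : idomainType) (n : nat) (rho : rep W k n).
Local Notation R := (Rh k n).
Local Notation act := (actR rho).

(** The homogeneous components of e g are e times those of g; as R is a domain, a component of g
    outside degree t - c would survive in e g. *)
Lemma rdeg_cancel (e g : R) c t : e != 0 -> rdeg c e -> rdeg t (e * g) -> rdeg (t - c) g.
Proof.
move=> e0 he hg; have S := rdeg_direct k n.
have [s [us s0 gE]] := dsproj_sum S g.
have r1 : ds_rep (@rdeg k n) (e * g) (fun j => e * dsproj S (j - c) g).
  split=> [j|].
    have -> : j = c + (j - c) by rewrite addrC subrK.
    by rewrite [X in dsproj S X]addrC addKr; apply: rdegM => //; exact: dsproj_in.
  exists [seq i + c | i <- s]; split.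
  - by rewrite map_inj_uniq // => i j; exact: addIr.
  - move=> j js; rewrite s0 ?mulr0 //; apply/negP => H; case/negP: js.
    by apply/mapP; exists (j - c) => //; rewrite subrK.
  - by rewrite big_map {1}gE mulr_sumr; apply: eq_bigr => i _; rewrite addrK.
have r2 := ds_rep1 (ds_sub S) hg.
suff -> : g = dsproj S (t - c) g by exact: dsproj_in.
have z i : i <> t - c -> dsproj S i g = 0.
  move=> it; have := ds_rep_uniq S r1 r2 (i + c); rewrite addrK.
  case: eqP => [E|_ /eqP]; first by case: it; rewrite -E addrK.
  by rewrite mulf_eq0 (negbTE e0) => /eqP.
rewrite {1}gE; have [ts|ts] := boolP (t - c \in s); last first.
  rewrite (s0 _ ts) big_seq big1 // => i iS; apply: z => E.
  by rewrite -E iS in ts.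
rewrite (bigD1_seq (t - c)) //= big1 ?addr0 // => i it; apply: z.
exact/eqP.
Qed.

Lemma rdeg1 : rdeg 0 (1 : R).
Proof. by right; exists 0%N; rewrite ?muln0 //; exact: dhomog1. Qed.

Variables (D : rdatum W k n) (HD : gdatum rho D).
Local Notation loc := (loc_of (is_root rho D)).
Local Notation lbim := (lbim rho D).

Lemma den_rdeg d : den rho D d -> exists i, rdeg i d.
Proof. by move=> /den_homogR/homogR_rdeg. Qed.

(** Field [gr_lat] replaces the condition that components are spanned by homogeneous elements of
    M_Q. It is stated inside M, and so passes through tensor products and twists, where M_Q
    changes. *)
Record graded (M : lbim) : Prop := Graded {
  gr_sum : direct_sum_of (@ldeg _ _ _ _ _ M);
  gr_l : forall i j f (m : M), rdeg i f -> ldeg j m -> ldeg (i + j) (lact M f m);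
  gr_r : forall i j f (m : M), rdeg i f -> ldeg j m -> ldeg (i + j) (ract M m f);
  gr_lat : forall w (m : M), lat w m -> exists d, den rho D d /\
    add_span (fun y => lat w y /\ exists i, ldeg i y) (ract M m d) }.

Lemma gr_compdeg (M : lbim) : lclosed M -> graded M ->
  forall w (x : MQ rho D M), lcomp w x ->
    add_span (fun y => lcomp w y /\ exists i, mqdeg i y) x.
Proof.
move=> cM gM w x /(lcomp_frac cM)[d [m [dd lm xm]]].
have [e [de sm]] := gr_lat gM lm.
have dde : den rho D (d * e) by exact: den_mul.
have [q dq] := den_dinv HD dde; have [c cde] := den_rdeg dde.
have -> : x = mq (ract M m e) q.
  by rewrite mq_ractl -[_ * q]mul1r -ract_mq -xm -ractM mulrA -loc_ofM dq ract1.
apply: (add_span_map (f := fun z => mq z q) _ _ _ sm); first exact: mq0l.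
  by move=> y z; exact: mqDl.
move=> y [ly [i hy]]; apply: add_span_gen; split; first exact: lcl_mq.
exists (i + (0 - c)); apply: add_span_gen; exists y, q, i, (0 - c); split=> //.
exists 1, (d * e), 0, c; split=> //; [exact: rdeg1 | exact: (den_neq0 HD dde) |].
have /= := congr1 (@lval _ _) dq; rewrite !tofrac1 => dqE.
have n0 : tofrac (d * e) != 0 by rewrite tofrac_eq0; exact: (den_neq0 HD dde).
by apply: (mulfI n0); rewrite [LHS]dqE mul1r mulfV.
Qed.

(** Converse of [gr_compdeg]: elements of [den] are homogeneous, so clearing denominators preserves
    homogeneity. *)
Lemma compdeg_gr_lat (M : lbim) : lclosed M -> right_flat M ->
  (forall i j f (m : M), rdeg i f -> ldeg j m -> ldeg (i + j) (ract M m f)) ->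
  direct_sum_of (@ldeg _ _ _ _ _ M) ->
  (forall w (x : MQ rho D M), lcomp w x ->
    add_span (fun y => lcomp w y /\ exists i, mqdeg i y) x) ->
  forall w (m : M), lat w m -> exists d, den rho D d /\
    add_span (fun y => lat w y /\ exists i, ldeg i y) (ract M m d).
Proof.
move=> cM fM Mr S H w m lm.
have homD i := dsPD (ds_sub S) (j := i).
have one i (y : MQ rho D M) : mqdeg i y -> exists d j (m' : M),
    [/\ den rho D d, rdeg j d, ldeg (i + j) m' & ract (MQ rho D M) y (loc d) = mq m' 1].
  apply: (add_span_ind (K := fun y => exists d j (m' : M),
    [/\ den rho D d, rdeg j d, ldeg (i + j) m' & ract (MQ rho D M) y (loc d) = mq m' 1])).
  - exists 1, 0, 0; split; [exact: den1|exact: rdeg1| |by rewrite ract0 mq0l].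
    by case: (ds_sub S (i + 0)).
  - move=> x z [d [j [a [dd hd ha xa]]]] [e [l [b [de he hb zb]]]].
    exists (d * e), (j + l), (ract M a e + ract M b d); split.
    + exact: den_mul.
    + exact: rdegM.
    + apply: homD; first by rewrite addrA addrC; exact: Mr.
      by rewrite [j + l]addrC addrA addrC; exact: Mr.
    rewrite ractD {2}[d * e]mulrC !loc_ofM !ractM xa zb !ract_mq !mul1r.
    by rewrite mqDl !mq_ractl !mulr1.
  - move=> _ [p [q [a [b [hp [f [e [a' [b' [hf he e0 -> qE]]]]] -> ->]]]]].
    have [d [g [dd dq]]] := Q_frac q; have [j hd] := den_rdeg dd.
    exists d, j, (ract M p g); split=> //; last first.
      by rewrite ract_mq mq_ractl mulr1 mulrC dq.
    (* Both g/d and f/e represent q; cancelling the homogeneous e then shows that g is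
       homogeneous. *)
    have eg : e * g = d * f.
      apply: (@tofrac_inj [the idomainType of R]).
      have /= dqE := congr1 (@lval _ _) dq.
      rewrite !tofracM -dqE qE mulrCA; congr (_ * _); rewrite mulrCA divff ?mulr1 //.
      by rewrite tofrac_eq0.
    have hg : rdeg (j + a' - b') g.
      by apply: (rdeg_cancel e0 he); rewrite eg; exact: rdegM.
    have -> : a + (a' - b') + j = (j + a' - b') + a.
      by rewrite -addrA addrC; congr (_ + _); rewrite addrC addrA.
    exact: Mr.
suff [d [u [dd su e]]] : exists d (u : M), [/\ den rho D d,
    add_span (fun y => lat w y /\ exists i, ldeg i y) u
    & ract (MQ rho D M) (mq m 1) (loc d) = mq u 1].
  exists d; split=> //; suff <- : u = ract M m d by [].
  by apply: (mq_inj2 (rho := rho) (D := D) fM); rewrite -e ract_mq mq_ractl mul1r mulr1.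
have sr f u : homogR f -> add_span (fun y : M => lat w y /\ exists i, ldeg i y) u ->
    add_span (fun y : M => lat w y /\ exists i, ldeg i y) (ract M u f).
  move=> /homogR_rdeg[j hj]; apply: (add_span_map (f := fun u => ract M u f)) => [|x y|].
  - exact: ract0.
  - exact: ractD.
  move=> y [ly [i hy]]; apply: add_span_gen; split; first exact: lat_r.
  by exists (j + i); exact: Mr.
move/H: lm; apply: (add_span_ind (K := fun x => exists d (u : M), [/\ den rho D d,
    add_span (fun y => lat w y /\ exists i, ldeg i y) u
    & ract (MQ rho D M) x (loc d) = mq u 1])).
- by exists 1, 0; split; [exact: den1 | exact: add_span0 | rewrite ract0 mq0l].
- move=> x y [d [a [dd sa xa]]] [e [b [de sb yb]]].
  exists (d * e), (ract _ a e + ract _ b d); split; first exact: den_mul.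
    by apply: add_spanD; [apply: sr (den_homogR de) sa | apply: sr (den_homogR dd) sb].
  rewrite ractD {2}[d * e]mulrC !loc_ofM !ractM xa yb !ract_mq !mul1r.
  by rewrite mqDl !mq_ractl !mulr1.
- move=> y [ly [i /one[d [j [m' [dd hd hm e]]]]]]; exists d, m'; split=> //.
  apply: add_span_gen; split; last by exists (i + j).
  by rewrite /lat -e; exact: lcl_r.
Qed.

Variable o : wset W.
Implicit Types (L : o) (M N : lbim).

Lemma in_CE L L' M : left_fg M ->
  in_C L L' M <-> good L L' M /\ graded M.
Proof.
move=> fg; split=> [H|[gM grM]].
  have gM := in_C_good fg H; split=> //; case: H => *; split=> //.
  by apply: compdeg_gr_lat => //; exact: (good_cl gM).
case: (gM) (grM) => *; case: grM => *; split=> //.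
- have [g gP] := fg; exists g => m; apply: (add_span_map (f := id) _ _ _ (gP m)) => //.
  move=> _ [a [y [yg ->]]]; apply: add_span_gen; exists a, 1, y.
  by rewrite ract1.
- by apply: gr_compdeg => //; exact: (good_cl gM).
Qed.

Section TensorGraded.
Variables (L1 L2 L3 : o) (M N : lbim).
Hypotheses (gM : good L1 L2 M) (gN : good L2 L3 N) (rM : graded M) (rN : graded N).
Let SM := gr_sum rM.
Let SN := gr_sum rN.

Lemma dsproj_l c f j (p : N) : rdeg c f ->
  dsproj SN (c + j) (lact N f p) = lact N f (dsproj SN j p).
Proof.
move=> hf; have -> : j = (c + j) - c by rewrite addrC addKr.
rewrite [in LHS]addrC subrK.
have [s [us s0 pE]] := dsproj_sum SN p.
apply: (ds_rep_uniq SN (dsproj_rep SN _) (b := fun i => lact N f (dsproj SN (i - c) p))).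
split=> [i|].
  have {1}-> : i = c + (i - c) by rewrite addrC subrK.
  by apply: (gr_l rN) => //; exact: dsproj_in.
exists [seq i + c | i <- s]; split.
- by rewrite map_inj_uniq // => i i'; exact: addIr.
- move=> i js; rewrite s0 ?lact0 //; apply/negP => H; case/negP: js.
  by apply/mapP; exists (i - c) => //; rewrite subrK.
- by rewrite big_map {1}pE lact_sum; apply: eq_bigr => i _; rewrite addrK.
Qed.

Let supp (m : M) : seq int := sval (cid (dsproj_sum SM m)).
Let suppP m : [/\ uniq (supp m), forall j, j \notin supp m -> dsproj SM j m = 0
  & m = \sum_(j <- supp m) dsproj SM j m].
Proof. exact: (svalP (cid (dsproj_sum SM m))). Qed.

(** The projection to degree i: m (x) p goes to the sum of m_a (x) p_(i-a) over the degrees a of m.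
    Only the whole sum is balanced, since a homogeneous f shifts a. *)
Let T (i : int) (m : M) (p : N) : tbim M N :=
  \sum_(a <- supp m) tp (dsproj SM a m) (dsproj SN (i - a) p).

Let T_any i m p s : uniq s -> {subset supp m <= s} ->
  T i m p = \sum_(a <- s) tp (dsproj SM a m) (dsproj SN (i - a) p).
Proof.
move=> us ss; have [um m0 _] := suppP m; symmetry.
apply: sum_uniq_support => // a /m0 ->; exact: tp0l.
Qed.

Let T_hom i a m p : ldeg a m -> T i m p = tp m (dsproj SN (i - a) p).
Proof.
move=> hm; have E := dsprojE SM hm.
rewrite (T_any i p (s := undup (a :: supp m))) ?undup_uniq //; last first.
  by move=> j jm; rewrite mem_undup inE jm orbT.
rewrite (bigD1_seq a) ?undup_uniq ?mem_undup ?inE ?eqxx //= big1.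
  by rewrite addr0 E eqxx.
by move=> j ja; rewrite E (negbTE ja) tp0l.
Qed.

Let T_Dl i m m' p : T i (m + m') p = T i m p + T i m' p.
Proof.
pose s := undup (supp (m + m') ++ supp m ++ supp m').
have us : uniq s by exact: undup_uniq.
rewrite !(@T_any i _ p s) //; try by move=> j; rewrite mem_undup !mem_cat => ->; rewrite ?orbT.
by rewrite -big_split; apply: eq_bigr => a _; rewrite dsprojD tpDl.
Qed.
Let T_Dr i m p p' : T i m (p + p') = T i m p + T i m p'.
Proof. by rewrite -big_split; apply: eq_bigr => a _; rewrite dsprojD tpDr. Qed.
Let T_0l i p : T i 0 p = 0.
Proof. by apply: (addrI (T i 0 p)); rewrite -T_Dl !addr0. Qed.

Let T_bal i : balanced (ract M) (lact N) (T i).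
Proof.
split=> [m m' p|m p p'|m f p]; [exact: T_Dl|exact: T_Dr|].
apply: (add_span_ind (K := fun f => T i (ract M m f) p = T i m (lact N f p)) _ _ _
  (rdeg_span f)).
- rewrite ract_0r lact_0l T_0l; apply: esym.
  by apply: (addrI (T i m 0)); rewrite -T_Dr !addr0.
- by move=> g g' Hg Hg'; rewrite ract_Dr T_Dl lact_Dl T_Dr Hg Hg'.
move=> g [c hg].
apply: (add_span_ind (K := fun m => T i (ract M m g) p = T i m (lact N g p)) _ _ _
  (ds_span SM m)).
- by rewrite ract0 !T_0l.
- by move=> x y Hx Hy; rewrite ractD !T_Dl Hx Hy.
move=> x [a hx]; rewrite (T_hom i _ hx) (T_hom i p (gr_r rM hg hx)) tp_mid.
rewrite opprD addrA addrAC -(dsproj_l _ _ hg).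
by rewrite [c + _]addrC subrK.
Qed.

(** The maps induced by T separate the degrees. For [gr_lat], a first denominator decomposes t into
    tensors m (x) p; then a denominator of m, twisted past p, and one of p make the factors
    homogeneous. *)
Lemma graded_ltens : graded (ltens M N).
Proof.
have lE i (t : ltens M N) : ldeg i t <-> add_span (fun t => exists (m : M) (p : N) (a b : int),
       [/\ ldeg a m, ldeg b p, i = a + b & t = tp m p]) t by [].
have TtE i j t : @ldeg _ _ _ _ _ (ltens M N) i t ->
    tlift (T j) t = if i == j then t else 0.
  apply: (add_span_ind (K := fun t => tlift (T j) t = if i == j then t else 0)).
  - by rewrite (additive0 (f := tlift (T j))) ?if_same // => x y; exact/tliftD/T_bal.
  - move=> x y Hx Hy; rewrite tliftD; last exact: T_bal.
    by rewrite Hx Hy; case: ifP; rewrite ?addr0.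
  - move=> _ [m [p [a [b [ha hb -> ->]]]]]; rewrite tlift_pure; last exact: T_bal.
    rewrite (T_hom j p ha) (dsprojE SN hb) subr_eq [a + b]addrC eq_sym.
    by case: ifP => // _; exact: tp0r.
split.
- apply: (@direct_sum_of_sep _ _ _ _ _ (fun j => tlift (T j))).
  + split=> [|x y]; first exact: add_span0.
    apply: add_spanB => _ [m [p [a [b [ha hb e ->]]]]].
    exists (- m), p, a, b; rewrite tpNl; split=> //.
    exact: (dsPN (ds_sub SM) ha).
  + by move=> j x y; exact/tliftD/T_bal.
  + by move=> j x hx; rewrite (TtE _ _ _ hx) eqxx.
  + by move=> i j x hx /eqP/negbTE ij; rewrite (TtE _ _ _ hx) ij.
  + elim/tb_ind => [|x y|m p]; [exact: add_span0|exact: add_spanD|].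
    apply: (add_span_map (f := fun m => tp m p) _ _ _ (ds_span SM m)).
    * exact: tp0l.
    * by move=> x y; exact: tpDl.
    move=> x [a hx]; apply: (add_span_map (f := tp x) _ _ _ (ds_span SN p)).
    * exact: tp0r.
    * by move=> u v; exact: tpDr.
    move=> y [b hy]; apply: add_span_gen; exists (a + b); apply: add_span_gen.
    by exists x, y, a, b.
- move=> i j f t hf; apply: add_span_map => [|x y|].
  + exact: lact0.
  + exact: lactD.
  + move=> _ [m [p [a [b [ha hb -> ->]]]]]; rewrite lact_tp; apply: add_span_gen.
    exists (lact M f m), p, (i + a), b; rewrite addrA; split=> //; exact: gr_l.
- move=> i j f t hf; apply: (add_span_map (f := fun t => ract (tbim M N) t f)) => [|x y|].
  + exact: ract0.
  + exact: ractD.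
  + move=> _ [m [p [a [b [ha hb -> ->]]]]]; rewrite ract_tp; apply: add_span_gen.
    exists m, (ract N p f), a, (i + b); rewrite addrCA; split=> //; exact: gr_r.
have cM := good_cl gM; have cN := good_cl gN.
have fT := right_flat_tens (g_flat gM) (g_flat gN).
move=> w t lt; have [d [dd st]] := tens_lat_frac fT cN lt.
pose P (y : tbim M N) := @lat _ _ _ _ _ (ltens M N) w y /\
  exists i, @ldeg _ _ _ _ _ (ltens M N) i y.
suff [e [de se]] : exists e, den rho D e /\ add_span P (ract (tbim M N) (ract (tbim M N) t d) e).
  by exists (d * e); rewrite ractM; split=> //; exact: den_mul.
have Pr f u : homogR f -> add_span P u -> add_span P (ract (tbim M N) u f).
  move=> /homogR_rdeg[j hj]; apply: (add_span_map (f := fun u => ract (tbim M N) u f)) => [|x y|].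
  - exact: ract0.
  - exact: ractD.
  move=> y [ly [i hy]]; apply: add_span_gen; split.
    exact: (lat_r (ltens_lclosed N cM)).
  exists (j + i); apply: (add_span_map (f := fun t => ract (tbim M N) t f) _ _ _ hy).
  + exact: ract0.
  + by move=> u1 u2; exact: ractD.
  + move=> _ [m [p [a [b [ha hb -> ->]]]]]; rewrite ract_tp; apply: add_span_gen.
    exists m, (ract N p f), a, (j + b); rewrite addrCA; split=> //; exact: gr_r.
apply: (add_span_ind (K := fun u => exists e, den rho D e /\
  add_span P (ract (tbim M N) u e)) _ _ _ st).
- by exists 1; split; [exact: den1 | rewrite ract0; exact: add_span0].
- move=> x y [e [de sx]] [e' [de' sy]]; exists (e * e'); split; first exact: den_mul.
  rewrite ractD {2}[e * e']mulrC !ractM.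
  by apply: add_spanD; [apply: Pr (den_homogR de') sx | apply: Pr (den_homogR de) sy].
move=> _ [m [p [a [b [la lb e ->]]]]].
have [->|p0] := pselect (p = 0).
  by exists 1; split; [exact: den1 | rewrite tp0r ract0; exact: add_span0].
have [gb _] := lat_supp gN lb p0.
have [d1 [dd1 sm]] := gr_lat rM la; have [d2 [dd2 sp]] := gr_lat rN lb.
exists (act b^-1%g d1 * d2); split.
  apply: den_mul => //; apply: den_act => //; apply: (genV _ gb).
  exact: (gd_inv HD).
rewrite ractM [ract _ (tp m p) _]ract_tp -(lat_twl gN _ lb) -tp_mid ract_tp.
apply: (add_span_map (f := fun m => tp m (ract N p d2)) _ _ _ sm).
- exact: tp0l.
- by move=> u v; exact: tpDl.
move=> y [ly [i hy]]; apply: (add_span_map (f := tp y) _ _ _ sp).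
- exact: tp0r.
- by move=> u v; exact: tpDr.
move=> z [lz [j hz]]; apply: add_span_gen; split; first exact: (ltens_lat ly lz e).
by exists (i + j); apply: add_span_gen; exists y, z, i, j.
Qed.

End TensorGraded.
End Graded.

(** * Semilinear isomorphisms *)

Section Semi.
Variables (W : groupType) (k : idomainType) (n : nat) (rho : rep W k n).
Local Notation R := (Rh k n).
Local Notation act := (actR rho).

Record semi (u v : W) (M N : bimod R R) (F : M -> N) : Prop := Semi {
  semiD : forall x y, F (x + y) = F x + F y;
  semil : forall f m, F (lact M f m) = lact N (act u f) (F m);
  semir : forall f m, F (ract M m f) = ract N (F m) (act v f) }.

Lemma semi_comp u v u' v' (M N P : bimod R R) (F : M -> N) (G : N -> P) :
  semi u v F -> semi u' v' G -> semi (u' * u)%g (v' * v)%g (fun m => G (F m)).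
Proof.
case=> FD Fl Fr [GD Gl Gr]; split=> [x y|f m|f m]; first by rewrite FD GD.
  by rewrite Fl Gl actRM.
by rewrite Fr Gr actRM.
Qed.

Lemma semi0 u v (M N : bimod R R) (F : M -> N) : semi u v F -> F 0 = 0.
Proof. by case=> FD _ _; apply: (addrI (F 0)); rewrite -FD !addr0. Qed.

Lemma bhom_semi (M N : bimod R R) (f : bhom M N) : semi 1%g 1%g f.
Proof.
have [fD fl fr] := bhomP f.
by split=> // a m; rewrite ?fl ?fr actR1.
Qed.

Lemma semi_bhom_axioms (M N : bimod R R) (F : M -> N) : semi 1%g 1%g F -> bhom_axioms F.
Proof. by case=> FD Fl Fr; split=> // [a x|x c]; rewrite ?Fl ?Fr actR1. Qed.

Lemma semi_gens u v (M N : bimod R R) (F : M -> N) (G : M -> Prop) :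
  (forall x, add_span G x) -> (forall x y, F (x + y) = F x + F y) ->
  (forall f m, G m -> F (lact M f m) = lact N (act u f) (F m)) ->
  (forall f m, G m -> F (ract M m f) = ract N (F m) (act v f)) -> semi u v F.
Proof.
move=> GS FD Hl Hr; have F0 : F 0 = 0 by apply: (addrI (F 0)); rewrite -FD !addr0.
split=> // f m.
- apply: (add_span_ind (K := fun m => F (lact M f m) = lact N (act u f) (F m))
    _ _ _ (GS m)) => [|x y Hx Hy|x Gx]; last exact: Hl.
    by rewrite lact0 F0 lact0.
  by rewrite lactD !FD lactD Hx Hy.
- apply: (add_span_ind (K := fun m => F (ract M m f) = ract N (F m) (act v f))
    _ _ _ (GS m)) => [|x y Hx Hy|x Gx]; last exact: Hr.
    by rewrite ract0 F0 ract0.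
  by rewrite ractD !FD ractD Hx Hy.
Qed.

Lemma semi_cancel_gens u v u' v' (M N : bimod R R) (F : M -> N) (F' : N -> M)
    (G : M -> Prop) : (forall x, add_span G x) -> semi u v F -> semi u' v' F' ->
  (forall m, G m -> F' (F m) = m) -> cancel F F'.
Proof.
move=> GS sF sF' FK m.
apply: (add_span_ind (K := fun m => F' (F m) = m) _ _ _ (GS m)) => [|x y Hx Hy|//].
  by rewrite (semi0 sF) (semi0 sF').
by rewrite (semiD sF) (semiD sF') Hx Hy.
Qed.

Definition cs_gen (s : W) (t : Cs_bim rho s) : Prop := exists f g, t = cs_tp rho s f g.
Lemma cs_gen_span s (t : Cs_bim rho s) : add_span (@cs_gen s) t.
Proof.
elim/cs_ind: t => [|x y|f g]; [exact: add_span0|exact: add_spanD|].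
by apply: add_span_gen; exists f, g.
Qed.

Section SemiTens.
Variables (u v z : W) (M M' N N' : bimod R R) (F : M -> M') (G : N -> N').
Hypotheses (hF : semi u v F) (hG : semi v z G).

Lemma semi_tens_bal : balanced (ract M) (lact N) (fun m p => tp (F m) (G p)).
Proof.
case: hF hG => FD Fl Fr [GD Gl Gr]; split=> [m m' p|m p p'|m b p].
- by rewrite FD tpDl.
- by rewrite GD tpDr.
- by rewrite Fr Gl tp_mid.
Qed.

Definition semi_tens : tbim M N -> tbim M' N' := tlift (fun m p => tp (F m) (G p)).

Lemma semi_tensE m p : semi_tens (tp m p) = tp (F m) (G p).
Proof. exact/tlift_pure/semi_tens_bal. Qed.

Lemma semi_tensP : semi u z semi_tens.
Proof.
have TD x y : semi_tens (x + y) = semi_tens x + semi_tens y.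
  exact/tliftD/semi_tens_bal.
have T0 : semi_tens 0 = 0 by apply: (addrI (semi_tens 0)); rewrite -TD !addr0.
split=> // f t.
- elim/tb_ind: t => [|x y Hx Hy|m p]; first by rewrite lact0 T0 lact0.
    by rewrite lactD !TD lactD Hx Hy.
  by rewrite lact_tp !semi_tensE lact_tp (semil hF).
- elim/tb_ind: t => [|x y Hx Hy|m p]; first by rewrite ract0 T0 ract0.
    by rewrite ractD !TD ractD Hx Hy.
  by rewrite ract_tp !semi_tensE ract_tp (semir hG).
Qed.
End SemiTens.

Lemma semi_tensK u v z (M M' N N' : bimod R R) (F : M -> M') (G : N -> N')
    (F' : M' -> M) (G' : N' -> N) (hF : semi u v F) (hG : semi v z G)
    (hF' : semi u^-1%g v^-1%g F') (hG' : semi v^-1%g z^-1%g G') :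
  cancel F F' -> cancel G G' -> cancel (semi_tens F G) (semi_tens F' G').
Proof.
move=> FK GK; elim/tb_ind => [|x y Hx Hy|m p].
- by rewrite (semi0 (semi_tensP hF hG)) (semi0 (semi_tensP hF' hG')).
- by rewrite (semiD (semi_tensP hF hG)) (semiD (semi_tensP hF' hG')) Hx Hy.
- by rewrite (semi_tensE hF hG) (semi_tensE hF' hG') FK GK.
Qed.

Section SemiLat.
Variables (D1 D2 : rdatum W k n).

(** The index u w v^-1 is forced: from m f = w(f) m follows F(m) v(f) = (u w)(f) F(m). *)
Definition lat_map u v (M : lbim rho D1) (N : lbim rho D2) (F : M -> N) : Prop :=
  forall w m, lat w m -> lat (u * w * v^-1)%g (F m).

(** A denominator over D1, twisted by z, is only known to be nonzero when regarded over D2, so the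
    final division is by [good_lat_div]. *)
Lemma lat_map_tens u v z (M N : lbim rho D1) (M' N' : lbim rho D2) (F : M -> M')
    (G : N -> N') (hF : semi u v F) (hG : semi v z G) (o : wset W) (L L' : o) :
  gdatum rho D1 -> gdatum rho D2 -> right_flat (tbim M N) -> lclosed N -> good L L' (ltens M' N') ->
  lclosed M' -> lat_map u v F -> lat_map v z G ->
  @lat_map u z (ltens M N) (ltens M' N') (semi_tens F G).
Proof.
move=> HD1 HD2 fT cN gT cM' lF lG w t lt.
have [d [dd st]] := tens_lat_frac fT cN lt.
have d0 : act z d != 0.
  apply/eqP => e; have := den_neq0 HD1 dd.
  by rewrite -[d](actRK rho z) e actR_0 eqxx.
have hT := semi_tensP hF hG.
apply: (good_lat_div HD2 gT d0); rewrite -(semir hT).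
apply: tens_lat_span => //.
apply: (add_span_map (f := semi_tens F G) _ _ _ st).
- exact: (semi0 hT).
- exact: (semiD hT).
move=> _ [m [p [x [y [lx ly <- ->]]]]]; rewrite (semi_tensE hF hG).
apply: add_span_gen; exists (F m), (G p), (u * x * v^-1)%g, (v * y * z^-1)%g.
by split=> //; [exact: lF | exact: lG | rewrite !mulgA mulgVK].
Qed.

Definition siso u v (M : lbim rho D1) (N : lbim rho D2) : Prop :=
  exists (F : M -> N) (G : N -> M),
    [/\ semi u v F /\ lat_map u v F, semi u^-1%g v^-1%g G,
        forall w m, lat w m -> lat (u^-1 * w * v)%g (G m),
        cancel F G & cancel G F].

End SemiLat.

Lemma siso_sym D1 D2 u v (M : lbim rho D1) (N : lbim rho D2) :
  siso u v M N -> siso u^-1%g v^-1%g N M.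
Proof.
case=> F [G [[sF lF] sG lG FK GK]]; exists G, F; split=> //.
- by split=> // w m /lG; rewrite invgK.
- by rewrite !invgK.
- by move=> w m /lF; rewrite invgK.
Qed.

Lemma siso_trans D1 D2 D3 u v u' v' (M : lbim rho D1) (N : lbim rho D2) (P : lbim rho D3) :
  siso u v M N -> siso u' v' N P -> siso (u' * u)%g (v' * v)%g M P.
Proof.
case=> F [G [[sF lF] sG lG FK GK]] [F' [G' [[sF' lF'] sG' lG' FK' GK']]].
exists (fun m => F' (F m)), (fun m => G (G' m)); split.
- split; first exact: semi_comp.
  by move=> w m /lF/lF'; rewrite invgM !mulgA.
- by rewrite !invgM; exact: semi_comp.
- by move=> w m /lG'/lG; rewrite invgM !mulgA.
- by move=> m; rewrite FK' FK.
- by move=> m; rewrite GK GK'.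
Qed.

Lemma siso_tens D1 D2 u v z (M N : lbim rho D1) (M' N' : lbim rho D2)
    (o o' : wset W) (L1 L2 L3 : o) (K1 K2 K3 : o') :
  gdatum rho D1 -> gdatum rho D2 ->
  nice L1 L2 M -> nice L2 L3 N -> nice K1 K2 M' -> nice K2 K3 N' ->
  siso u v M M' -> siso v z N N' -> siso u z (ltens M N) (ltens M' N').
Proof.
move=> H1 H2 nM nN nM' nN' [F [F' [[sF lF] sF' lF' FK FK']]]
  [G [G' [[sG lG] sG' lG' GK GK']]].
have gT := nice_good H1 (nice_ltens H1 nM nN).
have gT' := nice_good H2 (nice_ltens H2 nM' nN').
exists (semi_tens F G), (semi_tens F' G'); split.
- split; first exact: (semi_tensP sF sG).
  apply: (lat_map_tens sF sG H1 H2 _ _ gT') => //; [exact: (g_flat gT)|exact: (n_cl nN)|].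
  exact: (n_cl nM').
- exact: (semi_tensP sF' sG').
- have : @lat_map D2 D1 u^-1%g z^-1%g (ltens M' N') (ltens M N) (semi_tens F' G').
    apply: (lat_map_tens sF' sG' H2 H1 _ _ gT); [exact: (g_flat gT')|exact: (n_cl nN')| | |].
    + exact: (n_cl nM).
    + by move=> w m /lF'; rewrite invgK.
    + by move=> w m /lG'; rewrite invgK.
  by move=> H w m /H; rewrite invgK.
- exact: (semi_tensK sF sG sF' sG' FK GK).
- by apply: (semi_tensK sF' sG' _ _ FK' GK'); rewrite !invgK.
Qed.

(** The map is f |-> u(f). With w = u = 1 and v = s^-1 it turns R_1 into R_s, which is how letters
    outside K are absorbed. *)
Lemma siso_Rw D1 D2 (u v w : W) : siso u v (Rw rho D1 w) (Rw rho D2 (u * w * v^-1)%g).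
Proof.
have S D D' (a b c : W) : @semi a b (Rw rho D c) (Rw rho D' (a * c * b^-1)%g)
    (fun f : R => act a f).
  split=> [x y|f m|f m]; first exact: actR_D.
    exact: actR_M.
  transitivity (act a (act c f * (m : R))); first by [].
  have e : act a (act c f) = act (a * c * b^-1)%g (act b f) by rewrite -!actRM mulgVK.
  by rewrite actR_M e.
have Ll D D' (a b c : W) : @lat_map D D' a b (Rw rho D c) (Rw rho D' (a * c * b^-1)%g)
    (fun f : R => act a f).
  by move=> x m /Rw_lat[->|->]; [left | right; rewrite actR_0 mq0l].
have e : (u^-1 * (u * w * v^-1) * v^-1^-1)%g = w by rewrite invgK !mulgA mulVg mul1g mulgVK.
exists (fun f : R => act u f), (fun f : R => act u^-1%g f); split.
- by split; [exact: S | exact: Ll].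
- by have := S D2 D1 u^-1%g v^-1%g (u * w * v^-1)%g; rewrite e.
- by move=> x m lm; have := Ll D2 D1 u^-1%g v^-1%g (u * w * v^-1)%g x m lm; rewrite e invgK.
- by move=> f; exact: actRK.
- by move=> f; exact: actRVK.
Qed.

Lemma iso_siso (D : rdatum W k n) (M N : lbim rho D) : iso_C M N -> siso 1%g 1%g M N.
Proof.
case=> f [g [fm gm fK gK]]; exists f, g; split=> //; rewrite ?invg1.
- by split; [exact: bhom_semi | move=> w m lm; rewrite !(invg1, mul1g, mulg1); exact: mor_lat].
- exact: bhom_semi.
- by move=> w m lm; rewrite !(invg1, mul1g, mulg1); exact: mor_lat.
Qed.

(** The map is f (x) g |-> x(f) (x) x(g). The coroot of t is the transported coroot of s times the
    unit c, so delta is rescaled and the generators of the components correspond up to c. *)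
Lemma siso_Cs D1 D2 (x s t : W) (c : k) : gdatum rho D1 -> gdatum rho D2 ->
  gens D1 s -> gens D2 t -> t = (x * s * x^-1)%g -> c \is a GRing.unit ->
  coroot D2 t = c *: (rho x *m coroot D1 s) ->
  siso x x (Cs rho D1 s) (Cs rho D2 t).
Proof.
move=> H1 H2 D1s D2t tE cu crE.
have sE : s = (x^-1 * t * x^-1^-1)%g.
  by rewrite tE invgK !mulgA mulVg mul1g mulgVK.
have crE' : coroot D1 s = c^-1 *: (rho x^-1%g *m coroot D2 t).
  rewrite crE -scalemxAr scalerA mulVr // scale1r mulmxA -rhoM mulVg rho1.
  by rewrite mul1mx.
have cu' : c^-1 \is a GRing.unit by rewrite unitrV.
have main Da Db (y a b : W) (e : k) : gdatum rho Da -> gdatum rho Db ->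
    gens Da a -> gens Db b -> b = (y * a * y^-1)%g -> e \is a GRing.unit ->
    coroot Db b = e *: (rho y *m coroot Da a) ->
    exists F : Cs rho Da a -> Cs rho Db b,
      [/\ semi y y F, @lat_map Da Db y y (Cs rho Da a) (Cs rho Db b) F
        & forall f g, F (cs_tp rho a f g) = cs_tp rho b (act y f) (act y g)].
  move=> Ha Hb aa bb bE eu cE.
  have bal : @cs_bal _ _ _ rho a (Cs_bim rho b) (fun f g => cs_tp rho b (act y f) (act y g)).
    split=> [f f' g|f g g'|f h g hh].
    - by rewrite actR_D cstDl.
    - by rewrite actR_D cstDr.
    - have hb : act b (act y h) = act y h by rewrite -[in RHS]hh -!actRM bE mulgVK.
      by rewrite actR_M cst_mid // actR_M.
  have [F [FD FE]] := cs_lift bal; have F0 : F 0 = 0 by exact: additive0.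
  have sF : @semi y y (Cs_bim rho a) (Cs_bim rho b) F.
    apply: (semi_gens (cs_gen_span (s := a)) FD) => h _ [f [g ->]].
      by rewrite lact_cst [LHS]FE [F _]FE lact_cst actR_M.
    by rewrite ract_cst [LHS]FE [F _]FE ract_cst actR_M.
  exists F; split; [exact: sF| |exact: FE] => w m lm.
  have [al cal] := gd_corootP Ha aa; have [be cbe] := gd_corootP Hb bb.
  have gT := nice_good Hb (@cs_nice _ _ _ rho Db Hb (pt_wset W) b bb tt erefl be cbe).
  have [d [f [dd cases]]] := cs_lat_frac Ha aa cal lm.
  have d0 : act y d != 0.
    apply/eqP => z; have := den_neq0 Ha dd.
    by rewrite -[d](actRK rho y) z actR_0 eqxx.
  apply: (good_lat_div Hb gT d0); rewrite -(semir sF).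
  (* The factor e^-1 makes the pairing with the coroot of b equal to 1, so this is an admissible
     delta for b. *)
  pose al' := e^-1 *: actV rho y al.
  have cal' : pairing (coroot Db b) al' = 1.
    rewrite /pairing cE /al' -scalemxAl -scalemxAr scalerA mulVr // scale1r.
    by rewrite /actV mulmxA -[X in (X *m _) _ _]mulmxA -rhoM mulVg rho1 mulmx1.
  have alE : act y (symv al) = (e%:MP : {mpoly k[n]}) * symv al'.
    rewrite actR_symv /al' symvZ -mul_mpolyC mulrA -mpolyCM mulrV //.
    by rewrite mpolyC1 mul1r.
  have cT := good_cl gT.
  have cstC g' : cs_tp rho b 1 ((e%:MP : {mpoly k[n]}) * g') = cs_tp rho b (e%:MP : {mpoly k[n]}) g'.
    by rewrite -cst_mid ?mul1r //; exact: actR_const.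
  have sal : act y (act a (symv al)) = (e%:MP : {mpoly k[n]}) * act b (symv al').
    rewrite -actRM -[X in actR rho X _](mulgVK y) -bE actRM alE actR_M.
    by rewrite actR_const.
  case: cases => [->|[-> ->]|[-> ->]].
  - by rewrite F0; exact: (lat0 cT).
  - rewrite (semir sF); apply: (lat_r cT).
    have -> : F (cs1 rho a al) =
        lact (Cs_bim rho b) (e%:MP : {mpoly k[n]}) (cs1 rho b al').
      rewrite lact_cs1 /cs1 (additiveB FD) (FE (symv al)) (FE 1) alE sal (actR_1 rho y) cstC.
      exact: erefl.
    rewrite mulg1 mulgV; apply: (lat_l cT); exact: (cs_lat1 Hb bb cal').
  - rewrite (semir sF); apply: (lat_r cT).
    have -> : F (css rho a al) = lact (Cs_bim rho b) (e%:MP : {mpoly k[n]}) (css rho b al').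
      rewrite lact_css /css (additiveB FD) (FE (symv al)) (FE 1) alE (actR_1 rho y) cstC.
      exact: erefl.
    rewrite -bE; apply: (lat_l cT); exact: (cs_lats Hb bb cal').
have [F [sF lF FE]] := main D1 D2 x s t c H1 H2 D1s D2t tE cu crE.
have [G [sG lG GE]] := main D2 D1 x^-1%g t s c^-1 H2 H1 D2t D1s sE cu' crE'.
exists F, G; split; [by split | exact: sG | | |].
- by move=> w m /lG; rewrite invgK.
- apply: (semi_cancel_gens (cs_gen_span (s := s)) sF sG) => _ [f [g ->]].
  rewrite FE GE !actRK; exact: erefl.
- apply: (semi_cancel_gens (cs_gen_span (s := t)) sG sF) => _ [f [g ->]].
  rewrite GE FE !actRVK; exact: erefl.
Qed.

End Semi.

(** * Gradings of R_w, C_s and Bott-Samelson bimodules *)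

Section GradedGenerators.
Variables (W : groupType) (k : idomainType) (n : nat) (rho : rep W k n).
Local Notation R := (Rh k n).
Variables (D : rdatum W k n) (HD : gdatum rho D).

Lemma graded_Rw w : graded (Rw rho D w).
Proof.
split.
- exact: rdeg_direct.
- by move=> i j f m; exact: rdegM.
- by move=> i j f m hf hm; apply: rdegM => //; exact: actR_rdeg.
- move=> x m /Rw_lat[->|->].
    exists 1; split; first exact: den1.
    rewrite ract1; apply: (add_span_map (f := id) _ _ _ (rdeg_span m)) => // y hy.
    by apply: add_span_gen; split=> //; left.
  exists 1; split; first exact: den1.
  by rewrite ract0; exact: add_span0.
Qed.

Lemma rdeg_symv (a : 'rV[k]_n) : rdeg 2%:Z (symv a : R).
Proof. by right; exists 1%N => //; exact: symv_homog. Qed.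

Section GradedCs.
Variables (s : W) (Ds : gens D s).
Local Notation C := (Cs rho D s).
Local Notation cst := (@cs_tp W k n rho s).

Lemma rdeg_dem b f : rdeg b f -> rdeg (b - 2%:Z) (dem HD Ds f).
Proof.
move=> hf; apply: (rdeg_cancel (al_neq0 HD Ds) (rdeg_symv _)).
by rewrite demE; apply: rdegB => //; exact: actR_rdeg.
Qed.

Lemma rdeg_und a b f : rdeg b f -> rdeg b (und HD Ds a f).
Proof.
move=> hf; apply: rdegB => //; have -> : b = 2%:Z + (b - 2%:Z) by rewrite addrC subrK.
by apply: rdegM; [exact: rdeg_symv | exact: rdeg_dem].
Qed.

Lemma graded_Cs : graded C.
Proof.
have [a ca] := gd_corootP HD Ds.
have [cA [cB [AD BD AE BE tE]]] := cs_coordl HD Ds ca.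
have S := rdeg_direct k n.
have genE i (P : C -> Prop) : P 0 -> (forall x y, P x -> P y -> P (x + y)) ->
    (forall b c f g, rdeg b f -> rdeg c g -> i + 1 = b + c -> P (cst f g)) ->
    forall t : C, ldeg i t -> P t.
  move=> P0 PD Pg t; apply: add_span_ind => // _ [f [g [b [c [hf hg e ->]]]]].
  exact: (Pg b c).
have hA i (t : C) : ldeg i t -> rdeg (i + 1) (cA t).
  apply: (genE i (fun t => rdeg (i + 1) (cA t))) => [|x y|b c f g hf hg ->].
  - by rewrite (additive0 AD); left.
  - by rewrite AD; exact: (dsPD (ds_sub S)).
  - by rewrite AE; apply: rdegM => //; exact: rdeg_und.
have hB i (t : C) : ldeg i t -> rdeg (i + 1 - 2%:Z) (cB t).
  apply: (genE i (fun t => rdeg (i + 1 - 2%:Z) (cB t))) => [|x y|b c f g hf hg ->].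
  - by rewrite (additive0 BD); left.
  - by rewrite BD; exact: (dsPD (ds_sub S)).
  - by rewrite BE -addrA; apply: rdegM => //; exact: rdeg_dem.
(* The homogeneous parts of the coordinates in the left basis: i + 1 because of the grading shift of
   C_s, minus 2 for the degree of delta. *)
pose p (i : int) (t : C) : C :=
  cst (dsproj S (i + 1) (cA t)) 1 + cst (dsproj S (i + 1 - 2%:Z) (cB t)) (symv a).
have cspan (t : C) : add_span (fun t => exists i, @ldeg _ _ _ _ _ C i t) t.
  elim/cs_ind: t => [|x y|f g]; [exact: add_span0|exact: add_spanD|].
  apply: (add_span_map (f := fun f => cst f g) _ _ _ (rdeg_span f)); first exact: cst0l.
    by move=> u v; exact: cstDl.
  move=> u [b hu]; apply: (add_span_map (f := cst u) _ _ _ (rdeg_span g)); first exact: cst0r.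
    by move=> v v'; exact: cstDr.
  move=> v [c hv]; apply: add_span_gen; exists (b + c - 1); apply: add_span_gen.
  by exists u, v, b, c; rewrite subrK.
split.
- apply: (@direct_sum_of_sep _ _ _ _ _ p).
  + move=> i; split; first exact: add_span0.
    move=> x y; apply: add_spanB => _ [f [g [b [c [hf hg e ->]]]]].
    exists (- f), g, b, c; rewrite cstNl; split=> //.
    exact: (dsPN (ds_sub S)).
  + move=> i x y; rewrite /p AD BD !dsprojD !cstDl.
    exact: addrACA.
  + move=> i x hx; rewrite /p (dsprojE S (hA i x hx)) (dsprojE S (hB i x hx)) !eqxx.
    by rewrite -tE.
  + move=> i j x hx ij; rewrite /p (dsprojE S (hA i x hx)) (dsprojE S (hB i x hx)).
    rewrite (inj_eq (addIr _)) (inj_eq (addIr _)) (inj_eq (addIr _)).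
    by have -> : (j == i) = false; [apply/eqP => e; apply: ij | rewrite !cst0l addr0].
  + exact: cspan.
- move=> i j f t hf; apply: (genE j (fun t => ldeg (i + j) (lact C f t))).
  + by rewrite lact0; exact: add_span0.
  + by move=> x y hx hy; rewrite lactD; exact: add_spanD.
  + move=> b c g h hg hh e; rewrite lact_cst; apply: add_span_gen.
    by exists (f * g), h, (i + b), c; split=> //; [exact: rdegM | rewrite -!addrA e].
- move=> i j f t hf; apply: (genE j (fun t => ldeg (i + j) (ract C t f))).
  + by rewrite ract0; exact: add_span0.
  + by move=> x y hx hy; rewrite ractD; exact: add_spanD.
  + move=> b c g h hg hh e; rewrite ract_cst; apply: add_span_gen.
    exists g, (h * f), b, (c + i); split=> //; first exact: rdegM.
    by rewrite -addrA e addrC addrA.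
have ract_homog (y : C) i f w : @lat _ _ _ _ _ C w y -> ldeg i y ->
    add_span (fun y : C => lat w y /\ exists i, ldeg i y) (ract C y f).
  move=> ly hy; apply: (add_span_map (f := ract C y) _ _ _ (rdeg_span f)).
  - exact: ract_0r.
  - by move=> g h; exact: ract_Dr.
  move=> g [j hg]; apply: add_span_gen; split.
    exact: (lat_r (cs_lclosed HD Ds ca)).
  exists (j + i); apply: (genE i (fun y => ldeg (j + i) (ract C y g)) _ _ _ _ hy).
  + by rewrite ract0; exact: add_span0.
  + by move=> u v hu hv; rewrite ractD; exact: add_spanD.
  + move=> b c f' h hf' hh e; rewrite ract_cst; apply: add_span_gen.
    exists f', (h * g), b, (c + j); split=> //; first exact: rdegM.
    by rewrite -addrA e addrC addrA.
(* Both component generators have this form: polynomial degree 2, hence degree 1 after the shift. *)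
have gd1 (x y : R) : rdeg 2%:Z x -> rdeg 2%:Z y ->
    @ldeg _ _ _ _ _ C 1 (cst x 1 - cst 1 y).
  move=> hx hy; apply: add_spanB.
  - move=> _ [f [g [b [c [hf hg e ->]]]]]; exists (- f), g, b, c.
    by rewrite cstNl; split=> //; exact: (dsPN (ds_sub S)).
  - by apply: add_span_gen; exists x, 1, 2%:Z, 0; split=> //; exact: rdeg1.
  - by apply: add_span_gen; exists 1, y, 0, 2%:Z; split=> //; exact: rdeg1.
move=> w m /(cs_lat_frac HD Ds ca)[d [f [dd c]]]; exists d; split=> //.
case: c => [->|[-> ->]|[-> ->]]; first exact: add_span0.
- apply: (ract_homog _ 1); first exact: cs_lat1.
  by apply: gd1; [exact: rdeg_symv | apply: actR_rdeg; exact: rdeg_symv].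
- apply: (ract_homog _ 1); first exact: cs_lats.
  by apply: gd1; exact: rdeg_symv.
Qed.
End GradedCs.

Lemma graded_Bw (o : wset W) (L : o) u : in_exp (gens D) u -> graded (Bw rho D L u).
Proof.
elim: u L => [|s u IH] L uS; first exact: graded_Rw.
have Ds : gens D s by apply: uS; rewrite inE eqxx.
have uS' : in_exp (gens D) u by move=> t tu; apply: uS; rewrite inE tu orbT.
have gs : graded (Bs rho D L s).
  by rewrite /Bs; case: ifP => _; [exact: graded_Cs | exact: graded_Rw].
rewrite /=; case: u uS' IH uS => [|t u] uS' IH uS //.
apply: (graded_ltens HD (nice_good HD (Bs_nice HD L Ds)) (Bw_good HD _ uS') gs).
exact: IH.
Qed.

End GradedGenerators.

(** * Finite sums of Bott-Samelson bimodules *)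

Section Closure.
Variables (W : groupType) (k : idomainType) (n : nat) (rho : rep W k n).
Variables (D : rdatum W k n) (HD : gdatum rho D) (o : wset W).
Local Notation lbim := (lbim rho D).
Implicit Types (L : o) (M N P : lbim).

(** The notion [is_direct_sum] over any finite type, so that products and sums of index types need
    no reindexing until the end. *)
Definition fin_dsum (J : finType) M (X : J -> lbim) : Prop :=
  exists (inc : forall j, bhom (X j) M) (pro : forall j, bhom M (X j)),
  [/\ forall j, is_mor (inc j) /\ is_mor (pro j),
      forall j x, pro j (inc j x) = x,
      forall i j x, i <> j -> pro j (inc i x) = 0
    & forall m, m = \sum_j inc j (pro j m)].

Lemma fin_dsum_enum (J : finType) M (X : J -> lbim) : fin_dsum M X ->
  is_direct_sum M (fun i : 'I_#|J| => X (enum_val i)).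
Proof.
case=> inc [pro [H1 H2 H3 H4]].
exists (fun i => inc (enum_val i)), (fun i => pro (enum_val i)); split=> //.
  by move=> i j x ij; apply: H3 => /enum_val_inj.
move=> m; rewrite [LHS]H4.
by rewrite (reindex (@enum_val _ J)) //=; apply: onW_bij; exact: enum_val_bij.
Qed.

Lemma fin_dsum_iso (J : finType) M (X Y : J -> lbim) : fin_dsum M X ->
  (forall j, iso_C (X j) (Y j)) -> fin_dsum M Y.
Proof.
case=> inc [pro [H1 H2 H3 H4]] I.
pose f j := sval (cid (I j)); pose g j := sval (cid (svalP (cid (I j)))).
have fg j : [/\ is_mor (f j), is_mor (g j), cancel (f j) (g j) & cancel (g j) (f j)].
  exact: (svalP (cid (svalP (cid (I j))))).
exists (fun j => bcomp (g j) (inc j)), (fun j => bcomp (pro j) (f j)); split.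
- by move=> j; have [? ?] := H1 j; have [? ? _ _] := fg j; split; exact: is_mor_comp.
- by move=> j x; rewrite !bcompE H2; have [_ _ _ ->] := fg j.
- by move=> i j x ij; rewrite !bcompE H3 // bhom0.
- by move=> m; rewrite [LHS]H4; apply: eq_bigr => j _; rewrite !bcompE; have [_ _ -> _] := fg j.
Qed.

Lemma fin_dsum_ltens (J K : finType) M N (X : J -> lbim) (Y : K -> lbim) :
  fin_dsum M X -> fin_dsum N Y ->
  fin_dsum (ltens M N) (fun jk : J * K => ltens (X jk.1) (Y jk.2)).
Proof.
case=> inc [pro [H1 H2 H3 H4]] [inc' [pro' [H1' H2' H3' H4']]].
exists (fun jk => thom (inc jk.1) (inc' jk.2)), (fun jk => thom (pro jk.1) (pro' jk.2)); split.
- move=> [j l]; have [? ?] := H1 j; have [? ?] := H1' l.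
  by split; exact: is_mor_thom.
- move=> [j l] x; rewrite -[LHS]bcompE -thom_comp -[RHS]/(bid _ x) -thom_id.
  by congr (bfun (thom _ _) x); apply: bhom_ext => y; [exact: H2 | exact: H2'].
- move=> [i l] [j l'] x ne; rewrite -[LHS]bcompE -thom_comp.
  elim/tb_ind: x => [|x y Hx Hy|m p]; first exact: bhom0.
    by rewrite (bhomD (bhomP (thom _ _))) Hx Hy addr0.
  rewrite thomE !bcompE; have [ij|ij] := pselect (i = j); last by rewrite [X in tp X _]H3 // tp0l.
  have ll : l <> l' by move=> e; apply: ne; rewrite ij e.
  by rewrite [X in tp _ X]H3' // tp0r.
- elim/tb_ind => [|x y Hx Hy|m p].
  + by rewrite big1 // => j _; rewrite !bhom0.
  + rewrite {1}Hx {1}Hy -big_split; apply: eq_bigr => j _.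
    by rewrite (bhomD (bhomP (thom (pro _) _))) (bhomD (bhomP (thom (inc _) _))).
  + rewrite {1}[m]H4 tp_suml {1}[p]H4'.
    rewrite -(pair_bigA _ (fun j l => thom (inc j) (inc' l) (thom (pro j) (pro' l) (tp m p)))).
    apply: eq_bigr => j _; rewrite tp_sumr; apply: eq_bigr => l _.
    rewrite -[RHS]/(thom (inc j) (inc' l) (thom (pro j) (pro' l) (tp m p))) !thomE.
    exact: erefl.
Qed.

(* [in_A] and [in_Ao] are the cases [wactw L u = L'] and [Wo S L (wprod u)] of [Pw u]. *)
Definition in_AP L L' (Pw : seq W -> Prop) M : Prop :=
  in_C L L' M /\
  exists (d : nat) (us : 'I_d -> seq W),
    (forall i, in_exp (gens D) (us i) /\ Pw (us i)) /\
    is_direct_sum M (fun i => Bw rho D L (us i)).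

Section InAP.
Variables (L L' : o) (Pw : seq W -> Prop).
Hypothesis PwL : forall u, Pw u -> wactw L u = L'.

Lemma in_AP_good M : in_AP L L' Pw M -> good L L' M.
Proof.
case=> inM [d [us [uP [inc [pro [H1 H2 H3 H4]]]]]].
apply: (good_dsum (X := fun i => Bw rho D L (us i)) (inc := inc) (pro := pro)).
- by move=> j; case: (H1 j).
- by move=> j; case: (H1 j).
- exact: H4.
- by move=> j; have [uS /PwL <-] := uP j; exact: Bw_good.
- by split; [case: (inC_sum inM) | exact: (inC_lact inM) | exact: (inC_ract inM)].
Qed.

Lemma in_AP_graded M : in_AP L L' Pw M -> graded M.
Proof.
move=> iM; have gM := in_AP_good iM; case: iM => inM _.
by have [] := (in_CE HD L L' (g_fg gM)).1 inM.
Qed.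

Lemma in_AP_intro M (J : finType) (us : J -> seq W) :
  graded M -> lclosed M -> (forall j, in_exp (gens D) (us j) /\ Pw (us j)) ->
  fin_dsum M (fun j => Bw rho D L (us j)) -> in_AP L L' Pw M.
Proof.
move=> rM cM uP sM.
have gM : good L L' M.
  case: sM => inc [pro [H1 H2 H3 H4]].
  apply: (good_dsum (X := fun i => Bw rho D L (us i)) (inc := inc) (pro := pro)) => //.
  - by move=> j; case: (H1 j).
  - by move=> j; case: (H1 j).
  - by move=> j; have [uS /PwL <-] := uP j; exact: Bw_good.
split; first exact: (in_CE HD L L' (g_fg gM)).2.
exists #|J|, (fun i => us (enum_val i)); split=> //; exact: (fin_dsum_enum (X := fun j => Bw rho D L (us j)) sM).
Qed.

Lemma in_AP_Bw u : in_exp (gens D) u -> Pw u -> in_AP L L' Pw (Bw rho D L u).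
Proof.
move=> uS Pu; apply: (@in_AP_intro _ unit (fun _ => u)) => //.
- exact: graded_Bw.
- exact: (good_cl (Bw_good HD L uS)).
exists (fun _ => bid _), (fun _ => bid _); split=> //.
- by move=> _; split; exact: is_mor_id.
- by move=> [] [].
- by move=> m; rewrite (big_pred1 tt) // => -[].
Qed.

End InAP.

Lemma iso_C_refl M : iso_C M M.
Proof. by exists (bid M), (bid M); split=> //; exact: is_mor_id. Qed.

(** [Bw] puts no unit factor after the last letter, so an empty word calls for a unitor; otherwise
    the definition or the associator with induction suffices. *)
Lemma Bw_cat L u v : in_exp (gens D) u -> in_exp (gens D) v ->
  iso_C (ltens (Bw rho D L u) (Bw rho D (wactw L u) v)) (Bw rho D L (u ++ v)).
Proof.
move=> uS vS; elim: u L uS => [|s u IH] L uS.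
  have cB := good_cl (Bw_good HD L vS).
  exists (lun rho D _), (lun' (Bw rho D L v)); split.
  - exact: is_mor_lun.
  - exact: is_mor_lun'.
  - by move=> x; rewrite -bcompE lunK.
  - by move=> x; rewrite -bcompE lun'K.
have Ds : gens D s by apply: uS; rewrite inE eqxx.
have uS' : in_exp (gens D) u by move=> t tu; apply: uS; rewrite inE tu orbT.
have gs := nice_good HD (Bs_nice HD L Ds).
case: u uS uS' IH => [|t u] uS uS' IH.
  case: v vS {IH} => [|r v] vS; last exact: iso_C_refl.
  have cB := good_cl gs.
  exists (run rho D _), (run' (Bs rho D L s)); split.
  - exact: is_mor_run.
  - exact: is_mor_run'.
  - by move=> x; rewrite -bcompE runK.
  - by move=> x; rewrite -bcompE run'K.
have [f [g [fm gm fK gK]]] := IH (wact L s) uS'.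
have gu := Bw_good HD (wact L s) uS'; have gv := Bw_good HD (wactw (wact L s) (t :: u)) vS.
exists (bcomp (tassoc (Bs rho D L s) (Bw rho D (wact L s) (t :: u)) (Bw rho D (wactw (wact L s) (t :: u)) v)) (thom (bid _) f)),
  (bcomp (thom (bid _) g) (tassoc' _ _ _)); split.
- have h := is_mor_thom (@is_mor_id _ _ _ _ _ (Bs rho D L s)) fm.
  exact: (is_mor_comp (is_mor_assoc HD gs gu gv) h).
- have h := is_mor_thom (@is_mor_id _ _ _ _ _ (Bs rho D L s)) gm.
  exact: (is_mor_comp h (is_mor_assoc' HD gs gu gv)).
- move=> x; rewrite -[RHS]/(bid _ x) -[LHS]bcompE; congr (bfun _ x).
  apply: tb_hom_ext3 => m p q.
  by rewrite !bcompE tassocE !thomE [X in tp _ X]fK tassoc'E.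
- move=> x; rewrite -[RHS]/(bid _ x) -[LHS]bcompE; congr (bfun _ x).
  apply: tb_hom_ext => m y; rewrite !bcompE thomE.
  have -> : forall z, tassoc (Bs rho D L s) (Bw rho D (wact L s) (t :: u))
      (Bw rho D (wactw (wact L s) (t :: u)) v) (tassoc' _ _ _ z) = z.
    by move=> z; rewrite -bcompE tassoc'K.
  by rewrite thomE [X in tp _ X]gK.
Qed.

Lemma in_AP_ltens L1 L2 L3 (P1 P2 P3 : seq W -> Prop) M N :
  (forall u, P1 u -> wactw L1 u = L2) -> (forall u, P2 u -> wactw L2 u = L3) ->
  (forall u, P3 u -> wactw L1 u = L3) ->
  (forall u v, in_exp (gens D) u -> in_exp (gens D) v -> P1 u -> P2 v -> P3 (u ++ v)) ->
  in_AP L1 L2 P1 M -> in_AP L2 L3 P2 N -> in_AP L1 L3 P3 (ltens M N).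
Proof.
move=> H1 H2 H3 H12 iM iN.
have gM := in_AP_good H1 iM; have gN := in_AP_good H2 iN.
have rT := graded_ltens HD gM gN (in_AP_graded H1 iM) (in_AP_graded H2 iN).
have [_ [d [us [uP sM]]]] := iM; have [_ [e [vs [vP sN]]]] := iN.
apply: (@in_AP_intro _ _ _ H3 _ ('I_d * 'I_e)%type (fun ij => us ij.1 ++ vs ij.2)).
- exact: rT.
- exact: (ltens_lclosed N (good_cl gM)).
- move=> [i j] /=; have [uS uu] := uP i; have [vS vv] := vP j.
  by split; [exact/in_exp_cat | exact: H12].
apply: (fin_dsum_iso (fin_dsum_ltens sM sN)) => -[i j] /=.
have [uS uu] := uP i; have [vS vv] := vP j.
by rewrite -(H1 _ uu); exact: Bw_cat.
Qed.

Section IsMorOfGood.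
Variables (L1 L2 L3 L4 : o) (M N P : lbim).

End IsMorOfGood.

Lemma bim_bicategory (X : Type) : is_bicategory (bim_bicat rho D X).
Proof.
split=> /=.
- by move=> *; exact: bhom_ext.
- by move=> *; exact: bhom_ext.
- by move=> *; exact: bhom_ext.
- by move=> *; exact: thom_id.
- by move=> *; exact: thom_comp.
- move=> a b c d f f' g g' h h' x y z; apply: tb_hom_ext3 => m p q.
  by rewrite !bcompE tassocE !thomE tassocE.
- move=> a b f f' x; apply: tb_hom_ext => c m.
  by rewrite !bcompE thomE !lunE (bhoml (bhomP x)).
- move=> a b f f' x; apply: tb_hom_ext => m c.
  by rewrite !bcompE thomE !runE (bhomr (bhomP x)).
- move=> a b c d f g h; exists (tassoc' f g h); split; [exact: tassocK|exact: tassoc'K].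
- move=> a b f; exists (lun' f); split; [exact: lunK|exact: lun'K].
- move=> a b f; exists (run' f); split; [exact: runK|exact: run'K].
- move=> a b c d e f g h i; apply: bhom_ext => t.
  elim/tb_ind: t => [|x y Hx Hy|t q]; first by rewrite !bhom0.
    by rewrite (bhomD (bhomP (bcomp _ _))) Hx Hy (bhomD (bhomP (bcomp _ _))).
  elim/tb_ind: t => [|x y Hx Hy|t p]; first by rewrite tp0l !bhom0.
    by rewrite tpDl (bhomD (bhomP (bcomp _ _))) Hx Hy (bhomD (bhomP (bcomp _ _))).
  elim/tb_ind: t => [|x y Hx Hy|m r]; first by rewrite !tp0l !bhom0.
    by rewrite !tpDl (bhomD (bhomP (bcomp _ _))) Hx Hy (bhomD (bhomP (bcomp _ _))).
  by rewrite !bcompE !tassocE !thomE !tassocE !thomE tassocE.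
- move=> a b c f g; apply: tb_hom_ext3 => m z p.
  by rewrite !bcompE tassocE !thomE runE lunE tp_mid.
Qed.

End Closure.

Local Close Scope ring_scope.

(** * Blocks of a Coxeter system *)

Section Words.
Variables (W : groupType) (S : W -> Prop) (o : wset W).
Implicit Types (u v : seq W) (w x y s t : W) (L : o).
Local Open Scope group_scope.

Lemma wactw_cat L u v : wactw L (u ++ v) = wactw (wactw L u) v.
Proof. exact: foldl_cat. Qed.

Lemma gen_reduced w : gen S w -> exists u, reduced S u w.
Proof.
case=> u uw; pose P m := `[< exists v, expresses S v w /\ size v = m >].
have exP : exists m, P m by exists (size u); apply/asboolP; exists u.
case: (ex_minnP exP) => m /asboolP[v [vw vm]] mmin; exists v; split=> // v' v'w.
by rewrite vm; apply: mmin; apply/asboolP; exists v'.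
Qed.

(** The reflection sequence of a word, conjugated by x: position i contributes s_1 ... s_(i-1) s_i
    (s_1 ... s_(i-1))^-1. *)
Fixpoint tseq x u : seq W :=
  if u is s :: u' then (x * s * x^-1) :: tseq (x * s) u' else [::].

Lemma tseq_cat x u v : tseq x (u ++ v) = tseq x u ++ tseq (x * wprod u) v.
Proof.
elim: u x => [|s u IH] x /=; first by rewrite mulg1.
by rewrite IH mulgA.
Qed.

Lemma mem_tseq x u t : t \in tseq x u -> exists u1 s u2,
  u = u1 ++ s :: u2 /\ t = x * wprod u1 * s * (x * wprod u1)^-1.
Proof.
elim: u x => [|s u IH] x //=; rewrite inE => /orP[/eqP ->|/IH[u1 [r [u2 [-> ->]]]]].
  by exists [::], s, u; rewrite /= mulg1.
by exists (s :: u1), r, u2; rewrite /= !mulgA.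
Qed.

(** A position is in K exactly when its reflection fixes L, which turns the size of K into a count
    of reflections. *)
Lemma count_Kmask L x u :
  count id (Kmask (wact L x) u) = count (fun t => wact L t == L) (tseq x u).
Proof.
elim: u x => [|s u IH] x //=; rewrite -wactM IH; congr (_ + _)%N.
congr (nat_of_bool _); rewrite !wactM; apply/eqP/eqP => [->|H].
  by rewrite -wactM mulgV wact1.
by have := congr1 (fun M => wact M x) H; rewrite -wactM mulVg wact1.
Qed.

Lemma bword_noK L u : count id (Kmask L u) = 0 -> bword L u = wprod u.
Proof.
rewrite /bword; elim: u L => [|s u IH] L //=.
by case: eqP => //= _ /IH ->.
Qed.

Lemma bword_cons L s u :
  bword L (s :: u) = (if wact L s == L then 1 else s) * bword (wact L s) u.
Proof. by rewrite /bword /=; case: eqP => //= _; rewrite mul1g. Qed.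

Lemma bword_nil L : bword L [::] = 1. Proof. by []. Qed.

(** The second case provides a letter of K at which a relation can be cut and rotated. *)
Lemma bword_split L u : bword L u = wprod u \/ exists u1 c u2,
  u = u1 ++ c :: u2 /\ wact (wactw L u1) c = wactw L u1.
Proof.
elim: u L => [|s u IH] L; first by left.
case: (eqVneq (wact L s) L) => Ls; first by right; exists [::], s, u.
case: (IH (wact L s)) => [e|[u1 [c [u2 [-> H]]]]]; last first.
  by right; exists (s :: u1), c, u2.
by left; rewrite bword_cons (negbTE Ls) e.
Qed.

Lemma count1_split L u : count id (Kmask L u) = 1%N -> exists u1 s u2,
  [/\ u = u1 ++ s :: u2, count id (Kmask L u1) = 0,
      wact (wactw L u1) s = wactw L u1 & count id (Kmask (wactw L u1) u2) = 0].
Proof.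
elim: u L => [|s u IH] L //=; case: eqP => Ls /= K.
  by exists [::], s, u; split=> //=; move: K; rewrite Ls; case.
have [u1 [r [u2 [-> H1 H2 H3]]]] := IH _ K.
by exists (s :: u1), r, u2; split=> //=; case: eqP.
Qed.

Section Involutions.
Hypothesis Sinv : forall s, S s -> s * s = 1.

Let in_exp_cons s u : in_exp S (s :: u) -> S s /\ in_exp S u.
Proof.
move=> H; split; first by apply: H; rewrite inE eqxx.
by move=> t tu; apply: H; rewrite inE tu orbT.
Qed.

Lemma wactw_rev L u : in_exp S u -> wactw (wactw L u) (rev u) = L.
Proof.
by move=> uS; rewrite -!wact_wprod (wprod_rev Sinv uS) -wactM mulgV wact1.
Qed.

Lemma bword_rev L u : in_exp S u -> bword (wactw L u) (rev u) = (bword L u)^-1.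
Proof.
elim: u L => [|s u IH] L; first by rewrite /= !bword_nil invg1.
case/in_exp_cons => Ss uS; rewrite rev_cons -cats1 bword_cat /= IH //.
rewrite wactw_rev // !bword_cons bword_nil mulg1 -wactM Sinv // wact1 invgM eq_sym.
by case: eqP => _; rewrite ?invg1 // (invol_inv Sinv Ss).
Qed.

Lemma count_Krev L u : in_exp S u ->
  count id (Kmask (wactw L u) (rev u)) = count id (Kmask L u).
Proof.
elim: u L => [|s u IH] L //; case/in_exp_cons => Ss uS.
rewrite rev_cons -cats1 Kmask_cat count_cat /= IH // wactw_rev //.
by rewrite -wactM Sinv // wact1 addn0 addnC eq_sym.
Qed.

Fixpoint alt s t k : seq W := if k is k'.+1 then s :: alt t s k' else [::].

Lemma size_alt s t k : size (alt s t k) = k.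
Proof. by elim: k s t => //= k IH s t; rewrite IH. Qed.
Lemma alt_add s t a b :
  alt s t (a + b) = alt s t a ++ (if odd a then alt t s b else alt s t b).
Proof. by elim: a s t => //= a IH s t; rewrite IH; case: (odd a). Qed.
Lemma flatten_alt s t m : flatten (nseq m [:: s; t]) = alt s t (m + m).
Proof. by elim: m => //= m IH; rewrite IH addnS. Qed.
Lemma rev_alt s t k : rev (alt s t k) = if odd k then alt s t k else alt t s k.
Proof.
elim: k s t => [//|k IH] s t; rewrite -[LHS]/(rev (s :: alt t s k)) rev_cons IH -cats1.
by rewrite oddS; case ok: (odd k); rewrite -(addn1 k) /= alt_add ok.
Qed.
Lemma alt_palindrome s t j :
  alt s t (j + j).+1 = alt s t j ++ (if odd j then t else s) :: rev (alt s t j).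
Proof.
by rewrite -addnS alt_add rev_alt; case: (odd j).
Qed.

Lemma in_exp_alt s t k : S s -> S t -> in_exp S (alt s t k).
Proof.
elim: k s t => [|k IH] s t Ss St //= r; rewrite inE => /orP[/eqP->//|]; exact: IH.
Qed.

(** The first letter drops out. The rest is a palindrome X c X^-1 that fixes L, so c fixes the
    parameter reached after X and drops out as well; the contributions of X and its reverse
    cancel. *)
Lemma bword_alt_fixed L s t j : S s -> S t -> wact L s = L ->
  wactw L (alt s t (j.+1 + j.+1)) = L -> bword L (alt s t (j.+1 + j.+1)) = 1.
Proof.
move=> Ss St Ls; rewrite addSn addnS; pose A := alt t s (j + j).+1.
rewrite -[alt s t _]/(s :: A) -[wactw L (s :: A)]/(wactw (wact L s) A) Ls => LA.
rewrite bword_cons Ls eqxx mul1g; have E : A = _ := alt_palindrome t s j.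
set c := if odd j then s else t in E; pose X := alt t s j.
have XS : in_exp S X by exact: in_exp_alt.
rewrite E -/X bword_cat bword_cons.
have cX : wact (wactw L X) c = wactw L X.
  have := congr1 (fun M => wactw M X) LA.
  rewrite E -/X wactw_cat /= -wactw_cat -wact_wprod wprod_cat (wprod_rev Sinv XS).
  by rewrite mulVg wact1.
by rewrite cX eqxx mul1g bword_rev // mulgV.
Qed.

(** If b_L is not the plain product, some letter is in K, and the word is rotated to start with it.
    As the word acts trivially on parameters, rotation only conjugates the value of b. *)
Lemma bword_alt L s t m : S s -> S t -> (0 < m)%N -> wprod (alt s t (m + m)) = 1 ->
  bword L (alt s t (m + m)) = 1.
Proof.
move=> Ss St m0 P1; case: (bword_split L (alt s t (m + m))) => [->//|].
case=> u1 [c [u2 [e Lc]]]; pose a := size u1.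
have am : (a < m + m)%N.
  by rewrite -[X in (_ < X)%N](size_alt s t) e size_cat /= -addSnnS leq_addr.
have LP : wactw L (alt s t (m + m)) = L by rewrite -wact_wprod P1 wact1.
have e2 : alt s t (m + m) = alt s t a ++ (if odd a then alt t s (m + m - a) else alt s t (m + m - a)).
  by rewrite -alt_add subnKC // ltnW.
have [u1E cE] : u1 = alt s t a /\ c :: u2 = if odd a then alt t s (m + m - a) else alt s t (m + m - a).
  have := e2; rewrite {1}e => /eqP; rewrite eqseq_cat ?size_alt // => /andP[/eqP-> /eqP->].
  by split; rewrite ?size_alt.
pose s' := if odd a then t else s; pose t' := if odd a then s else t.
have cE' : c :: u2 = alt s' t' (m + m - a) by rewrite cE /s' /t'; case: (odd a).
have cs : c = s' by move: cE'; rewrite -(subnSK am) => -[].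
(* An alternating word of even length stays alternating under rotation; the two letters are
   exchanged when the cut is at an odd place. *)
have rot : (c :: u2) ++ u1 = alt s' t' (m + m).
  rewrite cE' u1E -{2}(subnK (ltnW am)) alt_add; congr (_ ++ _).
  rewrite oddB ?(ltnW am) // oddD addbb /= /s' /t'.
  by case: (odd a).
have Ss' : S s' by rewrite /s'; case: odd.
have St' : S t' by rewrite /t'; case: odd.
have L0L : wactw (wactw L u1) (c :: u2) = L by rewrite -wactw_cat -e.
have Q1 : bword (wactw L u1) ((c :: u2) ++ u1) = 1.
  case: m m0 rot {P1 e am LP e2 u1E cE cE'} => [//|j] _ rot.
  rewrite rot; apply: bword_alt_fixed => //; first by rewrite -cs.
  by rewrite -rot wactw_cat L0L.
rewrite e bword_cat; move: Q1; rewrite bword_cat L0L => Q1.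
apply: (@mulgI _ (bword (wactw L u1) (c :: u2))).
by rewrite mulgA Q1 mul1g mulg1.
Qed.

(** Along a relation the reflections are the (st)^j s, up to conjugation. When (st)^m = 1 the second
    half repeats the first, so each occurs an even number of times. *)
Lemma tseq_alt y s t i m : S s -> S t ->
  tseq (y * (s * t) ^+ i) (alt s t (m + m))
  = [seq y * (s * t) ^+ j * s * y^-1 | j <- iota (i + i) (m + m)].
Proof.
move=> Ss St; have sV := invol_inv Sinv Ss; have tV := invol_inv Sinv St.
have sw j : s * ((s * t) ^+ j)^-1 = (s * t) ^+ j * s.
  elim: j => [|j IH]; first by rewrite expg0 invg1 mul1g mulg1.
  rewrite {1}expgSr [(_ ^+ j * _)^-1]invgM [(s * t)^-1]invgM sV tV.
  transitivity (s * t * (s * ((s * t) ^+ j)^-1)); first by rewrite !mulgA.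
  by rewrite IH expgS !mulgA.
elim: m i => [|m IH] i //; rewrite addSn addnS /=.
congr [:: _, _ & _].
- rewrite invgM !mulgA; congr (_ * _); rewrite -!mulgA sw.
  by rewrite expgnDr !mulgA.
- transitivity (y * ((s * t) ^+ i * (s * t) * (s * ((s * t) ^+ i)^-1)) * y^-1).
    by rewrite !invgM sV !mulgA.
  by rewrite sw -addnS expgnDr expgS !mulgA.
- have -> : y * (s * t) ^+ i * s * t = y * (s * t) ^+ i.+1 by rewrite expgSr !mulgA.
  by rewrite IH addSn addnS.
Qed.

(** Four invariants of a word modulo the relations, checked on the insertion of one relation. The
    parity of the multiplicities of reflections is what later compares K on two expressions of one
    element. *)
Lemma cox_inv u v : cox_eq S u v ->
  [/\ wprod u = wprod v, odd (size u) = odd (size v),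
      forall x t, odd (count_mem t (tseq x u)) = odd (count_mem t (tseq x v))
    & forall L, bword L u = bword L v].
Proof.
elim=> [//|u' v' _ [-> -> H1 H2]|u' v' w' _ [-> -> H1 H2] _ [-> -> H3 H4]|
  u' v' s t m Ss St [m0 stm _]].
- by split=> //.
- by split=> // [x t|L]; rewrite ?H1 ?H2.
have P1 : wprod (alt s t (m + m)) = 1.
  rewrite -flatten_alt -stm; elim: (m) => [|j IH]; first by rewrite expg0.
  by rewrite expgS /= IH mulgA.
rewrite flatten_alt; split.
- by rewrite !wprod_cat P1 mul1g.
- by rewrite !size_cat size_alt !oddD addbb.
- move=> x r; rewrite !tseq_cat P1 mulg1 !count_cat !oddD.
  suff -> : odd (count_mem r (tseq (x * wprod u') (alt s t (m + m)))) = false by [].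
  have := tseq_alt (x * wprod u') 0 m Ss St; rewrite expg0 mulg1 => ->.
  rewrite addn0 iotaD map_cat count_cat add0n.
  have -> : [seq x * wprod u' * (s * t) ^+ j * s * (x * wprod u')^-1 | j <- iota m m]
    = [seq x * wprod u' * (s * t) ^+ j * s * (x * wprod u')^-1 | j <- iota 0 m].
    rewrite -{1}[m]addn0 iotaDl -map_comp; apply: eq_map => j /=.
    by rewrite expgnDr stm mul1g.
  by rewrite oddD addbb.
- move=> L; rewrite !bword_cat bword_alt // mul1g.
  by rewrite -[wactw _ (alt _ _ _)]wact_wprod P1 wact1.
Qed.

End Involutions.
End Words.

(** * Invariants of words and the endoscopic reflections *)

Section CoxeterSystem.
Variables (W : groupType) (S : W -> Prop) (o : wset W).
Hypothesis HS : coxeter_system S.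
Implicit Types (u v : seq W) (w x y s t : W) (L : o).
Local Open Scope group_scope.

Lemma cox_ord s : S s -> s * s = 1 /\ s <> 1.
Proof.
case: HS => H _ _ /H[_ ss /(_ 1%N isT)]; rewrite expg1 => s1.
by split=> //; rewrite -expg2.
Qed.
Lemma cox_sinv s : S s -> s * s = 1. Proof. by case/cox_ord. Qed.
Lemma cox_gen w : gen S w. Proof. by case: HS. Qed.

Lemma cox_words u v : in_exp S u -> in_exp S v -> wprod u = wprod v ->
  cox_eq S (u ++ rev v) [::].
Proof.
move=> uS vS e; case: HS => _ _; apply.
  by apply/in_exp_cat; split=> //; exact: in_exp_rev.
by rewrite wprod_cat (wprod_rev cox_sinv vS) e mulgV.
Qed.

Lemma cox_parity u v : in_exp S u -> in_exp S v -> wprod u = wprod v ->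
  odd (size u) = odd (size v).
Proof.
move=> uS vS /(cox_words uS vS)/(cox_inv o cox_sinv)[_ + _ _].
by rewrite size_cat size_rev oddD /=; case: (odd _); case: (odd _).
Qed.

Lemma cox_bword L u v : in_exp S u -> in_exp S v -> wprod u = wprod v ->
  bword L u = bword L v.
Proof.
move=> uS vS e; have [_ _ _ /(_ L)] := cox_inv o cox_sinv (cox_words uS vS e).
rewrite bword_cat -wact_wprod e wact_wprod (bword_rev cox_sinv) //.
rewrite bword_nil => H; apply: (@mulIg _ (bword L v)^-1).
by rewrite H mulgV.
Qed.

Lemma bval_uniq L w x y : bval S L w x -> bval S L w y -> x = y.
Proof. by case=> u [[uS uw] <-] [v [[vS vw] <-]]; apply: cox_bword => //; rewrite uw vw. Qed.

Lemma cox_tseq u v t : in_exp S u -> in_exp S v -> wprod u = wprod v ->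
  odd (count_mem t (tseq 1 u)) = odd (count_mem t (tseq 1 v)).
Proof.
move=> uS vS e.
have [_ _ /(_ 1 t) + _] := cox_inv o cox_sinv (cox_words uS vS e).
(* The contribution of the reversed word is not computed: it is eliminated against the same identity
   for v followed by its own reverse. *)
have [_ _ /(_ 1 t) + _] := cox_inv o cox_sinv (cox_words vS vS erefl).
rewrite !tseq_cat !mul1g e !count_cat !oddD /=.
by case: (odd (count_mem t (tseq 1 u))); case: (odd (count_mem t (tseq 1 v)));
  case: (odd _).
Qed.

(** If two positions gave the same reflection, both letters could be deleted without changing the
    product. *)
Lemma reduced_uniq u w : reduced S u w -> uniq (tseq 1 u).
Proof.
case=> -[uS uw] umin; apply: contrapT => /negP.
suff H x v : ~~ uniq (tseq x v) -> exists v1 s v2 r v3,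
    v = v1 ++ s :: v2 ++ r :: v3 /\ s * wprod v2 * r * (s * wprod v2)^-1 = s.
  case/H => v1 [s [v2 [r [v3 [e H1]]]]].
  have uS' : in_exp S (v1 ++ v2 ++ v3).
    move=> t tv; apply: uS; rewrite e !(mem_cat, inE).
    by move: tv; rewrite !mem_cat => /or3P[]->; rewrite ?orbT.
  have ss : s * s = 1 by apply/cox_sinv/uS; rewrite e mem_cat inE eqxx orbT.
  have yr : wprod v2 * r = s * wprod v2.
    by apply: (@mulgI _ s); rewrite mulgA -[LHS](mulgVK (s * wprod v2)) H1.
  have ew : expresses S (v1 ++ v2 ++ v3) w.
    split=> //; rewrite -uw e !wprod_cat /= !wprod_cat /=; congr (_ * _).
    by rewrite !mulgA -(mulgA s) yr !mulgA ss mul1g.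
  have := umin _ ew; rewrite e !size_cat /= !size_cat /= leq_add2l addnS => /ltnW.
  by rewrite ltnn.
elim: v x => [//|s v IH] x /=; rewrite negb_and negbK => /orP[/mem_tseq|/IH].
  case=> v1 [r [v2 [-> e]]]; exists [::], s, v1, r, v2; split=> //.
  by apply: (@mulgI _ x); apply: (@mulIg _ x^-1); rewrite e !invgM !mulgA.
by case=> v1 [t [v2 [r [v3 [-> H]]]]]; exists (s :: v1), t, v2, r, v3.
Qed.

(** A single position of u has a reflection b fixing L. Multiplicities agree modulo 2 and are at
    most 1 in a reduced word, so b is also the only such reflection for r. *)
Lemma reduced_count1 L u r w : in_exp S u -> reduced S r w -> wprod u = w ->
  count id (Kmask L u) = 1%N -> count id (Kmask L r) = 1%N.
Proof.
move=> uS rr uw; have [[rS rw] _] := rr; have ur := reduced_uniq rr.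
have := count_Kmask L 1 u; have := count_Kmask L 1 r; rewrite wact1 => -> ->.
pose fx t := wact L t == L; rewrite -!size_filter -/fx => u1.
have [b bE] : exists b, filter fx (tseq 1 u) = [:: b].
  by case: (filter fx _) u1 => [|b [|c l]] // _; exists b.
have ctE t v : fx t -> count_mem t (tseq 1 v) = count_mem t (filter fx (tseq 1 v)).
  move=> ft; rewrite count_filter; apply: eq_count => z /=.
  by case: eqP => // ->; rewrite ft.
have fb : fx b.
  by have : b \in filter fx (tseq 1 u); [rewrite bE inE | rewrite mem_filter => /andP[]].
have odd_t t : odd (count_mem t (tseq 1 r)) = odd (count_mem t (tseq 1 u)).
  by apply: cox_tseq => //; rewrite uw rw.
have uA : uniq (filter fx (tseq 1 r)) by exact: filter_uniq.
suff -> : size (filter fx (tseq 1 r)) = size [:: b] by [].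
apply/perm_size/uniq_perm => // t; rewrite inE.
apply/idP/eqP => [tA|->].
  have ft : fx t by move: tA; rewrite mem_filter => /andP[].
  have := odd_t t; rewrite !ctE // bE count_uniq_mem // tA /= addn0.
  by case: eqP.
have := odd_t b; rewrite !ctE // bE count_uniq_mem //= eqxx.
by case: (b \in _).
Qed.

Definition noK L u := count id (Kmask L u) = 0.

(** Deleting the letters of K leaves the visited parameters unchanged, so what remains has empty
    K. *)
Lemma block_word L L' (v : W) : is_block_value S L L' v -> exists p,
  [/\ in_exp S p, wprod p = v, wactw L p = L' & noK L p].
Proof.
case=> w [Lw [u [[uS uw] uv]]]; exists (mask (map negb (Kmask L u)) u).
have E u' L0 : wactw L0 (mask (map negb (Kmask L0 u')) u') = wactw L0 u' /\
    noK L0 (mask (map negb (Kmask L0 u')) u').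
  rewrite /noK; elim: u' L0 => [|s u' IH] L0 //=.
  case: eqP => [Ls|/eqP/negbTE Ls] /=; first by rewrite Ls; exact: IH.
  by rewrite Ls; exact: IH.
have [E1 E2] := E u L; split=> //.
- by move=> s /mem_mask /uS.
- by rewrite E1 -wact_wprod uw.
Qed.

Lemma word_block L p : in_exp S p -> noK L p ->
  is_block_value S L (wactw L p) (wprod p).
Proof.
move=> pS pK; exists (wprod p); split; first exact: wact_wprod.
by exists p; split=> //; exact: bword_noK.
Qed.

Lemma So_fix L t : So S L t -> wact L t = L.
Proof. by case=> -[]. Qed.

Lemma word_So L u : in_exp S u -> count id (Kmask L u) = 1%N -> bword L u = 1 ->
  wactw L u = L -> So S L (wprod u).
Proof.
move=> uS u1 ub uL; split.
  by split; [rewrite wact_wprod | exists u].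
have [r rr] := gen_reduced (cox_gen (wprod u)); exists r; split=> //.
exact: reduced_count1 rr erefl u1.
Qed.

Lemma So_letter L s : S s -> wact L s = L -> So S L s.
Proof.
move=> Ss Ls; rewrite -[s]mulg1 -[s * 1]/(wprod [:: s]); apply: word_So => //=.
- by move=> t; rewrite inE => /eqP->.
- by rewrite Ls eqxx.
- by rewrite bword_cons Ls eqxx mul1g.
Qed.

(** Since b_L(t) = 1, the parts around the letter in K have trivial product; this exhibits t as a
    conjugate of s. *)
Lemma So_word L t u : So S L t -> reduced S u t -> exists u1 s u2,
  [/\ u = u1 ++ s :: u2, noK L u1, wact (wactw L u1) s = wactw L u1,
      noK (wactw L u1) u2 & wprod u1 * wprod u2 = 1].
Proof.
case=> -[Lt tb] [u' [[[u'S u'w] _] u'1]] ru; have [[uS uw] _] := ru.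
have u1 := reduced_count1 u'S ru u'w u'1.
have [u1' [s [u2 [e H1 H2 H3]]]] := count1_split u1.
exists u1', s, u2; split=> //.
have ub : bword L u = 1 by apply: bval_uniq tb; exists u.
by move: ub; rewrite e bword_cat bword_cons H2 eqxx mul1g !bword_noK.
Qed.

(** v has an expression p with empty K, so surrounding a word for t by p and its reverse leaves one
    letter in K, while the values of b on p and its reverse cancel. *)
Lemma conj_So L L' (v t : W) : is_block_value S L L' v -> So S L' t -> So S L (v * t * v^-1).
Proof.
case/block_word => p [pS <- <- pK] St; have Lt := So_fix St.
case: (St) => -[_ tb] [u [[[uS ut] _] u1]].
have Lu : wactw (wactw L p) u = wactw L p by rewrite -wact_wprod ut.
have -> : wprod p * t * (wprod p)^-1 = wprod (p ++ u ++ rev p).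
  by rewrite !wprod_cat (wprod_rev cox_sinv) // ut mulgA.
apply: word_So.
- by apply/in_exp_cat; split=> //; apply/in_exp_cat; split=> //; exact: in_exp_rev.
- by rewrite !Kmask_cat !count_cat Lu (count_Krev cox_sinv) // pK u1.
- rewrite !bword_cat Lu (bword_rev cox_sinv) //.
  have -> : bword (wactw L p) u = 1 by apply: bval_uniq tb; exists u.
  by rewrite mul1g mulgV.
- by rewrite !wactw_cat Lu (wactw_rev cox_sinv).
Qed.

Lemma gen_Wo L w : gen (So S L) w -> Wo S L w.
Proof.
case=> u [uS <-]; elim: u uS => [|t u IH] uS.
  by split; [exact: wact1 | exists [::]].
have [Lt tb] : Wo S L t by case: (uS t); rewrite ?inE ?eqxx.
have [Lu ub] : Wo S L (wprod u) by apply: IH => r ru; apply: uS; rewrite inE ru orbT.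
split; first by rewrite /= wactM Lt Lu.
by rewrite -[1]mulg1; exact: bval_mul Lt tb ub.
Qed.

Lemma conj_gen_So L L' (v w : W) : is_block_value S L L' v -> gen (So S L') w ->
  gen (So S L) (v * w * v^-1).
Proof.
move=> bv [u [uS <-]]; exists [seq v * t * v^-1 | t <- u]; split.
  by move=> _ /mapP[t tu ->]; apply: conj_So bv _; exact: uS.
elim: u {uS} => [|t u IH] /=; first by rewrite mulg1 mulgV.
by rewrite IH !mulgA mulgVK.
Qed.

(** Well-definedness of the sign; it excludes that x and x s have equal length. *)
Definition odd_gens (T : W -> Prop) : Prop := forall u v,
  in_exp T u -> in_exp T v -> wprod u = wprod v -> odd (size u) = odd (size v).

Lemma So_conj L t : So S L t -> exists x s, S s /\ t = x * s * x^-1.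
Proof.
move=> St; have [u ru] := gen_reduced (cox_gen t).
have [u1 [s [u2 [e _ _ _ u12]]]] := So_word St ru.
have [[uS uw] _] := ru; exists (wprod u1), s; split.
  by apply: uS; rewrite e mem_cat inE eqxx orbT.
rewrite -uw e wprod_cat /= !mulgA; congr (_ * _).
by apply: (@mulgI _ (wprod u1)); rewrite u12 mulgV.
Qed.

(** Each generator is a conjugate of a letter of S, hence expands to a word of odd length, and the
    sign of W decides. *)
Lemma So_odd_gens L : odd_gens (So S L).
Proof.
have E u : in_exp (So S L) u -> exists u', [/\ in_exp S u', wprod u' = wprod u
    & odd (size u') = odd (size u)].
  elim: u => [|t u IH] uS; first by exists [::].
  have [u' [u'S u'w u'o]] : exists u', [/\ in_exp S u', wprod u' = wprod u
    & odd (size u') = odd (size u)].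
    by apply: IH => r ru; apply: uS; rewrite inE ru orbT.
  have [|x [s [Ss te]]] := @So_conj L t; first by apply: uS; rewrite inE eqxx.
  have [p [pS px]] := cox_gen x.
  exists (p ++ s :: rev p ++ u'); split.
  - apply/in_exp_cat; split=> // r; rewrite inE => /orP[/eqP->//|].
    by rewrite mem_cat mem_rev => /orP[/pS|/u'S].
  - by rewrite wprod_cat /= wprod_cat (wprod_rev cox_sinv) // px te u'w !mulgA.
  - rewrite size_cat /= size_cat size_rev oddD /= oddD u'o.
    by case: (odd (size p)); case: (odd (size u)).
move=> u v /E[u' [u'S u'w u'o]] /E[v' [v'S v'w v'o]] e.
by rewrite -u'o -v'o; apply: cox_parity => //; rewrite u'w v'w.
Qed.

Lemma S_odd_gens : odd_gens S.
Proof. by move=> u v uS vS e; exact: cox_parity. Qed.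

Lemma shorter_total (T : W -> Prop) x s : odd_gens T -> gen T x -> T s ->
  shorter T x (x * s) \/ shorter T (x * s) x.
Proof.
move=> TO gx Ts; have [u ru] := gen_reduced gx.
have [v rv] := gen_reduced (genM gx (gen_in Ts)).
have [[uT ux] _] := ru; have [[vT vx] _] := rv.
have usT : in_exp T (rcons u s).
  by move=> r; rewrite mem_rcons inE => /orP[/eqP->//|/uT].
have := TO (rcons u s) v usT vT; rewrite vx -cats1 wprod_cat ux /= mulg1 => /(_ erefl).
rewrite size_cat addn1 /= => o_uv; case: (ltngtP (size u) (size v)) => uv.
- by left; exists u, v.
- by right; exists v, u.
- by move: o_uv; rewrite uv; case: (odd _).
Qed.

End CoxeterSystem.

Local Open Scope ring_scope.

(** * Endoscopic data *)

Section RankOne.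
Variables (k : idomainType) (n : nat).
Implicit Types (c : 'cV[k]_n) (r : 'rV[k]_n).

Lemma pairing_mulr c r r' : r' *m (c *m r) = pairing c r' *: r.
Proof. by rewrite mulmxA (mx11_scalar (r' *m c)) mul_scalar_mx. Qed.
Lemma pairing_mull c r c' : c *m r *m c' = pairing c' r *: c.
Proof. by rewrite -mulmxA (mx11_scalar (r *m c')) mul_mx_scalar. Qed.
Lemma pairingZr c r e : pairing c (e *: r) = e * pairing c r.
Proof. by rewrite /pairing -scalemxAl mxE. Qed.

Definition primitive c r : Prop :=
  (exists v, pairing v r = 1) /\ (exists a, pairing c a = 1).

(** Evaluating the common rank one matrix at vectors dual to the primitive ones yields the scalars
    <c', a> and <c, a'>, which are inverse to each other. *)
Lemma rank1_unique c r c' r' : c *m r = c' *m r' -> primitive c r -> primitive c' r' ->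
  exists e : k, [/\ e \is a GRing.unit, r = e *: r' & c' = e *: c].
Proof.
move=> E [[v rv] [a ca]] [[v' rv'] [a' ca']].
have rE : r = pairing c' a *: r' by rewrite -pairing_mulr -E pairing_mulr ca scale1r.
have rE' : r' = pairing c a' *: r by rewrite -pairing_mulr E pairing_mulr ca' scale1r.
exists (pairing c' a); split=> //.
  have H : pairing c' a * pairing c a' = 1.
    by have := rv; rewrite {1}rE pairingZr {1}rE' pairingZr rv mulr1.
  by apply/unitrPr; exists (pairing c a').
have : c *m r *m v' = c' *m r' *m v' by rewrite E.
by rewrite !pairing_mull rv' scale1r {1}rE pairingZr rv' mulr1.
Qed.

End RankOne.

(** * Data made of reflections *)

Section DatumIntro.
Variables (W : groupType) (k : idomainType) (n : nat) (rho : rep W k n).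
Local Notation R := (Rh k n).

Record reflection (g : W) (c : 'cV[k]_n) (r : 'rV[k]_n) : Prop := Reflection {
  refl_ord : (g * g = 1)%g /\ g <> 1%g;
  refl_rho : rho g = 1%:M - c *m r;
  refl_prim : primitive c r;
  refl_two : pairing c r = 2%:R }.

Lemma rhoVK x : rho x *m rho x^-1%g = 1%:M.
Proof. by rewrite -rhoM mulgV rho1. Qed.
Lemma rhoKV x : rho x^-1%g *m rho x = 1%:M.
Proof. by rewrite -rhoM mulVg rho1. Qed.

Lemma pairing_act x c (r : 'rV[k]_n) : pairing (rho x *m c) (actV rho x r) = pairing c r.
Proof. by rewrite /pairing /actV mulmxA -[X in (X *m _) _ _]mulmxA rhoKV mulmx1. Qed.

Lemma reflection_conj g c r x : reflection g c r ->
  reflection (x * g * x^-1)%g (rho x *m c) (actV rho x r).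
Proof.
case=> -[gg g1] gr [[v rv] [a ca]] g2; split.
- split; first by rewrite !mulgA mulgVK -(mulgA x) gg mulg1 mulgV.
  move=> e; apply: g1; apply: (@mulgI _ x); apply: (@mulIg _ x^-1%g).
  by rewrite e mulg1 mulgV.
- rewrite !rhoM gr mulmxBr mulmx1 mulmxBl rhoVK; congr (_ - _).
  by rewrite /actV !mulmxA.
- split; first by exists (rho x *m v); rewrite pairing_act.
  by exists (actV rho x a); rewrite pairing_act.
- by rewrite pairing_act.
Qed.

Lemma actV_root g c r : reflection g c r -> actV rho g r = - r.
Proof.
case=> -[gg g1] gr _ g2; have gV : g^-1%g = g.
  by apply: (@mulgI _ g); rewrite mulgV gg.
rewrite /actV gV gr mulmxBr mulmx1 pairing_mulr g2 scaler_nat mulr2n opprD addrA.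
by rewrite subrr sub0r.
Qed.

Lemma symv_neq0 (r : 'rV[k]_n) : (exists v, pairing v r = 1) -> symv r != 0 :> R.
Proof.
case=> v rv; apply/eqP => r0.
have {}r0 : r = 0.
  by apply: symv_inj; rewrite r0 /symv big1 // => i _; rewrite mxE scale0r.
by move: rv; rewrite /pairing r0 mul0mx mxE => /esym/eqP; rewrite oner_eq0.
Qed.

Lemma actVN x r : actV rho x (- r) = - actV rho x r.
Proof. by rewrite /actV mulNmx. Qed.
Lemma symvN (r : 'rV[k]_n) : symv (- r) = - symv r.
Proof. by rewrite -scaleN1r symvZ scaleN1r. Qed.

(** Only [gd_den] takes an argument: when w g is shorter than w, the admissible pair is the one for
    w g, whose root is the opposite, so the inverse changes sign. *)
Lemma gdatum_intro (D : rdatum W k n) :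
  (forall g, gens D g -> reflection g (coroot D g) (root D g)) -> odd_gens (gens D) ->
  gdatum rho D.
Proof.
move=> Dr Dodd; split.
- by move=> g /Dr/refl_ord.
- by move=> g /Dr/refl_rho.
- by move=> g /Dr/refl_prim[].
- by move=> g /Dr/refl_prim[].
- by move=> g /Dr/refl_two.
move=> w g gw Dg; have rg := Dr g Dg.
have [gg _] := refl_ord rg.
have inv y : gen (gens D) y -> shorter (gens D) y (y * g)%g ->
    dinv rho D (symv (actV rho y (root D g))).
  move=> gy sh; apply: loc_of_inv; first by apply/symv_neq0/(refl_prim (reflection_conj y rg)).1.
  by exists (y * g * y^-1)%g, (y, g).
case: (shorter_total Dodd gw Dg) => [|sh]; first exact: inv.
have [||q dq] := inv (w * g)%g; [exact: genM gw (gen_in Dg)|by rewrite -mulgA gg mulg1|].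
exists (- q); move: dq; rewrite actVM (actV_root rg) actVN symvN.
have -> : loc_of (is_root rho D) (- symv (actV rho w (root D g))) =
    - loc_of (is_root rho D) (symv (actV rho w (root D g))).
  apply: (addrI (loc_of (is_root rho D) (symv (actV rho w (root D g))))).
  by rewrite -loc_ofD !subrr loc_of0.
by rewrite mulNr mulrN.
Qed.

Lemma gdatum_reflection (D : rdatum W k n) g : gdatum rho D -> gens D g ->
  reflection g (coroot D g) (root D g).
Proof.
move=> HD Dg; split; [exact: (gd_ord HD Dg)|exact: (gd_rho HD Dg)| |exact: (gd_pair HD Dg)].
by split; [exact: (gd_rootP HD Dg) | exact: (gd_corootP HD Dg)].
Qed.

Lemma gdatum_conj (D1 D2 : rdatum W k n) x s t : gdatum rho D1 -> gdatum rho D2 ->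
  gens D1 s -> gens D2 t -> t = (x * s * x^-1)%g ->
  exists e : k, [/\ e \is a GRing.unit, actV rho x (root D1 s) = e *: root D2 t
    & coroot D2 t = e *: (rho x *m coroot D1 s)].
Proof.
move=> H1 H2 D1s D2t tE.
have r1 := reflection_conj x (gdatum_reflection H1 D1s); rewrite -tE in r1.
have r2 := gdatum_reflection H2 D2t.
apply: rank1_unique (refl_prim r1) (refl_prim r2).
by apply: oppr_inj; apply: (addrI 1%:M); rewrite -(refl_rho r1) -(refl_rho r2).
Qed.

Lemma siso_Cs_conj (D1 D2 : rdatum W k n) x s t : gdatum rho D1 -> gdatum rho D2 ->
  gens D1 s -> gens D2 t -> t = (x * s * x^-1)%g ->
  siso x x (Cs rho D1 s) (Cs rho D2 t).
Proof.
move=> H1 H2 D1s D2t tE; have [e [eu _ cE]] := gdatum_conj H1 H2 D1s D2t tE.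
exact: (siso_Cs H1 H2 D1s D2t tE eu cE).
Qed.

End DatumIntro.

Section EndoscopicData.
Variables (W : groupType) (S : W -> Prop) (k : idomainType) (n : nat).
Variables (h : prerealization k n S) (o : wset W).
Hypothesis HS : coxeter_system S.
Implicit Types (L : o).

Lemma S_reflection s : S s -> reflection h s (alphav h s) (alpha h s).
Proof.
move=> Ss; split; first exact: (cox_ord HS Ss).
- have E j : col j (h s) = col j (1%:M - alphav h s *m alpha h s).
    by rewrite !colE alpha_refl // mulmxBl mul1mx pairing_mull.
  by apply/matrixP => i j; have := congr1 (fun c : 'cV_n => c i ord0) (E j); rewrite !mxE.
- by split; [exact: alpha_surj | exact: alphav_surj].
- exact: alpha_pair.
Qed.

Lemma full_gdatum : gdatum h (full_datum h).
Proof.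
apply: gdatum_intro => [g|]; [exact: S_reflection | exact: (S_odd_gens o HS)].
Qed.

Lemma chosen_pairP L t : So S L t -> refl_pair S t (chosen_pair S t).
Proof.
move=> St; rewrite /chosen_pair; case: pselect => [e|]; first exact: (svalP (cid e)).
case; have [x [s [Ss tE]]] := So_conj HS St.
have gx := cox_gen HS x.
have [sh|sh] := shorter_total (S_odd_gens o HS) gx Ss.
  by exists (x, s).
have ss := cox_sinv HS Ss.
(* Replacing x by x s gives the same reflection and reverses the comparison of lengths. *)
exists ((x * s)%g, s); split=> //=; first exact: cox_gen.
  by rewrite invgM (invol_inv (cox_sinv HS) Ss) !mulgA -(mulgA x) ss mulg1.
by rewrite -mulgA ss mulg1.
Qed.

Lemma So_reflection L t : So S L t -> reflection h t (refl_coroot h t) (refl_root h t).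
Proof.
move=> St; have [_ Ss tE _] := chosen_pairP St.
by rewrite {1}tE; exact/reflection_conj/S_reflection.
Qed.

Lemma endo_gdatum L : gdatum h (endo_datum h L).
Proof.
apply: gdatum_intro => [g|]; [exact: So_reflection | exact: (So_odd_gens HS)].
Qed.

(** Conjugation by a block value maps the generators of one endoscopic group to those of the other,
    and the chosen roots match up to units. *)
Lemma endo_rebases L L' v : is_block_value S L L' v ->
  rebases h v (endo_datum h L') (endo_datum h L).
Proof.
move=> bv w g gw Sg; have Sc := conj_So HS bv Sg.
have [e [eu rE _]] := gdatum_conj (endo_gdatum L') (endo_gdatum L) Sg Sc erefl.
have -> : (v * w = v * w * v^-1 * v)%g by rewrite mulgVK.
rewrite actVM rE /actV -scalemxAl symvZ -mul_mpolyC.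
apply: den_mul; first exact: den_const.
by apply: den_root => //; exact: (conj_gen_So HS bv gw).
Qed.

(** The chosen endoscopic roots are translates of simple roots, so all their translates are
    denominators over the full datum. *)
Lemma endo_full_rebases L v : rebases h v (endo_datum h L) (full_datum h).
Proof.
move=> w g gw Sg; have [_ Ss _ _] := chosen_pairP Sg.
rewrite -[root _ g]/(actV h (chosen_pair S g).1 (alpha h (chosen_pair S g).2)) -actVM.
by apply: den_root => //; exact: cox_gen.
Qed.

(* the reflections v s v^-1 for the letters s of the word in K, where v is the product of
   the preceding letters not in K *)
Fixpoint ts_of L (us : seq W) : seq W :=
  if us is s :: us' then
    if wact L s == L then s :: ts_of L us'
    else [seq (s * t * s^-1)%g | t <- ts_of (wact L s) us']
  else [::].

Lemma letter_block L s : S s -> wact L s <> L -> is_block_value S L (wact L s) s.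
Proof.
move=> Ss Ls; have := @word_block _ S o L [:: s]; rewrite /= mulg1; apply.
  by move=> t; rewrite inE => /eqP->.
by rewrite /noK /=; case: eqP.
Qed.

Lemma ts_of_So L us : in_exp S us -> in_exp (So S L) (ts_of L us).
Proof.
elim: us L => [|s us IH] L uS //=.
have Ss : S s by apply: uS; rewrite inE eqxx.
have uS' : in_exp S us by move=> t tu; apply: uS; rewrite inE tu orbT.
case: eqP => Ls t.
  by rewrite inE => /orP[/eqP->|]; [exact: So_letter | exact: IH].
case/mapP => r /IH Sr ->; apply: (conj_So HS _ (Sr uS')).
exact: letter_block.
Qed.

Lemma ts_of_prod L us : (wprod (ts_of L us) * bword L us)%g = wprod us.
Proof.
elim: us L => [|s us IH] L /=; first by rewrite mulg1.
rewrite bword_cons; case: eqP => Ls /=.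
  by rewrite mul1g Ls -mulgA IH.
have -> : wprod [seq (s * t * s^-1)%g | t <- ts_of (wact L s) us] =
    (s * wprod (ts_of (wact L s) us) * s^-1)%g.
  elim: (ts_of _ _) => [|t ts IHt] /=; first by rewrite mulg1 mulgV.
  by rewrite IHt !mulgA mulgVK.
by rewrite !mulgA mulgVK -mulgA IH.
Qed.

Lemma size_ts_of L us : size (ts_of L us) = count id (Kmask L us).
Proof.
elim: us L => [|s us IH] L //=; case: eqP => Ls /=; first by rewrite IH Ls.
by rewrite size_map IH.
Qed.

Lemma ts_of_cat L us vs : ts_of L (us ++ vs) =
  ts_of L us ++ [seq (bword L us * t * (bword L us)^-1)%g | t <- ts_of (wactw L us) vs].
Proof.
elim: us L => [|s us IH] L /=.
  by rewrite -[LHS]map_id; apply: eq_map => t; rewrite mul1g invg1 mulg1.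
rewrite bword_cons; case: eqP => Ls; first by rewrite IH Ls /= mul1g.
rewrite IH map_cat -map_comp; congr (_ ++ _); apply: eq_map => t /=.
by rewrite invgM !mulgA.
Qed.

Lemma ts_of_reduced L t u : So S L t -> reduced S u t ->
  [/\ ts_of L u = [:: t], bword L u = 1%g & wactw L u = L].
Proof.
move=> St ru; have [u1 [s [u2 [e K1 Ls K2 u12]]]] := So_word HS St ru.
have [[uS uw] _] := ru.
have ub : bword L u = 1%g by rewrite e bword_cat bword_cons Ls eqxx mul1g !bword_noK.
have := ts_of_prod L u; have := size_ts_of L u.
have -> : count id (Kmask L u) = 1%N.
  rewrite e Kmask_cat count_cat /= Ls eqxx.
  by rewrite [count id (Kmask L u1)]K1 [count id (Kmask _ u2)]K2.
case: (ts_of L u) => [|r [|]] // _; rewrite ub mulg1 /= mulg1 uw => ->.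
by split=> //; rewrite -wact_wprod uw; exact: (So_fix St).
Qed.

(** A reduced expression of a letter of x contributes that one reflection and neither moves L nor
    changes b_L, while p contributes no reflection; hence [ts_of] recovers x. *)
Lemma ts_of_expands L x x' p : in_exp (So S L) x -> expands S x x' -> noK L p ->
  [/\ ts_of L (x' ++ p) = x, bword L (x' ++ p) = wprod p & wactw L (x' ++ p) = wactw L p].
Proof.
move=> xS [us [sus ru ->]] pK.
have tp : ts_of L p = [::] by apply: size0nil; rewrite size_ts_of.
elim: x us xS sus ru => [|t x IH] [|u us] // xS sus ru.
  by split=> //; rewrite /= bword_noK.
have St : So S L t by apply: xS; rewrite inE eqxx.
have [tu bu Lu] := ts_of_reduced St (ru 0%N isT).
have [||i ix|e1 e2 e3] := IH us.
- by move=> r rx; apply: xS; rewrite inE rx orbT.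
- by case: sus.
- exact: (ru i.+1).
rewrite /= -catA ts_of_cat bword_cat wactw_cat tu bu Lu e1 e2 e3 mul1g; split=> //=.
by rewrite -[x in RHS]map_id; congr cons; apply: eq_map => r; rewrite mul1g invg1 mulg1.
Qed.

Lemma expands_exists L x : in_exp (So S L) x -> exists2 x', expands S x x' & in_exp S x'.
Proof.
elim: x => [|t x IH] xS; first by exists [::] => //; exists [::].
have [|x' [us [sus ru xE]] x'S] := IH.
  by move=> r rx; apply: xS; rewrite inE rx orbT.
have [u ru0] := gen_reduced (cox_gen HS t).
exists (u ++ x'); last by apply/in_exp_cat; split=> //; case: ru0 => -[].
exists (u :: us); split=> /=; [by rewrite sus | by case | by rewrite xE].
Qed.

Local Notation full := (full_datum h).
Local Notation endo := (endo_datum h).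
Local Notation pt := (pt_wset W).
Local Notation Bend L ts := (Bw h (endo L) (tt : pt) ts).

Lemma Bw_cons_siso D (o' : wset W) (L : o') s u : gdatum h D -> gens D s ->
  in_exp (gens D) u ->
  siso 1%g 1%g (ltens (Bs h D L s) (Bw h D (wact L s) u)) (Bw h D L (s :: u)).
Proof.
move=> HD Ds uS; apply: iso_siso; apply: (@Bw_cat _ _ _ _ _ HD o' L [:: s] u _ uS).
by move=> t; rewrite inE => /eqP->.
Qed.

Lemma siso_trans11 D1 D2 D3 u v (M : lbim h D1) (N : lbim h D2) (P : lbim h D3) :
  siso u v M N -> siso 1%g 1%g N P -> siso u v M P.
Proof. by move=> s1 s2; have := siso_trans s1 s2; rewrite !mul1g. Qed.
Lemma siso_trans11l D1 D2 D3 u v (M : lbim h D1) (N : lbim h D2) (P : lbim h D3) :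
  siso 1%g 1%g M N -> siso u v N P -> siso u v M P.
Proof. by move=> s1 s2; have := siso_trans s1 s2; rewrite !mulg1. Qed.
Lemma siso_sym11 D1 D2 (M : lbim h D1) (N : lbim h D2) :
  siso 1%g 1%g M N -> siso 1%g 1%g N M.
Proof. by move=> /siso_sym; rewrite !invg1. Qed.

Lemma Bend_nice L ts : in_exp (So S L) ts -> nice (tt : pt) tt (Bend L ts).
Proof.
move=> tsS; have := Bw_nice (endo_gdatum L) (tt : pt) tsS.
by case: (wactw _ _).
Qed.

Lemma Bend_conj L L' v ts : is_block_value S L L' v -> in_exp (So S L') ts ->
  siso v v (Bend L' ts) (Bend L [seq (v * t * v^-1)%g | t <- ts]).
Proof.
move=> bv; elim: ts => [|t ts IH] tsS.
  by have := @siso_Rw _ _ _ h (endo L') (endo L) v v 1%g; rewrite mulg1 mulgV.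
have St : So S L' t by apply: tsS; rewrite inE eqxx.
have tsS' : in_exp (So S L') ts by move=> r rt; apply: tsS; rewrite inE rt orbT.
have Sc := conj_So HS bv St.
have csS : in_exp (So S L) [seq (v * t * v^-1)%g | t <- ts].
  by move=> _ /mapP[r rt ->]; apply: conj_So bv _ => //; exact: tsS'.
have s1 := Bw_cons_siso (tt : pt) (endo_gdatum L') St tsS'.
have s2 := Bw_cons_siso (tt : pt) (endo_gdatum L) Sc csS.
apply: (siso_trans11l (siso_sym11 s1)); apply: siso_trans11 s2.
apply: (@siso_tens _ _ _ _ _ _ _ _ _ _ _ _ _ pt pt tt tt tt tt tt tt) => //.
- exact: endo_gdatum.
- exact: endo_gdatum.
- exact: (@Bs_nice _ _ _ h (endo L') (endo_gdatum L') pt tt t St).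
- exact: Bend_nice.
- exact: (@Bs_nice _ _ _ h (endo L) (endo_gdatum L) pt tt _ Sc).
- exact: Bend_nice.
- by rewrite /Bs /=; apply: siso_Cs_conj => //; exact: endo_gdatum.
- exact: IH.
Qed.

(* [B_us] over the full system is the endoscopic bimodule attached to the
   reflections [ts_of L us], twisted on the right by [w^beta]. *)
Lemma siso_Bw L us : in_exp S us ->
  siso 1%g (bword L us)^-1%g (Bend L (ts_of L us)) (Bw h full L us).
Proof.
elim: us L => [|s us IH] L uS.
  have := @siso_Rw _ _ _ h (endo L) full 1%g 1%g 1%g; rewrite invg1 !mulg1.
  by apply.
have Ss : S s by apply: uS; rewrite inE eqxx.
have uS' : in_exp S us by move=> t tu; apply: uS; rewrite inE tu orbT.
have HF := full_gdatum; have HE := endo_gdatum L.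
have s2 := Bw_cons_siso L HF Ss uS'.
have nF := Bw_nice HF (wact L s) uS'.
apply: siso_trans11 s2; rewrite bword_cons /=; case: eqP => Ls.
  have SL := So_letter HS Ss Ls; have tS := @ts_of_So L us uS'.
  have s1 := Bw_cons_siso (tt : pt) HE SL tS.
  apply: (siso_trans11l (siso_sym11 s1)); rewrite mul1g.
  apply: (@siso_tens _ _ _ _ _ _ _ _ _ _ _ _ _ pt o tt tt tt L L (wactw L us)) => //.
  + exact: (@Bs_nice _ _ _ h (endo L) HE pt tt s SL).
  + exact: Bend_nice.
  + by have := Bs_nice HF L Ss; rewrite Ls; apply.
  + by move: (nF); rewrite Ls; apply.
  + rewrite /Bs Ls !eqxx; apply: (siso_Cs_conj HE HF SL Ss).
    by rewrite mul1g invg1 mulg1.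
  + by have := IH L uS'; rewrite Ls; apply.
have bs : is_block_value S L (wact L s) s by exact: letter_block.
have tS := @ts_of_So (wact L s) us uS'.
pose ts := [seq (s * t * s^-1)%g | t <- ts_of (wact L s) us].
have tsS : in_exp (So S L) ts.
  by move=> _ /mapP[r rt ->]; apply: conj_So bs _ => //; exact: tS.
(* Conjugation by s is the price of moving R_s to the right: the reflections of the tail, computed
   from L s, become reflections for L. *)
have sc := siso_sym (Bend_conj bs tS).
have s3 := siso_trans sc (IH (wact L s) uS'); rewrite mul1g in s3.
have nE := Bend_nice tsS; have cE := n_cl nE.
(* A unit factor is inserted on the left; twisted by s^-1 on its right it becomes R_s. *)
have s4 : siso 1%g 1%g (Bend L ts) (ltens (Rw h (endo L) 1%g) (Bend L ts)).
  apply: siso_sym11; apply: iso_siso; exists (lun h (endo L) _), (lun' (Bend L ts)); split.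
  - exact: is_mor_lun.
  - exact: is_mor_lun'.
  - by move=> x; rewrite -bcompE lunK.
  - by move=> x; rewrite -bcompE lun'K.
apply: (siso_trans11l s4); rewrite invgM.
have nR : nice (tt : pt) tt (Rw h (endo L) 1%g) by apply: Rw_nice => //; exact: gen1.
apply: (@siso_tens _ _ _ _ _ _ _ _ _ _ _ _ _ pt o tt tt tt L (wact L s) (wactw (wact L s) us) HE HF nR nE _ nF _ s3).
  exact: Bs_nice.
rewrite /Bs; case: eqP => // _.
by have := @siso_Rw _ _ _ h (endo L) full 1%g s^-1%g 1%g; rewrite invgK !mul1g.
Qed.

End EndoscopicData.

(** * Twisted direct sums *)

Lemma dep_choice (I : Type) (T : I -> Type) (P : forall i, T i -> Prop) :
  (forall i, exists x, P i x) -> exists f : forall i, T i, forall i, P i (f i).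
Proof. by move=> H; exists (fun i => sval (cid (H i))) => i; exact: (svalP (cid (H i))). Qed.

Section TwistedSum.
Variables (W : groupType) (k : idomainType) (n : nat) (rho : rep W k n).
Local Notation R := (Rh k n).
Local Notation act := (actR rho).
Local Notation loc D := (loc_of (is_root rho D)).

Lemma semi_sum u v (M N : bimod R R) (F : M -> N) (I : Type) (r : seq I) (p : pred I)
    (f : I -> M) : semi rho u v F ->
  F (\sum_(i <- r | p i) f i) = \sum_(i <- r | p i) F (f i).
Proof. by move=> sF; apply: (big_morph F); [exact: (semiD sF) | exact: (semi0 sF)]. Qed.

Lemma semiB u v (M N : bimod R R) (F : M -> N) x y : semi rho u v F ->
  F (x - y) = F x - F y.
Proof.
move=> sF; apply: (addIr (F y)); rewrite -(semiD sF) !subrK.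
by [].
Qed.

Variables (D' D : rdatum W k n).

(* N is the direct sum of the M j with left action twisted by u and right action by v j:
   [ltwist] is the case of one summand and u = v, and the 2-functor that of u = 1. *)
Record tsum (N : lbim rho D) (J : finType) (u : W) (v : J -> W) (M : J -> lbim rho D')
    (inc : forall j, M j -> N) (pro : forall j, N -> M j) : Prop := Tsum {
  ts_inc : forall j, semi rho u (v j) (inc j);
  ts_pro : forall j, semi rho u^-1%g (v j)^-1%g (pro j);
  ts_K : forall j x, pro j (inc j x) = x;
  ts_0 : forall i j x, i <> j -> pro j (inc i x) = 0;
  ts_sum : forall x, x = \sum_j inc j (pro j x);
  ts_deg : forall d x, ldeg d x <-> forall j, ldeg d (pro j x);
  ts_lcomp : forall w x, lcomp w x <-> add_span (fun y => exists m q,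
    (forall j, lat (u^-1 * w * v j)%g (pro j m)) /\ y = mq m q) x }.

Variables (HD' : gdatum rho D') (HD : gdatum rho D).
Variables (N : lbim rho D) (J : finType) (u : W) (v : J -> W) (M : J -> lbim rho D').
Variables (inc : forall j, M j -> N) (pro : forall j, N -> M j).
Hypothesis T : tsum u v inc pro.
Hypothesis cM : forall j, lclosed (M j).

Let sI := ts_inc T.
Let sP := ts_pro T.

Lemma tsum_pro_inc i (x : forall j, M j) : pro i (\sum_j inc (x j)) = x i.
Proof.
rewrite (semi_sum _ _ _ (sP i)) (bigD1 i) //= (ts_K T) big1 ?addr0 // => j ji.
by apply: (ts_0 T); apply/eqP.
Qed.

Lemma tsum_ext (x y : N) : (forall j, pro j x = pro j y) -> x = y.
Proof.
by move=> H; rewrite (ts_sum T x) (ts_sum T y); apply: eq_bigr => j _; rewrite H.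
Qed.

Lemma tsum_lclosed : lclosed N.
Proof.
apply: (lclosed_span (ts_lcomp T)) => w f m H j.
by rewrite (semil (sP j)); exact: (lat_l (cM j)).
Qed.

Lemma tsum_inc_lat w j m : lat (u^-1 * w * v j)%g m -> lat w (inc (j := j) m).
Proof.
move=> lm; apply/(ts_lcomp T)/add_span_gen; exists (inc m), 1; split=> // i.
have [<-|/eqP ji] := eqVneq j i; first by rewrite (ts_K T).
by rewrite (ts_0 T) //; exact: (lat0 (cM i)).
Qed.

Lemma tsum_frac w x : right_flat N -> lat w x -> exists d, den rho D d /\
  forall j, lat (u^-1 * w * v j)%g (pro j (ract N x d)).
Proof.
move=> fN lx.
pose P (y : N) := forall j, lat (u^-1 * w * v j)%g (pro j y).
have Pr y f : P y -> P (ract N y f).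
  by move=> H j; rewrite (semir (sP j)); exact: (lat_r (cM j)).
suff [d [y [dd Py e]]] : exists d y, [/\ den rho D d, P y
    & ract (MQ rho D N) (mq x 1) (loc D d) = mq y 1].
  exists d; split=> //; suff <- : y = ract N x d by [].
  by apply: (mq_inj2 (rho := rho) (D := D) fN); rewrite -e ract_mq mq_ractl mul1r mulr1.
move/(ts_lcomp T): lx; apply: (add_span_ind (K := fun x => exists d y,
  [/\ den rho D d, P y & ract (MQ rho D N) x (loc D d) = mq y 1])).
- exists 1, 0; split; [exact: den1 | | by rewrite ract0 mq0l].
  by move=> j; rewrite (semi0 (sP j)); exact: (lat0 (cM j)).
- move=> y z [d [a [dd sa xa]]] [e [b [de sb yb]]].
  exists (d * e), (ract N a e + ract N b d); split; first exact: den_mul.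
    by move=> j; rewrite (semiD (sP j)); apply: (latD (cM j)); exact: Pr.
  rewrite ractD {2}[d * e]mulrC !loc_ofM !ractM xa yb !ract_mq !mul1r.
  by rewrite mqDl !mq_ractl !mulr1.
- move=> _ [m [q [lm ->]]]; have [d [a [dd e]]] := Q_frac q.
  exists d, (ract N m a); split=> //; first exact: Pr.
  by rewrite ract_mq mq_ractl mulr1 mulrC e.
Qed.

Variables (o' : wset W) (K K' : J -> o').
Hypothesis gM : forall j, good (K j) (K' j) (M j).

(** A lattice element of N is a tuple of lattice elements only after multiplication by a denominator
    over D; in the summand M j this is merely a nonzero polynomial, which [good_lat_div] removes. *)
Lemma tsum_lat w x : right_flat N ->
  lat w x <-> forall j, lat (u^-1 * w * v j)%g (pro j x).
Proof.
move=> fN; split=> [/(tsum_frac fN)[d [dd H]] j|H]; last first.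
  by apply/(ts_lcomp T)/add_span_gen; exists x, 1.
apply: (good_lat_div HD' (d := act (v j)^-1%g d) (gM j)).
  apply/eqP => e; have := den_neq0 HD dd.
  by rewrite -(actRVK rho (v j) d) e actR_0 eqxx.
by have := H j; rewrite (semir (sP j)).
Qed.

Hypothesis rM : forall j, graded (M j).
Hypothesis vD : forall j, rebases rho (v j) D' D.

Lemma tsum_deg_sum : direct_sum_of (@ldeg _ _ _ _ _ N).
Proof.
have S j := gr_sum (rM j).
split.
- move=> d; split=> [|x y]; rewrite !(ts_deg T).
    by move=> j; rewrite (semi0 (sP j)); case: (ds_sub (S j) d).
  by move=> Hx Hy j; rewrite (semiB _ _ (sP j)); case: (ds_sub (S j) d) => _; apply.
- move=> x; pose a j := sval (cid (ds_rep_ex (S j) (pro j x))).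
  have aP j : ds_rep (@ldeg _ _ _ _ _ (M j)) (pro j x) (a j).
    exact: (svalP (cid (ds_rep_ex (S j) (pro j x)))).
  pose s j := sval (cid (aP j).2).
  have sP' j : [/\ uniq (s j), forall d, d \notin s j -> a j d = 0
                 & pro j x = \sum_(d <- s j) a j d] by exact: (svalP (cid (aP j).2)).
  exists (undup (flatten [seq s j | j : J])), (fun d => \sum_j inc (a j d)); split.
    move=> d _; apply/(ts_deg T) => j.
    by rewrite (tsum_pro_inc j (fun j => a j d)); exact: (aP j).1.
  apply: tsum_ext => j; rewrite (semi_sum _ _ _ (sP j)).
  have [us s0 ->] := sP' j.
  rewrite -(sum_uniq_support us (undup_uniq (flatten [seq s j | j : J])) _ s0).
    by apply: eq_bigr => d _; rewrite (tsum_pro_inc j (fun j => a j d)).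
  move=> d ds; rewrite mem_undup; apply/flattenP; exists (s j) => //.
  by apply/mapP; exists j; rewrite ?mem_enum.
- move=> s c us cs e d ds; apply: tsum_ext => j; rewrite (semi0 (sP j)).
  have [_ _ H] := S j.
  apply: (H s (fun d => pro j (c d)) us) => // [i /cs/(ts_deg T)//|].
  by rewrite -(semi_sum _ _ _ (sP j)) e (semi0 (sP j)).
Qed.

Lemma tsum_graded : right_flat N -> graded N.
Proof.
move=> fN; split.
- exact: tsum_deg_sum.
- move=> i d f m hf /(ts_deg T) hm; apply/(ts_deg T) => j.
  by rewrite (semil (sP j)); apply: (gr_l (rM j)) => //; exact: actR_rdeg.
- move=> i d f m hf /(ts_deg T) hm; apply/(ts_deg T) => j.
  by rewrite (semir (sP j)); apply: (gr_r (rM j)) => //; exact: actR_rdeg.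
move=> w m /(tsum_lat _ _ fN) lm.
pose hom j (y : M j) := lat (u^-1 * w * v j)%g y /\ exists i, ldeg i y.
pose d j := sval (cid (gr_lat (rM j) (lm j))).
have dP j : den rho D' (d j) /\ add_span (@hom j) (ract (M j) (pro j m) (d j)).
  exact: (svalP (cid (gr_lat (rM j) (lm j)))).
have hr j f y : add_span (@hom j) y -> add_span (@hom j) (ract (M j) y f).
  apply: (add_span_map (f := fun y => ract (M j) y f)) => [|a b|a [la [i ai]]].
  + exact: ract0.
  + exact: ractD.
  apply: (add_span_map (f := fun f => ract (M j) a f) _ _ _ (rdeg_span f)).
  + exact: ract_0r.
  + by move=> b c; rewrite ract_Dr.
  + move=> g [c gc]; apply: add_span_gen; split; first exact: (lat_r (cM j)).
    by exists (c + i); exact: (gr_r (rM j)).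
(* The denominator found in M j has to act on N, hence is transported by v j; the product serves all
   summands at once. *)
exists (\prod_j act (v j) (d j)); split.
  by apply: den_prod => j _; apply: den_rebase (@vD j) _; case: (dP j).
rewrite (ts_sum T (ract N m _)); apply: add_span_sum => j _.
rewrite (semir (sP j)) (bigD1 j) //= actR_M actRK ractM.
apply: (add_span_map (f := fun y => inc (j := j) y) _ _ _ (hr j _ _ (dP j).2)).
- exact: (semi0 (sI j)).
- exact: (semiD (sI j)).
move=> y [ly [i yi]]; apply: add_span_gen; split; first exact: tsum_inc_lat.
exists i; apply/(ts_deg T) => j'.
have [e|/eqP jj'] := eqVneq j j'; first by subst j'; rewrite (ts_K T).
by rewrite (ts_0 T) //; case: (ds_sub (gr_sum (rM j')) i).
Qed.

(** The twists of [inc] and G cancel, as do those of F and [pro], so the composites are genuine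
    bimodule maps between N and the semilinear copy Y of B. *)
Lemma tsum_retract j (B : lbim rho D') (Y : lbim rho D) (f : bhom B (M j))
    (g : bhom (M j) B) (F : B -> Y) (G : Y -> B) : is_mor f -> is_mor g -> lclosed Y ->
  semi rho u (v j) F -> semi rho u^-1%g (v j)^-1%g G -> lat_map u (v j) F ->
  (forall w m, lat w m -> lat (u^-1 * w * v j)%g (G m)) ->
  exists (a : bhom Y N) (b : bhom N Y), [/\ is_mor a, is_mor b,
    forall x, a x = inc (f (G x)) & forall x, b x = F (g (pro j x))].
Proof.
move=> fm gm cY sF sG lF lG.
have sa : semi rho 1%g 1%g (fun x => inc (f (G x))).
  by have := semi_comp sG (semi_comp (bhom_semi rho f) (sI j)); rewrite !mulg1 !mulgV.
have sb : semi rho 1%g 1%g (fun x => F (g (pro j x))).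
  by have := semi_comp (sP j) (semi_comp (bhom_semi rho g) sF); rewrite !mulg1 !mulgV.
exists (Bhom (semi_bhom_axioms sa)), (Bhom (semi_bhom_axioms sb)); split=> //.
  apply: (is_mor_lat HD cY tsum_lclosed) => w m lm.
  by apply: tsum_inc_lat; apply: (mor_lat fm); exact: lG.
move=> w x /(ts_lcomp T); apply: (add_span_ind (K := fun x => lcomp w (fQ rho D _ x))).
- by rewrite bhom0; exact: lcl0.
- by move=> y z Hy Hz; rewrite (bhomD (bhomP (fQ rho D _))); exact: (lclD cY).
move=> _ [m [q [lm ->]]]; rewrite fQ_mq; apply: (lcl_mq cY).
by have := lF _ _ (mor_lat gm (lm j)); rewrite !mulgA mulgV mul1g mulgK; apply.
Qed.

Variables (Pw' : J -> seq W -> Prop) (o : wset W) (L L' : o) (Pw : seq W -> Prop).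

(** Each M j splits into Bott-Samelson bimodules over D', and the last hypothesis supplies
    semilinear copies over D. The pairs of a j and a summand of M j index the splitting of N, from
    which its flatness is then read off. *)
Lemma tsum_in_AP :
  (forall t, Pw t -> wactw L t = L') ->
  (forall j, in_AP (K j) (K' j) (Pw' j) (M j)) ->
  (forall j ts, in_exp (gens D') ts -> Pw' j ts -> exists us,
     [/\ in_exp (gens D) us, Pw us & siso u (v j) (Bw rho D' (K j) ts) (Bw rho D L us)]) ->
  in_AP L L' Pw N.
Proof.
move=> PwL iM conv.
have [d d2] := dep_choice (fun j => (iM j).2).
have [ts tsP] := dep_choice d2.
pose I : finType := {j : J & 'I_(d j)}.
have cv (i : I) : exists us, [/\ in_exp (gens D) us, Pw us
    & siso u (v (tag i)) (Bw rho D' (K (tag i)) (ts (tag i) (tagged i))) (Bw rho D L us)].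
  by have [/(_ (tagged i))[uS pw] _] := tsP (tag i); exact: conv uS pw.
have [us usP] := dep_choice cv.
pose Y i := Bw rho D L (us i).
have cY i : lclosed (Y i) by have [uS _ _] := usP i; exact: (good_cl (Bw_good HD L uS)).
pose Z j a := Bw rho D' (K j) (ts j a).
have [inc' ex_pro] := dep_choice (fun j => (tsP j).2).
have [pro' ipP] := dep_choice ex_pro.
have FGP (i : I) : exists FG : (Z (tag i) (tagged i) -> Y i) * (Y i -> Z (tag i) (tagged i)),
    exists ab : bhom (Y i) N * bhom N (Y i), [/\ cancel FG.1 FG.2 /\ cancel FG.2 FG.1,
    FG.1 0 = 0 /\ FG.2 0 = 0, is_mor ab.1 /\ is_mor ab.2,
    forall x, ab.1 x = inc (inc' (tag i) (tagged i) (FG.2 x))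
    & forall x, ab.2 x = FG.1 (pro' (tag i) (tagged i) (pro (tag i) x))].
  have [_ _ [F [G [[sF lF] sG lG FK GK]]]] := usP i.
  have [im _ _ _] := ipP (tag i); have [im1 im2] := im (tagged i).
  have [a [b [am bm aE bE]]] := tsum_retract im1 im2 (cY i) sF sG lF lG.
  exists (F, G), (a, b); split=> //; split=> //; [exact: (semi0 sF)|exact: (semi0 sG)].
have [FG FGP'] := dep_choice FGP; have [ab abP] := dep_choice FGP'.
have sN : fin_dsum N Y.
  exists (fun i => (ab i).1), (fun i => (ab i).2); split.
  - by move=> i; case: (abP i).
  - move=> i x; have [[_ GK] _ _ -> ->] := abP i; rewrite (ts_K T).
    by have [_ -> _ _] := ipP (tag i).
  - move=> i i' x ne; have [_ _ _ -> _] := abP i; have [_ [F0 _] _ _ ->] := abP i'.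
    have [e|/eqP ji] := eqVneq (tag i) (tag i'); last by rewrite (ts_0 T) // bhom0 F0.
    case: i i' x ne e F0 => [j a] [j' a'] x /= ne e F0; subst j'.
    rewrite (ts_K T); have [_ _ -> //] := ipP j.
    by move=> e; apply: ne; rewrite e.
  move=> x; rewrite [LHS](ts_sum T).
  transitivity (\sum_j \sum_(a : 'I_(d j)) inc (inc' j a (pro' j a (pro j x)))).
    apply: eq_bigr => j _; have [_ _ _ e] := ipP j.
    by rewrite {1}(e (pro j x)) (semi_sum _ _ _ (sI j)).
  rewrite (@sig_big_dep _ _ _ _ (fun j : J => 'I_(d j)) xpredT (fun _ => xpredT)
    (fun j a => inc (inc' j a (pro' j a (pro j x))))).
  apply: eq_bigr => i _; have [[FK _] _ _ -> ->] := abP i.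
  by rewrite FK.
have gN : good L L' N.
  case: (sN) => a [b [H1 H2 H3 H4]].
  apply: (good_dsum (X := Y) (inc := a) (pro := b)) => //.
  - by move=> i; case: (H1 i).
  - by move=> i; case: (H1 i).
  - by move=> i; have [uS /PwL <- _] := usP i; exact: Bw_good.
  exact: tsum_lclosed.
apply: (in_AP_intro HD PwL (us := us) (tsum_graded (g_flat gN)) tsum_lclosed _ sN).
by move=> i; case: (usP i).
Qed.

End TwistedSum.

(** * Bicategories of sums of Bott-Samelson bimodules *)

Section AlgebraicBicategory.
Variables (W : groupType) (k : idomainType) (n : nat) (rho : rep W k n).
Variables (D : rdatum W k n) (HD : gdatum rho D) (o : wset W).
Variables (X : Type) (ell : X -> o) (Pw : X -> X -> seq W -> Prop).
Hypothesis PwL : forall a b u, Pw a b u -> wactw (ell a) u = ell b.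
Hypothesis Pw_nil : forall a, Pw a a [::].
Hypothesis Pw_cat : forall a b c u v, in_exp (gens D) u -> in_exp (gens D) v ->
  Pw a b u -> Pw b c v -> Pw a c (u ++ v).

Let p1 (a b : X) (M : lbim rho D) := in_AP (ell a) (ell b) (Pw a b) M.
Let gd a b M (H : p1 a b M) := in_AP_good HD (@PwL a b) H.
Let cl a b M (H : p1 a b M) := good_cl (gd H).

(** The words are restricted by an abstract family [Pw], so that one proof covers the 2-category on
    o, its part over W_L^o and the endoscopic monoidal categories. *)
Lemma in_AP_closed : @sub_closed (bim_bicat rho D X) p1 (fun _ _ M N f => is_mor f).
Proof.
split.
- move=> a; have nS : in_exp (gens D) [::] by [].
  exact: (in_AP_Bw HD (@PwL a a) nS (Pw_nil a)).
- move=> a b c M N iM iN.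
  exact: (in_AP_ltens HD (@PwL a b) (@PwL b c) (@PwL a c) (@Pw_cat a b c) iM iN).
- by move=> a b M _; exact: is_mor_id.
- by move=> a b M N P f g _ _ _; exact: is_mor_comp.
- by move=> a b c M M' N N' f g _ _ _ _; exact: is_mor_thom.
- by move=> a b c d M N P iM iN iP; exact: (is_mor_assoc HD (gd iM) (gd iN) (gd iP)).
- by move=> a b M iM; exact: (is_mor_lun (cl iM)).
- by move=> a b M iM; exact: (is_mor_run (cl iM)).
Qed.

Lemma in_AP_bicategory (C : @sub_closed (bim_bicat rho D X) p1 (fun _ _ M N f => is_mor f)) :
  is_bicategory (sub_bicat C).
Proof.
apply: sub_bicategory; first exact: bim_bicategory.
- move=> a b c d M N P iM iN iP; exists (tassoc' M N P).
  split; [exact: (is_mor_assoc' HD (gd iM) (gd iN) (gd iP)) | exact: tassocK | exact: tassoc'K].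
- move=> a b M iM; exists (lun' M).
  by split; [exact: (is_mor_lun' HD (cl iM)) | exact: lunK | exact: lun'K].
- move=> a b M iM; exists (run' M).
  by split; [exact: (is_mor_run' HD (cl iM)) | exact: runK | exact: run'K].
Qed.

End AlgebraicBicategory.

(** * Twisted bimodules and their structural maps *)

Section LTwist.
Variables (W : groupType) (k : idomainType) (n : nat) (rho : rep W k n).
Variables (D' D : rdatum W k n) (v : W).

Lemma ltwist_tsum (M : lbim rho D') :
  @tsum W k n rho D' D (ltwist D v M) unit v (fun _ => v) (fun _ => M)
    (fun _ m => m) (fun _ m => m).
Proof.
split=> //.
- by move=> _; split=> // f m; [rewrite -[RHS]/(lact M _ m) | rewrite -[RHS]/(ract M m _)];
    rewrite actRK.
- by move=> [] [].
- by move=> x; rewrite (big_pred1 tt) // => -[].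
- by move=> d x; split=> [H []|/(_ tt)].
move=> w x; split; apply: (add_span_map (f := id)) => // _ [m [q [lm ->]]];
  apply: add_span_gen; exists m, q; split=> //.
exact: (lm tt).
Qed.

Variables (HD' : gdatum rho D') (HD : gdatum rho D).

Lemma ltwist_lclosed (M : lbim rho D') : lclosed M -> lclosed (ltwist D v M).
Proof. by move=> cM; apply: (tsum_lclosed (ltwist_tsum M)). Qed.

Lemma ltwist_lat (o' : wset W) (K K' : o') (M : lbim rho D') w (m : M) :
  good K K' M -> right_flat (ltwist D v M) ->
  @lat _ _ _ _ _ (ltwist D v M) w m <-> lat (v^-1 * w * v)%g m.
Proof.
move=> gM fT.
have := tsum_lat HD' HD (ltwist_tsum M) (fun _ => good_cl gM) (K := fun _ => K)
  (K' := fun _ => K') (fun _ => gM) w m fT.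
by move=> [H1 H2]; split=> [/H1/(_ tt)|H]; last exact: H2.
Qed.

Lemma ltwist_lat_gen (M : lbim rho D') w (m : M) :
  lat (v^-1 * w * v)%g m -> @lat _ _ _ _ _ (ltwist D v M) w m.
Proof. by move=> lm; apply: add_span_gen; exists m, 1. Qed.

End LTwist.

Section TwistMorphisms.
Variables (W : groupType) (k : idomainType) (n : nat) (rho : rep W k n).
Local Notation act := (actR rho).
Variables (D' D : rdatum W k n) (HD' : gdatum rho D') (HD : gdatum rho D).
Variables (o' : wset W).

Lemma is_mor_span (P : lbim rho D) (Q : lbim rho D) (G : W -> P -> Prop) (f : bhom P Q) :
  (forall w x, lcomp w x -> add_span (fun y => exists m q, G w m /\ y = mq m q) x) ->
  lclosed Q -> (forall w m, G w m -> lat w (f m)) -> is_mor f.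
Proof.
move=> H cQ Gf w x /H; apply: (add_span_ind (K := fun x => lcomp w (fQ rho D f x))).
- by rewrite bhom0; exact: lcl0.
- by move=> y z Hy Hz; rewrite (bhomD (bhomP (fQ rho D f))); exact: (lclD cQ).
by move=> _ [m [q [Gm ->]]]; rewrite fQ_mq; apply: (lcl_mq cQ); exact: Gf.
Qed.

Lemma is_mor_ltwist D1 v (M : lbim rho D1) (Q : lbim rho D) (f : bhom (ltwist D v M) Q) :
  lclosed Q -> (forall w (m : M), lat (v^-1 * w * v)%g m -> lat w (f m)) -> is_mor f.
Proof.
exact: (is_mor_span (P := ltwist D v M) (G := fun w m => @lat _ _ _ _ D1 M (v^-1 * w * v)%g m)).
Qed.

Lemma is_mor_tw_hom v v' (M N : lbim rho D') (f : bhom M N) : lclosed N -> is_mor f ->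
  @is_mor _ _ _ _ _ (ltwist D v M) (ltwist D v' N) (tw_hom rho v v' f).
Proof.
move=> cN fm; have cT := ltwist_lclosed D v' cN.
apply: (is_mor_ltwist cT) => w m lm; rewrite /tw_hom [bfun _ _]/=.
case: eqP => [e|_]; last exact: (lat0 cT).
by apply: ltwist_lat_gen; rewrite -e; exact: mor_lat.
Qed.

Lemma is_mor_tw_one (M : lbim rho D) : lclosed M ->
  @is_mor _ _ _ _ _ (ltwist D 1%g M) M (tw_one rho M).
Proof. by move=> cM; apply: is_mor_ltwist => // w m; rewrite invg1 mul1g mulg1. Qed.

Lemma is_mor_tw_mul D'' v v' (M : lbim rho D'') : lclosed M ->
  @is_mor _ _ _ _ _ (ltwist D (v * v')%g M) (ltwist D v (ltwist D' v' M)) (tw_mul rho v v' M).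
Proof.
move=> cM; apply: is_mor_ltwist; first exact/ltwist_lclosed/ltwist_lclosed.
move=> w m lm; apply: ltwist_lat_gen; apply: ltwist_lat_gen.
by move: lm; rewrite invgM !mulgA.
Qed.

Lemma is_mor_tw_R v : @is_mor _ _ _ _ _ (ltwist D v (Rw rho D' 1%g)) (Rw rho D 1%g) (tw_R rho D' v).
Proof.
have cR : lclosed (Rw rho D 1%g).
  exact: (n_cl (@Rw_nice _ _ _ rho D (pt_wset W) tt tt 1%g (gen1 _) erefl)).
apply: (is_mor_ltwist cR) => w m /Rw_lat[e|->]; last first.
  by rewrite -[tw_R _ _ _ _]/(act v 0) actR_0; exact: (lat0 cR).
left; have := congr1 (fun x => v * x * v^-1)%g e.
by rewrite !mulgA mulgV mul1g mulgK mulg1 mulgV.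
Qed.

(** The components of the twisted factors are spans over the Q of D; [ltwist_lat] identifies their
    lattices with lattices over D', where the tensor is formed. *)
Lemma is_mor_tw_tens v (K1 K2 K3 : o') (M N : lbim rho D') :
  good K1 K2 M -> good K2 K3 N -> right_flat (ltwist D v M) -> right_flat (ltwist D v N) ->
  @is_mor _ _ _ _ _ (ltens (ltwist D v M) (ltwist D v N)) (ltwist D v (ltens M N))
    (tw_tens rho v M N).
Proof.
move=> gM gN fM fN.
apply: (is_mor_span (P := ltens (ltwist D v M) (ltwist D v N)) (G := fun w t =>
  @tens_lat _ _ _ _ _ (ltwist D v M) (ltwist D v N) w t)).
- by move=> w x /ltens_lcompE.
- exact/ltwist_lclosed/ltens_lclosed/(good_cl gM).
move=> w _ [m [p [x [y [lm lp <- ->]]]]].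
have -> : tw_tens rho v M N (@tp _ _ _ (twist rho v M) (twist rho v N) m p) = @tp _ _ _ M N m p.
  exact/tlift_pure/tw_tens_bal.
have lm' : lat (v^-1 * x * v)%g (m : M) by apply/(ltwist_lat HD' HD _ _ gM fM).
have lp' : lat (v^-1 * y * v)%g (p : N) by apply/(ltwist_lat HD' HD _ _ gN fN).
apply: (@ltwist_lat_gen _ _ _ _ D' D v (ltens M N)); apply: (ltens_lat lm' lp').
by rewrite !mulgA mulgK.
Qed.

End TwistMorphisms.

(** * The endoscopic 2-category *)

Section EndoscopicBicategory.
Variables (W : groupType) (S : W -> Prop) (k : idomainType) (n : nat).
Variables (h : prerealization k n S) (o : wset W).
Hypothesis HS : coxeter_system S.
Local Notation pt := (pt_wset W).
Local Notation E L := (endo_datum h L).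
Implicit Types (L : o).

Lemma pt_wactw (a b : pt) u : wactw a u = b.
Proof. by case: (wactw a u); case: b. Qed.

Lemma in_Aendo_good L (M : lbim h (E L)) : in_Aendo M -> good (tt : pt) tt M.
Proof. exact: (in_AP_good (endo_gdatum h HS L) (Pw := fun u => wactw (tt : pt) u = tt) (fun _ e => e)). Qed.
Lemma in_Aendo_graded L (M : lbim h (E L)) : in_Aendo M -> graded M.
Proof. exact: (in_AP_graded (endo_gdatum h HS L) (Pw := fun u => wactw (tt : pt) u = tt) (fun _ e => e)). Qed.

Lemma in_Aendo_Bw L ts : in_exp (So S L) ts -> in_Aendo (Bw h (E L) (tt : pt) ts).
Proof.
move=> tsS; apply: (in_AP_Bw (endo_gdatum h HS L) (Pw := fun u => wactw (tt : pt) u = tt)) => //.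
exact: pt_wactw.
Qed.

Lemma in_Aendo_ltens L (M N : lbim h (E L)) : in_Aendo M -> in_Aendo N -> in_Aendo (ltens M N).
Proof.
pose Pw u := wactw (tt : pt) u = tt.
apply: (in_AP_ltens (endo_gdatum h HS L) (P1 := Pw) (P2 := Pw) (P3 := Pw)) => // *.
exact: pt_wactw.
Qed.

Lemma in_Aendo_btwist L L' (b : block S L L') (M : lbim h (E L')) :
  in_Aendo M -> in_Aendo (btwist b M).
Proof.
move=> iM; have H' := endo_gdatum h HS L'; have H := endo_gdatum h HS L.
have gM := in_Aendo_good iM.
pose P := fun u : seq W => wactw (tt : pt) u = tt.
have conv (j : unit) ts : in_exp (So S L') ts -> P ts -> exists us, [/\ in_exp (So S L) us,
    P us & siso (bw b) (bw b) (Bw h (E L') (tt : pt) ts) (Bw h (E L) (tt : pt) us)].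
  move=> tsS _; exists [seq (bw b * t * (bw b)^-1)%g | t <- ts]; split.
  - by move=> _ /mapP[t tt ->]; apply: (conj_So HS (bwP b)); exact: tsS.
  - exact: pt_wactw.
  - exact: (Bend_conj h HS (bwP b) tsS).
have := @tsum_in_AP _ _ _ _ _ _ H' H _ _ _ _ _ _ _ (ltwist_tsum (E L) (bw b) M)
  (fun _ => good_cl gM) pt (fun _ => tt) (fun _ => tt) (fun _ => gM)
  (fun _ => in_Aendo_graded iM) (fun _ => @endo_rebases _ _ _ _ h _ HS _ _ _ (bwP b)) (fun _ => P)
  pt tt tt P (fun _ e => e) (fun _ => iM) conv.
exact.
Qed.

Lemma edelta_emor L L' (X Y : ecell h L L') (g : eix X -> eix Y)
    (gt : forall i, bw (etag i) = bw (etag (g i)))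
    (phi : forall i, bhom (eobj i) (eobj (g i))) :
  in_endo Y -> (forall i, is_mor (phi i)) -> is_emor (edelta gt phi).
Proof.
move=> iY Hphi i j; rewrite /edelta /= /edelta_mx; case: eqP => [e|_].
  by case: _ / e.
by apply: is_mor_zero => //; exact: (good_cl (in_Aendo_good (iY j))).
Qed.

Lemma in_endo_one L : in_endo (ecell1 h L).
Proof. by move=> i; apply: (@in_Aendo_Bw L [::]). Qed.

Lemma in_endo_comp L L' L'' (X : ecell h L L') (Y : ecell h L' L'') :
  in_endo X -> in_endo Y -> in_endo (ecomp1 X Y).
Proof. by move=> iX iY [i j]; apply: in_Aendo_ltens => //; exact: in_Aendo_btwist. Qed.

Lemma endo_closedP : endo_closed h o.
Proof.
have cl L (M : lbim h (E L)) (iM : in_Aendo M) := good_cl (in_Aendo_good iM).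
split.
- exact: in_endo_one.
- exact: in_endo_comp.
- by move=> L L' X iX; apply: edelta_emor => // i; exact: is_mor_id.
- move=> L L' X Y Z f g iX iY iZ hf hg i j; apply: is_mor_sum; first exact: cl.
  by move=> l; apply: is_mor_comp; [exact: hf | exact: hg].
- move=> L L' L'' X X' Y Y' f g iX iX' iY iY' hf hg i j; apply: is_mor_thom; first exact: hf.
  by apply: is_mor_tw_hom; [exact: (cl _ _ (iY' _)) | exact: hg].
- move=> L1 L2 L3 L4 X Y Z iX iY iZ; apply: edelta_emor.
    by apply: in_endo_comp => //; exact: in_endo_comp.
  move=> [[i j] l] /=.
  have gX := in_Aendo_good (iX i); have gY := in_Aendo_good (in_Aendo_btwist (etag i) (iY j)).
  have iZ2 := in_Aendo_btwist (etag j) (iZ l).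
  have gZ := in_Aendo_good (in_Aendo_btwist (block_mul (etag i) (etag j)) (iZ l)).
  have gZ2 := in_Aendo_good (in_Aendo_btwist (etag i) iZ2).
  apply: (@is_mor_comp _ _ _ _ _ _ (ltens (eobj i) (ltens (btwist (etag i) (eobj j))
    (btwist (block_mul (etag i) (etag j)) (eobj l))))).
    exact: (is_mor_assoc (endo_gdatum h HS L1) gX gY gZ).
  apply: is_mor_thom; first exact: is_mor_id.
  apply: (@is_mor_comp _ _ _ _ _ _ (ltens (btwist (etag i) (eobj j))
    (btwist (etag i) (btwist (etag j) (eobj l))))).
    apply: is_mor_thom; first exact: is_mor_id.
    exact: (is_mor_tw_mul (E L2) (cl _ _ (iZ l))).
  exact: (is_mor_tw_tens (endo_gdatum h HS L2) (endo_gdatum h HS L1) (in_Aendo_good (iY j))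
    (in_Aendo_good iZ2) (g_flat gY) (g_flat gZ2)).
- move=> L L' X iX; apply: edelta_emor => // -[[] i] /=.
  apply: (@is_mor_comp _ _ _ _ _ _ (ltens (Rw h (E L) 1%g) (eobj i))).
    by apply: is_mor_thom; [exact: is_mor_id | exact: (is_mor_tw_one (cl _ _ (iX i)))].
  exact: (is_mor_lun (cl _ _ (iX i))).
- move=> L L' X iX; apply: edelta_emor => // -[i []] /=.
  apply: (@is_mor_comp _ _ _ _ _ _ (ltens (eobj i) (Rw h (E L) 1%g))).
    by apply: is_mor_thom; [exact: is_mor_id | exact: is_mor_tw_R].
  exact: (is_mor_run (cl _ _ (iX i))).
Qed.

End EndoscopicBicategory.

(** * Products of finite families of groups *)

Section DependentFunctions.
Variables (I : finType) (M : I -> zmodType).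

Definition dfun : Type := forall i, M i.
HB.instance Definition _ := gen_eqMixin dfun.
HB.instance Definition _ := gen_choiceMixin dfun.

Lemma dfun_ext (x y : dfun) : (forall i, x i = y i) -> x = y.
Proof. exact: functional_extensionality_dep. Qed.

Let add (x y : dfun) : dfun := fun i => x i + y i.
Let opp (x : dfun) : dfun := fun i => - x i.
Let zero : dfun := fun i => 0.
Let addA : associative add.
Proof. by move=> x y z; apply: dfun_ext => i; exact: addrA. Qed.
Let addC : commutative add.
Proof. by move=> x y; apply: dfun_ext => i; exact: addrC. Qed.
Let add0 : left_id zero add.
Proof. by move=> x; apply: dfun_ext => i; exact: add0r. Qed.
Let addN : left_inverse zero opp add.
Proof. by move=> x; apply: dfun_ext => i; exact: addNr. Qed.
HB.instance Definition _ := GRing.isZmodule.Build dfun addA addC add0 addN.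

Lemma dfunD (x y : dfun) i : (x + y) i = x i + y i. Proof. by []. Qed.
Lemma dfun_sum (K : Type) (r : seq K) (p : pred K) (x : K -> dfun) i :
  (\sum_(a <- r | p a) x a) i = \sum_(a <- r | p a) x a i.
Proof. by apply: (big_morph (fun x : dfun => x i)). Qed.

Definition dsingle (j : I) (m : M j) : dfun := fun i =>
  match j =P i with
  | ReflectT e => match e in _ = i' return M i' with erefl => m end
  | ReflectF _ => 0
  end.

Lemma dsingleE j m : dsingle m j = m.
Proof. by rewrite /dsingle; case: eqP => // e; rewrite (eq_axiomK e). Qed.
Lemma dsingle_neq j i (m : M j) : j <> i -> dsingle m i = 0.
Proof. by rewrite /dsingle; case: eqP. Qed.
Lemma dsingle_sum (x : dfun) : x = \sum_j dsingle (x j).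
Proof.
apply: dfun_ext => i; rewrite dfun_sum (bigD1 i) //= dsingleE big1 ?addr0 // => j /eqP ji.
exact: dsingle_neq.
Qed.
Lemma dsingleD j (m m' : M j) : dsingle (m + m') = dsingle m + dsingle m'.
Proof.
apply: dfun_ext => i; rewrite dfunD /dsingle; case: eqP => [e|_]; last by rewrite addr0.
by case: _ / e.
Qed.

End DependentFunctions.

(** * Construction of the twisted direct sum *)

Section TwistedSumObject.
Variables (W : groupType) (k : idomainType) (n : nat) (rho : rep W k n).
Local Notation R := (Rh k n).
Local Notation act := (actR rho).
Variables (D' D : rdatum W k n) (J : finType) (v : J -> W) (M : J -> lbim rho D').

Lemma twsum_axioms : @bimod_axioms R R (dfun (fun j => bcar (M j)))
  (fun f x => (fun j => lact (M j) f (x j)) : dfun (fun j => bcar (M j)))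
  (fun x f => (fun j => ract (M j) (x j) (act (v j) f)) : dfun (fun j => bcar (M j))).
Proof.
split=> *; apply: dfun_ext => j.
- exact: lact1.
- exact: lactM.
- exact: lact_Dl.
- exact: lactD.
- by rewrite actR_1; exact: ract1.
- by rewrite actR_M; exact: ractM.
- by rewrite actR_D; exact: ract_Dr.
- exact: ractD.
- exact: (bmC (bimodP (M j))).
Qed.
Definition twsum_bim : bimod R R := Bimod twsum_axioms.

Definition twsum : lbim rho D :=
  @Lbim W k n rho D twsum_bim (fun d x => forall j, ldeg d (x j))
    (fun w => add_span (fun y => exists (x : twsum_bim) (q : Q rho D),
       (forall j, lat (w * (v j)^-1)%g (x j)) /\ y = @mq W k n rho D twsum_bim x q)).

Definition dinc j (m : M j) : twsum := @dsingle J (fun j => bcar (M j)) j m.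
Definition dpro j (x : twsum) : M j := x j.

Lemma dpro_inc j m : dpro j (dinc m) = m. Proof. exact: dsingleE. Qed.
Lemma dpro_inc_neq i j (m : M i) : i <> j -> dpro j (dinc m) = 0.
Proof. exact: dsingle_neq. Qed.
Lemma twsum_ext (x y : twsum) : (forall j, dpro j x = dpro j y) -> x = y.
Proof. exact: dfun_ext. Qed.
Lemma dproD j x y : dpro j (x + y) = dpro j x + dpro j y. Proof. by []. Qed.
Lemma dpro_l j f x : dpro j (lact twsum f x) = lact (M j) f (dpro j x). Proof. by []. Qed.
Lemma dpro_r j f x : dpro j (ract twsum x f) = ract (M j) (dpro j x) (act (v j) f).
Proof. by []. Qed.
Lemma dinc_sum (x : twsum) : x = \sum_j dinc (dpro j x).
Proof. exact: dsingle_sum. Qed.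

(** The right action on M j goes through v j, so the inclusion of M j is semilinear with right twist
    (v j)^-1. *)
Lemma twsum_tsum : @tsum W k n rho D' D twsum J 1%g (fun j => (v j)^-1%g) M dinc dpro.
Proof.
split.
- move=> j; split=> [x y|f m|f m]; first exact: dsingleD.
    apply: twsum_ext => i; rewrite dpro_l actR1.
    have [e|/eqP ne] := eqVneq j i; first by subst i; rewrite !dpro_inc.
    by rewrite !dpro_inc_neq // lact0.
  apply: twsum_ext => i; rewrite dpro_r.
  have [e|/eqP ne] := eqVneq j i; first by subst i; rewrite !dpro_inc actRVK.
  by rewrite !dpro_inc_neq // ract0.
- by move=> j; split=> // f x; rewrite ?dpro_l ?dpro_r ?invg1 ?actR1 ?invgK.
- exact: dpro_inc.
- exact: dpro_inc_neq.
- exact: dinc_sum.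
- by [].
move=> w x; split; apply: (add_span_map (f := id)) => // y [m [q [lm ->]]];
  apply: add_span_gen; exists m, q; split=> // j; have := lm j;
  by rewrite invg1 mul1g.
Qed.

Lemma dinc_ext (N : bimod R R) (f g : bhom twsum N) :
  (forall j m, f (dinc (j := j) m) = g (dinc m)) -> f =1 g.
Proof.
by move=> H x; rewrite (dinc_sum x) !bhom_sum; apply: eq_bigr => j _; exact: H.
Qed.

End TwistedSumObject.

(** * Bijective morphisms *)

Section InverseMorphism.
Variables (W : groupType) (k : idomainType) (n : nat) (rho : rep W k n).
Variables (D : rdatum W k n) (HD : gdatum rho D) (o : wset W) (L L' : o).

Lemma bhom_inv_axioms (A C : pzRingType) (M N : bimod A C) (f : bhom M N) (g : N -> M) :
  cancel f g -> cancel g f -> bhom_axioms g.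
Proof.
move=> fK gK; have [f1 f2 f3] := bhomP f.
split=> [x y|a x|x c]; apply: (can_inj fK); rewrite ?f1 ?f2 ?f3 !gK;
  exact: erefl.
Qed.

(** After a denominator, g y decomposes into lattice elements. Applying f gives a decomposition of a
    multiple of y, which lies at w, so by uniqueness and injectivity the parts at other indices
    vanish. *)
Lemma is_mor_inv (M N : lbim rho D) (f : bhom M N) (g : bhom N M) :
  good L L' M -> good L L' N -> is_mor f -> cancel f g -> cancel g f -> is_mor g.
Proof.
move=> gM gN fm fK gK; apply: (is_mor_lat HD (good_cl gN) (good_cl gM)) => w y ly.
have [d [dd sd]] := lat_dec gM (g y).
have cM := good_cl gM; have cN := good_cl gN.
apply: (lat_div HD cM dd).
suff [a [ra [s [us sa xa]]]] : exists a : W -> M, (forall w, lat w (a w)) /\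
    exists s : seq W, [/\ uniq s, forall w, w \notin s -> a w = 0 &
      ract M (g y) d = \sum_(w <- s) a w].
  have E z : z <> w -> a z = 0.
    move=> zw; apply: (can_inj fK); rewrite bhom0; apply: (mq_inj (rho := rho) (D := D) (g_flat gN)).
    pose c z := mq (f (a z)) 1 : MQ rho D N.
    have [us1 us2] := (conj us us).
    have r1 : ds_rep (@lcomp _ _ _ _ _ N) (mq (ract N y d) 1) c.
      split=> [x|]; first exact: (mor_lat fm (ra x)).
      exists s; split=> // [x /sa|]; first by rewrite /c => ->; rewrite bhom0 mq0l.
      rewrite /c -(mq_suml (rho := rho)) -bhom_sum -xa (bhomr (bhomP f)) gK.
      exact: erefl.
    have r2 := ds_rep1 (ds_sub (g_sum gN)) (lat_r cN d ly).
    by rewrite -/(c z) (ds_rep_uniq (g_sum gN) r1 r2 z); case: eqP.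
  rewrite xa; apply: (lat_sum cM) => z _.
  by have [->|/eqP/E->] := eqVneq z w; [exact: ra | exact: (lat0 cM)].
have lds x : lat x (0 : M) /\ (forall a b : M, lat x a -> lat x b -> lat x (a - b)).
  by split; [exact: (lat0 cM) | exact: (latB cM)].
by have [a [H1 H2]] := ds_rep_span lds sd; exists a; split.
Qed.

End InverseMorphism.

(** * The 2-functor *)

Section Psi.
Variables (W : groupType) (S : W -> Prop) (k : idomainType) (n : nat).
Variables (h : prerealization k n S) (o : wset W).
Hypothesis HS : coxeter_system S.
Local Notation R := (Rh k n).
Local Notation act := (actR h).
Local Notation pt := (pt_wset W).
Local Notation E L := (endo_datum h L).
Local Notation full := (full_datum h).
Implicit Types (L : o).

Definition Psi1 L L' (X : ecell h L L') : lbim h full :=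
  twsum full (fun i : eix X => bw (etag i)) (fun i => eobj i).
Local Notation pr i := (@dpro _ _ _ _ _ full _ (fun a => bw (etag a)) (fun a => eobj a) i).
Local Notation inj i := (@dinc _ _ _ _ _ full _ (fun a => bw (etag a)) (fun a => eobj a) i).

Lemma block_expansion L L' (b : block S L L') ts : in_exp (So S L) ts -> exists us,
  [/\ in_exp S us, wactw L us = L', bword L us = bw b & ts_of L us = ts].
Proof.
move=> tsS; have [x' ex x'S] := expands_exists HS tsS.
have [p [pS pw pL pK]] := block_word (bwP b).
have [e1 e2 e3] := ts_of_expands HS tsS ex pK.
by exists (x' ++ p); split; [apply/in_exp_cat | rewrite e3 | rewrite e2 | exact: e1].
Qed.

(** The condition on words is left open to serve both the 2-functor and its restriction to the
    neutral block. *)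
Lemma Psi1_in_AP L L' (Pw : seq W -> Prop) (X : ecell h L L') : in_endo X ->
  (forall us, Pw us -> wactw L us = L') ->
  (forall (i : eix X) us, in_exp S us -> wactw L us = L' -> bword L us = bw (etag i) -> Pw us) ->
  in_AP L L' Pw (Psi1 X).
Proof.
move=> iX PwL HPw; have H' := endo_gdatum h HS L; have H := full_gdatum h o HS.
pose P := fun u : seq W => wactw (tt : pt) u = tt.
have conv (i : eix X) ts : in_exp (So S L) ts -> P ts -> exists us, [/\ in_exp S us,
    Pw us & siso 1%g (bw (etag i))^-1%g (Bw h (E L) (tt : pt) ts) (Bw h full L us)].
  move=> tsS _; have [us [uS uL ub <-]] := block_expansion (etag i) tsS.
  by exists us; split=> //; [exact: (HPw i) | rewrite -ub; exact: siso_Bw].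
have gM (i : eix X) := in_Aendo_good HS (iX i).
exact: (@tsum_in_AP _ _ _ _ _ _ H' H _ _ _ _ _ _ _
  (twsum_tsum full (fun i : eix X => bw (etag i)) (fun i => eobj i))
  (fun i => good_cl (gM i)) pt (fun _ => tt) (fun _ => tt) gM
  (fun i => in_Aendo_graded HS (iX i))
  (fun i => @endo_full_rebases _ _ _ _ h _ HS L (bw (etag i))^-1%g) (fun _ => P)
  o L L' Pw PwL iX conv).
Qed.

Lemma Psi1_in_A L L' (X : ecell h L L') : in_endo X -> in_A L L' (Psi1 X).
Proof.
move=> iX; apply: (Psi1_in_AP (Pw := fun us => wactw L us = L') iX) => //.
Qed.

Lemma Psi1_good L L' (X : ecell h L L') : in_endo X -> good L L' (Psi1 X).
Proof.
move=> /Psi1_in_A; apply: (in_AP_good (full_gdatum h o HS) (Pw := fun us => wactw L us = L')).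
by [].
Qed.

Lemma Psi1_lat L L' (X : ecell h L L') w (x : Psi1 X) : in_endo X ->
  lat w x <-> forall i, lat (w * (bw (etag i))^-1)%g (pr i x).
Proof.
move=> iX; have gM (i : eix X) := in_Aendo_good HS (iX i).
have := tsum_lat (endo_gdatum h HS L) (full_gdatum h o HS)
  (twsum_tsum full (fun i : eix X => bw (etag i)) (fun i => eobj i))
  (fun i => good_cl (gM i)) (o' := pt) (K := fun _ => tt) (K' := fun _ => tt) gM w x (g_flat (Psi1_good iX)).
move=> [H1 H2]; split=> [lx i|H].
  by have := H1 lx i; rewrite invg1 mul1g.
by apply: H2 => i; rewrite invg1 mul1g.
Qed.

Lemma Psi1_inj_lat L L' (X : ecell h L L') w i (m : eobj (e := X) i) : in_endo X ->
  lat (w * (bw (etag i))^-1)%g m -> lat w (inj i m).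
Proof.
move=> iX lm; have gM (i : eix X) := in_Aendo_good HS (iX i).
have := @tsum_inc_lat _ _ _ _ _ _ _ _ _ _ _ _ _ 
  (twsum_tsum full (fun i : eix X => bw (etag i)) (fun i => eobj i))
  (fun i => good_cl (gM i)) w i m.
by rewrite invg1 mul1g; apply.
Qed.

Section Psi2.
Variables (L L' : o) (X Y : ecell h L L').

Lemma Psi2_axioms (f : ehom X Y) : @bhom_axioms R R (Psi1 X) (Psi1 Y)
  (fun x => (fun j => \sum_i emx f i j (pr i x)) : Psi1 Y).
Proof.
split=> [x y|a x|x c]; apply: twsum_ext => j.
- rewrite dproD -big_split; apply: eq_bigr => i _.
  by rewrite dproD (bhomD (bhomP (emx f i j))).
- rewrite dpro_l [RHS]lact_sum; apply: eq_bigr => i _.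
  by rewrite dpro_l (bhoml (bhomP (emx f i j))).
rewrite dpro_r [RHS]ract_sum; apply: eq_bigr => i _.
rewrite dpro_r (bhomr (bhomP (emx f i j))).
(* Between different blocks the right twists disagree, but there the matrix entry vanishes. *)
have [->|/eqP ne] := eqVneq (bw (etag i)) (bw (etag j)) => //.
by rewrite !(emx0 f ne) !ract0.
Qed.
Definition Psi2 (f : ehom X Y) : bhom (Psi1 X) (Psi1 Y) := Bhom (Psi2_axioms f).

Lemma Psi2E f x j : pr j (Psi2 f x) = \sum_i emx f i j (pr i x).
Proof. by []. Qed.

Lemma Psi2_inj f i j m : pr j (Psi2 f (inj i m)) = emx f i j m.
Proof.
rewrite Psi2E (bigD1 i) //= dpro_inc big1 ?addr0 // => i' /eqP ii'.
by rewrite dpro_inc_neq ?bhom0 // => e; apply: ii'.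
Qed.

Lemma Psi2_mor f : in_endo X -> in_endo Y -> is_emor f -> is_mor (Psi2 f).
Proof.
move=> iX iY fm.
apply: (is_mor_lat (full_gdatum h o HS) (good_cl (Psi1_good iX)) (good_cl (Psi1_good iY))).
move=> w x /(Psi1_lat _ _ iX) lx; apply/(Psi1_lat _ _ iY) => j; rewrite Psi2E.
have cY := good_cl (in_Aendo_good HS (iY j)).
apply: (lat_sum cY) => i _.
have [e|/eqP ne] := eqVneq (bw (etag i)) (bw (etag j)).
  by rewrite -e; apply: (mor_lat (fm i j)).
by rewrite (emx0 f ne); exact: (lat0 cY).
Qed.

Lemma ehom_ext (f g : ehom X Y) : (forall i j m, emx f i j m = emx g i j m) -> f = g.
Proof.
case: f g => [f f0] [g g0] /= H.
have e : f = g.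
  apply: functional_extensionality_dep => i; apply: functional_extensionality_dep => j.
  by apply: bhom_ext; exact: H.
by subst g; congr Ehom; exact: Prop_irrelevance.
Qed.

Lemma Psi2_faithful f g : Psi2 f =1 Psi2 g -> f = g.
Proof. by move=> H; apply: ehom_ext => i j m; rewrite -!Psi2_inj H. Qed.

(** b_L is multiplicative and trivial on W_L^o, so both block values equal b_L(a). *)
Lemma block_disjoint (a : W) (b c : block S L L') : gen (So S L) (a * (bw b)^-1)%g ->
  gen (So S L) (a * (bw c)^-1)%g -> bw b = bw c.
Proof.
move=> /gen_Wo[Lb vb] /gen_Wo[Lc vc].
have [_ wb] := bw_in_block b; have [_ wc] := bw_in_block c.
apply: (bval_uniq HS (L := L) (w := a)).
  by have := bval_mul Lb vb wb; rewrite mulgVK mul1g.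
by have := bval_mul Lc vc wc; rewrite mulgVK mul1g.
Qed.

Section Full.
Variables (iX : in_endo X) (iY : in_endo Y) (g : bhom (Psi1 X) (Psi1 Y)).
Hypothesis gm : is_mor g.
Let c (i : eix X) (j : eix Y) (m : eobj (e := X) i) : eobj (e := Y) j := pr j (g (inj i m)).

Let cD (i : eix X) (j : eix Y) x y : c (i := i) j (x + y) = c j x + c j y.
Proof. by rewrite /c (semiD (ts_inc (twsum_tsum _ _ _) i)) (bhomD (bhomP g)). Qed.
Let c0 (i : eix X) (j : eix Y) : c (i := i) j 0 = 0.
Proof.
have e := cD (i := i) j 0 0; rewrite addr0 in e.
by apply: (addrI (c (i := i) j 0)); rewrite addr0; exact: (esym e).
Qed.
Let cl (i : eix X) (j : eix Y) a x : c (i := i) j (lact _ a x) = lact _ a (c j x).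
Proof.
by rewrite /c (semil (ts_inc (twsum_tsum _ _ _) i)) actR1 (bhoml (bhomP g)) dpro_l.
Qed.
Let cr (i : eix X) (j : eix Y) x f : c (i := i) j (ract _ x f) =
  ract _ (c j x) (act (bw (etag j)) (act (bw (etag i))^-1%g f)).
Proof.
by rewrite /c (semir (ts_inc (twsum_tsum _ _ _) i)) (bhomr (bhomP g)) dpro_r.
Qed.
Let c_lat (i : eix X) (j : eix Y) w m : lat w m -> lat (w * bw (etag i) * (bw (etag j))^-1)%g (c (i := i) j m).
Proof.
move=> lm; apply: ((Psi1_lat _ _ iY).1 _ j); apply: (mor_lat gm).
by apply: (Psi1_inj_lat iX); rewrite mulgK.
Qed.
(** A lattice element with nonzero image would put w [bw (etag i)] in the cosets of both blocks. A
    general m is a sum of lattice elements after a denominator, and the target is torsion free. *)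
Let c_zero (i : eix X) (j : eix Y) m : bw (etag i) <> bw (etag j) -> c (i := i) j m = 0.
Proof.
move=> ne; have gX := in_Aendo_good HS (iX i); have gY := in_Aendo_good HS (iY j).
have c_lat0 w (x : eobj (e := X) i) : lat w x -> c (i := i) j x = 0.
  move=> lx; apply: contrapT => nz.
  have [gw _] := lat_supp gX lx (fun e => nz (etrans (congr1 (c j) e) (c0 i j))).
  have [gw' _] := lat_supp gY (c_lat j lx) nz.
  by apply: ne; apply: (block_disjoint (a := w * bw (etag i)))%g; rewrite ?mulgK.
have [d [dd sd]] := lat_dec gX m.
have d0 : act (bw (etag j)) (act (bw (etag i))^-1%g d) != 0.
  apply/eqP => e; have := den_neq0 (endo_gdatum h HS L) dd.
  rewrite -(actRVK h (bw (etag i)) d) -[act _^-1%g d](actRK h (bw (etag j))) e.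
  by rewrite !actR_0 eqxx.
apply: (flat_torsion_free (g_flat gY) d0); rewrite -cr.
move: sd; apply: (add_span_ind (K := fun x => c j x = 0)) => [|x y x0 y0|x [w lx]].
- exact: c0.
- by rewrite cD x0 y0 addr0.
- exact: c_lat0 lx.
Qed.

Lemma Psi2_full : exists f : ehom X Y, is_emor f /\ Psi2 f =1 g.
Proof.
have ax i j : bhom_axioms (c (i := i) j).
  split=> [x y|a x|x f]; [exact: cD | exact: cl | rewrite cr].
  have [->|/eqP ne] := eqVneq (bw (etag i)) (bw (etag j)); first by rewrite actRVK.
  by rewrite c_zero // !ract0.
exists (@Ehom _ _ _ _ _ _ _ _ X Y (fun i j => Bhom (ax i j)) (fun i j ne m => c_zero m ne)); split.
  move=> i j; have cX := good_cl (in_Aendo_good HS (iX i)).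
  have cY := good_cl (in_Aendo_good HS (iY j)).
  have [e|/eqP ne] := eqVneq (bw (etag i)) (bw (etag j)); last first.
    by apply: is_mor_zero => // m; exact: c_zero.
  apply: (is_mor_lat (endo_gdatum h HS L) cX cY) => w m /(c_lat j).
  by rewrite e mulgK.
by apply: dinc_ext => i m; apply: twsum_ext => j; rewrite Psi2_inj.
Qed.

End Full.
End Psi2.
End Psi.

(** * Compatibility of the 2-functor with horizontal composition *)

Section PsiLaws.
Variables (W : groupType) (S : W -> Prop) (k : idomainType) (n : nat).
Variables (h : prerealization k n S) (o : wset W).
Local Notation R := (Rh k n).
Local Notation act := (actR h).
Local Notation full := (full_datum h).
Implicit Types (L : o).
Local Notation pr i := (@dpro _ _ _ _ _ full _ (fun a => bw (etag a)) (fun a => eobj a) i).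
Local Notation inj i := (@dinc _ _ _ _ _ full _ (fun a => bw (etag a)) (fun a => eobj a) i).

Lemma Psi2_edelta L L' (X Y : ecell h L L') (g : eix X -> eix Y)
    (gt : forall i, bw (etag i) = bw (etag (g i)))
    (phi : forall i, bhom (eobj i) (eobj (g i))) x i : injective g ->
  pr (g i) (Psi2 (edelta gt phi) x) = phi i (pr i x).
Proof.
move=> gI; rewrite Psi2E (bigD1 i) //= big1 ?addr0 => [|i' /eqP ne].
  by rewrite /edelta_mx; case: eqP => // e; rewrite (eq_axiomK e).
by rewrite /edelta_mx; case: eqP => // e; case: ne; exact: gI e.
Qed.

Lemma Psi2_id L L' (X : ecell h L L') : Psi2 (eid X) = bid (Psi1 X).
Proof.
apply: bhom_ext => x; apply: twsum_ext => i.
exact: (@Psi2_edelta _ _ X X id _ _ x i (fun _ _ e => e)).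
Qed.

Lemma Psi2_comp L L' (X Y Z : ecell h L L') (f : ehom X Y) (g : ehom Y Z) :
  Psi2 (ecomp2 f g) = bcomp (Psi2 f) (Psi2 g).
Proof.
apply: bhom_ext => x; apply: twsum_ext => l; rewrite bcompE !Psi2E.
under [RHS]eq_bigr => j _ do rewrite Psi2E bhom_sum.
by rewrite exchange_big; apply: eq_bigr => i _.
Qed.

Section Comp.
Variables (L L' L'' : o) (X : ecell h L L') (Y : ecell h L' L'').

Definition psic_fun (x : Psi1 X) (y : Psi1 Y) : Psi1 (ecomp1 X Y) :=
  fun ij => @tp _ _ _ (eobj ij.1) (twist h (bw (etag ij.1)) (eobj ij.2)) (pr ij.1 x) (pr ij.2 y).

Lemma psic_funE i j x y : pr ((i, j) : eix (ecomp1 X Y)) (psic_fun x y) =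
  @tp _ _ _ (eobj i) (twist h (bw (etag i)) (eobj j)) (pr i x) (pr j y).
Proof. by []. Qed.

(** The right action on the i-th part of x is twisted by its block value, the left action on the
    twisted second factor by the inverse, and the two cancel. *)
Lemma psic_bal : balanced (ract (Psi1 X)) (lact (Psi1 Y)) psic_fun.
Proof.
split=> [x x' y|x y y'|x b y]; apply: twsum_ext => -[i j].
- by rewrite dproD !psic_funE dproD tpDl.
- by rewrite dproD !psic_funE dproD tpDr.
rewrite !psic_funE dpro_r dpro_l tp_mid.
by rewrite -[lact (twist _ _ _) _ _]/(lact (eobj j) _ _) actRK.
Qed.

Definition psic : bhom (tbim (Psi1 X) (Psi1 Y)) (Psi1 (ecomp1 X Y)).
Proof.
refine (Bhom (tblift_axioms psic_bal _ _)).
- by move=> a x y; apply: twsum_ext => -[i j]; rewrite dpro_l !psic_funE dpro_l lact_tp.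
- move=> x y c; apply: twsum_ext => -[i j]; rewrite dpro_r !psic_funE dpro_r ract_tp.
  by rewrite -[ract (twist _ _ _) _ _]/(ract (eobj j) _ _) actRM actRK.
Defined.

Lemma psicE i j x y : pr ((i, j) : eix (ecomp1 X Y)) (psic (tp x y)) =
  @tp _ _ _ (eobj i) (twist h (bw (etag i)) (eobj j)) (pr i x) (pr j y).
Proof. by rewrite -psic_funE; congr (pr _ _); exact/tlift_pure/psic_bal. Qed.

Let sX := ts_inc (twsum_tsum full (fun i : eix X => bw (etag i)) (fun i => eobj i)).
Let sY := ts_inc (twsum_tsum full (fun j : eix Y => bw (etag j)) (fun j => eobj j)).

Section Iota.
Variables (i : eix X) (j : eix Y).
Let T := tbim (eobj i) (twist h (bw (etag i)) (eobj j)).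

Lemma psid_bal : balanced (ract (eobj i)) (lact (twist h (bw (etag i)) (eobj j)))
  (fun m p => tp (inj i m) (inj j p)).
Proof.
split=> [m m' p|m p p'|m b p].
- by rewrite (semiD (sX i)) tpDl.
- by rewrite (semiD (sY j)) tpDr.
by rewrite (semir (sX i)) tp_mid -[lact (twist _ _ _) _ _]/(lact (eobj j) _ _)
  (semil (sY j)) actR1.
Qed.
Definition iota (t : T) : tbim (Psi1 X) (Psi1 Y) := tlift (fun m p => tp (inj i m) (inj j p)) t.
Lemma iotaD s t : iota (s + t) = iota s + iota t.
Proof. exact/tliftD/psid_bal. Qed.
Lemma iotaE m p : iota (tp m p) = tp (inj i m) (inj j p).
Proof. exact/tlift_pure/psid_bal. Qed.
Lemma iota0 : iota 0 = 0.
Proof. by apply: (addrI (iota 0)); rewrite -iotaD !addr0. Qed.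

Lemma psic_iota t : psic (iota t) = inj ((i, j) : eix (ecomp1 X Y)) t.
Proof.
have sC := ts_inc (twsum_tsum full (fun i : eix (ecomp1 X Y) => bw (etag i)) (fun i => eobj i)) (i, j).
elim/tb_ind: t => [|s t Hs Ht|m p].
- by rewrite iota0 bhom0 (semi0 sC).
- by rewrite iotaD (bhomD (bhomP psic)) Hs Ht (semiD sC).
rewrite iotaE; apply: twsum_ext => -[i' j']; rewrite psicE.
have [e|/eqP ne] := eqVneq (i, j) (i', j').
  by case: e => ei ej; subst i' j'; rewrite !dpro_inc.
rewrite [RHS]dpro_inc_neq //.
have [e|/eqP ne'] := eqVneq i i'; last by rewrite dpro_inc_neq // tp0l.
have [e'|/eqP ne'] := eqVneq j j'; last by rewrite [dpro j' _]dpro_inc_neq // tp0r.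
by case: ne; rewrite e e'.
Qed.
End Iota.

Definition psid_fun (t : Psi1 (ecomp1 X Y)) : tbim (Psi1 X) (Psi1 Y) :=
  \sum_(ij : eix X * eix Y) iota (pr (ij : eix (ecomp1 X Y)) t).

Lemma psidK : cancel psid_fun psic.
Proof.
move=> t; rewrite bhom_sum [RHS]dinc_sum; apply: eq_bigr => -[i j] _.
exact: psic_iota.
Qed.

Lemma psicK : cancel psic psid_fun.
Proof.
have D x y : psid_fun (x + y) = psid_fun x + psid_fun y.
  by rewrite -big_split; apply: eq_bigr => ij _; rewrite dproD iotaD.
have Z : psid_fun 0 = 0 by apply: (addrI (psid_fun 0)); rewrite -D !addr0.
move=> t; elim/tb_ind: t => [|s t Hs Ht|x y].
- by rewrite bhom0 Z.
- by rewrite (bhomD (bhomP psic)) D Hs Ht.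
rewrite [in RHS](dinc_sum x) [in RHS](dinc_sum y) tp_suml.
under [RHS]eq_bigr => i _ do rewrite tp_sumr.
rewrite pair_bigA; apply: eq_bigr => -[i j] _.
by rewrite psicE iotaE.
Qed.

Definition psid : bhom (Psi1 (ecomp1 X Y)) (tbim (Psi1 X) (Psi1 Y)) :=
  Bhom (bhom_inv_axioms psicK psidK).

End Comp.

Lemma tw_homE (v v' : W) (M N : bimod R R) (f : bhom M N) m :
  tw_hom h v v' f m = if v == v' then f m else 0.
Proof. by []. Qed.

Lemma psic_nat L L' L'' (X X' : ecell h L L') (Y Y' : ecell h L' L'') (f : ehom X X')
    (g : ehom Y Y') :
  bcomp (thom (Psi2 f) (Psi2 g)) (psic X' Y') = bcomp (psic X Y) (Psi2 (ehcomp f g)).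
Proof.
apply: tb_hom_ext => x y; rewrite !bcompE thomE; apply: twsum_ext => -[i' j'].
rewrite psicE !Psi2E tp_suml; under eq_bigr => i _ do rewrite tp_sumr.
rewrite pair_bigA; apply: eq_bigr => -[i j] _; rewrite psicE.
rewrite [RHS]thomE tw_homE.
(* [tw_hom] vanishes between different twists, and so does the corresponding entry of f. *)
case: eqP => [//|ne]; by rewrite (emx0 f ne) !tp0l.
Qed.

Lemma psi_assoc L1 L2 L3 L4 (X : ecell h L1 L2) (Y : ecell h L2 L3) (Z : ecell h L3 L4) :
  bcomp (thom (psic X Y) (bid (Psi1 Z))) (bcomp (psic (ecomp1 X Y) Z) (Psi2 (eassoc X Y Z))) =
  bcomp (tassoc (Psi1 X) (Psi1 Y) (Psi1 Z))
    (bcomp (thom (bid (Psi1 X)) (psic Y Z)) (psic X (ecomp1 Y Z))).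
Proof.
apply: tb_hom_ext3 => x y z; rewrite !bcompE tassocE !thomE.
apply: twsum_ext => -[i [j l]].
have gI : injective (fun i : eix X * eix Y * eix Z => (i.1.1, (i.1.2, i.2))).
  by move=> [[a b] c] [[a' b'] c'] [-> -> ->].
apply: etrans; first exact: (@Psi2_edelta _ _ (ecomp1 (ecomp1 X Y) Z) (ecomp1 X (ecomp1 Y Z))
  (fun i => (i.1.1, (i.1.2, i.2))) _ _ _ ((i, j), l) gI).
rewrite [in RHS]psicE psicE psicE !bcompE.
rewrite (psicE i j x y) [X in thom _ _ X]tassocE thomE bcompE thomE.
congr (tp _ _); exact/tlift_pure/tw_tens_bal.
Qed.

Lemma psiu_axioms L : @bhom_axioms R R (Rw h full 1%g) (Psi1 (ecell1 h L))
  (fun f => (fun _ => f) : Psi1 (ecell1 h L)).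
Proof.
split=> [f g|a f|f c]; [exact: erefl|exact: erefl|].
apply: twsum_ext => i; rewrite dpro_r.
by rewrite -[RHS]/(act 1%g (act 1%g c) * f) actR1.
Qed.
Definition psiu L : bhom (Rw h full 1%g) (Psi1 (ecell1 h L)) := Bhom (psiu_axioms L).
Definition psiu'_fun L (x : Psi1 (ecell1 h L)) : Rw h full 1%g := x tt.

Lemma psiuK L : cancel (psiu L) (@psiu'_fun L). Proof. by move=> f; exact: erefl. Qed.
Lemma psiuVK L : cancel (@psiu'_fun L) (psiu L).
Proof. by move=> x; apply: functional_extensionality_dep => -[]; exact: erefl. Qed.
Definition psiu' L : bhom (Psi1 (ecell1 h L)) (Rw h full 1%g) :=
  Bhom (bhom_inv_axioms (@psiuK L) (@psiuVK L)).

Lemma psi_lunit L L' (X : ecell h L L') :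
  lun h full (Psi1 X) = bcomp (thom (psiu L) (bid (Psi1 X)))
    (bcomp (psic (ecell1 h L) X) (Psi2 (elunit X))).
Proof.
apply: tb_hom_ext => f x; rewrite !bcompE thomE lunE; apply: twsum_ext => i; rewrite dpro_l.
have gI : injective (fun i : unit * eix X => i.2) by move=> [[] a] [[] b] /= ->.
apply: esym; apply: etrans; first exact: (@Psi2_edelta _ _ (ecomp1 (ecell1 h L) X) X
  (fun i => i.2) _ _ _ (tt, i) gI).
by rewrite psicE bcompE thomE; exact: lunE.
Qed.

Lemma psi_runit L L' (X : ecell h L L') :
  run h full (Psi1 X) = bcomp (thom (bid (Psi1 X)) (psiu L'))
    (bcomp (psic X (ecell1 h L')) (Psi2 (erunit X))).
Proof.
apply: tb_hom_ext => x f; rewrite !bcompE thomE runE; apply: twsum_ext => i; rewrite dpro_r.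
have gI : injective (fun i : eix X * unit => i.1) by move=> [a []] [b []] /= ->.
apply: esym; apply: etrans; first exact: (@Psi2_edelta _ _ (ecomp1 X (ecell1 h L')) X
  (fun i => i.1) _ _ _ (i, tt) gI).
by rewrite psicE bcompE thomE; exact: runE.
Qed.

Hypothesis HS : coxeter_system S.

Lemma psic_mor L L' L'' (X : ecell h L L') (Y : ecell h L' L'') : in_endo X -> in_endo Y ->
  @is_mor _ _ _ _ _ (ltens (Psi1 X) (Psi1 Y)) (Psi1 (ecomp1 X Y)) (psic X Y).
Proof.
move=> iX iY; have iC := in_endo_comp HS iX iY.
apply: (is_mor_span (P := ltens (Psi1 X) (Psi1 Y))
  (G := fun w t => @tens_lat _ _ _ _ _ (Psi1 X) (Psi1 Y) w t)).
- by move=> w x /ltens_lcompE.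
- exact: (good_cl (Psi1_good HS iC)).
move=> w _ [x [y [a [b [lx ly <- ->]]]]]; apply/(Psi1_lat HS _ _ iC) => -[i j].
rewrite psicE.
have lx' := (Psi1_lat HS _ _ iX).1 lx i; have ly' := (Psi1_lat HS _ _ iY).1 ly j.
apply: (@ltens_lat _ _ _ _ _ (eobj i) (btwist (etag i) (eobj j)) _
  (a * (bw (etag i))^-1)%g (bw (etag i) * (b * (bw (etag j))^-1) * (bw (etag i))^-1)%g) => //.
  by apply: ltwist_lat_gen; rewrite !mulgA mulVg mul1g mulgVK.
by rewrite /= invgM !mulgA mulgVK.
Qed.

Lemma psid_mor L L' L'' (X : ecell h L L') (Y : ecell h L' L'') : in_endo X -> in_endo Y ->
  @is_mor _ _ _ _ _ (Psi1 (ecomp1 X Y)) (ltens (Psi1 X) (Psi1 Y)) (psid X Y).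
Proof.
move=> iX iY; have H := full_gdatum h o HS; have iC := in_endo_comp HS iX iY.
have gT : good L L'' (ltens (Psi1 X) (Psi1 Y)).
  apply: (in_AP_good H (Pw := fun us => wactw L us = L'') (fun _ e => e)).
  apply: (in_AP_ltens H (P1 := fun us => wactw L us = L') (P2 := fun us => wactw L' us = L'')
    (P3 := fun us => wactw L us = L'') (fun _ e => e) (fun _ e => e) (fun _ e => e)).
  - by move=> u v _ _ uL vL; rewrite wactw_cat uL.
  - exact: Psi1_in_A.
  - exact: Psi1_in_A.
apply: (@is_mor_inv _ _ _ _ _ H _ L L'' (ltens (Psi1 X) (Psi1 Y)) (Psi1 (ecomp1 X Y)) (psic X Y)
  (psid X Y) gT (Psi1_good HS iC) (psic_mor iX iY)); [exact: psicK | exact: psidK].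
Qed.

Lemma psiu_mor L : is_mor (psiu L).
Proof.
have H := full_gdatum h o HS; have i1 : in_endo (ecell1 h L) by exact: in_endo_one.
apply: (is_mor_lat H _ (good_cl (Psi1_good HS i1))).
  exact: (n_cl (@Rw_nice _ _ _ h full (pt_wset W) tt tt 1%g (gen1 _) erefl)).
move=> w f lf; apply/(Psi1_lat HS _ _ i1) => i.
by rewrite -[bw _]/(1%g : W) invg1 mulg1; case/Rw_lat: lf => [->|->]; [left|right; exact: mq0l].
Qed.

Lemma psiu'_mor L : is_mor (psiu' L).
Proof.
have H := full_gdatum h o HS; have i1 : in_endo (ecell1 h L) by exact: in_endo_one.
have gR : good L L (Rw h full 1%g) by apply: (nice_good H); apply: Rw_nice; [exact: gen1|exact: wact1].
apply: (@is_mor_inv _ _ _ _ _ H _ L L (Rw h full 1%g) (Psi1 (ecell1 h L)) (psiu L) (psiu' L)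
  gR (Psi1_good HS i1) (psiu_mor L)); [exact: psiuK | exact: psiuVK].
Qed.

End PsiLaws.

(** * Comparison of direct sums *)

Section DirectSums.
Variables (W : groupType) (k : idomainType) (n : nat) (rho : rep W k n).

Lemma fin_dsum_unique (D : rdatum W k n) (J : finType) (M N : lbim rho D) (Y : J -> lbim rho D) :
  lclosed M -> lclosed N -> fin_dsum M Y -> fin_dsum N Y -> iso_C M N.
Proof.
move=> cM cN [inc [pro [im pi1 pi0 ip]]] [inc' [pro' [im' pi1' pi0' ip']]].
exists (bsum (fun j => bcomp (pro j) (inc' j))), (bsum (fun j => bcomp (pro' j) (inc j))); split.
- apply: is_mor_sum => // j; have [_ ?] := im j; have [? _] := im' j; exact: is_mor_comp.
- apply: is_mor_sum => // j; have [_ ?] := im' j; have [? _] := im j; exact: is_mor_comp.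
- move=> x; rewrite [RHS]ip !bsumE; apply: eq_bigr => j _.
  rewrite !bcompE bhom_sum (bigD1 j) // bcompE pi1' big1 => [|i /andP[_ /eqP ij]].
    exact: (congr1 _ (addr0 _)).
  by rewrite bcompE pi0'.
move=> x; rewrite [RHS]ip' !bsumE; apply: eq_bigr => j _.
rewrite !bcompE bhom_sum (bigD1 j) // bcompE pi1 big1 => [|i /andP[_ /eqP ij]].
    exact: (congr1 _ (addr0 _)).
by rewrite bcompE pi0.
Qed.

Lemma fin_dsum_unit (D : rdatum W k n) (M : lbim rho D) : fin_dsum M (fun _ : unit => M).
Proof.
exists (fun _ => bid M), (fun _ => bid M); split=> //.
- by move=> _; split; exact: is_mor_id.
- by move=> [] [].
- by move=> m; rewrite (big_pred1 tt) // => -[].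
Qed.

(** Semilinear isomorphisms from the M j absorb the twists of the sum and leave an ordinary
    biproduct. *)
Lemma tsum_fin_dsum (D' D : rdatum W k n) (N : lbim rho D) (J : finType) u v
    (M : J -> lbim rho D') (inc : forall j, M j -> N) (pro : forall j, N -> M j)
    (Y : J -> lbim rho D) : gdatum rho D -> (forall j, lclosed (M j)) ->
  tsum u v inc pro -> (forall j, lclosed (Y j)) -> (forall j, siso u (v j) (M j) (Y j)) ->
  fin_dsum N Y.
Proof.
move=> HD cM T cY sY.
have FGP j : exists FG : (M j -> Y j) * (Y j -> M j),
    exists ab : bhom (Y j) N * bhom N (Y j), [/\ cancel FG.1 FG.2 /\ cancel FG.2 FG.1,
    FG.1 0 = 0, is_mor ab.1 /\ is_mor ab.2, forall x, ab.1 x = inc j (FG.2 x)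
    & forall x, ab.2 x = FG.1 (pro j x)].
  have [F [G [[sF lF] sG lG FK GK]]] := sY j.
  have [a [b [am bm aE bE]]] := tsum_retract HD T cM (j := j) (@is_mor_id _ _ _ _ _ (M j))
    (@is_mor_id _ _ _ _ _ (M j)) (cY j) sF sG lF lG.
  by exists (F, G), (a, b); split=> //; exact: (semi0 sF).
have [FG FGP'] := dep_choice FGP; have [ab abP] := dep_choice FGP'.
exists (fun j => (ab j).1), (fun j => (ab j).2); split.
- by move=> j; case: (abP j).
- by move=> j x; have [[_ GK] _ _ -> ->] := abP j; rewrite (ts_K T) GK.
- move=> i j x ij; have [_ _ _ -> _] := abP i; have [_ F0 _ _ ->] := abP j.
  by rewrite (ts_0 T) // F0.
move=> x; rewrite [LHS](ts_sum T); apply: eq_bigr => j _.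
by have [[FK _] _ _ -> ->] := abP j; rewrite FK.
Qed.

End DirectSums.

(** * The biequivalence *)

Section Biequivalence.
Variables (W : groupType) (S : W -> Prop) (k : idomainType) (n : nat).
Variables (h : prerealization k n S) (o : wset W).
Hypothesis HS : coxeter_system S.
Local Notation pt := (pt_wset W).
Local Notation E L := (endo_datum h L).
Local Notation full := (full_datum h).
Implicit Types (L : o).
Let HF : gdatum h full := full_gdatum h o HS.

Lemma A_closedP : A_closed h full o.
Proof.
apply: (in_AP_closed HF (ell := fun L : o => L) (Pw := fun L L' u => wactw L u = L')) => //.
by move=> L L' L'' u v _ _ <- <-; exact: wactw_cat.
Qed.

Lemma A_bicategory (clA : A_closed h full o) : is_bicategory (A_bicat clA).
Proof.
apply: (in_AP_bicategory HF (ell := fun L : o => L) (Pw := fun L L' u => wactw L u = L')) => //.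
Qed.

Section WithClosures.
Variables (clM : endo_closed h o) (clA : A_closed h full o).

Definition Psi : @pfun_data (endo_bicat clM) (A_bicat clA) (fun L : o => L) :=
  @PfunData (endo_bicat clM) (A_bicat clA) (fun L : o => L)
    (fun a b X => exist _ (Psi1 (sval X)) (Psi1_in_A HS (svalP X)))
    (fun a b X Y f => exist _ (Psi2 (sval f)) (Psi2_mor HS (svalP X) (svalP Y) (svalP f)))
    (fun a b c X Y => exist _ (psic (sval X) (sval Y)) (psic_mor HS (svalP X) (svalP Y)))
    (fun a => exist _ (psiu h a) (psiu_mor (h := h) HS a)).

Lemma Psi_pseudofunctor : is_pseudofunctor Psi.
Proof.
split.
- by move=> a b X; apply: sval_inj_prop; exact: Psi2_id.
- by move=> a b X Y Z f g; apply: sval_inj_prop; exact: Psi2_comp.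
- by move=> a b c X X' Y Y' f g; apply: sval_inj_prop; exact: psic_nat.
- move=> a b c X Y; exists (exist _ (psid (sval X) (sval Y)) (psid_mor HS (svalP X) (svalP Y))).
  by split; apply: sval_inj_prop; apply: bhom_ext; [exact: psicK | exact: psidK].
- move=> a; exists (exist _ (psiu' h a) (@psiu'_mor _ _ _ _ h _ HS a)).
  by split; apply: sval_inj_prop; apply: bhom_ext; [exact: psiuK | exact: psiuVK].
- by move=> a b c d X Y Z; apply: sval_inj_prop; exact: psi_assoc.
- by move=> a b X; apply: sval_inj_prop; exact: psi_lunit.
- by move=> a b X; apply: sval_inj_prop; exact: psi_runit.
Qed.

Lemma Psi_faithful (a b : o) (X Y : @c1 (endo_bicat clM) a b) (f g : c2 X Y) :
  F2 Psi f = F2 Psi g -> f = g.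
Proof.
move=> e; apply: sval_inj_prop; apply: Psi2_faithful => x.
by have := congr1 (fun p => bfun (sval p) x) e.
Qed.

Lemma Psi_full (a b : o) (X Y : @c1 (endo_bicat clM) a b) (g : c2 (F1 Psi X) (F1 Psi Y)) :
  exists f : c2 X Y, F2 Psi f = g.
Proof.
have [f [fm fE]] := Psi2_full HS (svalP X) (svalP Y) (svalP g).
by exists (exist _ f fm); apply: sval_inj_prop; exact: bhom_ext.
Qed.

Lemma endo_bicategory : is_bicategory (endo_bicat clM).
Proof.
exact: (pullback_bicategory (A_bicategory clA) Psi_pseudofunctor Psi_faithful Psi_full).
Qed.

Lemma bword_block L L' us : in_exp S us -> wactw L us = L' ->
  is_block_value S L L' (bword L us).
Proof. by move=> uS uL; exists (wprod us); split; [rewrite wact_wprod | exists us]. Qed.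

(** A word u in the decomposition of M gives a summand in the block with value b_L(u), attached to
    the reflections [ts_of L u]. *)
Lemma Psi1_esurj L L' (M : lbim h full) : in_A L L' M ->
  exists2 X : ecell h L L', in_endo X & iso_C (Psi1 X) M.
Proof.
move=> iM; have gM := in_AP_good HF (Pw := fun u => wactw L u = L') (fun _ e => e) iM.
have [_ [d [us [uP sM]]]] := iM.
pose X := @Ecell _ _ _ _ h o L L' 'I_d
  (fun i => Block (bword_block (uP i).1 (uP i).2))
  (fun i => Bw h (E L) (tt : pt) (ts_of L (us i))).
have tS i := ts_of_So (o := o) HS (L := L) (uP i).1.
have iX : in_endo X by move=> i; apply: in_Aendo_Bw => //; exact: tS.
exists X => //.
have cY i : lclosed (Bw h full L (us i)) by exact: (good_cl (Bw_good HF L (uP i).1)).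
apply: (fin_dsum_unique (good_cl (Psi1_good HS iX)) (good_cl gM)
  (Y := fun i => Bw h full L (us i)) _ sM).
apply: (tsum_fin_dsum HF _ (twsum_tsum full (fun i : eix X => bw (etag i)) (fun i => eobj i)) cY).
  by move=> i; exact: (good_cl (in_Aendo_good HS (iX i))).
by move=> i; apply: siso_Bw => //; exact: (uP i).1.
Qed.

Lemma A_iso1 (a b : o) (X Y : @c1 (A_bicat clA) a b) : iso_C (sval X) (sval Y) -> iso1 X Y.
Proof.
case=> f [g [fm gm fK gK]]; exists (exist _ f fm), (exist _ g gm).
by split; apply: sval_inj_prop; exact: bhom_ext.
Qed.

Lemma Psi_biequivalence : is_biequivalence Psi.
Proof.
have HA := A_bicategory clA; have HP := Psi_pseudofunctor.
split=> //.
  move=> a b; apply: (@local_equivalence_ff _ _ _ Psi a b HA).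
  - by move=> X; exact: (F2_id HP).
  - by move=> X Y Z f g; exact: (F2_comp HP).
  - exact: Psi_faithful.
  - exact: Psi_full.
  move=> [M iM]; have [X iX XM] := Psi1_esurj iM.
  by exists (exist _ X iX); apply: A_iso1.
move=> b; exists b, (id1 b), (id1 b).
by split; exists (lunit (id1 b)); exact: (lunit_inv HA).
Qed.

End WithClosures.
End Biequivalence.

(** * Closure of the restricted categories and values on words *)

Section Restriction.
Variables (W : groupType) (S : W -> Prop) (k : idomainType) (n : nat).
Variables (h : prerealization k n S) (o : wset W).
Hypothesis HS : coxeter_system S.
Local Notation pt := (pt_wset W).
Local Notation E L := (endo_datum h L).
Local Notation full := (full_datum h).
Implicit Types (L : o).
Let HF : gdatum h full := full_gdatum h o HS.

Lemma Wo_cat L u v : Wo S L (wprod u) -> Wo S L (wprod v) -> Wo S L (wprod (u ++ v)).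
Proof.
case=> Lu ub [Lv vb]; rewrite wprod_cat; split; first by rewrite wactM Lu.
by have := bval_mul Lu ub vb; rewrite mulg1.
Qed.

Lemma Wo_wactw L u : Wo S L (wprod u) -> wactw L u = L.
Proof. by case; rewrite wact_wprod. Qed.

Lemma Ao_closedP L : Ao_closed h full L.
Proof.
apply: (in_AP_closed HF (X := unit) (ell := fun _ => L) (Pw := fun _ _ u => Wo S L (wprod u))).
- by move=> _ _; exact: Wo_wactw.
- by move=> _; split; [exact: wact1 | exists [::]].
- by move=> _ _ _ u v _ _; exact: Wo_cat.
Qed.

Lemma Ao_bicategory L (clo : Ao_closed h full L) : is_bicategory (Ao_bicat clo).
Proof.
apply: (in_AP_bicategory HF (X := unit) (ell := fun _ => L) (Pw := fun _ _ u => Wo S L (wprod u))).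
by move=> _ _; exact: Wo_wactw.
Qed.

Lemma Aendo_closedP L : Aendo_closed h L.
Proof.
apply: (in_AP_closed (endo_gdatum h HS L) (X := pt) (ell := fun a : pt => a)
  (Pw := fun a b u => wactw a u = b)) => //.
by move=> *; exact: pt_wactw.
Qed.

Lemma Aendo_bicategory L (cl : Aendo_closed h L) : is_bicategory (Aendo_bicat cl).
Proof.
apply: (in_AP_bicategory (endo_gdatum h HS L) (X := pt) (ell := fun a : pt => a)
  (Pw := fun a b u => wactw a u = b)) => //.
Qed.

Lemma single_comp_morP L (cl : Aendo_closed h L) : single_comp_mor cl.
Proof.
move=> [] [] [] [M iM] [N iN]; apply: edelta_emor => //.
  by move=> i; apply: in_Aendo_ltens.
move=> i; apply: is_mor_thom; first exact: is_mor_id.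
by apply: is_mor_tw_one; exact: (good_cl (in_Aendo_good HS iN)).
Qed.

Lemma Psi1_single L (M : lbim h (E L)) : in_Aendo M -> in_Ao L (Psi1 (single M)).
Proof.
move=> iM; apply: (Psi1_in_AP HS (Pw := fun us => Wo S L (wprod us)) (X := single M)).
- by [].
- exact: Wo_wactw.
- by move=> i us uS uL ub; split; [rewrite wact_wprod | exists us].
Qed.

Lemma Psi1_single_iso L (M : lbim h (E L)) (Y : lbim h full) : in_Aendo M -> lclosed Y ->
  siso 1%g 1%g M Y -> iso_C (Psi1 (single M)) Y.
Proof.
move=> iM cY sY; have iX : in_endo (single M) by [].
apply: (fin_dsum_unique (J := unit) (Y := fun _ => Y) (good_cl (Psi1_good HS iX)) cY).
  apply: (tsum_fin_dsum HF _ (twsum_tsum full (fun i : eix (single M) => bw (etag i))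
    (fun i => eobj i)) (fun _ => cY)).
    by move=> i; exact: (good_cl (in_Aendo_good HS iM)).
  by move=> i; rewrite -[bw _]/(1%g : W) invg1; exact: sY.
exact: fin_dsum_unit.
Qed.

Lemma expands_in_exp x x' : expands S x x' -> in_exp S x'.
Proof.
case=> us [su ru ->] s /flattenP[u /(nthP [::])[i iu <-]].
by move: iu; rewrite su => /ru[[+ _] _]; apply.
Qed.

Lemma expands_siso L x x' : in_exp (So S L) x -> expands S x x' ->
  siso 1%g 1%g (Bw h (E L) (tt : pt) x) (Bw h full L x').
Proof.
move=> xS ex; have [//|e1 e2 _] := ts_of_expands HS xS ex (p := [::]).
rewrite cats0 in e1 e2; have := @siso_Bw W S k n h o HS L x' (expands_in_exp ex).
by rewrite e1 e2 invg1.
Qed.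

Lemma Psi2_single L (M N : lbim h (E L)) (f : bhom M N) x :
  (Psi2 (single_hom f) x : Psi1 (single N)) tt = f ((x : Psi1 (single M)) tt).
Proof.
rewrite -[LHS]/(\sum_(i : unit) _) (big_pred1 tt) //; by case.
Qed.

Lemma psi_single_comp L (M N : lbim h (E L)) x y :
  (Psi2 (single_comp M N) (psic (single M) (single N) (tp x y)) : Psi1 (single (ltens M N))) tt =
  tp ((x : Psi1 (single M)) tt) ((y : Psi1 (single N)) tt).
Proof.
have gI : injective (fun _ : unit * unit => tt) by move=> [[] []] [[] []].
apply: etrans; first exact: (@Psi2_edelta _ _ _ _ h o L L (ecomp1 (single M) (single N))
  (single (ltens M N)) (fun _ => tt) _ _ _ (tt, tt) gI).
by rewrite psicE thomE.
Qed.

End Restriction.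

(** * Restriction to the neutral block *)

Section RestrictedLaws.
Variables (W : groupType) (S : W -> Prop) (k : idomainType) (n : nat).
Variables (h : prerealization k n S) (o : wset W) (L : o).
Local Notation E := (endo_datum h L).
Local Notation full := (full_datum h).
Local Notation R := (Rh k n).
Implicit Types M N P : lbim h E.

(** For one summand in the neutral block the twist is trivial, so the value of the 2-functor is a
    copy of M. The laws of the restriction are tested after this projection, where the composition
    constraint becomes a tensor of projections. *)
Lemma sprj_axioms M : @bhom_axioms R R (Psi1 (single M)) M (fun x => (x : Psi1 (single M)) tt).
Proof.
split=> [x y|a x|x c]; [exact: erefl|exact: erefl|].
by rewrite -[LHS]/(ract M _ (actR h 1%g c)) actR1.
Qed.
Definition sprj M : bhom (Psi1 (single M)) M := Bhom (sprj_axioms M).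

Definition sinc_fun M (m : M) : Psi1 (single M) := fun _ => m.
Lemma sprjK M : cancel (sprj M) (@sinc_fun M).
Proof. by move=> x; apply: functional_extensionality_dep => -[]; exact: erefl. Qed.
Lemma sincK M : cancel (@sinc_fun M) (sprj M).
Proof. by move=> x; exact: erefl. Qed.
Definition sinc M : bhom M (Psi1 (single M)) := Bhom (bhom_inv_axioms (@sprjK M) (@sincK M)).

Lemma sprj_inj M (P : bimod R R) (f g : bhom P (Psi1 (single M))) :
  bcomp f (sprj M) = bcomp g (sprj M) -> f = g.
Proof.
move=> e; apply: bhom_ext => x; apply: (can_inj (@sprjK M)).
by rewrite -!bcompE e.
Qed.

Definition sgl M N (f : bhom M N) : bhom (Psi1 (single M)) (Psi1 (single N)) :=
  Psi2 (single_hom f).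
Lemma sglE M N (f : bhom M N) : bcomp (sgl f) (sprj N) = bcomp (sprj M) f.
Proof. by apply: bhom_ext => x; exact: Psi2_single. Qed.
Lemma sgl_app M N (f : bhom M N) x : sprj N (sgl f x) = f (sprj M x).
Proof. by rewrite -!bcompE sglE. Qed.

Definition scomp M N : bhom (tbim (Psi1 (single M)) (Psi1 (single N))) (Psi1 (single (ltens M N))) :=
  bcomp (psic (single M) (single N)) (Psi2 (single_comp M N)).
Lemma scompE M N : bcomp (scomp M N) (sprj (ltens M N)) = thom (sprj M) (sprj N).
Proof. by apply: tb_hom_ext => x y; rewrite bcompE thomE; exact: psi_single_comp. Qed.
Lemma scomp_app M N x y : sprj (ltens M N) (scomp M N (tp x y)) = tp (sprj M x) (sprj N y).
Proof. by rewrite -bcompE scompE thomE. Qed.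

Definition scomp' M N (z : Psi1 (single (ltens M N))) : tbim (Psi1 (single M)) (Psi1 (single N)) :=
  thom (sinc M) (sinc N) (sprj (ltens M N) z).
Lemma thom_sprjK M N : bcomp (thom (sprj M) (sprj N)) (thom (sinc M) (sinc N)) = bid _.
Proof. by apply: tb_hom_ext => x y; rewrite bcompE !thomE [sinc M _]sprjK [sinc N _]sprjK. Qed.
Lemma thom_sincK M N : bcomp (thom (sinc M) (sinc N)) (thom (sprj M) (sprj N)) = bid _.
Proof. by apply: tb_hom_ext => x y; rewrite bcompE !thomE [sprj M _]sincK [sprj N _]sincK. Qed.
Lemma scompK M N : cancel (scomp M N) (@scomp' M N).
Proof. by move=> t; rewrite /scomp' -[sprj _ _]bcompE scompE -bcompE thom_sprjK. Qed.
Lemma scompVK M N : cancel (@scomp' M N) (scomp M N).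
Proof.
move=> z; apply: (can_inj (@sprjK (ltens M N))).
by rewrite -[LHS]bcompE scompE -bcompE thom_sincK.
Qed.

(** The form in which [restriction] produces the unit constraint, including the image of the
    identity that comes from [incu]. *)
Definition sunit : bhom (Rw h full 1%g) (Psi1 (single (Rw h E 1%g))) :=
  bcomp (psiu h L) (Psi2 (eid (ecell1 h L))).
Lemma sunitE : sunit = psiu h L.
Proof. by rewrite /sunit Psi2_id; exact: bhom_ext. Qed.

Lemma sgl_id M : sgl (bid M) = bid (Psi1 (single M)).
Proof. by apply: sprj_inj; rewrite sglE; exact: bhom_ext. Qed.
Lemma sgl_comp M N P (f : bhom M N) (g : bhom N P) : sgl (bcomp f g) = bcomp (sgl f) (sgl g).
Proof.
apply: sprj_inj; apply: bhom_ext => x; rewrite sglE.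
by rewrite !bcompE !sgl_app.
Qed.
Lemma scomp_nat M M' N N' (f : bhom M M') (g : bhom N N') :
  bcomp (thom (sgl f) (sgl g)) (scomp M' N') =
  bcomp (scomp M N) (@sgl (ltens M N) (ltens M' N') (thom f g)).
Proof.
apply: (@sprj_inj (ltens M' N')); apply: tb_hom_ext => x y.
by rewrite !bcompE thomE scomp_app !sgl_app scomp_app thomE.
Qed.
Lemma scomp_assoc M N P :
  bcomp (thom (scomp M N) (bid (Psi1 (single P))))
    (bcomp (scomp (ltens M N) P) (@sgl (ltens (ltens M N) P) (ltens M (ltens N P)) (tassoc M N P))) =
  bcomp (tassoc (Psi1 (single M)) (Psi1 (single N)) (Psi1 (single P)))
    (bcomp (thom (bid (Psi1 (single M))) (scomp N P)) (scomp M (ltens N P))).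
Proof.
apply: (@sprj_inj (ltens M (ltens N P))); apply: tb_hom_ext3 => x y z.
rewrite !bcompE tassocE !thomE sgl_app.
rewrite (@scomp_app (ltens M N) P) (@scomp_app M (ltens N P)) (@scomp_app M N) (@scomp_app N P).
exact: tassocE.
Qed.
Lemma scomp_lunit M : lun h full (Psi1 (single M)) =
  bcomp (thom sunit (bid (Psi1 (single M)))) (bcomp (scomp (Rw h E 1%g) M)
    (@sgl (ltens (Rw h E 1%g) M) M (lun h E M))).
Proof.
rewrite sunitE; apply: (@sprj_inj M); apply: tb_hom_ext => f x.
rewrite !bcompE thomE lunE sgl_app (@scomp_app (Rw h E 1%g) M).
by rewrite (bhoml (bhomP (sprj M))); apply: esym; exact: lunE.
Qed.
Lemma scomp_runit M : run h full (Psi1 (single M)) =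
  bcomp (thom (bid (Psi1 (single M))) sunit) (bcomp (scomp M (Rw h E 1%g))
    (@sgl (ltens M (Rw h E 1%g)) M (run h E M))).
Proof.
rewrite sunitE; apply: (@sprj_inj M); apply: tb_hom_ext => x f.
rewrite !bcompE thomE runE sgl_app (@scomp_app M (Rw h E 1%g)).
by rewrite (bhomr (bhomP (sprj M))); apply: esym; exact: runE.
Qed.

Lemma single_homK M N (f : ehom (single M) (single N)) : single_hom (emx f tt tt) = f.
Proof. by apply: ehom_ext => -[] [] m. Qed.

Hypothesis HS : coxeter_system S.
Let HF : gdatum h full := full_gdatum h o HS.
Let HE : gdatum h E := endo_gdatum h HS L.

Lemma in_Ao_good (M : lbim h full) : in_Ao L M -> good L L M.
Proof.
by apply: (in_AP_good HF (Pw := fun u => Wo S L (wprod u))); exact: Wo_wactw.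
Qed.

Lemma sgl_mor M N (f : bhom M N) : in_Aendo M -> in_Aendo N -> is_mor f -> is_mor (sgl f).
Proof.
move=> iM iN fm; have iX : in_endo (single M) by []; have iY : in_endo (single N) by [].
by apply: (Psi2_mor HS iX iY) => -[] [].
Qed.

(** A word expressing an element of W_L^o has trivial b_L, so [siso_Bw] is untwisted. Formal sums
    are not at hand in the monoidal category of W_L^o: the sum has to be realised as one bimodule
    over the endoscopic datum. *)
Lemma Ao_esurj (M : lbim h full) : in_Ao L M ->
  exists2 N : lbim h E, in_Aendo N & iso_C (Psi1 (single N)) M.
Proof.
move=> iM; have gM := in_Ao_good iM; have [_ [d [us [uP sM]]]] := iM.
pose B i := Bw h E (tt : pt_wset W) (ts_of L (us i)).
have iB i : in_Aendo (B i) by apply: in_Aendo_Bw => //; apply: ts_of_So => //; exact: (uP i).1.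
have cB i := good_cl (in_Aendo_good HS (iB i)).
(* With trivial twists the twisted sum is an ordinary direct sum. *)
pose N := twsum E (fun _ : 'I_d => 1%g) B.
have T := twsum_tsum E (fun _ : 'I_d => 1%g) B.
have sB i : siso 1%g 1^-1%g (B i) (B i) by rewrite invg1; apply: iso_siso; exact: iso_C_refl.
have iN : in_Aendo N.
  pose P := fun u : seq W => wactw (tt : pt_wset W) u = tt.
  have conv (i : 'I_d) ts : in_exp (So S L) ts -> P ts -> exists us, [/\ in_exp (So S L) us,
      P us & siso 1%g 1^-1%g (Bw h E (tt : pt_wset W) ts) (Bw h E (tt : pt_wset W) us)].
    move=> tS tP; exists ts; split=> //; rewrite invg1; apply: iso_siso; exact: iso_C_refl.
  have rb : rebases h 1^-1%g E E by rewrite invg1; apply: rebases_gen; exact: gen1.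
  exact: (@tsum_in_AP _ _ _ _ _ _ HE HE _ _ _ _ _ _ _ T cB (pt_wset W) (fun _ => tt)
    (fun _ => tt) (fun i => in_Aendo_good HS (iB i)) (fun i => in_Aendo_graded HS (iB i))
    (fun _ => rb) (fun _ => P) (pt_wset W) tt tt P (fun _ e => e) iB conv).
exists N => //; have iX : in_endo (single N) by [].
have cY i : lclosed (Bw h full L (us i)) by exact: (good_cl (Bw_good HF L (uP i).1)).
apply: (fin_dsum_unique (good_cl (Psi1_good HS iX)) (good_cl gM)
  (Y := fun i => Bw h full L (us i)) _ sM).
apply: (fin_dsum_iso (X := fun i => Psi1 (single (B i)))); last first.
  move=> i; apply: (Psi1_single_iso HS (iB i) (cY i)).
  have b1 : bword L (us i) = 1%g.
    have [uS [_ vb]] := uP i; apply: (bval_uniq HS _ vb).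
    by exists (us i).
  by have := @siso_Bw W S k n h o HS L (us i) (uP i).1; rewrite b1 invg1.
have [inc [pro [im pi1 pi0 ip]]] := tsum_fin_dsum HE cB T cB sB.
exists (fun i => sgl (inc i)), (fun i => sgl (pro i)); split.
- by move=> i; have [? ?] := im i; split; exact: sgl_mor.
- by move=> i x; apply: (can_inj (@sprjK (B i))); rewrite !sgl_app pi1.
- by move=> i j x ij; apply: (can_inj (@sprjK (B j))); rewrite !sgl_app pi0 // bhom0.
move=> x; apply: (can_inj (@sprjK N)); rewrite bhom_sum [LHS]ip.
by apply: eq_bigr => i _; rewrite !sgl_app.
Qed.

Section Restriction.
Variables (clM : endo_closed h o) (clA : A_closed h full o).
Variables (cl : Aendo_closed h L) (clo : Ao_closed h full L).
Variables (pc : single_comp_mor cl) (pr : restricts_to_Ao (Psi HS clM clA) cl).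
Local Notation PsiL := (restriction clo pc pr).

Lemma restriction_pseudofunctor : is_pseudofunctor PsiL.
Proof.
split.
- by move=> a b M; apply: sval_inj_prop; exact: sgl_id.
- by move=> a b M N P f g; apply: sval_inj_prop; exact: sgl_comp.
- by move=> a b c M M' N N' f g; apply: sval_inj_prop; exact: scomp_nat.
- move=> a b c M N.
  have gT := in_Ao_good (@cl_comp1 _ _ _ clo tt tt tt _ _ (pr M) (pr N)).
  have gC := in_Ao_good (pr (comp1 M N)).
  pose g : bhom (Psi1 (single (ltens (sval M) (sval N)))) (tbim (Psi1 (single (sval M))) (Psi1 (single (sval N)))) :=
    Bhom (bhom_inv_axioms (@scompK (sval M) (sval N)) (@scompVK (sval M) (sval N))).
  have gm := @is_mor_inv _ _ _ _ _ HF _ L L (ltens (Psi1 (single (sval M))) (Psi1 (single (sval N))))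
    (Psi1 (single (ltens (sval M) (sval N)))) (scomp (sval M) (sval N)) g gT gC
    (svalP (Fc PsiL M N)) (@scompK (sval M) (sval N)) (@scompVK (sval M) (sval N)).
  exists (exist _ g gm).
  by split; apply: sval_inj_prop; apply: bhom_ext; [exact: scompK | exact: scompVK].
- move=> a; exists (exist _ (psiu' h L) (@psiu'_mor _ _ _ _ h _ HS L)).
  split; apply: sval_inj_prop; apply: bhom_ext => x.
    by rewrite -[LHS]/(psiu' h L (sunit x)) sunitE; exact: psiuK.
  by rewrite -[LHS]/(sunit (psiu' h L x)) sunitE; exact: psiuVK.
- by move=> a b c d M N P; apply: sval_inj_prop; exact: scomp_assoc.
- by move=> a b M; apply: sval_inj_prop; exact: scomp_lunit.
- by move=> a b M; apply: sval_inj_prop; exact: scomp_runit.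
Qed.

Lemma restriction_equivalence : local_equivalence PsiL tt tt.
Proof.
have HP := restriction_pseudofunctor.
apply: (@local_equivalence_ff _ _ _ PsiL tt tt (Ao_bicategory HS clo)).
- by move=> M; exact: (F2_id HP).
- by move=> M N P f g; exact: (F2_comp HP).
- move=> M N f g e; apply: sval_inj_prop; apply: bhom_ext => m.
  have := congr1 (fun p => sprj (sval N) (bfun (sval p) (sinc_fun m))) e.
  by rewrite -[LHS]/(sprj _ (sgl (sval f) _)) -[RHS]/(sprj _ (sgl (sval g) _)) !sgl_app !sincK.
- move=> M N g; have iX : in_endo (single (sval M)) by move=> i; exact: (svalP M).
  have iY : in_endo (single (sval N)) by move=> i; exact: (svalP N).
  have [f [fm fE]] := Psi2_full HS iX iY (svalP g).
  exists (exist _ (emx f tt tt) (fm tt tt)); apply: sval_inj_prop; apply: bhom_ext => x.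
  by rewrite -[LHS]/(Psi2 (single_hom (emx f tt tt)) x) single_homK; exact: fE.
move=> [M iM]; have [N iN [f [g [fm gm fK gK]]]] := Ao_esurj iM.
exists (exist _ N iN), (exist _ f fm), (exist _ g gm).
by split; apply: sval_inj_prop; exact: bhom_ext.
Qed.

End Restriction.
End RestrictedLaws.

Theorem theorem3p5p10
  (W : groupType) (S : W -> Prop) (o : wset W) (k : idomainType) (n : nat)
  (h : prerealization k n S) :
  coxeter_system S -> reflection_balanced h -> reflection_stable_abe h ->
  exists (clM : endo_closed h o) (clA : A_closed h (full_datum h) o),
  is_bicategory (endo_bicat clM) /\ is_bicategory (A_bicat clA) /\
  exists Psi : @pfun_data (endo_bicat clM) (A_bicat clA) (fun L : o => L),
  is_biequivalence Psi /\
  forall L : o,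
  exists (cl : Aendo_closed h L) (clo : Ao_closed h (full_datum h) L),
  is_bicategory (Aendo_bicat cl) /\ is_bicategory (Ao_bicat clo) /\
  exists (pc : single_comp_mor cl) (pr : restricts_to_Ao Psi cl),
  let Psi_L := restriction clo pc pr in
  [/\ is_pseudofunctor Psi_L,
      local_equivalence Psi_L tt tt
    & forall x x' : seq W, in_exp (So S L) x -> expands S x x' ->
      exists Bx : in_Aendo (Bw h (endo_datum h L) (tt : pt_wset W) x),
      iso_C (sval (F1 Psi_L (exist _ (Bw h (endo_datum h L) (tt : pt_wset W) x) Bx)))
            (Bw h (full_datum h) L x')].
Proof.
move=> HS _ _; pose clM := endo_closedP h o HS; pose clA := A_closedP h o HS.
exists clM, clA; split; first exact: (endo_bicategory HS clM clA).
split; first exact: A_bicategory.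
exists (Psi HS clM clA); split; first exact: Psi_biequivalence.
move=> L; exists (Aendo_closedP h HS L), (Ao_closedP h HS L).
split; first exact: Aendo_bicategory.
split; first exact: Ao_bicategory.
exists (single_comp_morP HS (cl := Aendo_closedP h HS L)).
have pr : restricts_to_Ao (Psi HS clM clA) (Aendo_closedP h HS L).
  by move=> [] [] M; exact: (Psi1_single HS (svalP M)).
exists pr => Psi_L; split.
- exact: restriction_pseudofunctor.
- exact: restriction_equivalence.
move=> x x' xS ex; have iB := in_Aendo_Bw h HS xS; exists iB.
apply: (Psi1_single_iso HS iB); last exact: expands_siso.
by apply: (good_cl (Bw_good (full_gdatum h o HS) L _)); exact: (expands_in_exp ex).
Qed.
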